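(* Let $T>0$ and assume: (a) for each $1\le i\le m$, $\mathcal K_i:\mathbb R\times\mathbb R^n\to[0,\infty)$ is continuous with $\mathcal K_i(t,0)>0$ and $\int_{\mathbb R^n}\mathcal K_i(t,x)\,\mathrm dx=1$ for all $t\in\mathbb R$; (b) $g\in C^{0,0,1}(\mathbb R\times\overline\Omega_0\times\mathbb R^m,\mathbb R^m)$; for all $t\ge0$, $x\in\overline\Omega_0$, $u\in\mathbb M$ the matrix $(\partial g_i(t,x,u)/\partial u_j)_{m\times m}$ is cooperative and irreducible; for each $1\le i\le m$, $g_i(t,x,0)=0$, and $g_i(t,x,u)\le0$ whenever $u\in\mathbb M$ with $u_i=v_i$; (c) $\alpha g(t,x,u)<g(t,x,\alpha u)$ for $u\in\mathbb M\cap\mathrm{Int}(\mathbb R^m_+)$, $t\ge0$, $x\in\overline\Omega_0$, $\alpha\in(0,1)$; (d) $\mathcal K_i(t+T,x)=\mathcal K_i(t,x)$ and $g_i(t+T,x,u)=g_i(t,x,u)$ for each $1\le i\le m$. Consider $$\frac{\partial u}{\partial t}=D\int_{\Omega_0}\mathcal K(t,x-y)u(t,y)\,\mathrm dy-Du+g(t,x,u),\quad t>0,\ x\in\overline\Omega_0,\qquad u(0,x)=u_0(x).\qquad(\ast)$$ With $\omega(\Phi)$ the exponential growth bound defined in the context, the following hold: (1) If $\omega(\Phi)<0$, then $0$ is globally asymptotically stable for $(\ast)$ in $\hat X_+^v$. (2) If $\omega(\Phi)=0$ and either $\alpha g(t,x,u)\ll g(t,x,\alpha u)$ for all $u\in\mathbb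 M\cap\mathrm{Int}(\mathbb R^m_+)$, $t\ge0$, $x\in\overline\Omega_0$, $\alpha\in(0,1)$, or $\omega(\Phi)=0$ is the principal eigenvalue (of $L_T$), then $0$ is globally asymptotically stable for $(\ast)$ in $\hat X_+^v$. (3) If $\omega(\Phi)>0$, then $w^\ast$ is globally asymptotically stable for $(\ast)$ in $\hat X_+^v\setminus\hat{\mathbf 0}$, where $w^\ast\in\mathrm{Int}(\mathcal C_T^+)$ is the unique positive $T$-periodic solution of the equation in $\tilde X_+^v$.
   Context: $m,n\ge1$ are integers; $\Omega_0\subset\mathbb R^n$ is a bounded, simply connected domain with smooth boundary; $D=\mathrm{diag}\{d_1,\dots,d_m\}$, $d_i>0$. $\mathcal K(t,x-y)u(t,y):=(\mathcal K_1(t,x-y)u_1(t,y),\dots,\mathcal K_m(t,x-y)u_m(t,y))^T$. In $\mathbb R^m$: $\|a\|_{\mathbb R^m}=\max_i|a_i|$; $a\ge b$ means $a-b\in\mathbb R^m_+$; $a>b$ means $a\ge b$, $a\ne b$; $a\gg b$ means $a-b\in\mathrm{Int}(\mathbb R^m_+)$. $v\in\mathrm{Int}(\mathbb R^m_+)$ is fixed and $\mathbb M=\{u\in\mathbb R^m:0\le u\le v\}$. A matrix is cooperative if its off-diagonal entries are nonnegative. $C^{0,0,1}$: continuous in $(t,x,u)$ with continuous first derivatives in $u$. $X=C(\overline\Omega_0,\mathbb R^m)$ with the sup norm. $\hat X$: Banach space of bounded Lebesgue measurable functions $\overline\Omega_0\to\mathbb R^m$ (defined everywhere, not classes) with $\|\varphi\|_{\hat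 X}=\sup_{x\in\overline\Omega_0}\|\varphi(x)\|_{\mathbb R^m}$; $\hat X_+^v=\{\varphi\in\hat X:0\le\varphi(x)\le v,\ x\in\overline\Omega_0\}$; $\hat{\mathbf 0}=\{\varphi\in\hat X:\varphi=0\text{ a.e. in }\overline\Omega_0\}$. $\mathcal C_T$: continuous $u:\mathbb R\times\overline\Omega_0\to\mathbb R^m$ with $u(t+T,x)=u(t,x)$, with the sup norm; $\mathcal C_T^+$: its cone of nonnegative functions. $\tilde X$: bounded measurable functions $u:\mathbb R\times\overline\Omega_0\to\mathbb R^m$ (defined everywhere) with $u(t+T,x)=u(t,x)$, with the sup norm; $\tilde X_+^v=\{u\in\tilde X:0\le u(t,x)\le v\}$. $\Phi(t,s)$, $t\ge s$, is the evolution family on $X$ generated by $\frac{\partial u}{\partial t}=D\int_{\Omega_0}\mathcal K(t,x-y)u(t,y)\,\mathrm dy-Du+\left(\frac{\partial g_i(t,x,0)}{\partial u_j}\right)_{m\times m}u$, and $\omega(\Phi)=\inf\{\tilde\omega:\exists M\ge1\text{ such that }\|\Phi(t,s)\|\le Me^{\tilde\omega(t-s)}\ \forall t\ge s\}$. $L_T$ is the operator $[L_Tu](t,x)=-\frac{\partial u}{\partial t}(t,x)+D\int_{\Omega_0}\mathcal K(t,x-y)u(t,y)\,\mathrm dy-Du+\left(\frac{\partial g_i(t,x,0)}{\partial u_j}\right)_{m\times m}u(t,x)$ on $\mathcal C_T$ (domain: functions $C^1$ in $t$); its spectral bound satisfies $s(L_T)=\omega(\Phi)=\frac{\ln r(\Phi(T,0))}{T}$.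 ''$\omega(\Phi)=0$ is the principal eigenvalue'' means that $0=s(L_T)$ is an eigenvalue of $L_T$ with an eigenfunction in $\mathrm{Int}(\mathcal C_T^+)$. When $\omega(\Phi)>0$, the equation in $(\ast)$, considered for $t\in\mathbb R$, has a unique positive $T$-periodic solution $w^\ast$ in $\tilde X_+^v$ (positive: every component is $>0$ at every $(t,x)$), and $w^\ast\in\mathrm{Int}(\mathcal C_T^+)$. Stability. Let $u(t,\cdot;\varphi)$ be the solution (in $C([0,\infty),\hat X)$) with $u(0,\cdot)=\varphi$. A solution $w$ is globally asymptotically stable in $S\subset\hat X$ if $\lim_{t\to\infty}\|u(t,\cdot;\varphi)-w(t,\cdot)\|_{\hat X}=0$ for all $\varphi\in S$, and for every $\varepsilon>0$ there is $\delta>0$ such that $\varphi\in S$, $\|\varphi-w(0,\cdot)\|_{\hat X}<\delta$ imply $\|u(t,\cdot;\varphi)-w(t,\cdot)\|_{\hat X}<\varepsilon$ for all $t\ge0$. *)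

(* Defs.v *)
From HB Require Import structures.
From mathcomp Require Import all_boot all_order all_algebra.
From mathcomp Require Import all_classical all_reals all_analysis.

Set Implicit Arguments.
Unset Strict Implicit.
Unset Printing Implicit Defensive.

Import Order.TTheory GRing.Theory Num.Theory.
Import numFieldNormedType.Exports.

Local Open Scope classical_set_scope.
Local Open Scope ring_scope.

(* Points of R^n are row vectors, states in R^m are column vectors.  The norm
   of matrices in the library is the maximum of the moduli of the entries. *)

Section lebesgue_measure_on_Rn.
Context {R : realType} {n : nat}.
Implicit Types (a b : 'rV[R]_n) (X : set 'rV[R]_n).

Definition box a b : set 'rV[R]_n :=
  [set x | forall i, a 0 i < x 0 i <= b 0 i].

Definition box_volume a b : R := \prod_(i < n) Num.max 0 (b 0 i - a 0 i).

Lemma box_volume_ge0 a b : 0 <= box_volume a b.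
Proof. by apply: prodr_ge0 => i _; rewrite le_max lexx. Qed.

(* The covering families are countable; they may be finite or empty. *)
Definition box_cover X : set (set nat * (nat -> 'rV[R]_n) * (nat -> 'rV[R]_n)) :=
  [set C | X `<=` \bigcup_(k in C.1.1) box (C.1.2 k) (C.2 k)].

Definition cover_volume
    (C : set nat * (nat -> 'rV[R]_n) * (nat -> 'rV[R]_n)) : \bar R :=
  (\esum_(k in C.1.1) (box_volume (C.1.2 k) (C.2 k))%:E)%E.

Definition lebesgue_outer X : \bar R :=
  ereal_inf [set cover_volume C | C in box_cover X].

Lemma cover_volume_ge0 C : (0 <= cover_volume C)%E.
Proof. by apply: esum_ge0 => k _; rewrite lee_fin box_volume_ge0. Qed.

Lemma lebesgue_outer_ge0 X : (0 <= lebesgue_outer X)%E.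
Proof. by apply: le_ereal_inf_tmp => _ [C _ <-]; exact: cover_volume_ge0. Qed.

Lemma lebesgue_outer0 : lebesgue_outer set0 = 0%E.
Proof.
apply/eqP; rewrite eq_le lebesgue_outer_ge0 andbT.
apply: ereal_inf_lbound; exists (set0, fun=> 0, fun=> 0) => //.
by rewrite /cover_volume esum_set0.
Qed.

Lemma le_lebesgue_outer :
  {homo lebesgue_outer : A B / A `<=` B >-> (A <= B)%E}.
Proof.
move=> A B AB; apply: ereal_inf_le_tmp => _ [C BC <-].
by exists C => //; exact: subset_trans BC.
Qed.

Lemma lebesgue_outer_sigma_subadditive : sigma_subadditive lebesgue_outer.
Proof.
move=> A; have [[i ioo]|] := pselect (exists i, lebesgue_outer (A i) = +oo%E).
  rewrite (eseries_pinfty _ _ ioo) ?leey// => k _.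
  by rewrite -ltNye (lt_le_trans _ (lebesgue_outer_ge0 _)).
rewrite -forallNE => Aoo.
suff add2e (e : {posnum R}) : (lebesgue_outer (\bigcup_k A k) <=
    \sum_(i <oo) lebesgue_outer (A i) + e%:num%:E)%E.
  by apply/lee_addgt0Pr => _/posnumP[].
rewrite (le_trans _ (epsilon_trick _ _ _))//; last first.
  by move=> k; exact: lebesgue_outer_ge0.
pose P k C := box_cover (A k) C /\
  (cover_volume C <= lebesgue_outer (A k) + (e%:num / (2 ^ k.+1)%:R)%:E)%E.
have [G PG] : {G & forall k, P k (G k)}.
  apply: (@choice _ _ P) => k; rewrite /P.
  have fA : lebesgue_outer (A k) \is a fin_num.
    by rewrite ge0_fin_numE ?lebesgue_outer_ge0// ltey; apply/eqP/Aoo.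
  have ek : (0 < e%:num / (2 ^ k.+1)%:R :> R)%R by [].
  have [_ [C CA <-] /ltW CV] := lb_ereal_inf_adherent ek fA.
  by exists C.
have /card_esym/ppcard_eqP[f] := card_nat2.
pose vol (z : nat * nat) : \bar R :=
  (box_volume ((G z.1).1.2 z.2) ((G z.1).2 z.2))%:E.
have vol0 z : (0 <= vol z)%E by rewrite lee_fin box_volume_ge0.
pose Q : set (nat * nat) := setT `*`` (fun k => (G k).1.1).
pose C0 := (f @^-1` Q, fun k => (G (f k).1).1.2 (f k).2,
            fun k => (G (f k).1).2 (f k).2).
apply: (@le_trans _ _ (cover_volume C0)).
  apply: ereal_inf_lbound; exists C0 => //.
  move=> x [i _ /((PG i).1)[j Gj xj]]; exists (f^-1%FUN (i, j)).
    by rewrite /C0/= invK ?inE.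
  by rewrite /C0/= invK ?inE.
have -> : cover_volume C0 = (\esum_(z in Q) vol z)%E.
  rewrite /cover_volume/= (@reindex_esum _ _ _ (f @^-1` Q) Q f)//.
  split=> //; first by move=> x y _ _ /inj; apply; rewrite inE.
  by move=> z Qz; exists (f^-1%FUN z); rewrite /= ?invK ?inE.
rewrite /Q -(esum_esum (a := fun i j => vol (i, j)))//.
rewrite nneseries_esumT//; last first.
  by move=> k; rewrite adde_ge0 ?lebesgue_outer_ge0.
by apply: le_esum => k _; exact: (PG k).2.
Qed.

HB.instance Definition _ := isOuterMeasure.Build R 'rV[R]_n lebesgue_outer
  lebesgue_outer0 lebesgue_outer_ge0 le_lebesgue_outer
  lebesgue_outer_sigma_subadditive.

Definition lebesgue_outer_measure : {outer_measure set 'rV[R]_n -> \bar R} :=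
  lebesgue_outer.

(* The Carathéodory measurable sets of this outer measure are the Lebesgue
   measurable sets, and the measure below is complete. *)
Definition lebesgue_type := caratheodory_type lebesgue_outer_measure.

HB.instance Definition _ := Measurable.on lebesgue_type.

Definition lebesgue : {measure set lebesgue_type -> \bar R} :=
  (lebesgue_outer_measure : set (caratheodory_type lebesgue_outer_measure) -> _).

End lebesgue_measure_on_Rn.

Arguments lebesgue_type : clear implicits.
Arguments lebesgue : clear implicits.

Section domains.
Context {R : realType} {n : nat}.
Implicit Types (Omega U : set 'rV[R]_n).

Definition domain Omega := [/\ Omega !=set0, open Omega & connected Omega].

(* A loop is contracted through loops with the same base point f 0. *)
Definition simply_connected Omega :=
  forall f : R -> 'rV[R]_n,
    {within `[0, 1], continuous f} ->
    (forall s, s \in `[0, 1] -> Omega (f s)) ->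
    f 0 = f 1 ->
    exists H : R * R -> 'rV[R]_n,
      [/\ {within `[0, 1] `*` `[0, 1], continuous H},
          forall r s, r \in `[0, 1] -> s \in `[0, 1] -> Omega (H (r, s)),
          forall s, s \in `[0, 1] -> H (0, s) = f s,
          forall s, s \in `[0, 1] -> H (1, s) = f 0 &
          forall r, r \in `[0, 1] -> H (r, 0) = f 0 /\ H (r, 1) = f 0].

(* Meant for open U. *)
Fixpoint Ck_on (k : nat) U (f : 'rV[R]_n -> R) : Prop :=
  {within U, continuous f} /\
  if k is k'.+1 then
    forall i, (forall x, U x -> derivable f x (delta_mx 0 i)) /\
              Ck_on k' U (fun x => 'D_(delta_mx 0 i) f x)
  else True.

Definition smooth_on U f := forall k, Ck_on k U f.

(* Near each of its boundary points Omega is the sublevel set of a smooth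
   function without critical point there. *)
Definition smooth_boundary Omega :=
  forall p, (closure Omega `\` Omega°) p ->
    exists U rho, [/\ open U, U p, smooth_on U rho,
      (exists i, 'D_(delta_mx 0 i) rho p != 0) &
      Omega `&` U = [set x | U x /\ rho x < 0]].

End domains.

Section cones.
Context {R : realType} {m : nat}.
Implicit Types (a b u v : 'cV[R]_m) (A : 'M[R]_m).

Definition nneg_cone : set 'cV[R]_m := [set a | forall i, 0 <= a i 0].

Definition vle a b := nneg_cone (b - a).
Definition vlt a b := vle a b /\ a <> b.
Definition vll a b := nneg_cone° (b - a).

Definition order_interval v : set 'cV[R]_m := [set u | vle 0 u /\ vle u v].

Definition cooperative A := forall i j, i != j -> 0 <= A i j.

(* In particular every 1 x 1 matrix is irreducible. *)
Definition irreducible_mx A :=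
  forall S : {set 'I_m}, S != finset.set0 -> S != finset.setT ->
    exists i j, [/\ i \in S, j \notin S & A i j != 0].

Definition jacobian_mx (f : 'cV[R]_m -> 'cV[R]_m) u : 'M[R]_m :=
  \matrix_(i, j) ('D_(delta_mx j 0) f u) i 0.

(* Extended-real valued, so that it is +oo for unbounded functions. *)
Definition supnorm {E : Type} (A : set E) (f : E -> 'cV[R]_m) : \bar R :=
  ereal_sup [set (`|f x|)%:E | x in A].

Definition lebesgue_measurable {k} (A : set 'rV[R]_k)
    (f : 'rV[R]_k -> 'cV[R]_m) :=
  forall i, measurable_fun (A : set (lebesgue_type R k)) (fun x => f x i 0).

End cones.

(* Functions on the closure of Omega are represented by functions on the whole
   space of which only the values on the closure matter. *)
Section function_spaces.
Context {R : realType} {m n : nat}.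
Variables (Omega : set 'rV[R]_n) (v : 'cV[R]_m) (T : R).
Implicit Types (phi : 'rV[R]_n -> 'cV[R]_m) (u w : R -> 'rV[R]_n -> 'cV[R]_m).

Local Notation cOmega := (closure Omega).

Definition Xspace phi := {within cOmega, continuous phi}.

Definition Xhat phi :=
  lebesgue_measurable cOmega phi /\ (supnorm cOmega phi < +oo)%E.

Definition Xhat_v : set ('rV[R]_n -> 'cV[R]_m) :=
  [set phi | Xhat phi /\ forall x, cOmega x -> order_interval v (phi x)].

Definition Xhat_null : set ('rV[R]_n -> 'cV[R]_m) :=
  [set phi | Xhat phi /\
     {ae lebesgue R n, forall x, cOmega x -> phi x = 0}].

Definition cylinder : set (R * 'rV[R]_n) := setT `*` cOmega.

Definition on_cylinder u : R * 'rV[R]_n -> 'cV[R]_m := fun p => u p.1 p.2.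

Definition periodic u := forall (t : R) x, cOmega x -> u (t + T) x = u t x.

Definition CT u := {within cylinder, continuous (on_cylinder u)} /\ periodic u.

Definition CT_nneg u :=
  CT u /\ forall (t : R) x, cOmega x -> nneg_cone (u t x).

Definition CT_nneg_int u :=
  CT u /\ exists2 e : R, 0 < e & forall w, CT w ->
    (supnorm cylinder (on_cylinder (fun t => (w t \- u t)%R)) < e%:E)%E ->
    CT_nneg w.

(* R x R^n is identified with R^(1 + n). *)
Definition Xtilde u :=
  [/\ lebesgue_measurable [set z : 'rV[R]_(1 + n) | cOmega (rsubmx z)]
        (fun z => u (lsubmx z 0 0) (rsubmx z)),
      (supnorm cylinder (on_cylinder u) < +oo)%E &
      periodic u].

Definition Xtilde_v u :=
  Xtilde u /\ forall (t : R) x, cOmega x -> order_interval v (u t x).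

End function_spaces.

Section equation.
Context {R : realType} {m n : nat}.
Variables (Omega : set 'rV[R]_n) (d : 'rV[R]_m).
Variables (K : 'I_m -> R -> 'rV[R]_n -> R).
Variables (g : R -> 'rV[R]_n -> 'cV[R]_m -> 'cV[R]_m) (v : 'cV[R]_m) (T : R).
Implicit Types (phi : 'rV[R]_n -> 'cV[R]_m) (u w : R -> 'rV[R]_n -> 'cV[R]_m).

Local Notation cOmega := (closure Omega).

Definition C001 :=
  let G (p : R * 'rV[R]_n * 'cV[R]_m) := g p.1.1 p.1.2 p.2 in
  let dG j (p : R * 'rV[R]_n * 'cV[R]_m) :=
    'D_(delta_mx j 0) (g p.1.1 p.1.2) p.2 in
  [/\ {within [set p | cOmega p.1.2], continuous G},
      (forall (t : R) x a j, cOmega x -> derivable (g t x) a (delta_mx j 0)) &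
      (forall j, {within [set p | cOmega p.1.2], continuous (dG j)})].

Definition dispersal t phi x : 'cV[R]_m :=
  \col_i \int[lebesgue R n]_(y in Omega)
    (K i t (x - (y : 'rV[R]_n)) * phi y i 0).

Definition nonlinear_rhs t phi x : 'cV[R]_m :=
  diag_mx d *m dispersal t phi x - diag_mx d *m phi x + g t x (phi x).

Definition linear_rhs t phi x : 'cV[R]_m :=
  diag_mx d *m dispersal t phi x - diag_mx d *m phi x
  + jacobian_mx (g t x) 0 *m phi x.

(* Solutions of the initial value problem in C([0, +oo), Xhat). *)
Record is_solution phi u : Prop := {
  solution_Xhat : forall t : R, 0 <= t -> Xhat Omega (u t) ;
  solution_continuous : forall t : R, 0 <= t ->
    supnorm cOmega (u s \- u t)
      @[s --> within [set s | 0 <= s] (nbhs t)] --> 0%E ;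
  solution_equation : forall (t : R) x, 0 < t -> cOmega x ->
    is_derive t 1 (fun s : R => u s x) (nonlinear_rhs t (u t) x) ;
  solution_initial : forall x, cOmega x -> u 0 x = phi x }.

Definition positive_periodic_solution w :=
  [/\ Xtilde_v Omega v T w,
      (forall (t : R) x i, cOmega x -> 0 < w t x i 0) &
      (forall (t : R) x, cOmega x ->
        is_derive t 1 (fun s : R => w s x) (nonlinear_rhs t (w t) x))].

(* The second clause is the existence of u(t, .; phi), which the notation
   presupposes. *)
Definition globally_asymptotically_stable
    (S : set ('rV[R]_n -> 'cV[R]_m)) w :=
  [/\ is_solution (w 0) w,
      (forall phi, S phi -> exists u, is_solution phi u),
      (forall phi u, S phi -> is_solution phi u ->
        supnorm cOmega (u t \- w t) @[t --> +oo%R] --> 0%E) &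
      (forall eps : R, 0 < eps -> exists2 delta : R, 0 < delta &
        forall phi u, S phi -> is_solution phi u ->
          (supnorm cOmega (phi \- w 0)%R < delta%:E)%E ->
          forall t : R, 0 <= t -> (supnorm cOmega (u t \- w t)%R < eps%:E)%E)].

Definition operator_norm
    (A : ('rV[R]_n -> 'cV[R]_m) -> 'rV[R]_n -> 'cV[R]_m) : \bar R :=
  ereal_sup [set supnorm cOmega (A phi) |
    phi in [set phi | Xspace Omega phi /\ (supnorm cOmega phi <= 1)%E]].

(* Phi t s is relevant for s <= t only.  The last clause says that t |->
   Phi t s phi is differentiable in X, from the right at t = s. *)
Record generated_evolution_family
    (Phi : R -> R -> ('rV[R]_n -> 'cV[R]_m) -> 'rV[R]_n -> 'cV[R]_m)
    : Prop := {
  evolution_X : forall (t s : R) phi, s <= t -> Xspace Omega phi ->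
    Xspace Omega (Phi t s phi) ;
  evolution_linear : forall (t s c : R) phi psi x, s <= t ->
    Xspace Omega phi -> Xspace Omega psi -> cOmega x ->
    Phi t s (fun y => c *: phi y + psi y) x
    = c *: Phi t s phi x + Phi t s psi x ;
  evolution_bounded : forall t s : R, s <= t -> (operator_norm (Phi t s) < +oo)%E ;
  evolution_id : forall (s : R) phi x, Xspace Omega phi -> cOmega x ->
    Phi s s phi x = phi x ;
  evolution_comp : forall (t r s : R) phi x, s <= r -> r <= t ->
    Xspace Omega phi -> cOmega x -> Phi t r (Phi r s phi) x = Phi t s phi x ;
  evolution_continuous : forall (t s : R) phi, s <= t -> Xspace Omega phi ->
    supnorm cOmega (Phi q.1 q.2 phi \- Phi t s phi)
      @[q --> within [set q : R * R | q.2 <= q.1] (nbhs (t, s))] --> 0%E ;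
  evolution_generator : forall (t s : R) phi, s <= t -> Xspace Omega phi ->
    supnorm cOmega (fun x => h^-1 *: (Phi (t + h) s phi x - Phi t s phi x)
                             - linear_rhs t (Phi t s phi) x)
      @[h --> within [set h : R | h != 0 /\ s <= t + h] (nbhs 0)] --> 0%E }.

Definition growth_bound
    (Phi : R -> R -> ('rV[R]_n -> 'cV[R]_m) -> 'rV[R]_n -> 'cV[R]_m)
    : \bar R :=
  ereal_inf [set (omega%:E)%E | omega in [set omega : R |
    exists2 M : R, 1 <= M & forall t s : R, s <= t ->
      (operator_norm (Phi t s) <= (M * expR (omega * (t - s)))%:E)%E]].

Definition LT_domain u :=
  [/\ CT Omega T u,
      (forall (t : R) x, cOmega x -> derivable (fun s : R => u s x) t 1) &
      {within cylinder Omega,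
        continuous (on_cylinder (fun t x => derive1 (fun s : R => u s x) t))}].

Definition LT u t x : 'cV[R]_m :=
  - derive1 (fun s : R => u s x) t + linear_rhs t (u t) x.

(* The spectral bound of LT is growth_bound Phi. *)
Definition is_principal_eigenvalue_growth_bound
    (Phi : R -> R -> ('rV[R]_n -> 'cV[R]_m) -> 'rV[R]_n -> 'cV[R]_m) :=
  exists2 lambda : R, growth_bound Phi = lambda%:E &
    exists psi, [/\ LT_domain psi, CT_nneg_int Omega T psi &
      forall (t : R) x, cOmega x -> LT psi t x = lambda *: psi t x].

End equation.

(* Main.v *)
Require Import Defs.
From HB Require Import structures.
From mathcomp Require Import all_boot all_order all_algebra.
From mathcomp Require Import all_classical all_reals all_analysis.
From mathcomp Require Import measurable_realfun ring lra.

Set Implicit Arguments.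
Unset Strict Implicit.
Unset Printing Implicit Defensive.

Import Order.TTheory GRing.Theory Num.Theory.
Import numFieldNormedType.Exports.

Local Open Scope classical_set_scope.
Local Open Scope ring_scope.

(** All conclusions come from comparing solutions with each other and with
    multiples of each other.

    Two properties of the equation carry it.  Because of cooperativity, ordered
    initial values give ordered solutions ([comparison_principle]), and because of
    subhomogeneity a multiple a u of a solution u, 0 < a <= 1, is a lower solution
    ([trajectory_scaled_order]).  The comparison principle is proved for families
    of curves without compactness of the index set: initial values are merely
    measurable, so extrema over the domain need not be attained.

    Irreducibility turns these into quantitative statements.  Within a fixed time
    a positive component feeds all others at the same point ([mixing]), and since
    the kernels are positive near 0 and the domain is connected, any positive
    amount spreads over the whole domain ([spreading_Harnack]).  Therefore, if
    u >= a w with a < 1 and w stays away from 0, the strict inequality in the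
    subhomogeneity improves a by a definite factor within a fixed time
    ([improvement]).  As a first consequence, any two solutions that stay away from
    0 merge, and do so uniformly ([merging]).

    Let U be the solution that starts from v, which lies above all others in the
    box.  Since U(t + T) <= U(t), there is a dichotomy: U tends to 0 uniformly, or U
    stays away from 0 ([dichotomy]).  To show that U stays away from 0 everywhere if
    it does so in one component at one point, [improvement] is applied to the orbits
    of U at two neighbouring points.  In the first case 0 attracts the box
    ([zero_stable]).  In the second case the merging of U with its shifts by
    multiples of T gives a periodic limit w ([persistent_limit]); it attracts every
    solution whose initial value is not almost everywhere 0, because such a solution
    is above a multiple of v after one period ([limit_stable]).  Here the smoothness
    of the boundary enters: it makes the boundary a null set
    ([smooth_boundary_null]), so that a function on the closed domain which is not
    almost everywhere 0 has a positive integral over the open domain.  Uniqueness of w cannot use [merging], as the time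
    slices of a competitor q need not be measurable in space; the ratio q / w is
    improved from period to period instead ([positive_orbit_ge]).

    It remains to link the two cases with the growth bound of the linearization at
    0, which dominates the reaction because g(a u) / a decreases in a.
    - If the growth bound is negative, the evolution family applied to v
      decays and lies above U; so U tends to 0 ([extinct_of_negative]).
    - If U tends to 0, then at late times U solves the linear equation up to an
      error eta U, since its components are comparable ([components_comparable]).
      Thus exp(eta t) U dominates the evolution family, and the growth bound is at
      most eta for every eta > 0 ([growth_bound_of_extinct]).  So a positive growth
      bound excludes the first case.
    - If the growth bound is 0, the periodic limit w cannot exist.  With strict
      subhomogeneity in all components exp(e t) w is a lower solution of the linear
      equation for some e > 0, and the growth bound would be positive
      ([strict_growth]).  With a principal eigenfunction psi, the smallest multiple
      of psi above w could be lowered, as the difference of the two gains from the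
      strict subhomogeneity ([no_positive_linear_orbit]). *)

(** * Differential inequalities on a time interval *)

Section continuity_in_terms_of_balls.
Context {R : realType} {S : pseudoMetricType R} {V : normedModType R}.

Lemma within_continuous_ballP (A : set S) (f : S -> V) :
  {within A, continuous f} <->
  forall x, A x -> forall e : R, 0 < e -> exists2 d : R, 0 < d &
    forall y, A y -> ball x d y -> `|f x - f y| < e.
Proof.
rewrite subspace_continuousP; split => H x Ax.
  move=> e e0; have /cvgrPdist_lt/(_ e e0) := H x Ax.
  by rewrite near_withinE => /nbhs_ballP[d /= d0 hd]; exists d => // y Ay /hd; exact.
apply/cvgrPdist_lt => e e0; have [d d0 hd] := H x Ax e e0.
rewrite near_withinE; apply/nbhs_ballP; exists d => //= y xy Ay; exact: hd.
Qed.

End continuity_in_terms_of_balls.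

Lemma compact_finite_ball_cover {R : realType} {S : pseudoMetricType R}
    (A : set S) (r : S -> R) : compact A -> (forall x, A x -> 0 < r x) ->
  exists2 s : seq S, (forall x, x \in s -> A x) &
    forall y, A y -> exists2 x, x \in s & ball x (r x) y.
Proof.
move=> cA r0.
pose inA (s : seq S) := forall x, x \in s -> A x.
(* F is the filter of the finite subsets of A, directed by inclusion. *)
pose F : set_system (seq S) := [set B | exists2 s0, inA s0 &
  forall s, inA s -> {subset s0 <= s} -> B s].
have FF : Filter F.
  split; first by exists [::].
    move=> B B' [s sA sB] [s' sA' sB']; exists (s ++ s').
      by move=> x; rewrite mem_cat => /orP[/sA|/sA'].
    move=> q qA qs; split; [apply: sB|apply: sB'] => // x xs; apply: qs;
      by rewrite mem_cat xs ?orbT.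
  by move=> B B' BB' [s sA sB]; exists s => // q qA qs; apply: BB'; exact: sB.
pose P (s : seq S) y := inA s -> exists2 x, x \in s & ball x (r x) y.
have [|s sA sP] := (compact_near_coveringP A).1 cA (seq S) F P FF.
  move=> x Ax; exists (ball x (r x), [set s | inA s -> x \in s]).
    split; first by apply: nbhsx_ballx; exact: r0.
    exists [:: x]; first by move=> y; rewrite inE => /eqP ->.
    by move=> s _ xs _; apply: xs; rewrite inE.
  by move=> [y s] /= [xy xs] sA; exists x => //; exact: xs.
exists s => // y Ay; exact: sP.
Qed.

Lemma is_derive_line {R : realType} {V W : normedModType R} (f : V -> W) (x e : V) (s : R) :
  derivable f (x + s *: e) e ->
  is_derive s 1 (fun r : R => f (x + r *: e)) ('D_e f (x + s *: e)).
Proof.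
move=> df.
have E : (fun h : R => h^-1 *: (f (x + (h *: 1 + s) *: e) - f (x + s *: e)))
    = (fun h : R => h^-1 *: (f (h *: e + (x + s *: e)) - f (x + s *: e))).
  by apply/funext => h; rewrite [h *: 1]mulr1 scalerDl addrCA.
by split; rewrite /derivable /derive /= E.
Qed.

Lemma small_factor {R : realType} (A e : R) : 0 <= A -> 0 < e -> exists2 r : R, 0 < r & A * r <= e.
Proof.
move=> A0 e0; have A1 : 0 < A + 1 by rewrite ltr_wpDl.
exists (e / (A + 1)); first by rewrite divr_gt0.
by rewrite mulrCA ler_piMr ?(ltW e0)// ler_pdivrMr// mul1r lerDl.
Qed.

Section evolution_of_a_real_function.
Context {R : realType}.
Implicit Types (a b c t : R) (f df : R -> R).

(** The end points are treated separately because solutions are only continuous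
    at the initial time. *)
Definition evolves a b f df :=
  {within `[a, b], continuous f} /\
  forall t, a < t < b -> is_derive t 1 f (df t).

Lemma evolvesW a b a' b' f df :
  a <= a' -> b' <= b -> evolves a b f df -> evolves a' b' f df.
Proof.
move=> aa' b'b [cf dfE]; split.
  apply: continuous_subspaceW cf => x /=; rewrite !in_itv/= => /andP[x1 x2].
  by rewrite (le_trans aa')// (le_trans _ b'b).
move=> t /andP[t1 t2]; apply: dfE.
by rewrite (le_lt_trans aa')// (lt_le_trans _ b'b).
Qed.

Lemma evolves_everywhere a b f df :
  (forall t, is_derive t 1 f (df t)) -> evolves a b f df.
Proof.
move=> H; split; last by move=> t _.
apply: continuous_subspaceT => x.
by apply/differentiable_continuous/derivable1_diffP; case: (H x).
Qed.

Lemma eq_evolves a b f df g dg :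
  f = g -> (forall t, a < t < b -> df t = dg t) ->
  evolves a b f df -> evolves a b g dg.
Proof.
by move=> <- e [cf H]; split => // t tab; rewrite -e//; exact: H.
Qed.

Lemma evolves_cst a b c : evolves a b (fun=> c) (fun=> 0).
Proof. by apply: evolves_everywhere => t; exact: is_derive_cst. Qed.

Lemma evolvesD a b f df g dg : evolves a b f df -> evolves a b g dg ->
  evolves a b (fun t => f t + g t) (fun t => df t + dg t).
Proof.
move=> [cf Hf] [cg Hg]; split.
  by move=> x; apply: cvgD; [exact: cf|exact: cg].
by move=> t tab; have := Hf t tab; have := Hg t tab => ? ?; exact: is_deriveD.
Qed.

Lemma evolvesN a b f df : evolves a b f df ->
  evolves a b (fun t => - f t) (fun t => - df t).
Proof.
move=> [cf Hf]; split; first by move=> x; apply: cvgN; exact: cf.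
by move=> t tab; have := Hf t tab => ?; exact: is_deriveN.
Qed.

Lemma evolvesB a b f df g dg : evolves a b f df -> evolves a b g dg ->
  evolves a b (fun t => f t - g t) (fun t => df t - dg t).
Proof. by move=> hf hg; apply: evolvesD => //; exact: evolvesN. Qed.

Lemma evolvesM a b f df g dg : evolves a b f df -> evolves a b g dg ->
  evolves a b (fun t => f t * g t) (fun t => df t * g t + f t * dg t).
Proof.
move=> [cf Hf] [cg Hg]; split.
  by move=> x; apply: cvgM; [exact: cf|exact: cg].
move=> t tab; have := Hf t tab; have := Hg t tab => ? ?.
apply: is_derive_eq; rewrite addrC; congr (_ + _); exact: mulrC.
Qed.

Lemma evolvesZ a b c f df : evolves a b f df ->
  evolves a b (fun t => c * f t) (fun t => c * df t).
Proof.
move=> hf; apply: eq_evolves (evolvesM (evolves_cst a b c) hf) => // t _.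
by rewrite mul0r add0r.
Qed.

Lemma evolves_id a b : evolves a b id (fun=> 1).
Proof. by apply: evolves_everywhere => t; exact: is_derive_id. Qed.

Lemma evolves_expR a b c s :
  evolves a b (fun t => expR (c * (t - s))) (fun t => c * expR (c * (t - s))).
Proof.
apply: evolves_everywhere => t.
have h : is_derive t 1 (fun t => c * (t - s)) c.
  have := @is_derive_shift R t 1 (- s) => h1.
  have h2 := @is_deriveZ R R R (shift (- s)) c t 1 1 h1.
  by apply: (is_derive_eq h2); rewrite scaler1.
have h2 := @is_derive1_comp R expR (fun t => c * (t - s)) t _ _ (is_derive_expR _) h.
by apply: (is_derive_eq h2); rewrite mulrC.
Qed.

Lemma evolves_MVT a b f df : a < b -> evolves a b f df ->
  exists2 c, a < c < b & f b - f a = df c * (b - a).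
Proof.
move=> ab [cf Hf].
have Hf' x : x \in `]a, b[%R -> is_derive x 1 f (df x) by rewrite in_itv/=; exact: Hf.
have [c cab E] := MVT ab Hf' cf.
by exists c => //; move: cab; rewrite in_itv/=.
Qed.

Lemma evolves_bounded_slope a b s t f df (B : R) : a <= b -> evolves a b f df ->
  (forall r, a < r < b -> `|df r| <= B) ->
  a <= s <= b -> a <= t <= b -> `|f s - f t| <= B * `|s - t|.
Proof.
move=> ab; wlog st : s t / t <= s.
  move=> H hf hB sab tab; have [/H|/ltW/H] := leP t s; first exact.
  by rewrite distrC [`|s - t|]distrC; exact.
move=> hf hB sab tab.
move: st; rewrite le_eqVlt => /predU1P[->|st].
  by rewrite !subrr normr0 mulr0.
have hf' : evolves t s f df by apply: evolvesW hf; lra.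
have [c ct ->] := evolves_MVT st hf'.
by rewrite normrM ler_wpM2r//; apply: hB; lra.
Qed.

Lemma evolves_incr a b f df : a <= b -> evolves a b f df ->
  (forall t, a < t < b -> 0 <= df t) -> f a <= f b.
Proof.
rewrite le_eqVlt => /predU1P[->//|ab] hf H.
have [c cab E] := evolves_MVT ab hf.
by rewrite -subr_ge0 E mulr_ge0 ?subr_ge0 ?(ltW ab)//; exact: H.
Qed.

(** At a minimum point with value below the barrier the function would still
    be increasing, so that it was smaller shortly before. *)
Lemma barrier a b f df c : evolves a b f df -> c <= f a ->
  (forall t, a < t < b -> f t < c -> 0 < df t) ->
  forall t, a <= t <= b -> c <= f t.
Proof.
move=> [cf Hf] ca H t tab.
have ab : a <= b by lra.
have [t0 t0ab mint0] := EVT_min ab cf.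
suff : c <= f t0 by move=> h; apply: (le_trans h); apply: mint0; rewrite in_itv.
rewrite leNgt; apply/negP => ft0.
have at0 : a < t0.
  move: t0ab; rewrite in_itv/= => /andP[]; rewrite le_eqVlt => /predU1P[at0|//].
  by move: ft0; rewrite -at0 ltNge ca.
have t0b : t0 <= b by move: t0ab; rewrite in_itv/= => /andP[].
have [e e0 he] : exists2 e, 0 < e & forall s, a <= s <= b -> `|t0 - s| < e -> f s < c.
  have t0i : `[a, b]%classic t0 by [].
  have ft0' : 0 < c - f t0 by rewrite subr_gt0.
  have [e e0 he] := (within_continuous_ballP _ _).1 cf t0 t0i _ ft0'.
  exists e => // s sab st; have := he s.
  by rewrite /= in_itv/= distrC ltr_distl => /(_ sab st)/andP[_]; rewrite addrC subrK.
pose s := Num.max a (t0 - e / 2).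
have ast0 : s < t0 by rewrite gt_max at0/= ltrBlDr ltrDl divr_gt0.
have as_ : a <= s by rewrite le_max lexx.
have [x /andP[x1 x2] E] := evolves_MVT ast0 (evolvesW as_ t0b (conj cf Hf)).
have : 0 < f t0 - f s.
  rewrite E mulr_gt0 ?subr_gt0//; apply: H; first lra.
  apply: he; first lra.
  have : t0 - e / 2 <= s by rewrite le_max lexx orbT.
  by rewrite gtr0_norm ?subr_gt0//; lra.
rewrite subr_gt0 ltNge => /negP; apply; apply: mint0.
by rewrite in_itv/=; apply/andP; split=> //; lra.
Qed.

(** The function exp(C (t - a)) f t - k (t - a) is increasing. *)
Lemma decay_lower_bound a b f df (C k : R) : a <= b -> 0 <= C -> 0 <= k ->
  evolves a b f df ->
  (forall t, a < t < b -> - (C * f t) + k <= df t) ->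
  expR (- (C * (b - a))) * (f a + k * (b - a)) <= f b.
Proof.
move=> ab C0 k0 hf H.
have h : evolves a b (fun t => expR (C * (t - a)) * f t - k * (t - a))
   (fun t => C * expR (C * (t - a)) * f t + expR (C * (t - a)) * df t - k).
  apply: eq_evolves (evolvesB (evolvesM (evolves_expR a b C a) hf)
    (evolvesZ k (evolvesB (evolves_id a b) (evolves_cst a b a)))) => // t _.
  by rewrite subr0 mulr1.
have := evolves_incr ab h; rewrite subrr !mulr0 expR0 mul1r subr0 => H1.
suff: f a <= expR (C * (b - a)) * f b - k * (b - a).
  rewrite lerBrDr => h1.
  by rewrite expRN mulrC ler_pdivrMr ?expR_gt0// [f b * _]mulrC.
apply: H1 => t tab; have := H t tab => h1.
have e1 : 1 <= expR (C * (t - a)) by rewrite -expR0 ler_expR mulr_ge0//; lra.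
have : 0 <= expR (C * (t - a)) * (C * f t + df t - k).
  by rewrite mulr_ge0 ?expR_ge0//; lra.
have : 0 <= (expR (C * (t - a)) - 1) * k by rewrite mulr_ge0 // subr_ge0.
nra.
Qed.

End evolution_of_a_real_function.

Section comparison.
Context {R : realType} {E : Type}.
Variables (D : set E) (a b : R).
Implicit Types (z dz y dy : R -> E -> R).

(** With the weight exp(-2Lt) the derivative of a component is positive as soon
    as that component is below three quarters of the common lower bound, so the
    common lower bound improves by this factor; no extremum over E needs to be
    attained. *)
Lemma comparison_principle z dz (L B : R) : 0 < L ->
  (forall e, D e -> evolves a b (z^~ e) (dz^~ e)) ->
  (forall e, D e -> 0 <= z a e) ->
  (forall t e, a <= t <= b -> D e -> - B <= z t e) ->
  (forall (N : R) t e, a < t < b -> D e -> 0 <= N ->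
     (forall e', D e' -> - N <= z t e') -> z t e < 0 -> - (L * N) <= dz t e) ->
  forall t e, a <= t <= b -> D e -> 0 <= z t e.
Proof.
move=> L0 ev za zB zd t e tab De.
have B0 : 0 <= `|B| by [].
pose w s := expR (- (2 * L) * (s - a)).
have w0 s : 0 < w s by exact: expR_gt0.
have step n : forall s e', a <= s <= b -> D e' -> - (`|B| * (3 / 4) ^+ n) <= w s * z s e'.
  elim: n => [|n IH] s e' sab De'.
    rewrite expr0 mulr1 lerNl -mulrN.
    have [zle|zge] := leP 0 (z s e').
      by rewrite (le_trans _ (normr_ge0 B))// mulr_ge0_le0 ?oppr_le0// ltW.
    have h1 : - z s e' <= `|B| by rewrite lerNl (le_trans _ (zB s e' sab De'))// lerN2 ler_norm.
    have h2 : w s <= 1 by rewrite -expR0 ler_expR; nra.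
    have := w0 s => w00; nra.
  have [A0|A0] := eqVneq (`|B| * (3 / 4) ^+ n) 0.
    by have := IH s e' sab De'; rewrite exprSr (mulrA `|B|) A0 mul0r.
  set A := _ * _ in IH A0.
  have {}A0 : 0 < A by rewrite lt_neqAle eq_sym A0 /= /A mulr_ge0// exprn_ge0//; lra.
  have -> : - (`|B| * (3 / 4) ^+ n.+1) = - (3 / 4 * A) by rewrite /A exprSr; lra.
  pose dw s := w s * (dz s e' - 2 * L * z s e').
  have hev : evolves a b (fun s => w s * z s e') dw.
    apply: eq_evolves (evolvesM (evolves_expR a b (- (2 * L)) a) (ev e' De')) => // r _.
    by rewrite /dw /w; ring.
  apply: (barrier hev) => //.
    by rewrite /w subrr mulr0 expR0 mul1r (le_trans _ (za e' De'))//; lra.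
  move=> r rab hr.
  have rab' : a <= r <= b by lra.
  have zr0 : z r e' < 0.
    by rewrite -(pmulr_rlt0 _ (w0 r)); lra.
  have := zd (A / w r) r e' rab De'.
  have AW : 0 <= A / w r by rewrite divr_ge0// ltW.
  move=> /(_ AW) h.
  have {}h := h _ zr0.
  have h1 : - (L * (A / w r)) <= dz r e'.
    apply: h => e'' De''.
    by rewrite -mulNr ler_pdivrMr// mulrC; exact: IH.
  rewrite /dw mulrBr.
  have h2 : - (L * A) <= w r * dz r e'.
    have -> : - (L * A) = w r * - (L * (A / w r)) by field; rewrite gt_eqF.
    by rewrite ler_pM2l.
  nra.
have hlim : `|B| * (3 / 4) ^+ n @[n --> \oo] --> (0 : R).
  rewrite -[X in _ --> X](mulr0 `|B|); apply: cvgM; first exact: cvg_cst.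
  by apply: cvg_expr; rewrite ger0_norm; lra.
have : 0 <= w t * z t e.
  rewrite leNgt; apply/negP => wz0.
  have wz0' : 0 < - (w t * z t e) by rewrite oppr_gt0.
  move/cvgrPdist_lt/(_ _ wz0') : hlim => -[n _ /(_ n)/=]; rewrite leqnn sub0r normrN => /(_ isT).
  have := step n t e tab De; have := ler_norm (`|B| * (3 / 4) ^+ n).
  by rewrite lerNl; lra.
by rewrite pmulr_rge0.
Qed.

End comparison.

Section Gronwall.
Context {R : realType} {E : Type}.
Variables (D : set E) (a b : R).
Implicit Types (y dy : R -> E -> R).

(** The functions obtained by adding y to the bound and by subtracting it form a
    family with twice as many members to which the comparison principle applies. *)
Lemma Gronwall y dy (L B eps0 eps : R) : 0 < L -> 0 <= eps0 -> 0 <= eps ->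
  (forall e, D e -> evolves a b (y^~ e) (dy^~ e)) ->
  (forall e, D e -> `|y a e| <= eps0) ->
  (forall t e, a <= t <= b -> D e -> `|y t e| <= B) ->
  (forall (N : R) t e, a < t < b -> D e ->
     (forall e', D e' -> `|y t e'| <= N) -> `|dy t e| <= L * N + eps) ->
  forall t e, a <= t <= b -> D e ->
    `|y t e| <= (eps0 + eps * (t - a)) * expR (L * (t - a)).
Proof.
move=> L0 e00 e0 ev ya yB yd t e tab De.
pose sg (c : bool) : R := if c then 1 else -1.
pose bd s := (eps0 + eps * (s - a)) * expR (L * (s - a)).
pose dbd s := eps * expR (L * (s - a)) + L * bd s.
have bd0 s : a <= s -> 0 <= bd s.
  by move=> as_; rewrite /bd mulr_ge0 ?expR_ge0// addr_ge0// mulr_ge0// subr_ge0.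
have bdE : evolves a b bd dbd.
  apply: eq_evolves (evolvesM (evolvesD (evolves_cst a b eps0)
    (evolvesZ eps (evolvesB (evolves_id a b) (evolves_cst a b a))))
    (evolves_expR a b L a)) => // s _.
  by rewrite /dbd /bd; ring.
pose z s (p : E * bool) := bd s + sg p.2 * y s p.1.
pose dz s (p : E * bool) := dbd s + sg p.2 * dy s p.1.
have key c : 0 <= z t (e, c).
  refine (@comparison_principle R (E * bool)%type [set p | D p.1] a b z dz L
    `|B| L0 _ _ _ _ t (e, c) tab De).
  - by move=> [e' c'] /= De'; apply: evolvesD => //; apply: evolvesZ; exact: ev.
  - move=> [e' c'] /= De'; rewrite /z /bd subrr !mulr0 addr0 expR0 mulr1/=.
    have := ya e' De'; rewrite ler_norml => /andP[h1 h2].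
    by case: c' => /=; lra.
  - move=> s [e' c'] /= sab De'; rewrite /z /=.
    have b0 : 0 <= bd s by apply: bd0; case/andP: sab.
    have := yB s e' sab De'; rewrite ler_norml => /andP[h1 h2].
    have := ler_norm B => h3.
    by case: c' => /=; lra.
  - move=> N s [e' c'] sab /= De' N0 hN _.
    have as_ : a <= s by lra.
    have : `|dy s e'| <= L * (bd s + N) + eps.
      apply: yd => // e'' De''.
      have := hN (e'', true) De''; have := hN (e'', false) De''.
      by rewrite /z/= ler_norml => h1 h2; apply/andP; split; lra.
    rewrite ler_norml => /andP[h1 h2]; rewrite /dz /dbd /=.
    have h3 : eps <= eps * expR (L * (s - a)).
      by rewrite ler_peMr// -expR0 ler_expR mulr_ge0 ?subr_ge0// ltW.
    by case: c' => /=; lra.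
have := key true; have := key false; rewrite /z/= ler_norml -/(bd t) => h1 h2.
by apply/andP; split; lra.
Qed.

End Gronwall.

(** * Lebesgue measure on R^n *)

Lemma closed_within_preimage {S V : topologicalType} (A : set S) (f : S -> V) D :
  closed A -> {within A, continuous f} -> closed D -> closed (A `&` f @^-1` D).
Proof.
move=> cA cf cD.
have /closed_subspaceP[W cW WE] := (continuous_closedP _).1 cf _ cD.
by rewrite setIC -[_ `&` _]WE; exact: closedI.
Qed.

Section invariance_of_Lebesgue_measure.
Context {R : realType} {n : nat}.
Implicit Types (a b h x : 'rV[R]_n) (X Z : set 'rV[R]_n) (c : R).

Lemma lebesgue_outer_translate_le h X :
  (lebesgue_outer [set x : 'rV[R]_n | X (x - h)%R] <= lebesgue_outer X)%E.
Proof.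
apply: le_ereal_inf_tmp => _ [[[S A] B] XC <-].
apply: (le_trans (ereal_inf_lbound (ex_intro2 _ _ (S, fun k => A k + h, fun k => B k + h) _ erefl))).
  move=> x /= /XC[k Sk Xk]; exists k => // i; have := Xk i.
  by rewrite !mxE lerBlDr ltrBrDr.
rewrite /cover_volume/= le_eqVlt; apply/orP; left; apply/eqP.
by apply: eq_esum => k _; congr EFin; apply: eq_bigr => i _; rewrite !mxE opprD addrACA subrr addr0.
Qed.

Lemma lebesgue_outer_translate h X :
  lebesgue_outer [set x : 'rV[R]_n | X (x - h)%R] = lebesgue_outer X.
Proof.
apply/eqP; rewrite eq_le lebesgue_outer_translate_le/=.
rewrite [leLHS](_ : _ = lebesgue_outer [set x : 'rV[R]_n | [set x : 'rV[R]_n | X (x - h)%R] (x - (- h))%R]).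
  exact: lebesgue_outer_translate_le.
by congr lebesgue_outer; apply/seteqP; split => x /=; rewrite opprK addrK.
Qed.

Lemma lebesgue_outer_bigcup_null (F : nat -> set 'rV[R]_n) :
  (forall k, lebesgue_outer (F k) = 0%E) -> lebesgue_outer (\bigcup_k F k) = 0%E.
Proof.
move=> F0; apply/eqP; rewrite eq_le lebesgue_outer_ge0 andbT.
by apply: (le_trans (lebesgue_outer_sigma_subadditive _)); rewrite eseries0.
Qed.

(** A hyperplane cuts each box of a covering into two boxes, and their volumes
    add up. *)
Lemma box_measurable_half i c :
  measurable ([set x : 'rV[R]_n | c < x 0 i] : set (lebesgue_type R n)).
Proof.
apply: le_caratheodory_measurable => X /=.
set H := [set x | _]; apply: le_ereal_inf_tmp => _ [[[S A] B] XC <-].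
pose A' k : 'rV[R]_n := \row_j (if j == i then Num.max (A k 0 j) c else A k 0 j).
pose B' k : 'rV[R]_n := \row_j (if j == i then Num.min (B k 0 j) c else B k 0 j).
have h1 : (lebesgue_outer (X `&` H) <= cover_volume (S, A', B))%E.
  apply: ereal_inf_lbound; exists (S, A', B) => // x [/XC[k Sk Xk] Hx].
  exists k => // j; rewrite /= mxE; case: eqP => [->|_]; last exact: Xk.
  by have /andP[h1 h2] := Xk i; rewrite gt_max h1 Hx.
have h2 : (lebesgue_outer (X `&` ~` H) <= cover_volume (S, A, B'))%E.
  apply: ereal_inf_lbound; exists (S, A, B') => // x [/XC[k Sk Xk] /negP Hx].
  exists k => // j; rewrite /= mxE; case: eqP => [->|_]; last exact: Xk.
  by have /andP[h3 h4] := Xk i; rewrite h3 le_min h4 leNgt.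
apply: (le_trans (leeD h1 h2)).
rewrite /cover_volume/= -esumD => [|k _|k _]; last 2 first.
- by rewrite lee_fin box_volume_ge0.
- by rewrite lee_fin box_volume_ge0.
apply: le_esum => k Sk; rewrite -EFinD lee_fin le_eqVlt; apply/orP; left; apply/eqP.
have volE a b : box_volume a b =
    Num.max 0 (b 0 i - a 0 i) * \prod_(j < n | j != i) Num.max 0 (b 0 j - a 0 j).
  by rewrite /box_volume (bigD1 i).
rewrite !volE !mxE eqxx.
under eq_bigr => j /negbTE ji do rewrite mxE ji.
under [X in _ + _ * X = _]eq_bigr => j /negbTE ji do rewrite mxE ji.
rewrite -mulrDl; congr (_ * _); rewrite !maxEle !minEle.
by repeat case: ifPn; rewrite -?ltNge; lra.
Qed.

Lemma box_measurable a b : measurable (box a b : set (lebesgue_type R n)).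
Proof.
have -> : box a b = \bigcap_(i in [set: 'I_n]) ([set x : 'rV[R]_n | a 0 i < x 0 i] `&` ~` [set x : 'rV[R]_n | b 0 i < x 0 i]).
  apply/seteqP; split => x /=.
    move=> H i _; have /andP[h1 h2] := H i.
    by split => //=; apply/negP; rewrite -leNgt.
  move=> H i; have [//= h1 /negP] := H i I.
  by rewrite -leNgt h1.
apply: fin_bigcap_measurable; first exact: finite_finset.
move=> i _; apply: measurableI; first exact: box_measurable_half.
by apply: measurableC; exact: box_measurable_half.
Qed.

Lemma mx_norm_lt x (e : R) : 0 < e -> `|x| < e <-> forall i, `|x 0 i| < e.
Proof.
move=> e0; split => H.
  by move=> i; apply: le_lt_trans H; rewrite /Num.norm/= mx_normrE (le_trans _ (le_bigmax _ _ (0, i))).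
rewrite /Num.norm/= mx_normrE; apply/bigmax_ltP; split => // -[i j] _ /=.
by rewrite ord1; exact: H.
Qed.

Lemma open_lebesgue_measurable X : open X -> measurable (X : set (lebesgue_type R n)).
Proof.
move=> oX.
pose q (p : 'rV[rat]_n) : 'rV[R]_n := map_mx ratr p.
pose F (p : 'rV[rat]_n * 'rV[rat]_n) : set (lebesgue_type R n) :=
  if `[< box (q p.1) (q p.2) `<=` X >] then box (q p.1) (q p.2) else set0.
have -> : X = \bigcup_p F p.
  apply/seteqP; split => [x Xx|x [p _]]; last by rewrite /F; case: asboolP => // h /h.
  have /nbhs_ballP[e/= e0 xe] := oX x Xx.
  have h1 i : exists r : rat, (x 0 i - e < ratr r < x 0 i)%R.
    have [r] := @rat_in_itvoo R (x 0 i - e) (x 0 i) ltac:(by rewrite ltrBlDr ltrDl).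
    by rewrite in_itv/=; exists r.
  have h2 i : exists r : rat, (x 0 i < ratr r < x 0 i + e)%R.
    have [r] := @rat_in_itvoo R (x 0 i) (x 0 i + e) ltac:(by rewrite ltrDl).
    by rewrite in_itv/=; exists r.
  have [p1 p1E] := choice h1; have [p2 p2E] := choice h2.
  exists (\row_i p1 i, \row_i p2 i) => //; rewrite /F ifT; last first.
    apply/asboolP => y /= By; apply: xe; rewrite -ball_normE/=.
    apply/mx_norm_lt => // i; have := By i; rewrite !mxE ltr_norml.
    by have := p1E i; have := p2E i; lra.
  by move=> i /=; rewrite !mxE; have := p1E i; have := p2E i; lra.
apply: countable_bigcupT_measurable => [|p]; first exact: countableP.
by rewrite /F; case: ifP => _ //; exact: box_measurable.
Qed.

Lemma closed_lebesgue_measurable X : closed X -> measurable (X : set (lebesgue_type R n)).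
Proof.
by move=> cX; rewrite -(setCK X); apply: measurableC; apply: open_lebesgue_measurable; exact: closed_openC.
Qed.

Lemma bounded_lebesgue_lty X : bounded_set X -> (lebesgue_outer X < +oo)%E.
Proof.
move=> /ex_strict_bound_gt0[M M0 /= XM].
pose C : set nat * (nat -> 'rV[R]_n) * (nat -> 'rV[R]_n) :=
  ([set 0%N], fun=> const_mx (- M), fun=> const_mx M).
apply: (@le_lt_trans _ _ (cover_volume C)).
  apply: ereal_inf_lbound; exists C => // x Xx; exists 0%N => // i /=.
  have /mx_norm_lt h := XM x Xx; have := h M0 i.
  by rewrite !mxE ltr_norml => /andP[-> /ltW].
by rewrite /cover_volume/= esum_set1 ?lee_fin ?box_volume_ge0// ltry.
Qed.

End invariance_of_Lebesgue_measure.

Section measure_preserving_maps.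
Context {R : realType} {n : nat}.
Implicit Types (a b h x : 'rV[R]_n) (X Z : set 'rV[R]_n) (c : R).

Lemma translate_lebesgue_measurable h X : measurable (X : set (lebesgue_type R n)) ->
  measurable ([set x : 'rV[R]_n | X (x - h)] : set (lebesgue_type R n)).
Proof.
move=> mX; apply: le_caratheodory_measurable => Y /=.
have mXY := mX [set x : 'rV[R]_n | Y (x + h)].
have E W : lebesgue_outer [set x : 'rV[R]_n | W (x + h)%R] = lebesgue_outer W.
  by rewrite -(lebesgue_outer_translate (- h) W); congr lebesgue_outer; apply/seteqP; split => x /=; rewrite opprK.
rewrite -(E Y) -(E (Y `&` _)) -(E (Y `&` ~` _)).
rewrite [leRHS]mXY le_eqVlt; apply/orP; left; apply/eqP; congr (_ + _)%E;
  congr lebesgue_outer; apply/seteqP; split => x /=; rewrite ?addrK//.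
Qed.

(** Infinitely many disjoint translates of the same measure fit into a set of
    finite measure only if this measure is zero. *)
Lemma lebesgue_null_of_disjoint_translates (e : 'rV[R]_n) Z :
  measurable (Z : set (lebesgue_type R n)) -> bounded_set Z ->
  (forall x (s : R), 0 < s <= 1 -> Z x -> Z (x + s *: e) -> False) ->
  lebesgue_outer Z = 0%E.
Proof.
move=> mZ bZ dZ.
pose F (k : nat) : set (lebesgue_type R n) := [set x : 'rV[R]_n | Z (x - (k.+1%:R)^-1 *: e)].
have mF k : measurable (F k) by exact: translate_lebesgue_measurable.
have tF : trivIset setT F.
  apply/trivIsetP => i j _ _ ij; rewrite -subset0 => x [/= Zi Zj].
  wlog : i j ij Zi Zj / (i < j)%N.
    move=> H; move: (ij); rewrite neq_ltn => /orP[/H|/H]; first exact.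
    by apply => //; rewrite eq_sym.
  move=> lij; apply: (dZ _ ((i.+1%:R)^-1 - (j.+1%:R)^-1) _ Zi).
    have h1 : (j.+1%:R)^-1 < (i.+1%:R)^-1 :> R by rewrite ltf_pV2 ?posrE// ltr_nat.
    have h2 : 0 < (j.+1%:R)^-1 :> R by rewrite invr_gt0.
    have h3 : (i.+1%:R)^-1 <= 1 :> R by rewrite invf_le1// ler1n.
    by rewrite subr_gt0 h1 lerBlDr (le_trans h3)// lerDl ltW.
  by move: Zj; rewrite scalerBl addrA subrK.
have EF k : lebesgue R n (F k) = lebesgue_outer Z by exact: lebesgue_outer_translate.
have [M M0 /= ZM] := ex_strict_bound_gt0 bZ.
have bW : bounded_set [set x : 'rV[R]_n | `|x| < M + `|e|].
  exists (M + `|e|); split; first exact: num_real.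
  by move=> y hy x /= hx; apply: ltW; exact: lt_trans hy.
have lW := bounded_lebesgue_lty bW.
have ltyZ := bounded_lebesgue_lty bZ.
have fZ : lebesgue_outer Z \is a fin_num by rewrite ge0_fin_numE// lebesgue_outer_ge0.
have fW : lebesgue_outer [set x : 'rV[R]_n | (`|x| < M + `|e|)%R] \is a fin_num.
  by rewrite ge0_fin_numE// lebesgue_outer_ge0.
have hN N : (fine (lebesgue_outer Z) * N%:R <= fine (lebesgue_outer [set x : 'rV[R]_n | (`|x| < M + `|e|)%R]))%R.
  rewrite -lee_fin EFinM !fineK//.
  have <- : (\sum_(0 <= k < N) lebesgue R n (F k) = lebesgue_outer Z * N%:R%:E)%E.
    under eq_bigr do rewrite EF.
    rewrite -(fineK fZ) (sumEFin _ _ (fun=> fine (lebesgue_outer Z))).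
    by rewrite big_const_nat subn0 iter_addr_0 -EFinM mulr_natr.
  apply: (@le_trans _ _ (lebesgue R n (\bigcup_k F k))).
    rewrite measure_bigcup// (@eq_eseriesl _ _ xpredT) => [|k]; last by rewrite in_setT.
    exact: nneseries_lim_ge.
  apply: le_lebesgue_outer => x [k _ /=] /ZM h.
  rewrite -(subrK ((k.+1%:R)^-1 *: e) x) (le_lt_trans (ler_normD _ _))//.
  rewrite ltr_leD// normrZ ler_piMl// ger0_norm ?invr_ge0//.
  by rewrite invf_le1// ler1n.
apply/eqP; rewrite -(fineK fZ); apply/eqP; congr EFin.
apply/eqP; rewrite eq_le fine_ge0 ?lebesgue_outer_ge0// andbT leNgt; apply/negP => c0.
have := hN (Num.bound (fine (lebesgue_outer [set x : 'rV[R]_n | (`|x| < M + `|e|)%R]) / fine (lebesgue_outer Z))).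
rewrite mulrC -ler_pdivlMr// leNgt => /negP; apply; apply: archi_boundP.
by rewrite divr_ge0// fine_ge0// lebesgue_outer_ge0.
Qed.

(** The reflected boxes lack a face on the other side; faces are null sets since
    their translates in the orthogonal direction are disjoint. *)
Lemma lebesgue_outer_opp_le X : (lebesgue_outer [set x : 'rV[R]_n | X (- x)%R] <= lebesgue_outer X)%E.
Proof.
apply: le_ereal_inf_tmp => _ [[[S A] B] XC <-].
pose face k (i : 'I_n) : set 'rV[R]_n := [set x : 'rV[R]_n | - x 0 i = B k 0 i /\ forall j, A k 0 j <= - x 0 j <= B k 0 j].
have face0 k i : lebesgue_outer (face k i) = 0%E.
  apply: (@lebesgue_null_of_disjoint_translates (delta_mx 0 i)).
  - apply: closed_lebesgue_measurable.
    have -> : face k i = [set x : 'rV[R]_n | - x 0 i = B k 0 i] `&` \bigcap_(j in [set: 'I_n]) ([set x : 'rV[R]_n | A k 0 j <= - x 0 j] `&` [set x : 'rV[R]_n | - x 0 j <= B k 0 j]).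
      apply/seteqP; split=> [x [h1 h2]|x [h1 h2]]; split => // j; first by move=> _; have /andP[] := h2 j.
      by have [/= h3 h4] := h2 j I; rewrite h3.
    have cc j : continuous (fun x : 'rV[R]_n => - x 0 j).
      by move=> x; apply: (@continuousN _ _ _ (fun x : 'rV[R]_n => x 0 j)); exact: coord_continuous.
    have cl j (D : set R) : closed D -> closed [set x : 'rV[R]_n | D (- x 0 j)].
      by move=> cD; exact: ((continuous_closedP _).1 (cc j) _ cD).
    apply: closedI; first exact: (cl i _ (@closed_eq _ _)).
    apply: closed_bigI => j _; apply: closedI; first exact: (cl j _ (@closed_ge _ _)).
    exact: (cl j _ (@closed_le _ _)).
  - exists (`|A k| + `|B k| + 1); split; first exact: num_real.
    move=> y hy x /= [_ H]; apply/ltW; apply: lt_trans hy.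
    have nA j (C : 'rV[R]_n) : `|C 0 j| <= `|C|.
      by rewrite [leRHS]mx_normrE (le_trans _ (le_bigmax _ _ (0, j))).
    apply/mx_norm_lt; first by rewrite ltr_wpDl// addr_ge0.
    move=> j; have := H j; have := nA j (A k); have := nA j (B k).
    by rewrite !ler_norml ltr_norml; lra.
  - move=> x s /andP[s0 _] [h1 _] [h2 _]; move: h2; rewrite !mxE !eqxx mulr1/= -h1 opprD.
    by move/eqP; rewrite -subr_eq0 addrAC subrr add0r oppr_eq0 gt_eqF.
pose Fc := \bigcup_k \bigcup_i (if (i < n)%N =P true is ReflectT h then face k (Ordinal h) else set0).
have Fc0 : lebesgue_outer Fc = 0%E.
  apply: lebesgue_outer_bigcup_null => k; apply: lebesgue_outer_bigcup_null => i.
  by case: eqP => // _; exact: lebesgue_outer0.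
pose C : set nat * (nat -> 'rV[R]_n) * (nat -> 'rV[R]_n) := (S, fun k => - B k, fun k => - A k).
have -> : cover_volume (S, A, B) = cover_volume C.
  apply: eq_esum => k _ /=; congr EFin; apply: eq_bigr => i _.
  by rewrite !mxE opprK addrC.
rewrite -[leRHS]adde0 -Fc0.
apply: (@le_trans _ _ (lebesgue_outer ((\bigcup_(k in S) box (- B k) (- A k)) `|` Fc))).
  apply: le_lebesgue_outer => x /= /XC[k Sk Xk] /=.
  have [[i h]|H] := pselect (exists i, - x 0 i = B k 0 i).
    right; exists k => //; exists i => //; case: eqP => [h'|]; last by rewrite ltn_ord.
    have -> : Ordinal h' = i by exact: val_inj.
    by split => // j; have := Xk j; rewrite !mxE => /andP[/ltW -> ->].
  left; exists k => // i; have := Xk i; rewrite !mxE.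
  have : - x 0 i != B k 0 i by apply/eqP => h; apply: H; exists i.
  move=> ne /andP[/= h1 h2]; have h3 : - x 0 i < B k 0 i by rewrite lt_neqAle ne.
  by rewrite ltrNl lerNr h3 ltW.
apply: (le_trans (outer_measureU2 lebesgue_outer_measure _ _)).
apply: leeD => //; apply: ereal_inf_lbound; exists C => //.
Qed.

Lemma lebesgue_outer_opp X : lebesgue_outer [set x : 'rV[R]_n | X (- x)%R] = lebesgue_outer X.
Proof.
apply/eqP; rewrite eq_le lebesgue_outer_opp_le/=.
rewrite [leLHS](_ : _ = lebesgue_outer [set x : 'rV[R]_n | [set x : 'rV[R]_n | X (- x)%R] (- x)%R]).
  exact: lebesgue_outer_opp_le.
by congr lebesgue_outer; apply/seteqP; split => x /=; rewrite opprK.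
Qed.

Lemma opp_lebesgue_measurable X : measurable (X : set (lebesgue_type R n)) ->
  measurable ([set x : 'rV[R]_n | X (- x)] : set (lebesgue_type R n)).
Proof.
move=> mX; apply: le_caratheodory_measurable => Y /=.
have mXY := mX [set x : 'rV[R]_n | Y (- x)].
rewrite -(lebesgue_outer_opp Y) -(lebesgue_outer_opp (Y `&` _)) -(lebesgue_outer_opp (Y `&` ~` _)).
rewrite [leRHS]mXY le_eqVlt; apply/orP; left; apply/eqP; congr (_ + _)%E;
  congr lebesgue_outer; apply/seteqP; split => x /=; rewrite ?opprK//.
Qed.

End measure_preserving_maps.

Section sets_of_measure_zero.
Context {R : realType} {n : nat}.
Implicit Types (a b h x : 'rV[R]_n) (X Z U Omega : set 'rV[R]_n) (c : R).

(** Otherwise the whole space, a countable union of translates of a small ball,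
    would be null. *)
Lemma ball_lebesgue_gt0 x (e : R) : lebesgue_outer [set: 'rV[R]_n] != 0%E -> 0 < e ->
  (0 < lebesgue_outer (ball x e))%E.
Proof.
move=> nz e0; rewrite lt_neqAle lebesgue_outer_ge0 andbT; apply/negP => /eqP/esym H.
move/eqP: nz; apply; apply/eqP; rewrite eq_le lebesgue_outer_ge0 andbT.
pose q (p : 'rV[rat]_n) : 'rV[R]_n := map_mx ratr p.
have Hq (y : 'rV[R]_n) : lebesgue_outer (ball y e) = 0%E.
  rewrite -H -[RHS](lebesgue_outer_translate (y - x)); congr lebesgue_outer.
  by apply/seteqP; split => w; rewrite -!ball_normE/= (_ : x - (w - (y - x)) = y - w)//;
    rewrite opprB addrC addrAC subrK.
pose F (k : nat) : set 'rV[R]_n := if unpickle k is Some p then ball (q p) e else set0.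
rewrite -[leRHS](@lebesgue_outer_bigcup_null R n F) => [|k]; last first.
  by rewrite /F; case: unpickle => [p|]; [exact: Hq|exact: lebesgue_outer0].
apply: le_lebesgue_outer => y _.
have h1 i : exists r : rat, (y 0 i < ratr r < y 0 i + e)%R.
  have [r] := @rat_in_itvoo R (y 0 i) (y 0 i + e) ltac:(by rewrite ltrDl).
  by rewrite in_itv/=; exists r.
have [p pE] := choice h1.
exists (pickle (\row_i p i : 'rV[rat]_n)) => //; rewrite /F pickleK -ball_normE/=.
apply/mx_norm_lt => // i; rewrite !mxE ltr_norml.
by have := pE i; lra.
Qed.

Lemma open_lebesgue_gt0 U : lebesgue_outer [set: 'rV[R]_n] != 0%E ->
  open U -> U !=set0 -> (0 < lebesgue_outer U)%E.
Proof.
move=> nz oU [x Ux]; have /nbhs_ballP[e/= e0 xe] := oU x Ux.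
by apply: (lt_le_trans (ball_lebesgue_gt0 x nz e0)); exact: le_lebesgue_outer.
Qed.

(** A level set crossed transversally by the lines in direction e_i meets each
    of these lines at most once, so its small translates are disjoint. *)
Lemma transversal_level_set_null (rho : 'rV[R]_n -> R) U p i :
  open U -> U p -> smooth_on U rho -> 'D_(delta_mx 0 i) rho p != 0 ->
  exists2 r : R, 0 < r &
    lebesgue_outer (closed_ball p r `&` [set x | U x /\ rho x = 0]) = 0%E.
Proof.
move=> oU Up sm nz.
have [crho /(_ i)[drho [cD _]]] := sm 1%N.
have /nbhs_ballP[e1/= e10 h1] := oU p Up.
have nz' : 0 < `|'D_(delta_mx 0 i) rho p| by rewrite normr_gt0.
have [e2 e20 h2] := (within_continuous_ballP _ _).1 cD p Up _ nz'.
pose r := Num.min e1 e2 / 2.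
have r0 : 0 < r by rewrite divr_gt0// lt_min e10 e20.
have rm : r < Num.min e1 e2.
  by rewrite ltr_pdivrMr// mulr_natr mulr2n ltrDl lt_min e10 e20.
have re1 : r < e1 by rewrite (lt_le_trans rm)// ge_min lexx.
have re2 : r < e2 by rewrite (lt_le_trans rm)// ge_min lexx orbT.
have inU y : `|p - y| <= r -> U y /\ 'D_(delta_mx 0 i) rho y != 0.
  move=> py; have Uy : U y by apply: h1; rewrite -ball_normE/=; exact: le_lt_trans re1.
  split => //; apply/eqP => Dy.
  have := h2 y Uy; rewrite -ball_normE/= Dy subr0 ltxx => H.
  by have := H (le_lt_trans py re2).
exists r => //; rewrite closed_ballE//; apply: (@lebesgue_null_of_disjoint_translates R n (delta_mx 0 i)).
- apply: closed_lebesgue_measurable.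
  have -> : closed_ball_ Num.norm p r `&` [set x | U x /\ rho x = 0] =
     closed_ball_ Num.norm p r `&` (rho @^-1` [set 0]).
    apply/seteqP; split => [x [h3 [_ h4]]//|x [h3 h4]]; split => //; split => //.
    exact: (inU x h3).1.
  have cb : closed (closed_ball_ Num.norm p r) by rewrite -closed_ballE//; exact: closed_ball_closed.
  have cr : {within closed_ball_ Num.norm p r, continuous rho}.
    by apply: continuous_subspaceW crho => y /inU[].
  by apply: closed_within_preimage => //; exact: closed_eq.
- exists (`|p| + r); split; first exact: num_real.
  move=> y hy x [h3 _]; apply/ltW/(le_lt_trans _ hy).
  by rewrite -[x](subKr p) (le_trans (ler_normB _ _))// lerD2l.
- move=> x s /andP[s0 _] [xr [_ rx]] [xsr [_ rxs]].
  have seg (t : R) : 0 <= t <= s -> `|p - (x + t *: delta_mx 0 i)| <= r.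
    move=> /andP[t0 ts].
    have -> : p - (x + t *: delta_mx 0 i) = (1 - t / s) *: (p - x) + (t / s) *: (p - (x + s *: delta_mx 0 i)).
      rewrite !scalerBr !scalerDr scalerA divfK ?gt_eqF// scalerBl !scale1r scalerBl scale1r.
      by apply/rowP => j; rewrite !mxE; ring.
    have t1 : 0 <= t / s by rewrite divr_ge0// ltW.
    have t2 : t / s <= 1 by rewrite ler_pdivrMr// mul1r.
    have t3 : 0 <= 1 - t / s by rewrite subr_ge0.
    rewrite (le_trans (ler_normD _ _))// (normrZ (1 - t / s)) (normrZ (t / s)) (ger0_norm t1) (ger0_norm t3).
    have := ler_wpM2l t1 xsr; have := ler_wpM2l t3 xr; lra.
  have ev : evolves 0 s (fun t => rho (x + t *: delta_mx 0 i)) (fun t => 'D_(delta_mx 0 i) rho (x + t *: delta_mx 0 i)).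
    have dv (q : R) : 0 <= q <= s -> is_derive q 1 (fun t => rho (x + t *: delta_mx 0 i)) ('D_(delta_mx 0 i) rho (x + q *: delta_mx 0 i)).
      by move=> /seg/inU[Ut _]; apply: is_derive_line; exact: drho.
    split; last by move=> t /andP[/ltW t0 /ltW ts]; apply: dv; rewrite t0.
    apply: derivable_within_continuous => t; rewrite in_itv/= => ts.
    by case: (dv t ts).
  have [c /andP[/ltW c0 /ltW cs]] := evolves_MVT s0 ev.
  rewrite rxs scale0r addr0 rx subrr subr0 => /esym/eqP.
  rewrite mulf_eq0 (gt_eqF s0) orbF => H.
  by have [|_ /negP] := inU (x + c *: delta_mx 0 i); [apply: seg; rewrite c0|].
Qed.

(** Near each boundary point the boundary lies in a level set as above; being
    compact it is covered by finitely many of them. *)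
Lemma smooth_boundary_null Omega : open Omega -> bounded_set Omega ->
  smooth_boundary Omega -> lebesgue_outer (closure Omega `\` Omega) = 0%E.
Proof.
move=> oO bO sO.
have cB : compact (closure Omega `\` Omega).
  apply: bounded_closed_compact.
    have [M [Mr HM]] := bO; exists M; split => // y My x [xO _].
    have : closure [set x : 'rV[R]_n | `|x| <= y] x.
      by apply: closure_subset xO => z Oz; exact: HM.
    suff /closure_id <- : closed [set x : 'rV[R]_n | `|x| <= y] by [].
    have -> : [set x : 'rV[R]_n | `|x| <= y] = (fun x : 'rV[R]_n => `|x|) @^-1` [set z | z <= y] by [].
    by apply: ((continuous_closedP _).1 _ _ (@closed_le _ _)); exact: norm_continuous.
  apply: closedI; first exact: closed_closure.
  exact: open_closedC.
have H p : exists r : R, (closure Omega `\` Omega) p -> 0 < r /\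
    lebesgue_outer (closed_ball p r `&` (closure Omega `\` Omega)) = 0%E.
  have [Bp|] := pselect ((closure Omega `\` Omega) p); last by exists 0.
  have [U [rho [oU Up sm [i Di] UE]]] : exists U rho, [/\ open U, U p, smooth_on U rho,
      (exists i, 'D_(delta_mx 0 i) rho p != 0) & Omega `&` U = [set x | U x /\ rho x < 0]].
    by apply: sO; rewrite (interior_id _).1.
  have [r r0 rN] := transversal_level_set_null oU Up sm Di.
  have /nbhs_ballP[e/= e0 eU] := oU p Up.
  pose r' := Num.min r (e / 2).
  have r'0 : 0 < r' by rewrite lt_min r0 divr_gt0.
  exists r' => _; split => //.
  apply/eqP; rewrite eq_le lebesgue_outer_ge0 andbT -rN.
  apply: le_lebesgue_outer => x; rewrite !closed_ballE//= /closed_ball_/= => -[xr [cx nx]].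
  have Ux : U x.
    apply: eU; rewrite -ball_normE/= (le_lt_trans xr)// (@le_lt_trans _ _ (e / 2))//; first by rewrite ge_min lexx orbT.
    by rewrite ltr_pdivrMr// mulr_natr mulr2n ltrDl.
  split; first by rewrite (le_trans xr)// ge_min lexx.
  split => //; apply/eqP; rewrite eq_le; apply/andP; split; last first.
    rewrite leNgt; apply/negP => h; apply: nx.
    by have : [set x | U x /\ rho x < 0] x by []; rewrite -UE => -[].
  rewrite leNgt; apply/negP => rx.
  have [d d0 hd] := (within_continuous_ballP _ _).1 (sm 0%N).1 x Ux _ rx.
  have nbx : nbhs x (ball x d `&` U).
    by apply: filterI; [exact: nbhsx_ballx|exact: oU].
  have [y [Oy [xy Uy]]] := cx _ nbx.
  have : (Omega `&` U) y by [].
  rewrite UE => -[_ ry]; have := hd y Uy xy.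
  by rewrite ltr_norml => /andP[_]; lra.
have [r hr] := choice H.
have [s sB Bs] := @compact_finite_ball_cover R 'rV[R]_n _ r cB (fun p Bp => (hr p Bp).1).
pose F k := closed_ball (nth 0 s k) (r (nth 0 s k)) `&` (closure Omega `\` Omega).
apply/eqP; rewrite eq_le lebesgue_outer_ge0 andbT.
rewrite -[leRHS](@lebesgue_outer_bigcup_null R n (fun k => if (k < size s)%N then F k else set0)); last first.
  move=> k; case: ifPn => [ks|_]; last exact: lebesgue_outer0.
  exact: (hr _ (sB _ (mem_nth 0 ks))).2.
apply: le_lebesgue_outer => y By; have [x xs xy] := Bs y By.
exists (index x s) => //; rewrite index_mem xs; split => //; rewrite nth_index//.
exact: subset_closed_ball.
Qed.

End sets_of_measure_zero.

(** * Integrals over a bounded domain *)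

Section integrals_without_measurability.
Context d {T : measurableType d} {R : realType} (mu : {measure set T -> \bar R}).
Variables (D : set T) (mD : measurable D) (muD : (mu D < +oo)%E).

Import HBNNSimple.

(** The integral of a nonnegative function is the supremum of those of the
    simple functions below it, whether or not the function is measurable. *)
Lemma ge0_integral_mono (f h : T -> \bar R) :
  (forall x, D x -> 0 <= f x)%E -> (forall x, D x -> f x <= h x)%E ->
  (\int[mu]_(x in D) f x <= \int[mu]_(x in D) h x)%E.
Proof.
move=> f0 fh; rewrite !ge0_integralE//; last by move=> x Dx; rewrite (le_trans (f0 x Dx))// fh.
apply: ereal_sup_le => _ [s sf <-]; exists s => // x.
apply: (le_trans (sf x)); rewrite /patch; case: ifPn => //.
by rewrite inE; exact: fh.
Qed.

Let fin_integral (f : T -> R) (B : R) : (forall x, D x -> 0 <= f x <= B) ->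
  (\int[mu]_(x in D) (f x)%:E)%E \is a fin_num.
Proof.
move=> fB; rewrite ge0_fin_numE; last first.
  by apply: integral_ge0 => x /fB; rewrite lee_fin => /andP[].
apply: (@le_lt_trans _ _ (\int[mu]_(x in D) `|B|%:E)%E).
  apply: ge0_integral_mono => x /fB; rewrite lee_fin => /andP[// _ fb].
  by rewrite (le_trans fb)// ler_norm.
rewrite integral_cst// lte_mul_pinfty//.
Qed.

Lemma Rintegral_mono (f h : T -> R) (B : R) :
  (forall x, D x -> 0 <= f x) -> (forall x, D x -> f x <= h x) ->
  (forall x, D x -> h x <= B) ->
  \int[mu]_(x in D) f x <= \int[mu]_(x in D) h x.
Proof.
move=> f0 fh hB; apply: fine_le.
- by apply: (fin_integral (B := B)) => x Dx; rewrite f0// (le_trans (fh x Dx))// hB.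
- by apply: (fin_integral (B := B)) => x Dx; rewrite hB// (le_trans (f0 x Dx))// fh.
- by apply: ge0_integral_mono => x Dx; rewrite lee_fin ?f0// fh.
Qed.

(** Without measurability the integral is not additive.  Here f - e stays below h,
    and the simple functions below f are lowered by e instead. *)
Lemma Rintegral_le_add_cst (f h : T -> R) (B e : R) : 0 <= e ->
  (forall x, D x -> 0 <= f x) -> (forall x, D x -> f x <= h x + e) ->
  (forall x, D x -> 0 <= h x <= B) ->
  \int[mu]_(x in D) f x <= \int[mu]_(x in D) h x + e * fine (mu D).
Proof.
move=> e0 f0 fh hB.
have fB x : D x -> 0 <= f x <= B + e.
  by move=> Dx; rewrite f0//= (le_trans (fh x Dx))// lerD2r; case/andP: (hB x Dx).
rewrite -lee_fin EFinD !fineK ?(fin_integral hB) ?(fin_integral fB)//.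
have fmuD : mu D \is a fin_num by rewrite ge0_fin_numE.
rewrite EFinM fineK// ge0_integralE//.
apply: ge_ereal_sup => _ [s sf <-].
pose s' x := Num.max (s x - e) 0.
have ms' : measurable_fun setT s'.
  by apply: measurable_maxr => //; apply: measurable_funB.
have -> : sintegral mu s = (\int[mu]_(x in D) (s x)%:E)%E.
  rewrite integral_nnsfun//; congr sintegral; apply/funext => x.
  rewrite /patch; case: ifPn => // /negP xD; apply/eqP; rewrite eq_le fun_ge0 andbT.
  have := sf x; rewrite /patch ifF ?lee_fin//.
  by apply/negP.
apply: (@le_trans _ _ (\int[mu]_(x in D) ((s' x)%:E + e%:E))%E).
  apply: ge0_integral_mono => x Dx; rewrite lee_fin//.
  by rewrite -lerBlDr /s' le_max lexx.
rewrite ge0_integralD//; last 2 first.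
- by move=> x _; rewrite lee_fin /s' le_max lexx orbT.
- by apply/measurable_EFinP; exact: measurable_funTS.
rewrite integral_cst// leeD2r//; apply: ge0_integral_mono => x Dx.
  by rewrite lee_fin /s' le_max lexx orbT.
rewrite lee_fin /s' ge_max; have /andP[-> _] := hB x Dx; rewrite andbT lerBlDr.
rewrite (le_trans _ (fh x Dx))//.
by have := sf x; rewrite /patch ifT ?inE// lee_fin.
Qed.

End integrals_without_measurability.

Section measurability_on_Rn.
Context {R : realType} {n : nat}.

Lemma within_continuous_measurable (A : set 'rV[R]_n) (f : 'rV[R]_n -> R) :
  measurable (A : set (lebesgue_type R n)) -> {within A, continuous f} ->
  measurable_fun (A : set (lebesgue_type R n)) f.
Proof.
move=> mA /continuousP cf; apply: (measurability _ (RGenOpens.measurableE R)).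
move=> _ [_ [a [b ->] <-]].
have oab : open (`]a, b[%classic : set R) by exact: interval_open.
have /open_subspaceP[V oV VE] := cf _ oab.
rewrite setIC -[_ `&` _]VE; apply: measurableI => //.
exact: open_lebesgue_measurable.
Qed.

Lemma reflect_lebesgue_integral (k : 'rV[R]_n -> R) x : continuous k ->
  (forall y, 0 <= k y) ->
  (\int[lebesgue R n]_y (k (x - (y : 'rV[R]_n)))%:E = \int[lebesgue R n]_y (k y)%:E)%E.
Proof.
move=> ck k0.
pose phi (y : lebesgue_type R n) : lebesgue_type R n := x - (y : 'rV[R]_n).
have E (A : set 'rV[R]_n) : phi @^-1` A = [set y : 'rV[R]_n | [set z : 'rV[R]_n | A (- z)] (y - x)].
  by apply/seteqP; split => y /=; rewrite opprB.
have mphi : measurable_fun setT phi.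
  move=> _ A mA; rewrite setTI E.
  by apply: translate_lebesgue_measurable; exact: opp_lebesgue_measurable.
have mk : measurable_fun [set: lebesgue_type R n] (fun y => (k y)%:E).
  apply/measurable_EFinP; apply: within_continuous_measurable; first exact: measurableT.
  by apply: continuous_subspaceT => y; exact: ck.
have := @ge0_integral_pushforward _ _ _ _ R phi mphi (lebesgue R n) setT _ measurableT mk.
rewrite preimage_setT => <-; last by move=> y _; rewrite lee_fin.
apply: eq_measure_integral => A mA _.
transitivity (lebesgue_outer (phi @^-1` A)) => //.
by rewrite E lebesgue_outer_translate lebesgue_outer_opp.
Qed.

End measurability_on_Rn.

Definition spread {R : realType} {n : nat} (Omega : set 'rV[R]_n)
    (k phi : 'rV[R]_n -> R) (x : 'rV[R]_n) : R :=
  \int[lebesgue R n]_(y in Omega) (k (x - (y : 'rV[R]_n)) * phi y).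

Section spread.
Context {R : realType} {n : nat}.
Variable Omega : set 'rV[R]_n.
Hypothesis oO : open Omega.
Hypothesis bO : bounded_set Omega.
Implicit Types (k phi psi : 'rV[R]_n -> R) (x : 'rV[R]_n) (B c e : R).

Let vol := fine (lebesgue R n Omega).

Definition convolution_kernel k := continuous k /\ forall x, 0 <= k x.

Definition bounded_measurable phi :=
  measurable_fun (Omega : set (lebesgue_type R n)) phi /\
  exists B, forall y, Omega y -> `|phi y| <= B.

Let mO : measurable (Omega : set (lebesgue_type R n)).
Proof. exact: open_lebesgue_measurable. Qed.

Let ltyO : (lebesgue R n Omega < +oo)%E.
Proof. exact: bounded_lebesgue_lty. Qed.

Lemma closure_bounded_compact : compact (closure Omega).
Proof.
apply: bounded_closed_compact; last exact: closed_closure.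
have [M [Mr HM]] := bO; exists M; split => // y My x xO.
have : closure [set x : 'rV[R]_n | `|x| <= y] x.
  by apply: closure_subset xO => z Oz; exact: HM.
suff /closure_id <- : closed [set x : 'rV[R]_n | `|x| <= y] by [].
by apply: ((continuous_closedP _).1 _ _ (@closed_le _ _)); exact: norm_continuous.
Qed.

Lemma kernel_bounded k x : convolution_kernel k -> exists2 B, 0 < B & forall y, Omega y -> k (x - y) <= B.
Proof.
move=> [ck k0].
have c1 : {within closure Omega, continuous (fun y => k (x - y))}.
  apply: continuous_subspaceT => y; apply: continuous_comp; last exact: ck.
  by apply: continuousB; [exact: cst_continuous|exact: cvg_id].
have /ex_strict_bound_gt0[B B0 /= HB] : bounded_set ((fun y => k (x - y)) @` closure Omega).
  exact/compact_bounded/continuous_compact/closure_bounded_compact.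
exists B => // y Oy; apply: (le_trans (ler_norm _)); apply/ltW; apply: HB.
by exists y => //; exact: subset_closure.
Qed.

Lemma bounded_measurableD phi psi : bounded_measurable phi -> bounded_measurable psi ->
  bounded_measurable (fun y => phi y + psi y).
Proof.
move=> [m1 [B1 h1]] [m2 [B2 h2]]; split; first exact: measurable_funD.
by exists (B1 + B2) => y Oy; rewrite (le_trans (ler_normD _ _))// lerD ?h1 ?h2.
Qed.

Lemma bounded_measurable_cst c : bounded_measurable (fun=> c).
Proof. by split; [exact: measurable_cst|exists `|c|]. Qed.

Lemma bounded_measurableZ c phi : bounded_measurable phi ->
  bounded_measurable (fun y => c * phi y).
Proof.
move=> [m1 [B1 h1]]; split; first exact: measurable_funM.
by exists (`|c| * B1) => y Oy; rewrite normrM ler_wpM2l// h1.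
Qed.

Lemma bounded_measurableB phi psi : bounded_measurable phi -> bounded_measurable psi ->
  bounded_measurable (fun y => phi y - psi y).
Proof.
move=> h1 /(bounded_measurableZ (-1)) h2; have := bounded_measurableD h1 h2.
by under eq_fun do rewrite mulN1r.
Qed.

Lemma spread_integrable k phi x : convolution_kernel k -> bounded_measurable phi ->
  (lebesgue R n).-integrable Omega (EFin \o (fun y => k (x - (y : 'rV[R]_n)) * phi y)).
Proof.
move=> kk [mphi [B hB]]; apply: (measurable_bounded_integrable mO ltyO).
  apply: (measurable_funM _ mphi); apply: (within_continuous_measurable mO).
  apply: continuous_subspaceT => y; apply: continuous_comp; last exact: kk.1.
  by apply: continuousB; [exact: cst_continuous|exact: cvg_id].
have [B' B'0 hB'] := kernel_bounded x kk.
exists (B' * B); split; first exact: num_real.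
move=> y hy z Oz /=; apply/ltW/(le_lt_trans _ hy).
by rewrite normrM ler_pM// ?hB// ger0_norm ?hB'//; exact: kk.2.
Qed.

Lemma spreadD k phi psi x : convolution_kernel k -> bounded_measurable phi -> bounded_measurable psi ->
  spread Omega k (fun y => phi y + psi y) x = spread Omega k phi x + spread Omega k psi x.
Proof.
move=> kk h1 h2; rewrite /spread; under eq_Rintegral do rewrite mulrDr.
by rewrite RintegralD//; exact: spread_integrable.
Qed.

Lemma spreadZ k phi c x : convolution_kernel k -> bounded_measurable phi ->
  spread Omega k (fun y => c * phi y) x = c * spread Omega k phi x.
Proof.
move=> kk h1; rewrite /spread; under eq_Rintegral do rewrite mulrCA.
by rewrite RintegralZl//; exact: spread_integrable.
Qed.

Lemma spreadB k phi psi x : convolution_kernel k -> bounded_measurable phi -> bounded_measurable psi ->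
  spread Omega k (fun y => phi y - psi y) x = spread Omega k phi x - spread Omega k psi x.
Proof.
move=> kk h1 h2; rewrite -[in RHS]mulN1r -(spreadZ (-1) x kk h2).
rewrite -(spreadD x kk h1 (bounded_measurableZ (-1) h2)).
by congr spread; apply/funext => y; rewrite mulN1r.
Qed.

Lemma spread_ge0 k phi x : convolution_kernel k -> (forall y, Omega y -> 0 <= phi y) ->
  0 <= spread Omega k phi x.
Proof.
move=> [_ k0] h; apply: Rintegral_ge0 => y Oy; rewrite mulr_ge0//; exact: h.
Qed.

Lemma le_spread k phi psi x : convolution_kernel k -> bounded_measurable phi -> bounded_measurable psi ->
  (forall y, Omega y -> phi y <= psi y) -> spread Omega k phi x <= spread Omega k psi x.
Proof.
move=> kk h1 h2 h; rewrite -subr_ge0 -spreadB//; apply: spread_ge0 => // y Oy.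
by rewrite subr_ge0 h.
Qed.

Lemma le_spread_nonmeasurable k phi psi x B : convolution_kernel k ->
  (forall y, Omega y -> 0 <= phi y <= psi y) -> (forall y, Omega y -> psi y <= B) ->
  spread Omega k phi x <= spread Omega k psi x.
Proof.
move=> kk h hB; have [Bk Bk0 hBk] := kernel_bounded x kk.
apply: (@Rintegral_mono _ _ _ _ _ mO ltyO _ _ (Bk * B)) => y Oy; have /andP[h1 h2] := h y Oy.
- by rewrite mulr_ge0// kk.2.
- by rewrite ler_wpM2l// kk.2.
- by rewrite ler_pM ?hBk ?hB// ?kk.2// (le_trans h1).
Qed.

Lemma spread1_le1 k x : convolution_kernel k -> (\int[lebesgue R n]_y (k y)%:E = 1)%E ->
  spread Omega k (fun=> 1) x <= 1.
Proof.
move=> kk k1; rewrite /spread/Rintegral -[leRHS]/(fine 1%E) -k1.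
rewrite -(reflect_lebesgue_integral x kk.1 kk.2).
under [X in fine X <= _]eq_integral do rewrite mulr1.
have H : (\int[lebesgue R n]_(y in Omega) (k (x - (y : 'rV[R]_n)))%:E <=
   \int[lebesgue R n]_y (k (x - (y : 'rV[R]_n)))%:E)%E.
  apply: (ge0_subset_integral _ mO measurableT) => [||//].
  - apply/measurable_EFinP; apply: (within_continuous_measurable measurableT).
    apply: continuous_subspaceT => y; apply: continuous_comp; last exact: kk.1.
    by apply: continuousB; [exact: cst_continuous|exact: cvg_id].
  - by move=> y _; rewrite lee_fin kk.2.
apply: fine_le => //.
- rewrite ge0_fin_numE; last by apply: integral_ge0 => y _; rewrite lee_fin kk.2.
  by rewrite (le_lt_trans H)// (reflect_lebesgue_integral x kk.1 kk.2) k1 ltry.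
- by rewrite (reflect_lebesgue_integral x kk.1 kk.2) k1.
Qed.

Lemma spread_cst k c x : convolution_kernel k ->
  spread Omega k (fun=> c) x = c * spread Omega k (fun=> 1) x.
Proof.
move=> kk; rewrite -spreadZ//; last exact: bounded_measurable_cst.
by congr spread; apply/funext => y; rewrite mulr1.
Qed.

Lemma spread_norm_le k phi x B : convolution_kernel k -> (\int[lebesgue R n]_y (k y)%:E = 1)%E ->
  bounded_measurable phi -> (forall y, Omega y -> `|phi y| <= B) -> 0 <= B ->
  `|spread Omega k phi x| <= B.
Proof.
move=> kk k1 h hB B0.
have cB c : `|c| <= B -> `|spread Omega k (fun=> c) x| <= B.
  move=> cB; rewrite spread_cst// normrM -[leRHS]mulr1 ler_pM//.
  by rewrite ger0_norm ?spread1_le1// spread_ge0.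
rewrite ler_norml; apply/andP; split.
  apply: (@le_trans _ _ (spread Omega k (fun=> - B) x)).
    have := cB (- B); rewrite normrN ger0_norm// => /(_ (lexx _)).
    by rewrite ler_norml => /andP[].
  apply: le_spread => //; first exact: bounded_measurable_cst.
  by move=> y /hB; rewrite ler_norml => /andP[].
apply: (@le_trans _ _ (spread Omega k (fun=> B) x)).
  apply: le_spread => //; first exact: bounded_measurable_cst.
  by move=> y /hB; rewrite ler_norml => /andP[].
by have := cB B; rewrite ger0_norm// => /(_ (lexx _)); rewrite ler_norml => /andP[].
Qed.

Lemma spread_dist_le k1 k2 phi x1 x2 B e : convolution_kernel k1 -> convolution_kernel k2 ->
  bounded_measurable phi -> (forall y, Omega y -> `|phi y| <= B) -> 0 <= B ->
  (forall y, Omega y -> `|k1 (x1 - y) - k2 (x2 - y)| <= e) ->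
  `|spread Omega k1 phi x1 - spread Omega k2 phi x2| <= e * B * vol.
Proof.
move=> kk1 kk2 h hB B0 he; rewrite /spread.
have i1 := spread_integrable x1 kk1 h; have i2 := spread_integrable x2 kk2 h.
rewrite -RintegralB//.
have i3 : (lebesgue R n).-integrable Omega (EFin \o (fun y => k1 (x1 - (y : 'rV[R]_n)) * phi y - k2 (x2 - (y : 'rV[R]_n)) * phi y)).
  exact: (integrableB mO i1 i2).
apply: (le_trans (le_normr_Rintegral mO i3)).
have -> : e * B * vol = \int[lebesgue R n]_(y in Omega) (e * B).
  rewrite /Rintegral integral_cst// fineM//.
  by rewrite ge0_fin_numE.
apply: (@Rintegral_mono _ _ _ _ _ mO ltyO _ _ (e * B)) => // y Oy.
rewrite -mulrBl normrM ler_pM//; first exact: he.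
exact: hB.
Qed.

Lemma spread_le_add_cst k1 k2 phi x1 x2 B e : convolution_kernel k1 -> convolution_kernel k2 ->
  (forall y, Omega y -> 0 <= phi y <= B) -> 0 <= e -> 0 <= B ->
  (forall y, Omega y -> k1 (x1 - y) <= k2 (x2 - y) + e) ->
  spread Omega k1 phi x1 <= spread Omega k2 phi x2 + e * B * vol.
Proof.
move=> kk1 kk2 hB e0 B0 he; have [Bk Bk0 hBk] := kernel_bounded x2 kk2.
apply: (@Rintegral_le_add_cst _ _ _ _ _ mO ltyO _ _ (Bk * B)).
- by rewrite mulr_ge0.
- by move=> y /hB /andP[h _]; rewrite mulr_ge0// kk1.2.
- move=> y Oy; have /andP[h1 h2] := hB y Oy.
  have := ler_wpM2r h1 (he y Oy); have := ler_wpM2l e0 h2.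
  by rewrite mulrDl; lra.
- move=> y Oy; have /andP[h1 h2] := hB y Oy.
  by rewrite mulr_ge0 ?kk2.2//= ler_pM ?hBk// kk2.2.
Qed.

End spread.

(** * Functions of time, place and state *)

Section compactness.
Context {R : realType}.

Lemma seq_pos_lower_bound {I : eqType} (s : seq I) (r : I -> R) :
  (forall i, i \in s -> 0 < r i) -> exists2 d : R, 0 < d & forall i, i \in s -> d <= r i.
Proof.
elim: s => [|a s IH] H; first by exists 1.
have [|d d0 hd] := IH; first by move=> i is_; apply: H; rewrite inE is_ orbT.
exists (Num.min (r a) d); first by rewrite lt_min d0 H ?inE ?eqxx.
move=> i; rewrite inE => /predU1P[->|is_]; first by rewrite ge_min lexx.
by rewrite ge_min hd ?orbT.
Qed.

Lemma finite_pos_choice {I : finType} (P : I -> R -> Prop) :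
  (forall i r s, 0 < s <= r -> P i r -> P i s) ->
  (forall i, exists2 r : R, 0 < r & P i r) -> exists2 r : R, 0 < r & forall i, P i r.
Proof.
move=> mono h; have ex i : exists r, 0 < r /\ P i r by have [r] := h i; exists r.
have [r hr] := choice ex.
have [|s s0 hs] := @seq_pos_lower_bound I (enum I) r; first by move=> i _; exact: (hr i).1.
by exists s => // i; apply: mono (hr i).2; rewrite s0 hs ?mem_enum.
Qed.

Lemma finite_bound_choice {I : finType} (P : I -> R -> Prop) :
  (forall i r s, r <= s -> P i r -> P i s) ->
  (forall i, exists2 r : R, 0 < r & P i r) -> exists2 r : R, 0 < r & forall i, P i r.
Proof.
move=> mono h; have ex i : exists r, 0 < r /\ P i r by have [r] := h i; exists r.
have [r hr] := choice ex; have r0 i : 0 <= r i by exact/ltW/(hr i).1.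
exists (1 + \sum_i r i) => [|i]; first by rewrite ltr_wpDr// sumr_ge0.
by apply: mono (hr i).2; rewrite (bigD1 i)//= addrCA lerDl addr_ge0// sumr_ge0.
Qed.

Lemma compact_uniformly_continuous {S : pseudoMetricType R} {V : normedModType R}
    (A : set S) (f : S -> V) : compact A -> {within A, continuous f} ->
  forall e : R, 0 < e -> exists2 d : R, 0 < d &
    forall p q, A p -> A q -> ball p d q -> `|f p - f q| < e.
Proof.
move=> cA /within_continuous_ballP cf e e0.
have e2 : 0 < e / 2 by rewrite divr_gt0.
have H p : exists d : R, A p -> 0 < d /\ forall q, A q -> ball p d q -> `|f p - f q| < e / 2.
  have [/cf/(_ _ e2)[d d0 hd]|nA] := pselect (A p); first by exists d.
  by exists 0.
have [r hr] := choice H.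
have [|s sA As] := @compact_finite_ball_cover R S A (fun p => r p / 2) cA.
  by move=> p /hr[r0 _]; rewrite divr_gt0.
have [|d d0 hd] := @seq_pos_lower_bound _ s (fun p => r p / 2).
  by move=> p /sA/hr[r0 _]; rewrite divr_gt0.
exists d => // p q Ap Aq pq.
have [c cs cp] := As p Ap; have [rc0 hc] := hr c (sA c cs).
have rc2 : r c = r c / 2 + r c / 2 by rewrite -splitr.
have cq : ball c (r c) q.
  rewrite rc2; apply: ball_triangle cp _; apply: le_ball pq.
  exact: hd.
have cp' : ball c (r c) p by apply: le_ball cp; rewrite {2}rc2 lerDl ltW// divr_gt0.
have -> : f p - f q = (f p - f c) + (f c - f q) by rewrite addrA subrK.
rewrite (le_lt_trans (ler_normD _ _))// [ltRHS]splitr ltrD ?hc//.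
by rewrite distrC hc.
Qed.

Lemma col_norm_lt (m : nat) (x : 'cV[R]_m) (e : R) : 0 < e ->
  `|x| < e <-> forall i, `|x i 0| < e.
Proof.
move=> e0; split => H.
  by move=> i; apply: le_lt_trans H; rewrite /Num.norm/= mx_normrE (le_trans _ (le_bigmax _ _ (i, 0))).
rewrite /Num.norm/= mx_normrE; apply/bigmax_ltP; split => // -[i j] _ /=.
by rewrite ord1; exact: H.
Qed.

Lemma col_norm_le (m : nat) (x : 'cV[R]_m) (e : R) : 0 <= e ->
  `|x| <= e <-> forall i, `|x i 0| <= e.
Proof.
move=> e0; split => H.
  by move=> i; apply: le_trans H; rewrite /Num.norm/= mx_normrE (le_trans _ (le_bigmax _ _ (i, 0))).
rewrite /Num.norm/= mx_normrE; apply/bigmax_leP; split => // -[i j] _ /=.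
by rewrite ord1; exact: H.
Qed.

Lemma col_box_compact (m : nat) (lo hi : 'I_m -> R) :
  compact [set u : 'cV[R]_m | forall k, lo k <= u k 0 <= hi k].
Proof.
pose A := [set u : 'rV[R]_m | forall i, `[lo i, hi i]%classic (u 0 i)].
have cA : compact A.
  by apply: (@rV_compact _ _ (fun i => `[lo i, hi i]%classic)) => i; exact: segment_compact.
have -> : [set u : 'cV[R]_m | forall k, lo k <= u k 0 <= hi k] = trmx @` A.
  apply/seteqP; split => [u uB|u [w wA <-] i]; last first.
    by rewrite mxE; have := wA i; rewrite /= in_itv.
  by exists u^T; [move=> i; rewrite mxE /= in_itv/=; exact: uB|rewrite trmxK].
apply: continuous_compact cA.
apply/(@within_continuous_ballP R) => w _ e e0; exists e => // z _.
rewrite -ball_normE/= => /(mx_norm_lt _ e0) h.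
by apply/col_norm_lt => // i; have := h i; rewrite !mxE.
Qed.

Lemma col_closed_ball_compact (m : nat) (B : R) :
  compact [set u : 'cV[R]_m | forall i, `|u i 0| <= B].
Proof.
have -> : [set u : 'cV[R]_m | forall i, `|u i 0| <= B] =
    [set u : 'cV[R]_m | forall k, - B <= u k 0 <= B].
  by apply/seteqP; split => u uB k; have := uB k; rewrite ler_norml.
exact: (@col_box_compact m (fun=> - B) (fun=> B)).
Qed.

End compactness.

Section admissible_functions.
Context {R : realType} {m n : nat}.
Variables (C : set 'rV[R]_n) (T : R).
Hypothesis cC : compact C.
Hypothesis T0 : 0 < T.
Implicit Types (f : R -> 'rV[R]_n -> 'cV[R]_m -> R) (Q : set 'cV[R]_m).

(** The reaction term, its derivatives and the kernels have this form; by
    periodicity their properties are uniform in time. *)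
Definition admissible f :=
  {within [set p : R * 'rV[R]_n * 'cV[R]_m | C p.1.2],
     continuous (fun p => f p.1.1 p.1.2 p.2)} /\
  forall t x u, C x -> f (t + T) x u = f t x u.

Lemma eq_admissible f1 f2 : (forall t x u, f1 t x u = f2 t x u) ->
  admissible f1 -> admissible f2.
Proof.
by move=> E; have -> : f1 = f2 by apply/funext => t; apply/funext => x; apply/funext.
Qed.

Lemma admissibleD f1 f2 : admissible f1 -> admissible f2 ->
  admissible (fun t x u => f1 t x u + f2 t x u).
Proof.
move=> [c1 p1] [c2 p2]; split; first by move=> z; apply: cvgD; [exact: c1|exact: c2].
by move=> t x u Cx; rewrite p1// p2.
Qed.

Lemma admissibleZ c f : admissible f -> admissible (fun t x u => c * f t x u).
Proof.
move=> [c1 p1]; split; first by move=> z; apply: cvgM; [exact: cvg_cst|exact: c1].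
by move=> t x u Cx; rewrite p1.
Qed.

Lemma admissibleB f1 f2 : admissible f1 -> admissible f2 ->
  admissible (fun t x u => f1 t x u - f2 t x u).
Proof.
move=> h1 /(admissibleZ (-1)) h2; apply: eq_admissible (admissibleD h1 h2) => t x u.
by rewrite mulN1r.
Qed.

Lemma admissible_cst c : admissible (fun _ _ _ => c).
Proof. by split => // z; exact: cvg_cst. Qed.

Lemma admissible_sum (I : Type) (r : seq I) (P : pred I) (f : I -> R -> 'rV[R]_n -> 'cV[R]_m -> R) :
  (forall i, P i -> admissible (f i)) ->
  admissible (fun t x u => \sum_(i <- r | P i) f i t x u).
Proof.
move=> H; elim: r => [|a r IH].
  by apply: eq_admissible (admissible_cst 0) => t x u; rewrite big_nil.
have E t x u : (if P a then f a t x u else 0) + \sum_(i <- r | P i) f i t x u =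
    \sum_(i <- a :: r | P i) f i t x u.
  by rewrite big_cons; case: ifP; rewrite ?add0r.
apply: (eq_admissible E); apply: admissibleD IH; case Pa: (P a); [exact: H|exact: admissible_cst].
Qed.

Lemma admissible_scale c f : admissible f -> admissible (fun t x u => f t x (c *: u)).
Proof.
move=> [c1 p1]; split; last by move=> t x u Cx; rewrite p1.
apply/(@within_continuous_ballP R) => -[[t x] u] /= Cx e e0.
have [d d0 hd] := (@within_continuous_ballP R _ _ _ _).1 c1 ((t, x), c *: u) Cx e e0.
exists (d / (`|c| + 1)) => [|[[t' x'] u'] /= Cx' [[bt bx] bu]].
  by rewrite divr_gt0// ltr_wpDl.
have le1 : d / (`|c| + 1) <= d by rewrite ler_pdivrMr ?ltr_wpDl// -[leLHS]mulr1 ler_pM2l// lerDr.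
apply: (hd ((t', x'), c *: u')) => //; split; first by split; [exact: le_ball bt|exact: le_ball bx].
have {}bu : `|u - u'| < d / (`|c| + 1) by move: bu; rewrite -ball_normE.
rewrite -ball_normE/= -scalerBr normrZ.
apply: (@le_lt_trans _ _ ((`|c| + 1) * `|u - u'|)).
  by rewrite ler_wpM2r// lerDl.
by rewrite mulrC -ltr_pdivlMr// ltr_wpDl.
Qed.

Lemma periodic_int (f : R -> R) : (forall t, f (t + T) = f t) ->
  forall (k : int) t, f (t + k%:~R * T) = f t.
Proof.
move=> H.
have Hn (k : nat) t : f (t + k%:R * T) = f t.
  elim: k t => [|k IH] t; first by rewrite mul0r addr0.
  by rewrite -natr1 mulrDl mul1r addrA H IH.
case=> k t; first exact: Hn.
rewrite NegzE mulrNz mulNr; have := Hn k.+1 (t - k.+1%:R * T).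
by rewrite subrK.
Qed.

Lemma period_shift t : exists k : int, 0 <= t + k%:~R * T < T.
Proof.
exists (- Num.floor (t / T)); rewrite mulrNz mulNr subr_ge0 ltrBlDr.
have := Num.Theory.floor_le (t / T); have := Num.Theory.lt_succ_floor (t / T).
rewrite ler_pdivlMr// ltr_pdivrMr// intrD mulrDl mul1r => h1 h2.
by rewrite h2 addrC.
Qed.

Definition time_window Q := [set p : R * 'rV[R]_n * 'cV[R]_m |
  [/\ - T <= p.1.1 <= T + T, C p.1.2 & Q p.2]].

Lemma time_window_compact Q : compact Q -> compact (time_window Q).
Proof.
move=> cQ; have -> : time_window Q = (`[- T, T + T]%classic `*` C) `*` Q.
  by apply/seteqP; split => [[[t x] u] [h1 h2 h3]|[[t x] u] [[h1 h2] h3]]; do ?split => //; move: h1; rewrite /= in_itv.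
apply: compact_setX => //; apply: compact_setX => //; exact: segment_compact.
Qed.

Lemma admissible_uniform f Q : admissible f -> compact Q ->
  forall e : R, 0 < e -> exists2 d : R, 0 < d & forall t t' x x' u u',
    C x -> C x' -> Q u -> Q u' -> `|t - t'| < d -> `|x - x'| < d -> `|u - u'| < d ->
    `|f t x u - f t' x' u'| < e.
Proof.
move=> [cf pf] cQ e e0.
have cw : {within time_window Q, continuous (fun p => f p.1.1 p.1.2 p.2)}.
  by apply: continuous_subspaceW cf => p [].
have [d d0 hd] := compact_uniformly_continuous (time_window_compact cQ) cw e0.
exists (Num.min d T); first by rewrite lt_min d0.
move=> t t' x x' u u' Cx Cx' Qu Qu'; rewrite !lt_min => /andP[t1 t2] /andP[x1 _] /andP[u1 _].
have [k /andP[k1 k2]] := period_shift t.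
have E y w s : C y -> f (s + k%:~R * T) y w = f s y w.
  by move=> Cy; apply: (periodic_int (f := fun s => f s y w)) => r; exact: pf.
rewrite -(E x u t)// -(E x' u' t')//.
have := hd (t + k%:~R * T, x, u) (t' + k%:~R * T, x', u').
apply.
- by split => //=; move: k1 k2 T0; lra.
- by split => //=; move: t2; rewrite ltr_norml; move: k1 k2 T0; lra.
- split => /=; last by rewrite -ball_normE.
  by split => /=; rewrite -ball_normE//= opprD addrACA subrr addr0.
Qed.

Lemma admissible_uniform_family {I : finType} (f : I -> R -> 'rV[R]_n -> 'cV[R]_m -> R) Q :
  (forall i, admissible (f i)) -> compact Q ->
  forall e : R, 0 < e -> exists2 d : R, 0 < d & forall i t t' x x' u u',
    C x -> C x' -> Q u -> Q u' -> `|t - t'| < d -> `|x - x'| < d -> `|u - u'| < d ->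
    `|f i t x u - f i t' x' u'| < e.
Proof.
move=> af cQ e e0; apply: finite_pos_choice => [i r s /andP[s0 sr] h|i]; last exact: admissible_uniform.
by move=> t t' x x' u u' Cx Cx' Qu Qu' ht hx hu; apply: h => //; exact: lt_le_trans sr.
Qed.

Lemma admissible_bounded f Q : admissible f -> compact Q ->
  exists2 B : R, 0 < B & forall t x u, C x -> Q u -> `|f t x u| <= B.
Proof.
move=> [cf pf] cQ.
have cw : {within time_window Q, continuous (fun p => f p.1.1 p.1.2 p.2)}.
  by apply: continuous_subspaceW cf => p [].
have /ex_strict_bound_gt0[B B0 /= HB] : bounded_set ((fun p => f p.1.1 p.1.2 p.2) @` time_window Q).
  exact/compact_bounded/continuous_compact/time_window_compact.
exists B => // t x u Cx Qu; have [k /andP[k1 k2]] := period_shift t.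
rewrite -(periodic_int (f := fun s => f s x u) _ k t) => [|r]; last exact: pf.
apply/ltW; apply: HB; exists (t + k%:~R * T, x, u) => //; split => //=.
by move: k1 k2 T0; lra.
Qed.

Lemma admissible_pos f Q : admissible f -> compact Q ->
  (forall t x u, C x -> Q u -> 0 < f t x u) ->
  exists2 e : R, 0 < e & forall t x u, C x -> Q u -> e <= f t x u.
Proof.
move=> [cf pf] cQ f0.
have cw : {within time_window Q, continuous (fun p => f p.1.1 p.1.2 p.2)}.
  by apply: continuous_subspaceW cf => p [].
have [[p Wp]|W0] := pselect (time_window Q !=set0); last first.
  exists 1 => // t x u Cx Qu; exfalso; apply: W0; exists ((0, x), u); split => //=.
  by move: T0; lra.
have [c] := compact_EVT_min (ex_intro _ p Wp) (time_window_compact cQ) cw.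
rewrite inE => -[_ Cc Qc] hc.
exists (f c.1.1 c.1.2 c.2); first exact: f0.
move=> t x u Cx Qu; have [k /andP[k1 k2]] := period_shift t.
rewrite -(periodic_int (f := fun s => f s x u) _ k t) => [|r]; last exact: pf.
apply: (hc (t + k%:~R * T, x, u)); rewrite inE; split => //=.
by move: k1 k2 T0; lra.
Qed.

End admissible_functions.

(** * The reaction term *)

Lemma is_derive_coord {R : realType} {m : nat} (f : R -> 'cV[R]_m) (t : R) (df : 'cV[R]_m) i :
  is_derive t 1 f df -> is_derive t 1 (fun s => f s i 0) (df i 0).
Proof.
move=> [fd <-]; have fdi := (derivable_mxP f t 1).1 fd i 0.
by apply: DeriveDef => //; rewrite (derive_mx fd) mxE.
Qed.

Lemma is_derive_col {R : realType} {m : nat} (f : R -> 'cV[R]_m) (t : R) (df : 'cV[R]_m) :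
  (forall i, is_derive t 1 (fun s => f s i 0) (df i 0)) -> is_derive t 1 f df.
Proof.
move=> H; have fd : derivable f t 1.
  by apply/(derivable_mxP f t 1) => i j; rewrite ord1; case: (H i).
apply: DeriveDef => //; rewrite (derive_mx fd); apply/matrixP => i j; rewrite mxE ord1.
by case: (H i).
Qed.

Lemma mean_value {R : realType} (f df : R -> R) (s : R) :
  (forall t : R, is_derive t 1 f (df t)) ->
  exists2 c : R, (0 <= c <= s) || (s <= c <= 0) & f s - f 0 = df c * s.
Proof.
move=> H; have [s0|s0|->] := ltgtP s 0.
- have [c c0] := evolves_MVT s0 (evolves_everywhere s 0 H).
  rewrite sub0r => E; exists c; last by rewrite -opprB E mulrN opprK.
  by apply/orP; right; lra.
- have [c c0] := evolves_MVT s0 (evolves_everywhere 0 s H).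
  by rewrite subr0 => E; exists c => //; apply/orP; left; lra.
- by exists 0; rewrite ?lexx// subrr mulr0.
Qed.

Definition partial {R : realType} {m n : nat}
    (g : R -> 'rV[R]_n -> 'cV[R]_m -> 'cV[R]_m) i j t x u :=
  ('D_(delta_mx j 0) (g t x) u) i 0.

(** The hypotheses of the theorem in coordinates, for all times and with the
    consequence of the smoothness of the boundary that matters. *)
Record system {R : realType} {m n : nat} (Omega : set 'rV[R]_n) (d : 'rV[R]_m)
  (K : 'I_m -> R -> 'rV[R]_n -> R)
  (g : R -> 'rV[R]_n -> 'cV[R]_m -> 'cV[R]_m) (v : 'cV[R]_m) (T : R) : Prop := System {
  sys_m : (0 < m)%N ;
  sys_open : open Omega ;
  sys_nonempty : Omega !=set0 ;
  sys_connected : connected Omega ;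
  sys_bounded : bounded_set Omega ;
  sys_boundary : lebesgue_outer (closure Omega `\` Omega) = 0%E ;
  sys_d : forall i, 0 < d 0 i ;
  sys_v : forall i, 0 < v i 0 ;
  sys_T : 0 < T ;
  sys_K : forall i t, convolution_kernel (K i t) ;
  sys_K0 : forall i t, 0 < K i t 0 ;
  sys_K1 : forall i t, (\int[lebesgue R n]_x (K i t x)%:E = 1)%E ;
  sys_Kc : forall i, continuous (fun p : R * 'rV[R]_n => K i p.1 p.2) ;
  sys_Kper : forall i t x, K i (t + T) x = K i t x ;
  sys_g : forall i, admissible (closure Omega) T (fun t x u => g t x u i 0) ;
  sys_dg : forall (t : R) x (u : 'cV[R]_m) j, closure Omega x -> derivable (g t x) u (delta_mx j 0) ;
  sys_pg : forall i j, admissible (closure Omega) T (partial g i j) ;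
  sys_coop : forall (t : R) x (u : 'cV[R]_m) i j, closure Omega x ->
    (forall k, 0 <= u k 0 <= v k 0) -> i != j -> 0 <= partial g i j t x u ;
  sys_irr : forall (t : R) x (u : 'cV[R]_m) (S : {set 'I_m}), closure Omega x ->
    (forall k, 0 <= u k 0 <= v k 0) -> S != finset.set0 -> S != finset.setT ->
    exists i j, [/\ i \in S, j \notin S & partial g i j t x u != 0] ;
  sys_g0 : forall (t : R) x, closure Omega x -> g t x 0 = 0 ;
  sys_gv : forall (t : R) x (u : 'cV[R]_m) i, closure Omega x -> (forall k, 0 <= u k 0 <= v k 0) ->
    u i 0 = v i 0 -> g t x u i 0 <= 0 ;
  sys_sub : forall (t : R) x (u : 'cV[R]_m) (a : R), closure Omega x ->
    (forall k, 0 < u k 0 <= v k 0) -> 0 < a < 1 ->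
    (forall i, a * g t x u i 0 <= g t x (a *: u) i 0) /\
    exists i, a * g t x u i 0 < g t x (a *: u) i 0 }.

Section reaction.
Context {R : realType} {m n : nat}.
Variables (Omega : set 'rV[R]_n) (d : 'rV[R]_m) (K : 'I_m -> R -> 'rV[R]_n -> R).
Variables (g : R -> 'rV[R]_n -> 'cV[R]_m -> 'cV[R]_m) (v : 'cV[R]_m) (T : R).
Hypothesis H : system Omega d K g v T.

Local Notation C := (closure Omega).
Implicit Types (t s : R) (x : 'rV[R]_n) (u w : 'cV[R]_m) (i j k : 'I_m).

Definition in_box u := forall k, 0 <= u k 0 <= v k 0.

Let cC : compact C := closure_bounded_compact (sys_bounded H).

Lemma in_box_compact : compact in_box.
Proof. exact: (@col_box_compact R m (fun=> 0) (fun k => v k 0)). Qed.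

(** Change the coordinates one after the other and use the mean value theorem
    for each of them. *)
Lemma reaction_increment t x u w i : C x ->
  exists xi : 'I_m -> 'cV[R]_m,
    (forall k j a b, a <= u j 0 <= b -> a <= w j 0 <= b -> a <= xi k j 0 <= b) /\
    g t x u i 0 - g t x w i 0 = \sum_k partial g i k t x (xi k) * (u k 0 - w k 0).
Proof.
move=> Cx.
pose h (k : nat) : 'cV[R]_m := \col_j (if (j < k)%N then u j 0 else w j 0).
have hS k : h k.+1 = h k + (u k 0 - w k 0) *: delta_mx k 0.
  apply/colP => j; rewrite !mxE eqxx andbT ltnS leq_eqVlt.
  have [->|jk] := eqVneq j k; first by rewrite eqxx ltnn mulr1 addrC subrK.
  by rewrite (_ : (j == k :> nat) = false) ?mulr0 ?addr0//; exact: negbTE.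
have ex k : exists c : R, ((0 <= c <= u k 0 - w k 0) || (u k 0 - w k 0 <= c <= 0)) /\
    g t x (h k.+1) i 0 - g t x (h k) i 0 =
    partial g i k t x (h k + c *: delta_mx k 0) * (u k 0 - w k 0).
  have [s|c c1 E] := @mean_value R (fun s => g t x (h k + s *: delta_mx k 0) i 0)
    (fun s => partial g i k t x (h k + s *: delta_mx k 0)) (u k 0 - w k 0).
    apply: (is_derive_coord (f := fun s => g t x (h k + s *: delta_mx k 0))).
    by apply: is_derive_line; exact: (sys_dg H).
  by exists c; split=> //; rewrite -E hS scale0r addr0.
have [c cP] := choice ex.
exists (fun k => h k + c k *: delta_mx k 0); split.
  move=> k j a b uab wab; rewrite !mxE eqxx andbT.
  have [jk|jk] := eqVneq j k.
    by subst j; rewrite ltnn mulr1; have [hc _] := cP k; move: uab wab hc; lra.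
  by rewrite mulr0 addr0; case: ifP.
under eq_bigr => k _ do rewrite -(cP k).2.
have -> : \sum_(k < m) (g t x (h k.+1) i 0 - g t x (h k) i 0) =
   \sum_(0 <= k < m) (g t x (h k.+1) i 0 - g t x (h k) i 0) by rewrite big_mkord.
rewrite telescope_sumr//; congr (g t x _ i 0 - g t x _ i 0).
  by apply/colP => j; rewrite mxE ltn_ord.
by apply/colP => j; rewrite mxE.
Qed.

Lemma partial_bounded (B : R) : exists2 L : R, 0 < L &
  forall t x u i j, C x -> (forall k, `|u k 0| <= B) -> `|partial g i j t x u| <= L.
Proof.
suff [L L0 hL] : exists2 L : R, 0 < L & forall p : 'I_m * 'I_m, forall t x u, C x ->
    (forall k, `|u k 0| <= B) -> `|partial g p.1 p.2 t x u| <= L.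
  by exists L => // t x u i j; exact: (hL (i, j)).
apply: finite_bound_choice => [p r s rs h t x u Cx uB|p]; first by rewrite (le_trans _ rs)// h.
exact: (admissible_bounded cC (sys_T H) (sys_pg H p.1 p.2) (@col_closed_ball_compact R m B)).
Qed.

Lemma partial_uniform (e : R) : 0 < e -> exists2 r : R, 0 < r &
  forall i j t t' x x' u u', C x -> C x' -> in_box u -> in_box u' ->
    `|t - t'| < r -> `|x - x'| < r -> `|u - u'| < r ->
    `|partial g i j t x u - partial g i j t' x' u'| < e.
Proof.
move=> e0; have [r r0 hr] := admissible_uniform_family cC (sys_T H)
  (fun p : 'I_m * 'I_m => sys_pg H p.1 p.2) in_box_compact e0.
by exists r => // i j; exact: (hr (i, j)).
Qed.

Lemma reaction_Lipschitz (B : R) : exists2 L : R, 0 < L &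
  forall t x u w i (N : R), C x -> (forall k, `|u k 0| <= B) -> (forall k, `|w k 0| <= B) ->
    (forall k, `|u k 0 - w k 0| <= N) -> `|g t x u i 0 - g t x w i 0| <= L * N.
Proof.
have [L L0 hL] := partial_bounded B.
exists (L * m%:R); first by rewrite mulr_gt0// ltr0n (sys_m H).
move=> t x u w i N Cx uB wB uw; have [xi [hxi ->]] := reaction_increment t u w i Cx.
apply: (le_trans (ler_norm_sum _ _ _)).
apply: (@le_trans _ _ (\sum_(k < m) L * N)).
  apply: ler_sum => k _; rewrite normrM ler_pM// hL// => j.
  by rewrite ler_norml hxi// -ler_norml.
by rewrite sumr_const card_ord -mulr_natr; lra.
Qed.

Lemma in_box_norm : exists2 B : R, 0 < B & forall u, in_box u -> forall k, `|u k 0| <= B.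
Proof.
exists (1 + \sum_k v k 0).
  by rewrite ltr_wpDr// sumr_ge0// => k _; exact/ltW/(sys_v H).
move=> u uM k; have /andP[u0 uv] := uM k; rewrite ger0_norm// (le_trans uv)//.
rewrite (bigD1 k)//= addrCA lerDl addr_ge0// sumr_ge0// => j _; exact/ltW/(sys_v H).
Qed.

(** Cooperativity, in the form that the comparison principle needs. *)
Lemma reaction_quasimonotone : exists2 L : R, 0 < L &
  forall t x u w i (N : R), C x -> in_box u -> in_box w -> 0 <= N ->
    (forall k, - N <= u k 0 - w k 0) -> u i 0 - w i 0 <= N ->
    - (L * N) <= g t x u i 0 - g t x w i 0.
Proof.
have [B B0 hB] := in_box_norm; have [L L0 hL] := partial_bounded B.
exists (L * m%:R); first by rewrite mulr_gt0// ltr0n (sys_m H).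
move=> t x u w i N Cx uM wM N0 uwN uwi.
have [xi [hxi ->]] := reaction_increment t u w i Cx.
have xiM k : in_box (xi k) by move=> j; apply: hxi; [exact: uM|exact: wM].
have -> : - (L * m%:R * N) = \sum_(k < m) - (L * N).
  by rewrite sumr_const card_ord -[RHS]mulr_natr; ring.
apply: ler_sum => k _; have := hL t x (xi k) i k Cx (hB _ (xiM k)).
have [->|ki] := eqVneq k i.
  move=> hp; have : `|partial g i i t x (xi i) * (u i 0 - w i 0)| <= L * N.
    by rewrite normrM ler_pM// ler_norml uwi uwN.
  by rewrite ler_norml => /andP[].
have p0 : 0 <= partial g i k t x (xi k) by apply: (sys_coop H _ Cx (xiM k)); rewrite eq_sym.
rewrite ger0_norm// => pL; have := ler_wpM2l p0 (uwN k); have := ler_wpM2r N0 pL.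
lra.
Qed.

Lemma reaction_ordered : exists2 L : R, 0 < L &
  forall t x u w i, C x -> in_box u -> in_box w -> (forall k, w k 0 <= u k 0) ->
    - (L * (u i 0 - w i 0)) <= g t x u i 0 - g t x w i 0.
Proof.
have [B B0 hB] := in_box_norm; have [L L0 hL] := partial_bounded B.
exists L => // t x u w i Cx uM wM wu.
have [xi [hxi ->]] := reaction_increment t u w i Cx.
have xiM k : in_box (xi k) by move=> j; apply: hxi; [exact: uM|exact: wM].
rewrite (bigD1 i)//= -[leLHS]addr0 lerD//.
  have := hL t x (xi i) i i Cx (hB _ (xiM i)); rewrite ler_norml => /andP[h _].
  by rewrite -mulNr ler_wpM2r// subr_ge0.
apply: sumr_ge0 => k ki; rewrite mulr_ge0 ?subr_ge0//.
by apply: (sys_coop H _ Cx (xiM k)); rewrite eq_sym.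
Qed.

(** The pair (i, j) with a nonzero entry varies with the state.  The sum of all
    entries with i in S and j outside is continuous and positive, hence bounded
    below on the box; so one of its terms is, too. *)
Let irr_uniform : exists2 sg : R, 0 < sg & forall t x u (S : {set 'I_m}), C x -> in_box u ->
  S != finset.set0 -> S != finset.setT ->
  exists i j, [/\ i \in S, j \notin S & sg <= partial g i j t x u].
Proof.
pose f (S : {set 'I_m}) t x u :=
  \sum_(i in S) \sum_(j | j \notin S) partial g i j t x u.
have coop t x u (S : {set 'I_m}) i j : C x -> in_box u -> i \in S -> j \notin S ->
    0 <= partial g i j t x u.
  move=> Cx uM iS jS; apply: (sys_coop H _ Cx uM).
  by apply: contraNneq jS => <-.
have [e' e'0 he'] : exists2 e : R, 0 < e & forall S : {set 'I_m}, S != finset.set0 ->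
    S != finset.setT -> forall t x u, C x -> in_box u -> e <= f S t x u.
  apply: finite_pos_choice => [S r s /andP[_ sr] h S0 ST t x u Cx uM|S].
    by rewrite (le_trans sr)// h.
  have [/andP[S0 ST]|nS] := boolP ((S != finset.set0) && (S != finset.setT)); last first.
    by exists 1 => // S0 ST; move: nS; rewrite S0 ST.
  have af : admissible C T (f S).
    by apply: admissible_sum => i _; apply: admissible_sum => j _; exact: (sys_pg H).
  have [|e e0 he] := admissible_pos cC (sys_T H) af in_box_compact; last by exists e.
  move=> t x u Cx uM; have [i [j [iS jS pij]]] := sys_irr H t Cx uM S0 ST.
  have pij0 : 0 < partial g i j t x u by rewrite lt_neqAle eq_sym pij (coop _ _ _ S).
  rewrite /f (bigD1 i)//= (bigD1 j)//= -addrA ltr_wpDr// addr_ge0//.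
    by apply: sumr_ge0 => l /andP[lS _]; exact: (coop _ _ _ S).
  by apply: sumr_ge0 => k /andP[kS _]; apply: sumr_ge0 => l lS; exact: (coop _ _ _ S).
pose N : R := m%:R * m%:R.
have N0 : 0 < N by rewrite mulr_gt0// ltr0n (sys_m H).
exists (e' / N); first by rewrite divr_gt0.
move=> t x u S Cx uM S0 ST.
have h : e' <= f S t x u by exact: he'.
have [[i [j h1]]|nex] := pselect (exists i j, [/\ i \in S, j \notin S & e' / N <= partial g i j t x u]).
  by exists i, j.
exfalso; have h2 i j : i \in S -> j \notin S -> partial g i j t x u < e' / N.
  move=> iS jS; rewrite ltNge; apply/negP => h3; apply: nex; by exists i, j.
have [i0 [j0 [i0S j0S _]]] := sys_irr H t Cx uM S0 ST.
have : f S t x u < \sum_(i < m) \sum_(j < m) e' / N.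
  have c0 : 0 <= e' / N by rewrite divr_ge0 ?ltW.
  apply: (@le_lt_trans _ _ (\sum_(i in S) \sum_(j | j \notin S) partial g i j t x u)) => //.
  rewrite (bigD1 i0)//= [ltRHS](bigD1 i0)//=; apply: ltr_leD.
    rewrite (bigD1 j0)//= [ltRHS](bigD1 j0)//=; apply: ltr_leD; first exact: h2.
    rewrite big_mkcond [leRHS]big_mkcond; apply: ler_sum => j _.
    by case: ifPn => [/andP[jS ->]|_]; [rewrite ltW// h2|case: ifP].
  rewrite big_mkcond [leRHS]big_mkcond; apply: ler_sum => i _.
  case: ifPn => [/andP[iS ->]|_]; last by case: ifP => // _; apply: sumr_ge0.
  rewrite big_mkcond; apply: ler_sum => j _.
  by case: ifPn => [jS|_//]; rewrite ltW// h2.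
rewrite !sumr_const !card_ord -mulrnA -[X in _ < X]mulr_natr natrM -/N divfK ?gt_eqF//.
by rewrite ltNge h.
Qed.

(** Irreducibility with constants: from every proper set of components that are
    left out, one component is pushed up by a component outside the set.  The
    pair stays the same while time and lower state vary a little; the increment
    u - w may be large. *)
Lemma reaction_irreducible : exists L sg r : R, [/\ 0 < L, 0 < sg, 0 < r &
  forall t0 x w0 (S : {set 'I_m}), C x -> in_box w0 -> S != finset.set0 -> S != finset.setT ->
  exists i j, [/\ i \in S, j \notin S & forall t u w, `|t - t0| < r -> in_box u -> in_box w ->
    (forall k, `|w k 0 - w0 k 0| < r) -> (forall k, w k 0 <= u k 0) ->
    - (L * (u i 0 - w i 0)) + sg * (u j 0 - w j 0) <= g t x u i 0 - g t x w i 0]].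
Proof.
have [L L0 hL] := reaction_ordered; have [sg sg0 hsg] := irr_uniform.
have [B B0 hB] := in_box_norm.
have sg2 : 0 < sg / 2 by rewrite divr_gt0.
have [r' r'0 hr'] := partial_uniform sg2.
pose r2 := r' / 2; have r20 : 0 < r2 by rewrite divr_gt0.
pose c := Num.min 1 (r2 / (2 * B)).
have c0 : 0 < c by rewrite lt_min ltr01 divr_gt0// mulr_gt0.
exists L, (sg / 2 * c), r2; split => //; first by rewrite mulr_gt0.
move=> t0 x w0 S Cx w0M S0 ST; have [i [j [iS jS pij]]] := hsg t0 x w0 S Cx w0M S0 ST.
exists i, j; split => // t u w tt0 uM wM ww0 wu.
have ij : i != j by apply: contraNneq jS => <-.
pose s := Num.min r2 (u j 0 - w j 0).
have s0 : 0 <= s by rewrite le_min subr_ge0 wu ltW.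
have sr : s <= r2 by rewrite ge_min lexx.
have suw : s <= u j 0 - w j 0 by rewrite ge_min lexx orbT.
pose w' := w + s *: delta_mx j 0.
have w'E k : w' k 0 = w k 0 + (if k == j then s else 0).
  by rewrite /w' !mxE eqxx andbT; case: eqP => _; rewrite ?mulr1 ?mulr0.
have w'M : in_box w'.
  move=> k; rewrite w'E; have := wM k; have := uM k; have := wu k.
  by case: eqP => [->|_]; lra.
have w'u k : w' k 0 <= u k 0 by rewrite w'E; have := wu k; case: eqP => [->|_]; lra.
have h1 := hL t x u w' i Cx uM w'M w'u; rewrite !w'E (negbTE ij) addr0 in h1.
have [xi [hxi E]] := reaction_increment t w' w i Cx.
have xiM k : in_box (xi k) by move=> l; apply: hxi; [exact: w'M|exact: wM].
have xiw0 k : `|w0 - xi k| < r'.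
  apply/col_norm_lt => // l; rewrite !mxE.
  have hl : w l 0 <= xi k l 0 <= w l 0 + s.
    by apply: hxi; [rewrite w'E; case: ifP => _; lra|lra].
  have := ww0 l; rewrite !ltr_norml => /andP[]; move: sr hl; rewrite /r2.
  by move=> h3 /andP[h4 h5] h6 h7; lra.
have pj : sg / 2 <= partial g i j t x (xi j).
  have := hr' i j t0 t x x w0 (xi j) Cx Cx w0M (xiM j).
  rewrite subrr normr0 distrC => /(_ (lt_trans tt0 _)).
  have r2r : r2 < r' by rewrite /r2; lra.
  by move=> /(_ r2r r'0 (xiw0 j)); rewrite ltr_norml => /andP[_]; move: pij; clear -cC; lra.
have E' : g t x w' i 0 - g t x w i 0 = partial g i j t x (xi j) * s.
  rewrite E (bigD1 j)//= big1 ?addr0 => [|k kj]; last by rewrite w'E (negbTE kj) addr0 subrr mulr0.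
  by rewrite w'E eqxx addrAC subrr add0r.
have cs : c * (u j 0 - w j 0) <= s.
  have uw0 : 0 <= u j 0 - w j 0 by rewrite subr_ge0.
  rewrite le_min; apply/andP; split; last by rewrite ler_piMl// ge_min lexx.
  apply: (@le_trans _ _ (r2 / (2 * B) * (2 * B))).
    rewrite ler_pM ?(ltW c0)//; first by rewrite ge_min lexx orbT.
    by have := hB u uM j; have := hB w wM j; rewrite !ler_norml; clear -cC; lra.
  by rewrite divfK// gt_eqF// mulr_gt0.
have : sg / 2 * c * (u j 0 - w j 0) <= partial g i j t x (xi j) * s.
  rewrite -mulrA; apply: ler_pM => //; first exact: ltW.
  by rewrite mulr_ge0 ?subr_ge0// ltW.
by rewrite -E'; move: h1; clear -cC; lra.
Qed.

End reaction.

Section subhomogeneity.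
Context {R : realType} {m n : nat}.
Variables (Omega : set 'rV[R]_n) (d : 'rV[R]_m) (K : 'I_m -> R -> 'rV[R]_n -> R).
Variables (g : R -> 'rV[R]_n -> 'cV[R]_m -> 'cV[R]_m) (v : 'cV[R]_m) (T : R).
Hypothesis H : system Omega d K g v T.

Local Notation C := (closure Omega).
Local Notation in_box := (in_box v).
Implicit Types (t s a r : R) (x : 'rV[R]_n) (u w : 'cV[R]_m) (i j k : 'I_m).

Let cC : compact C := closure_bounded_compact (sys_bounded H).

Lemma in_box_scale a u : 0 <= a <= 1 -> in_box u -> in_box (a *: u).
Proof.
move=> /andP[a0 a1] uM k; rewrite mxE; have /andP[u0 uv] := uM k.
by rewrite mulr_ge0//= (le_trans _ uv)// ler_piMl.
Qed.

Lemma in_box_v : in_box v.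
Proof. by move=> k; rewrite lexx ltW// (sys_v H). Qed.

Lemma in_box0 : in_box 0.
Proof. by move=> k; rewrite mxE lexx ltW// (sys_v H). Qed.

(** Boundary states are limits of interior ones. *)
Lemma reaction_subhomogeneous t x u a i : C x -> in_box u -> 0 < a <= 1 ->
  a * g t x u i 0 <= g t x (a *: u) i 0.
Proof.
move=> Cx uM /andP[a0]; rewrite le_eqVlt => /predU1P[->|a1]; first by rewrite mul1r scale1r.
have [B B0 hB] := in_box_norm H; have [L L0 hL] := reaction_Lipschitz H B.
rewrite leNgt; apply/negP => hlt.
pose D := a * g t x u i 0 - g t x (a *: u) i 0.
have D0 : 0 < D by rewrite subr_gt0.
pose e := Num.min (1 / 2) (D / (4 * L * (2 * B))).
have LB : 0 < 4 * L * (2 * B) by rewrite !mulr_gt0.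
have e0 : 0 < e by rewrite lt_min !divr_gt0.
have e1 : e <= 1 / 2 by rewrite ge_min lexx.
have eD : e * (4 * L * (2 * B)) <= D by rewrite -ler_pdivlMr// ge_min lexx orbT.
pose w := (1 - e) *: u + e *: v.
have wk k : w k 0 = u k 0 + e * (v k 0 - u k 0) by rewrite !mxE; ring.
have wI k : 0 < w k 0 <= v k 0.
  have /andP[u0 uv] := uM k; have v0 := sys_v H k.
  have -> : w k 0 = (1 - e) * u k 0 + e * v k 0 by rewrite !mxE.
  apply/andP; split; first by rewrite ltr_wpDl ?mulr_gt0// mulr_ge0//; lra.
  have vE : v k 0 = (1 - e) * v k 0 + e * v k 0 by ring.
  by rewrite [leRHS]vE lerD2r ler_wpM2l//; lra.
have wM : in_box w by move=> k; have /andP[/ltW -> ->] := wI k.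
have uw k : `|u k 0 - w k 0| <= e * (2 * B).
  rewrite wk opprD addrA subrr sub0r normrN normrM gtr0_norm// ler_wpM2l ?(ltW e0)//.
  by rewrite (le_trans (ler_normB _ _))//; have := hB u uM k; have := hB v in_box_v k; lra.
have [hs _] := sys_sub H t Cx wI (introT andP (conj a0 a1)).
have h1 := hL t x u w i _ Cx (hB _ uM) (hB _ wM) uw.
have a01 : 0 <= a <= 1 by rewrite !ltW.
have auw k : `|(a *: u) k 0 - (a *: w) k 0| <= e * (2 * B).
  have -> : (a *: u) k 0 - (a *: w) k 0 = a * (u k 0 - w k 0).
    by rewrite mxE [X in _ - X]mxE mulrBr.
  by rewrite normrM gtr0_norm// (le_trans _ (uw k))// ler_piMl// ltW.
have h2 := hL t x _ _ i _ Cx (hB _ (in_box_scale a01 uM)) (hB _ (in_box_scale a01 wM)) auw.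
have h3 := hs i.
have h4 : a * (g t x u i 0 - g t x w i 0) <= L * (e * (2 * B)).
  apply: (le_trans (ler_norm _)); rewrite normrM gtr0_norm//.
  by rewrite (le_trans _ h1)// ler_piMl// ltW.
move: h2; rewrite ler_norml => /andP[h2 _].
have h5 : D <= 2 * (L * (e * (2 * B))) by rewrite /D; lra.
have : 0 < L * (e * (2 * B)) by rewrite !mulr_gt0.
move: h5 eD; have -> : e * (4 * L * (2 * B)) = 4 * (L * (e * (2 * B))) by ring.
by lra.
Qed.

Lemma reaction_ratio t x u r s i : C x -> in_box u -> 0 < r <= s -> s <= 1 ->
  g t x (s *: u) i 0 / s <= g t x (r *: u) i 0 / r.
Proof.
move=> Cx uM /andP[r0 rs] s1; have s0 : 0 < s by exact: lt_le_trans rs.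
have s01 : 0 <= s <= 1 by rewrite ltW.
have rs1 : 0 < r / s <= 1 by rewrite divr_gt0//= ler_pdivrMr// mul1r.
have := reaction_subhomogeneous t i Cx (in_box_scale s01 uM) rs1.
rewrite scalerA divfK ?gt_eqF// => h.
by rewrite ler_pdivlMr// mulrAC -mulrA mulrC.
Qed.

(** The linearization at the rest state dominates: divide g(au) by a and let a
    tend to zero. *)
Lemma reaction_le_linear t x u i : C x -> in_box u ->
  g t x u i 0 <= \sum_j partial g i j t x 0 * u j 0.
Proof.
move=> Cx uM; apply/ler_addgt0Pr => e e0.
have [B B0 hB] := in_box_norm H.
pose S := 1 + \sum_j u j 0.
have S0 : 0 < S by rewrite ltr_wpDr// sumr_ge0// => j _; case/andP: (uM j).
have eS : 0 < e / S by rewrite divr_gt0.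
have [r' r'0 hr'] := partial_uniform H eS.
pose a := Num.min 1 (r' / (2 * B)).
have a0 : 0 < a by rewrite lt_min ltr01 divr_gt0// mulr_gt0.
have a1 : a <= 1 by rewrite ge_min lexx.
have aB : a * (2 * B) <= r' by rewrite -ler_pdivlMr ?mulr_gt0// ge_min lexx orbT.
have a01 : 0 <= a <= 1 by rewrite ltW.
have := reaction_ratio t i Cx uM (introT andP (conj a0 a1)) (lexx 1).
rewrite scale1r divr1 => h; apply: (le_trans h).
have [xi [hxi]] := reaction_increment H t (a *: u) 0 i Cx.
rewrite (sys_g0 H _ Cx) mxE subr0 => ->.
rewrite ler_pdivrMr// mulrDl mulr_suml.
have -> : e * a = \sum_j (e / S) * u j 0 * a + e / S * a.
  rewrite -mulr_suml -mulr_sumr -mulrDl; congr (_ * _).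
  by rewrite -[in X in _ + X](mulr1 (e / S)) -mulrDr addrC -/S divfK// gt_eqF.
have eSa : 0 <= e / S * a by rewrite mulr_ge0// ltW.
rewrite addrA -big_split/= ler_wpDr//.
apply: ler_sum => j _; rewrite !mxE subr0 [a * _]mulrC mulrA -mulrDl ler_wpM2r ?(ltW a0)//.
rewrite -mulrDl; have /andP[u0 _] := uM j; rewrite ler_wpM2r//.
have xi_small l : 0 <= xi j l 0 <= a * u l 0.
  have /andP[ul0 _] := uM l; have aul : 0 <= a * u l 0 by rewrite mulr_ge0// ltW.
  by apply: hxi; rewrite !mxE ?lexx ?aul.
have xiM : in_box (xi j).
  move=> l; have /andP[h1 h2] := xi_small l; rewrite h1 (le_trans h2)//.
  by have := in_box_scale a01 uM l; rewrite mxE => /andP[].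
have := hr' i j t t x x (xi j) 0 Cx Cx xiM in_box0; rewrite !subrr !normr0 subr0 => /(_ r'0 r'0).
have nx : `|xi j| < r'.
  apply/(col_norm_lt _ r'0) => l; have /andP[h1 h2] := xi_small l.
  rewrite ger0_norm// (le_lt_trans h2)// (lt_le_trans _ aB)// ltr_pM2l//.
  by have := hB u uM l; rewrite ler_norml => /andP[_]; move: B0; lra.
by move=> /(_ nx); rewrite ltr_norml => /andP[_]; clear -cC; lra.
Qed.

Lemma reaction_near_zero (eta : R) : 0 < eta -> exists2 r : R, 0 < r &
  forall t x u i, C x -> in_box u -> (forall k, u k 0 < r) ->
    \sum_j partial g i j t x 0 * u j 0 - eta * \sum_j u j 0 <= g t x u i 0.
Proof.
move=> e0.
have [r' r'0 hr'] := partial_uniform H e0.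
exists r' => // t x u i Cx uM ur.
have [xi [hxi]] := reaction_increment H t u 0 i Cx.
rewrite (sys_g0 H _ Cx) mxE subr0 => ->.
rewrite mulr_sumr -sumrB; apply: ler_sum => j _.
rewrite mxE subr0 -mulrBl; have /andP[u0 _] := uM j; rewrite ler_wpM2r//.
have xi_small l : 0 <= xi j l 0 <= u l 0.
  by have /andP[ul0 _] := uM l; apply: hxi; rewrite ?mxE ?lexx ?ul0.
have xiM : in_box (xi j).
  move=> l; have /andP[h1 h2] := xi_small l; rewrite h1 (le_trans h2)//.
  by have /andP[] := uM l.
have := hr' i j t t x x 0 (xi j) Cx Cx in_box0 xiM.
rewrite !subrr !normr0 sub0r normrN => /(_ r'0 r'0).
have nx : `|xi j| < r'.
  apply/(col_norm_lt _ r'0) => l; have /andP[h1 h2] := xi_small l.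
  by rewrite ger0_norm// (le_lt_trans h2).
by move=> /(_ nx); rewrite ltr_norml => /andP[_]; clear -cC; lra.
Qed.

(** By subhomogeneity g(a u) / a decreases with a; the gap is what it loses
    between 1 - theta and 1. *)
Definition gap (theta : R) i t x u :=
  g t x ((1 - theta) *: u) i 0 / (1 - theta) - g t x u i 0.

Lemma gap_admissible theta i : admissible C T (gap theta i).
Proof.
apply: admissibleB; last exact: (sys_g H).
apply: (eq_admissible (f1 := fun t x u => (1 - theta)^-1 * g t x ((1 - theta) *: u) i 0)).
  by move=> t x u; rewrite mulrC.
by apply: admissibleZ; apply: (@admissible_scale _ _ _ _ _ _ (fun t x u => g t x u i 0)); exact: (sys_g H).
Qed.

Lemma gap_ge0 theta i t x u : 0 < theta < 1 -> C x -> in_box u -> 0 <= gap theta i t x u.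
Proof.
move=> /andP[h0 h1] Cx uM; rewrite /gap subr_ge0.
have := @reaction_ratio t x u (1 - theta) 1 i Cx uM; rewrite scale1r divr1; apply => //.
by rewrite subr_gt0 h1/= lerBlDr lerDl ltW.
Qed.

Lemma gap_le theta a i t x u : 0 < theta < 1 -> 0 < a <= 1 - theta -> C x -> in_box u ->
  a * gap theta i t x u <= g t x (a *: u) i 0 - a * g t x u i 0.
Proof.
move=> /andP[h0 h1] /andP[a0 a1] Cx uM; rewrite /gap mulrBr lerD2r.
rewrite mulrC -ler_pdivlMr//.
apply: reaction_ratio => //; first by rewrite a0.
by rewrite lerBlDr lerDl ltW.
Qed.

Lemma gap_le_linear theta i t x u : 0 < theta < 1 -> C x -> in_box u ->
  gap theta i t x u <= \sum_j partial g i j t x 0 * u j 0 - g t x u i 0.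
Proof.
move=> /andP[h0 h1] Cx uM; rewrite /gap lerD2r ler_pdivrMr ?subr_gt0//.
have th : 0 <= 1 - theta <= 1 by rewrite subr_ge0 ltW//= lerBlDr lerDl ltW.
apply: (le_trans (reaction_le_linear t i Cx (in_box_scale th uM))).
rewrite mulr_suml; apply: ler_sum => j _; rewrite mxE.
by rewrite mulrCA mulrC.
Qed.

Lemma gap_pos theta (delta : R) : 0 < theta < 1 -> 0 < delta -> exists2 e : R, 0 < e &
  forall t x u, C x -> in_box u -> (forall k, delta <= u k 0) ->
    exists i, e <= gap theta i t x u.
Proof.
move=> th delta0; have /andP[h0 h1] := th.
pose Q : set 'cV[R]_m := [set u | forall k, delta <= u k 0 <= v k 0].
have cQ : compact Q by exact: (@col_box_compact R m (fun=> delta) (fun k => v k 0)).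
have QM u : Q u -> in_box u.
  by move=> uQ k; have /andP[h2 ->] := uQ k; rewrite (le_trans _ h2)// ltW.
have af : admissible C T (fun t x u => \sum_i gap theta i t x u).
  by apply: admissible_sum => i _; exact: gap_admissible.
have [|e e0 he] := admissible_pos cC (sys_T H) af cQ.
  move=> t x u Cx Qu; have uM := QM _ Qu.
  have uI k : 0 < u k 0 <= v k 0 by have /andP[h2 ->] := Qu k; rewrite (lt_le_trans _ h2).
  have th' : 0 < 1 - theta < 1 by rewrite subr_gt0 h1 ltrBlDr ltrDl.
  have [_ [i hi]] := sys_sub H t Cx uI th'.
  rewrite (bigD1 i)//= ltr_pwDl//; last by apply: sumr_ge0 => j _; exact: gap_ge0.
  by rewrite /gap subr_gt0 ltr_pdivlMr ?subr_gt0// mulrC.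
have m0 : 0 < m%:R :> R by rewrite ltr0n (sys_m H).
exists (e / m%:R) => [|t x u Cx uM ud]; first by rewrite divr_gt0.
have [//|nex] := pselect (exists i, e / m%:R <= gap theta i t x u).
have : e <= \sum_i gap theta i t x u.
  by apply: he => // k; have /andP[_ ->] := uM k; rewrite ud.
have : \sum_i gap theta i t x u < \sum_(i < m) e / m%:R.
  apply: ltr_sum => [|j _]; first by apply/hasP; exists (Ordinal (sys_m H)); rewrite ?mem_index_enum.
  by rewrite ltNge; apply/negP => h2; apply: nex; exists j.
by rewrite sumr_const card_ord -[X in _ < X]mulr_natr divfK ?gt_eqF// ltNge => /negP.
Qed.

(** The gap of a curve that moves at most at speed Lam stays open, in the same
    component, for some time. *)
Lemma gap_persists (delta theta Lam tau : R) : 0 < delta -> 0 < theta < 1 -> 0 < Lam -> 0 < tau ->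
  exists e r : R, [/\ 0 < e, 0 < r, r < tau & forall t0 x (P : R -> 'cV[R]_m), C x ->
    (forall t, t0 <= t <= t0 + tau -> in_box (P t)) -> (forall k, delta <= P t0 k 0) ->
    (forall t k, t0 <= t <= t0 + tau -> `|P t k 0 - P t0 k 0| <= Lam * `|t - t0|) ->
    exists i, forall t, t0 < t < t0 + r -> e <= gap theta i t x (P t)].
Proof.
move=> del0 th Lam0 tau0; have [e e0 he] := gap_pos th del0.
have e2 : 0 < e / 2 by rewrite divr_gt0.
have [r r0 hr] := admissible_uniform_family cC (sys_T H) (gap_admissible theta)
  (in_box_compact (v := v)) e2.
pose r' := Num.min (tau / 2) (Num.min r (r / Lam)).
have r'0 : 0 < r' by rewrite !lt_min r0 !divr_gt0.
exists (e / 2), r'; split=> // [|t0 x P Cx PM P0 hP].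
  by rewrite gt_min ltr_pdivrMr// mulr_natr mulr2n ltrDl tau0.
have t0I : t0 <= t0 <= t0 + tau by rewrite lexx lerDl ltW.
have [i hi] := he t0 x (P t0) Cx (PM t0 t0I) P0; exists i => t /andP[t1 t2].
have r'tau : r' <= tau by rewrite ge_min ler_pdivrMr// mulr_natr mulr2n lerDl ltW.
have tI : t0 <= t <= t0 + tau by rewrite (ltW t1) (le_trans (ltW t2))// lerD2l.
have dt : `|t - t0| < r' by rewrite gtr0_norm ?subr_gt0// ltrBlDl.
have : `|gap theta i t x (P t) - gap theta i t0 x (P t0)| < e / 2.
  apply: hr; rewrite ?subrr ?normr0//; [exact: PM|exact: PM| |].
    by apply: (lt_le_trans dt); rewrite !ge_min lexx !orbT.
  apply/(col_norm_lt _ r0) => j; rewrite [X in `|X|]mxE [X in _ + X]mxE.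
  rewrite (le_lt_trans (hP t j tI))// mulrC -ltr_pdivlMr//.
  by apply: (lt_le_trans dt); rewrite !ge_min lexx !orbT.
by rewrite ltr_norml => /andP[h1 h2]; move: h1 hi; lra.
Qed.

End subhomogeneity.

(** * Solutions and comparison *)

Section sup_norm.
Context {R : realType} {m : nat} {E : Type}.
Implicit Types (A : set E) (f : E -> 'cV[R]_m).

Lemma supnorm_le A f (e : R) : (supnorm A f <= e%:E)%E <-> forall x, A x -> `|f x| <= e.
Proof.
split=> [h x Ax|h].
  by rewrite -lee_fin (le_trans _ h)//; apply: ereal_sup_ubound; exists x.
by apply: ge_ereal_sup => _ [x Ax <-]; rewrite lee_fin h.
Qed.

Lemma supnorm_lt A f (e : R) : (supnorm A f < e%:E)%E -> forall x, A x -> `|f x| < e.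
Proof.
move=> h x Ax; rewrite -lte_fin (le_lt_trans _ h)//; apply: ereal_sup_ubound; by exists x.
Qed.

Lemma supnorm_ge0 A f : A !=set0 -> (0 <= supnorm A f)%E.
Proof.
move=> [x Ax]; apply: (@le_trans _ _ (`|f x|)%:E); first by rewrite lee_fin.
by apply: ereal_sup_ubound; exists x.
Qed.

Lemma supnorm_lty A f : (supnorm A f < +oo)%E -> exists B : R, forall x, A x -> `|f x| <= B.
Proof.
move=> h; have [[x Ax]|A0] := pselect (A !=set0); last first.
  by exists 0 => x Ax; exfalso; apply: A0; exists x.
have h0 := @supnorm_ge0 A f (ex_intro _ x Ax).
exists (fine (supnorm A f)); apply/supnorm_le.
by rewrite fineK// ge0_fin_numE.
Qed.

Lemma supnorm_cvg0 {S : Type} (F : set_system S) {FF : Filter F} A (f : S -> E -> 'cV[R]_m) :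
  A !=set0 -> (supnorm A (f s) @[s --> F] --> 0%E) <->
  forall e : R, 0 < e -> \forall s \near F, forall x, A x -> `|f s x| <= e.
Proof.
move=> A0; split=> [h e e0|h].
  have nb : nbhs (0%E : \bar R) [set y : \bar R | (y < e%:E)%E].
    by apply: open_nbhs_nbhs; split; [exact: open_ereal_lt_ereal|rewrite /= lte_fin].
  have hF : \forall s \near F, (supnorm A (f s) < e%:E)%E by exact: h nb.
  by apply: filterS hF => s hs' x Ax; apply/ltW; exact: (supnorm_lt hs').
apply/fine_cvgP; split.
  have := h 1 ltr01; apply: filterS => s hs.
  rewrite ge0_fin_numE ?supnorm_ge0// (le_lt_trans _ (ltry 1))//; exact/supnorm_le.
apply/cvgrPdist_le => e e0; have := h e e0; apply: filterS => s hs /=.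
have hle : (supnorm A (f s) <= e%:E)%E by apply/supnorm_le.
have hf : supnorm A (f s) \is a fin_num.
  by rewrite ge0_fin_numE ?supnorm_ge0// (le_lt_trans hle)// ltry.
rewrite sub0r normrN ger0_norm ?fine_ge0 ?supnorm_ge0//.
by rewrite -lee_fin fineK.
Qed.

Lemma uniformly_bounded_of_local (u : R -> E -> 'cV[R]_m) A (a b : R) :
  (forall t, a <= t <= b -> exists B : R, forall x, A x -> `|u t x| <= B) ->
  (forall t, a <= t <= b -> exists2 e : R, 0 < e & forall s, a <= s <= b -> `|t - s| < e ->
     forall x, A x -> `|u s x - u t x| <= 1) ->
  exists B : R, forall t x, a <= t <= b -> A x -> `|u t x| <= B.
Proof.
move=> hb hc.
have ex t : exists p : R * R, a <= t <= b -> (forall x, A x -> `|u t x| <= p.1) /\ 0 < p.2 /\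
    forall s, a <= s <= b -> `|t - s| < p.2 -> forall x, A x -> `|u s x - u t x| <= 1.
  have [tab|ntab] := pselect (a <= t <= b); last by exists (0, 0) => /ntab.
  by have [B hB] := hb t tab; have [e e0 he] := hc t tab; exists (B, e).
have [p hp] := choice ex.
have [|s sA As] := @compact_finite_ball_cover R R `[a, b]%classic (fun t => (p t).2) (@segment_compact _ a b).
  by move=> t /=; rewrite in_itv/= => /hp[_ []].
exists (\sum_(t <- s) `|(p t).1| + 1) => t x tab Ax.
have [t' t's] := As t (tab : `[a, b]%classic t); rewrite -ball_normE/= => t't.
have t'ab : a <= t' <= b by have := sA t' t's; rewrite /= in_itv.
have [h1 [_ h2]] := hp t' t'ab.
rewrite -[u t x](subrK (u t' x)) addrC (le_trans (ler_normD _ _))// lerD//; last exact: h2.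
rewrite (le_trans (h1 x Ax))// (le_trans (ler_norm _))//.
rewrite (big_rem t')//= lerDl sumr_ge0//.
Qed.

End sup_norm.

Section comparison_of_solutions.
Context {R : realType} {m n : nat}.
Variables (Omega : set 'rV[R]_n) (d : 'rV[R]_m) (K : 'I_m -> R -> 'rV[R]_n -> R).
Variables (g : R -> 'rV[R]_n -> 'cV[R]_m -> 'cV[R]_m) (v : 'cV[R]_m) (T : R).
Hypothesis H : system Omega d K g v T.

Local Notation C := (closure Omega).
Local Notation in_box := (in_box v).
Local Notation rhs := (nonlinear_rhs Omega d K g).
Implicit Types (t s a b r : R) (x y : 'rV[R]_n) (i j k : 'I_m).
Implicit Types (phi psi : 'rV[R]_n -> 'cV[R]_m) (u w : R -> 'rV[R]_n -> 'cV[R]_m).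

Let oO := sys_open H.
Let bO := sys_bounded H.

Lemma closure_nonempty : C !=set0.
Proof. by have [x Ox] := sys_nonempty H; exists x; exact: subset_closure. Qed.

Lemma rhsE t phi x i : rhs t phi x i 0 =
  d 0 i * spread Omega (K i t) (fun y => phi y i 0) x - d 0 i * phi x i 0 + g t x (phi x) i 0.
Proof. by rewrite /nonlinear_rhs mxE !mul_diag_mx !mxE. Qed.

Definition dmax := \sum_i d 0 i.

Lemma d_le_dmax i : d 0 i <= dmax.
Proof. by rewrite /dmax (bigD1 i)//= lerDl sumr_ge0// => j _; exact/ltW/(sys_d H). Qed.

Lemma dmax_ge0 : 0 <= dmax.
Proof. by apply: sumr_ge0 => i _; exact/ltW/(sys_d H). Qed.

Definition slice_bm phi := forall i, bounded_measurable Omega (fun y => phi y i 0).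

(** What comparison needs of a solution on a time interval: measurable slices
    make the nonlocal term additive, and a common bound starts the comparison. *)
Record trajectory a b u : Prop := Trajectory {
  traj_ev : forall x i, C x ->
    evolves a b (fun t => u t x i 0) (fun t => rhs t (u t) x i 0) ;
  traj_bm : forall t, a <= t <= b -> slice_bm (u t) ;
  traj_bd : exists B : R, forall t x i, a <= t <= b -> C x -> `|u t x i 0| <= B }.

Lemma trajectoryW a b a' b' u : a <= a' -> b' <= b -> trajectory a b u -> trajectory a' b' u.
Proof.
move=> aa' b'b [ev bm [B bd]].
have sub t : a' <= t <= b' -> a <= t <= b.
  by move=> /andP[h1 h2]; rewrite (le_trans aa')// (le_trans h2).
split; first by move=> x i Cx; apply: evolvesW (ev x i Cx).
  by move=> t /sub; exact: bm.
by exists B => t x i /sub; exact: bd.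
Qed.

Lemma Xhat_slice_bm phi : Xhat Omega phi -> slice_bm phi.
Proof.
move=> [mphi /supnorm_lty[B hB]] i; split.
  apply: measurable_funS (mphi i); last exact: subset_closure.
  by apply: closed_lebesgue_measurable; exact: closed_closure.
exists `|B| => y Oy; have /(col_norm_le _ (normr_ge0 B)) : `|phi y| <= `|B|.
  by rewrite (le_trans (hB y (subset_closure Oy)))// ler_norm.
exact.
Qed.

Lemma solution_trajectory phi u b : 0 <= b -> is_solution Omega d K g phi u -> trajectory 0 b u.
Proof.
move=> b0 [uX uc ue u0].
have bd : exists B : R, forall t x, 0 <= t <= b -> C x -> `|u t x| <= B.
  apply: uniformly_bounded_of_local => t /andP[t0 tb].
    exact: supnorm_lty (uX t t0).2.
  have /(supnorm_cvg0 _ closure_nonempty)/(_ 1 ltr01) := uc t t0.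
  rewrite near_withinE => /nbhs_ballP[e /= e0 he]; exists e => // s /andP[s0 sb] ts x Cx.
  by apply: he.
split.
- move=> x i Cx; split; last first.
    by move=> t /andP[t0 tb]; apply: is_derive_coord; exact: ue.
  apply/(@within_continuous_ballP R) => t /=; rewrite in_itv/= => /andP[t0 tb] e e0.
  have e2 : 0 < e / 2 by rewrite divr_gt0.
  have /(supnorm_cvg0 _ closure_nonempty)/(_ _ e2) := uc t t0.
  rewrite near_withinE => /nbhs_ballP[r /= r0 hr]; exists r => // s; rewrite in_itv/= => /andP[s0 sb] ts.
  have /(col_norm_le _ (ltW e2))/(_ i) := hr s ts s0 x Cx.
  rewrite !mxE distrC => h; apply: (le_lt_trans h).
  by rewrite ltr_pdivrMr// mulr_natr mulr2n ltrDl.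
- by move=> t /andP[t0 _]; apply: Xhat_slice_bm; exact: uX.
- have [B hB] := bd; exists `|B| => t x i tb Cx.
  by apply: (col_norm_le _ (normr_ge0 B)).1 i; rewrite (le_trans (hB t x tb Cx))// ler_norm.
Qed.

Lemma spread_ge_cst (k phi : 'rV[R]_n -> R) x (N : R) : convolution_kernel k -> (\int[lebesgue R n]_y (k y)%:E = 1)%E ->
  bounded_measurable Omega phi -> 0 <= N -> (forall y, Omega y -> - N <= phi y) -> - N <= spread Omega k phi x.
Proof.
move=> kk k1 bphi N0 h.
apply: (@le_trans _ _ (spread Omega k (fun=> - N) x)).
  rewrite spread_cst// mulNr lerN2 ler_piMr//.
  exact: (spread1_le1 oO).
apply: le_spread => //; exact: bounded_measurable_cst.
Qed.

(** Curves that satisfy the differential inequality of an upper and a lower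
    solution; only lower bounds of the difference at the same time enter, so
    that the nonlocal term may be controlled in any way. *)
Lemma box_comparison (D : set 'rV[R]_n) a b u w (du dw : R -> 'rV[R]_n -> 'I_m -> R) (L1 : R) :
  D `<=` C -> 0 <= L1 ->
  (forall x i, D x -> evolves a b (fun t => u t x i 0) (fun t => du t x i)) ->
  (forall x i, D x -> evolves a b (fun t => w t x i 0) (fun t => dw t x i)) ->
  (forall t x, a <= t <= b -> D x -> in_box (u t x) /\ in_box (w t x)) ->
  (forall x i, D x -> w a x i 0 <= u a x i 0) ->
  (forall (N : R) t x i, a < t < b -> D x -> 0 <= N ->
     (forall y k, D y -> - N <= u t y k 0 - w t y k 0) ->
     - (L1 * N) - d 0 i * (u t x i 0 - w t x i 0) + (g t x (u t x) i 0 - g t x (w t x) i 0)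
       <= du t x i - dw t x i) ->
  forall t x i, a <= t <= b -> D x -> w t x i 0 <= u t x i 0.
Proof.
move=> DC L10 eu ew bx h0 hd t x i tab Dx.
have [B B0 hB] := in_box_norm H.
have [L L0 hL] := reaction_quasimonotone H.
rewrite -subr_ge0.
refine (@comparison_principle R ('rV[R]_n * 'I_m)%type [set p | D p.1] a b
  (fun t p => u t p.1 p.2 0 - w t p.1 p.2 0) (fun t p => du t p.1 p.2 - dw t p.1 p.2)
  (L1 + L) (2 * B) _ _ _ _ _ t (x, i) tab Dx).
- by rewrite ltr_wpDl.
- by move=> [y j] /= Dy; apply: evolvesB; [exact: eu|exact: ew].
- by move=> [y j] /= Dy; rewrite subr_ge0 h0.
- move=> s [y j] sab /= Dy; have [uM wM] := bx s y sab Dy.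
  have := hB _ uM j; have := hB _ wM j; rewrite !ler_norml => /andP[_ h1] /andP[h2 _].
  by rewrite mulr_natl mulr2n opprD lerD// lerN2.
- move=> N s [y j] sab /= Dy N0 hN neg.
  have sab' : a <= s <= b by case/andP: sab => *; rewrite !ltW.
  have [uM wM] := bx s y sab' Dy.
  have hN' y' k : D y' -> - N <= u s y' k 0 - w s y' k 0 by move=> Dy'; exact: (hN (y', k)).
  apply: le_trans (hd N s y j sab Dy N0 hN').
  have hq := hL s y _ _ j N (DC _ Dy) uM wM N0 (fun k => hN' y k Dy) (le_trans (ltW neg) N0).
  have hdd : 0 <= - (d 0 j * (u s y j 0 - w s y j 0)).
    by rewrite oppr_ge0 mulr_ge0_le0 ?ltW// (sys_d H).
  rewrite mulrDl opprD lerD//.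
  by rewrite -[leLHS]addr0 lerD.
Qed.

Lemma trajectory_scaled_order a b u w (al : R) : 0 < al <= 1 ->
  trajectory a b u -> trajectory a b w ->
  (forall t x, a <= t <= b -> C x -> in_box (u t x) /\ in_box (w t x)) ->
  (forall x i, C x -> al * w a x i 0 <= u a x i 0) ->
  forall t x i, a <= t <= b -> C x -> al * w t x i 0 <= u t x i 0.
Proof.
move=> /andP[al0 al1] tu tw bx h0.
have al01 : 0 <= al <= 1 by rewrite ltW.
suff S : forall t x i, a <= t <= b -> C x -> (al *: w t x) i 0 <= u t x i 0.
  by move=> t x i tab Cx; have := S t x i tab Cx; rewrite mxE.
apply: (@box_comparison C a b u (fun t x => al *: w t x) (fun t x i => rhs t (u t) x i 0)
  (fun t x i => al * rhs t (w t) x i 0) dmax) => //.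
- exact: dmax_ge0.
- by move=> x i Cx; exact: traj_ev.
- move=> x i Cx; apply: eq_evolves (evolvesZ al (traj_ev tw i Cx)) => //.
  by apply/funext => t; rewrite mxE.
- move=> t x tab Cx; have [h1 h2] := bx t x tab Cx; split => //.
  exact: in_box_scale.
- by move=> x i Cx; rewrite mxE h0.
move=> N t x i tab Cx N0 hN.
have tab' : a <= t <= b by case/andP: tab => *; rewrite !ltW.
have [uM wM] := bx t x tab' Cx.
rewrite !rhsE.
have bu := traj_bm tu tab' i; have bw := traj_bm tw tab' i.
have sp : - N <= spread Omega (K i t) (fun y => u t y i 0) x - al * spread Omega (K i t) (fun y => w t y i 0) x.
  have bwa := bounded_measurableZ al bw.
  rewrite -(spreadZ oO bO al x (sys_K H i t) bw) -(spreadB oO bO x (sys_K H i t) bu bwa).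
  have hy y : Omega y -> - N <= u t y i 0 - al * w t y i 0.
    by move=> Oy; have := hN y i (subset_closure Oy); rewrite mxE.
  exact: (spread_ge_cst x (sys_K H i t) (sys_K1 H i t) (bounded_measurableB bu bwa) N0 hy).
have hs := reaction_subhomogeneous H t i Cx wM (introT andP (conj al0 al1)).
have d0 := sys_d H i.
have hsp : - (dmax * N) <= d 0 i * (spread Omega (K i t) (fun y => u t y i 0) x - al * spread Omega (K i t) (fun y => w t y i 0) x).
  apply: (@le_trans _ _ (d 0 i * - N)); last by rewrite ler_pM2l.
  by rewrite mulrN lerN2 ler_wpM2r// d_le_dmax.
rewrite !mxE.
move: hsp hs; set S1 := spread _ _ _ _; set S2 := spread _ _ _ _; set g1 := g _ _ _ _ _; set g2 := g _ _ _ _ _; set g3 := g _ _ _ _ _.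
move=> hsp hs; nra.
Qed.

Lemma trajectory_dist (B : R) : exists2 L : R, 0 < L & forall a b u w (e : R), 0 <= e ->
  trajectory a b u -> trajectory a b w ->
  (forall t x i, a <= t <= b -> C x -> `|u t x i 0| <= B /\ `|w t x i 0| <= B) ->
  (forall x i, C x -> `|u a x i 0 - w a x i 0| <= e) ->
  forall t x i, a <= t <= b -> C x -> `|u t x i 0 - w t x i 0| <= e * expR (L * (t - a)).
Proof.
have [L L0 hL] := reaction_Lipschitz H B.
exists (2 * dmax + L) => [|a b u w e e0 tu tw bd h0 t x i tab Cx].
  by rewrite ltr_wpDl// mulr_ge0// dmax_ge0.
have -> : e * expR ((2 * dmax + L) * (t - a)) = (e + 0 * (t - a)) * expR ((2 * dmax + L) * (t - a)).
  by rewrite mul0r addr0.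
refine (@Gronwall R ('rV[R]_n * 'I_m)%type [set p | C p.1] a b
  (fun t p => u t p.1 p.2 0 - w t p.1 p.2 0)
  (fun t p => rhs t (u t) p.1 p.2 0 - rhs t (w t) p.1 p.2 0)
  (2 * dmax + L) (B + B) e 0 _ e0 (lexx 0) _ _ _ _ t (x, i) tab Cx).
- by rewrite ltr_wpDl// mulr_ge0// dmax_ge0.
- by move=> [y j] /= Cy; apply: evolvesB; [exact: (traj_ev tu)|exact: (traj_ev tw)].
- by move=> [y j] /= Cy; exact: h0.
- move=> s [y j] sab /= Cy; have [h1 h2] := bd s y j sab Cy.
  by rewrite (le_trans (ler_normB _ _))// lerD.
- move=> N s [y j] sab /= Cy hN; rewrite addr0.
  have sab' : a <= s <= b by case/andP: sab => *; rewrite !ltW.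
  have N0 : 0 <= N by apply: le_trans (hN (y, j) Cy); exact: normr_ge0.
  have bu := traj_bm tu sab' j; have bw := traj_bm tw sab' j.
  rewrite !rhsE.
  have sp : `|spread Omega (K j s) (fun y => u s y j 0) y - spread Omega (K j s) (fun y => w s y j 0) y| <= N.
    rewrite -(spreadB oO bO y (sys_K H j s) bu bw).
    have hy y' : Omega y' -> `|u s y' j 0 - w s y' j 0| <= N.
      by move=> Oy'; exact: (hN (y', j) (subset_closure Oy')).
    exact: (spread_norm_le oO bO y (sys_K H j s) (sys_K1 H j s) (bounded_measurableB bu bw) hy N0).
  have hg : `|g s y (u s y) j 0 - g s y (w s y) j 0| <= L * N.
    apply: hL => // k; [exact: (bd s y k sab' Cy).1|exact: (bd s y k sab' Cy).2|].
    exact: (hN (y, k) Cy).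
  have hj := hN (y, j) Cy; have dj := d_le_dmax j; have d0 := sys_d H j; rewrite /= in hj.
  set S1 := spread _ _ _ _ in sp *; set S2 := spread _ _ _ _ in sp *.
  set g1 := g _ _ _ _ _ in hg *; set g2 := g _ _ _ _ _ in hg *.
  have -> : d 0 j * S1 - d 0 j * u s y j 0 + g1 - (d 0 j * S2 - d 0 j * w s y j 0 + g2) =
    d 0 j * (S1 - S2) - d 0 j * (u s y j 0 - w s y j 0) + (g1 - g2) by ring.
  rewrite (le_trans (ler_normD _ _))// mulrDl lerD//.
  rewrite (le_trans (ler_normB _ _))// mulr_natl mulr2n mulrDl !normrM !(gtr0_norm d0).
  by rewrite lerD// ler_pM// ltW.
Qed.

Lemma trajectory_ge_spread : exists2 c : R, 0 < c & forall a b u, trajectory a b u ->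
  (forall t x, a <= t <= b -> C x -> in_box (u t x)) ->
  forall t x i, a < t < b -> C x ->
    d 0 i * spread Omega (K i t) (fun y => u t y i 0) x - c * u t x i 0 <= rhs t (u t) x i 0.
Proof.
have [L L0 hL] := reaction_ordered H.
exists (dmax + L) => [|a b u tu bx t x i tab Cx]; first by rewrite ltr_wpDl// dmax_ge0.
have tab' : a <= t <= b by case/andP: tab => *; rewrite !ltW.
have uM := bx t x tab' Cx.
have u0 k : (0 : 'cV[R]_m) k 0 <= u t x k 0 by rewrite mxE; case/andP: (uM k).
have := hL t x (u t x) 0 i Cx uM (in_box0 H) u0.
rewrite (sys_g0 H _ Cx) mxE !subr0 rhsE => h.
have ui : 0 <= u t x i 0 by case/andP: (uM i).
have := ler_wpM2r ui (d_le_dmax i); rewrite mulrDl.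
by lra.
Qed.

End comparison_of_solutions.

Section kernels_and_moduli.
Context {R : realType} {m n : nat}.
Variables (Omega : set 'rV[R]_n) (d : 'rV[R]_m) (K : 'I_m -> R -> 'rV[R]_n -> R).
Variables (g : R -> 'rV[R]_n -> 'cV[R]_m -> 'cV[R]_m) (v : 'cV[R]_m) (T : R).
Hypothesis H : system Omega d K g v T.

Local Notation C := (closure Omega).
Local Notation in_box := (in_box v).
Local Notation rhs := (nonlinear_rhs Omega d K g).
Local Notation trajectory := (trajectory Omega d K g).
Implicit Types (t s a b r : R) (x y : 'rV[R]_n) (i j k : 'I_m).
Implicit Types (phi psi : 'rV[R]_n -> 'cV[R]_m) (u w : R -> 'rV[R]_n -> 'cV[R]_m).

Let cC : compact C := closure_bounded_compact (sys_bounded H).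
Let oO := sys_open H.
Let bO := sys_bounded H.
Let dmax := @dmax R m d.
Let dmax0 : 0 <= dmax := dmax_ge0 H.
Let d_le i : d 0 i <= dmax := d_le_dmax H i.

Lemma closure_bounded : exists2 B : R, 0 < B & forall x, C x -> `|x| <= B.
Proof.
have /ex_strict_bound_gt0[B B0 /= HB] : bounded_set C by exact: compact_bounded cC.
by exists B => // x Cx; exact/ltW/HB.
Qed.

Let big_ball (B : R) : set 'rV[R]_n := [set z | `|z| <= B].

Let big_ball_compact B : compact (big_ball B).
Proof.
apply: bounded_closed_compact.
  exists B; split; first exact: num_real.
  by move=> y By z /= zB; rewrite (le_trans zB)// ltW.
by apply: ((continuous_closedP _).1 _ _ (@closed_le _ _)); exact: norm_continuous.
Qed.

Let K_admissible B i : @admissible R m n (big_ball B) T (fun t z _ => K i t z).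
Proof.
split; last by move=> t x u _; exact: (sys_Kper H).
apply: continuous_subspaceT => p.
apply: (@continuous_comp _ _ _ (fun q : R * 'rV[R]_n * 'cV[R]_m => q.1) (fun q => K i q.1 q.2)).
  exact: cvg_fst.
exact: (sys_Kc H).
Qed.

Let one : set 'cV[R]_m := [set u | forall k, 0 <= u k 0 <= 0].

Let one_compact : compact one.
Proof. exact: (@col_box_compact R m (fun=> 0) (fun=> 0)). Qed.

Let one0 : one 0.
Proof. by move=> k; rewrite mxE lexx. Qed.

Lemma K_uniform (e : R) : 0 < e -> exists2 r : R, 0 < r & forall i t t' x x' y,
  C x -> C x' -> Omega y -> `|t - t'| < r -> `|x - x'| < r ->
  `|K i t (x - y) - K i t' (x' - y)| < e.
Proof.
move=> e0; have [B B0 HB] := closure_bounded.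
have [r r0 hr] := admissible_uniform_family (@big_ball_compact (B + B)) (sys_T H)
  (K_admissible (B + B)) one_compact e0.
exists r => // i t t' x x' y Cx Cx' Oy ht hx; have Cy := subset_closure Oy.
have bb z : C z -> big_ball (B + B) (z - y).
  by move=> Cz; rewrite /big_ball/= (le_trans (ler_normB _ _))// lerD// HB.
apply: (hr i t t' _ _ 0 0 (bb x Cx) (bb x' Cx') one0 one0 ht); last by rewrite subrr normr0.
by rewrite opprB addrA subrK.
Qed.

Lemma K_bounded : exists2 B : R, 0 < B & forall i t x y, C x -> Omega y -> K i t (x - y) <= B.
Proof.
have [B B0 HB] := closure_bounded.
suff [M M0 hM] : exists2 M : R, 0 < M & forall i t z, `|z| <= B + B -> K i t z <= M.
  exists M => // i t x y Cx Oy; apply: hM.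
  by rewrite (le_trans (ler_normB _ _))// lerD// HB//; exact: subset_closure.
apply: finite_bound_choice => [i r s rs h t z hz|i]; first by rewrite (le_trans _ rs)// h.
have [M M0 hM] := admissible_bounded (@big_ball_compact (B + B)) (sys_T H) (K_admissible (B + B) i) one_compact.
by exists M => // t z hz; rewrite (le_trans (ler_norm _))// (hM t z 0).
Qed.

Lemma K_lower : exists k0 r0 : R, [/\ 0 < k0, 0 < r0 & forall i t z, `|z| < r0 -> k0 <= K i t z].
Proof.
suff [r r0 hr] : exists2 r : R, 0 < r & forall i t z, `|z| < r -> r <= K i t z by exists r, r.
apply: finite_pos_choice => [i r s /andP[s0 sr] h t z zs|i].
  by rewrite (le_trans sr)// h// (lt_le_trans zs).
have [|e e0 he] := admissible_pos (@big_ball_compact 0) (sys_T H) (K_admissible 0 i) one_compact.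
  by move=> t z u; rewrite /big_ball/= normr_le0 => /eqP -> _; exact: (sys_K0 H).
have e2 : 0 < e / 2 by rewrite divr_gt0.
have [r r0 hr] := admissible_uniform (@big_ball_compact 1) (sys_T H) (K_admissible 1 i) one_compact e2.
exists (Num.min (e / 2) (Num.min r 1)); first by rewrite !lt_min e2 r0 ltr01.
move=> t z; rewrite !lt_min => /and3P[_ zr z1]; rewrite ge_min; apply/orP; left.
have h0 : e <= K i t 0 by apply: (he t 0 0) => //; rewrite /big_ball/= normr0.
have : `|K i t 0 - K i t z| < e / 2.
  by apply: (hr t t 0 z 0 0); rewrite ?subrr ?normr0 ?sub0r ?normrN// /big_ball/= ?normr0// ltW.
by rewrite ltr_norml => /andP[_ h1]; lra.
Qed.

Lemma reaction_uniform (e : R) : 0 < e -> exists2 r : R, 0 < r &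
  forall i t t' x x' (p p' : 'cV[R]_m), C x -> C x' -> in_box p -> in_box p' ->
    `|t - t'| < r -> `|x - x'| < r -> `|p - p'| < r -> `|g t x p i 0 - g t' x' p' i 0| < e.
Proof.
exact: (admissible_uniform_family cC (sys_T H) (sys_g H) (in_box_compact (v := v))).
Qed.

Definition vol := fine (lebesgue R n Omega).

Lemma vol_ge0 : 0 <= vol.
Proof. by rewrite fine_ge0// lebesgue_outer_ge0. Qed.

(** The nonlocal term depends continuously on time and place, uniformly for
    all bounded densities. *)
Lemma influx_modulus (B e : R) : 0 <= B -> 0 < e -> exists2 r : R, 0 < r &
  forall i t t' x x' (phi : 'rV[R]_n -> R), C x -> C x' -> `|t - t'| < r -> `|x - x'| < r ->
  bounded_measurable Omega phi -> (forall y, Omega y -> `|phi y| <= B) ->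
  `|d 0 i * spread Omega (K i t) phi x - d 0 i * spread Omega (K i t') phi x'| <= e.
Proof.
move=> B0 e0; have A0 : 0 <= dmax * (B * vol) by rewrite !mulr_ge0// vol_ge0.
have [e' e'0 he'] := small_factor A0 e0; have [r r0 hr] := K_uniform e'0.
exists r => // i t t' x x' phi Cx Cx' tt xx bphi phiB.
rewrite -mulrBr normrM gtr0_norm ?(sys_d H)//; apply: le_trans he'.
rewrite -mulrA; apply: ler_pM => //; first exact/ltW/(sys_d H).
rewrite mulrC mulrA; apply: (spread_dist_le oO bO (sys_K H i t) (sys_K H i t') bphi phiB B0) => y Oy.
exact/ltW/hr.
Qed.

Lemma influx_modulus_ge0 (B e : R) : 0 <= B -> 0 < e -> exists2 r : R, 0 < r &
  forall i t x x' (phi : 'rV[R]_n -> R), C x -> C x' -> `|x - x'| < r ->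
  (forall y, Omega y -> 0 <= phi y <= B) ->
  d 0 i * spread Omega (K i t) phi x <= d 0 i * spread Omega (K i t) phi x' + e.
Proof.
move=> B0 e0; have A0 : 0 <= dmax * (B * vol) by rewrite !mulr_ge0// vol_ge0.
have [e' e'0 he'] := small_factor A0 e0; have [r r0 hr] := K_uniform e'0.
exists r => // i t x x' phi Cx Cx' xx phiB; have d0 := sys_d H i.
have hK y : Omega y -> K i t (x - y) <= K i t (x' - y) + e'.
  move=> Oy; rewrite -lerBlDl (le_trans (ler_norm _))//; apply/ltW/hr => //.
  by rewrite subrr normr0.
have := spread_le_add_cst oO bO (sys_K H i t) (sys_K H i t) phiB (ltW e'0) B0 hK.
move/(ler_wpM2l (ltW d0))/le_trans; apply; rewrite mulrDr lerD2l -/vol.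
apply: le_trans he'; rewrite -mulrA [leRHS]mulrAC -mulrA; apply: ler_pM => //; first exact: ltW.
  by rewrite !mulr_ge0 ?vol_ge0// ltW.
Qed.

Lemma spread_bound i t (phi : 'rV[R]_n -> R) x (B : R) : bounded_measurable Omega phi ->
  (forall y, Omega y -> `|phi y| <= B) -> 0 <= B -> `|spread Omega (K i t) phi x| <= B.
Proof.
by move=> h1 h2 B0; exact: (spread_norm_le oO bO x (sys_K H i t) (sys_K1 H i t) h1 h2 B0).
Qed.

(** The right-hand side is bounded on the box. *)
Lemma trajectory_time_Lipschitz : exists2 Lam : R, 0 < Lam & forall a b u, a <= b -> trajectory a b u ->
  (forall t x, a <= t <= b -> C x -> in_box (u t x)) ->
  forall s t x i, a <= s <= b -> a <= t <= b -> C x -> `|u s x i 0 - u t x i 0| <= Lam * `|s - t|.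
Proof.
have [B B0 hB] := in_box_norm H; have [L L0 hL] := reaction_Lipschitz H B.
exists (dmax * B + dmax * B + L * B) => [|a b u ab tu bx s t x i sab tab Cx].
  by rewrite ltr_wpDl ?mulr_gt0// addr_ge0// mulr_ge0// ltW.
apply: (evolves_bounded_slope ab (traj_ev tu i Cx)) => // r rab.
have rab' : a <= r <= b by case/andP: rab => *; rewrite !ltW.
have uB y k : C y -> `|u r y k 0| <= B by move=> Cy; apply: hB; exact: bx.
rewrite rhsE (le_trans (ler_normD _ _))// lerD//.
  rewrite (le_trans (ler_normB _ _))// !normrM !(gtr0_norm (sys_d H i)).
  have d0 := ltW (sys_d H i); rewrite lerD//; apply: ler_pM => //.
    apply: spread_bound; [exact: (traj_bm tu)| |exact: ltW].
    by move=> y Oy; apply: uB; exact: subset_closure.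
  exact: uB.
have := hL r x (u r x) 0 i B Cx (fun k => uB x k Cx).
rewrite (sys_g0 H _ Cx) mxE subr0; apply => k; first by rewrite mxE normr0 ltW.
by rewrite mxE subr0 uB.
Qed.

(** Two nearby points: the nonlocal term and the reaction term differ little,
    and the difference of the two curves obeys a Gronwall inequality. *)
Lemma trajectory_space_modulus : exists2 L : R, 0 < L & forall e : R, 0 < e ->
  exists2 r : R, 0 < r & forall a b u x x' (e0 : R), trajectory a b u ->
  (forall t x, a <= t <= b -> C x -> in_box (u t x)) -> C x -> C x' -> `|x - x'| < r -> 0 <= e0 ->
  (forall i, `|u a x i 0 - u a x' i 0| <= e0) ->
  forall t i, a <= t <= b -> `|u t x i 0 - u t x' i 0| <= (e0 + e * (t - a)) * expR (L * (t - a)).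
Proof.
have [B B0 hB] := in_box_norm H; have [L L0 hL] := reaction_Lipschitz H B.
exists (dmax + L) => [|e e0]; first by rewrite ltr_wpDl.
have e2 : 0 < e / 2 by rewrite divr_gt0.
have [r1 r10 hr1] := influx_modulus (ltW B0) e2.
have [r2 r20 hr2] := reaction_uniform e2.
exists (Num.min r1 r2); first by rewrite lt_min r10.
move=> a b u x x' e1 tu bx Cx Cx' xx' e10 h0 t i tab.
have xr1 : `|x - x'| < r1 by rewrite (lt_le_trans xx')// ge_min lexx.
have xr2 : `|x - x'| < r2 by rewrite (lt_le_trans xx')// ge_min lexx orbT.
refine (@Gronwall R 'I_m setT a b (fun t i => u t x i 0 - u t x' i 0)
  (fun t i => rhs t (u t) x i 0 - rhs t (u t) x' i 0) (dmax + L) (B + B) e1 e _ e10 (ltW e0) _ _ _ _ t i tab I).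
- by rewrite ltr_wpDl.
- by move=> j _; apply: evolvesB; exact: (traj_ev tu).
- by move=> j _; exact: h0.
- move=> s j sab _; rewrite (le_trans (ler_normB _ _))// lerD// hB//; exact: bx.
move=> N s j sab _ hN.
have sab' : a <= s <= b by case/andP: sab => *; rewrite !ltW.
have uM := bx s x sab' Cx; have uM' := bx s x' sab' Cx'.
rewrite !rhsE.
set S1 := spread _ _ _ _; set S2 := spread _ _ _ _; set g1 := g _ _ _ _ _; set g2 := g _ _ _ _ _.
have hS : `|d 0 j * S1 - d 0 j * S2| <= e / 2.
  have ss0 : `|s - s| < r1 by rewrite subrr normr0.
  apply: (hr1 j s s x x' _ Cx Cx' ss0 xr1 (traj_bm tu sab' j)) => y Oy.
  exact: hB _ (bx s y sab' (subset_closure Oy)) j.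
have hg1 : `|g1 - g s x' (u s x) j 0| <= e / 2.
  by apply/ltW; apply: hr2 => //; rewrite subrr normr0.
have hg2 : `|g s x' (u s x) j 0 - g2| <= L * N.
  by apply: hL => // k; [exact: hB|exact: hB|exact: hN].
have hN' := hN j I; have d0 := sys_d H j.
have -> : d 0 j * S1 - d 0 j * u s x j 0 + g1 - (d 0 j * S2 - d 0 j * u s x' j 0 + g2) =
  (d 0 j * S1 - d 0 j * S2) - d 0 j * (u s x j 0 - u s x' j 0) +
  (g1 - g s x' (u s x) j 0) + (g s x' (u s x) j 0 - g2) by ring.
have hN2 : `|d 0 j * (u s x j 0 - u s x' j 0)| <= dmax * N.
  by rewrite normrM gtr0_norm//; apply: ler_pM => //; exact: ltW.
rewrite (le_trans (ler_normD _ _))// (le_trans (lerD (ler_normD _ _) (lexx _)))//.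
rewrite (le_trans (lerD (lerD (ler_normB _ _) (lexx _)) (lexx _)))//.
rewrite (le_trans (lerD (lerD (lerD hS hN2) hg1) hg2))// mulrDl.
by rewrite le_eqVlt; apply/orP; left; apply/eqP; field.
Qed.

End kernels_and_moduli.

(** * Existence of solutions *)

Section primitives.
Context {R : realType}.
Implicit Types (f F : R -> R) (b : R).

Definition primitive f t := \int[@lebesgue_measure R]_(s in `[0, t]) f s.

Lemma primitive0 f : primitive f 0 = 0.
Proof. by rewrite /primitive set_itv1 Rintegral_set1. Qed.

Lemma primitive_evolves f b : 0 <= b -> continuous f -> evolves 0 b (primitive f) f.
Proof.
move=> b0 cf.
have int c : (@lebesgue_measure R).-integrable `[0, c] (EFin \o f).
  apply: continuous_compact_integrable; first exact: segment_compact.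
  exact: continuous_subspaceT.
split; first exact: (parameterized_integral_continuous b0 (int b)).
move=> t /andP[t0 tb].
have [df dfE] := continuous_FTC1_closed tb (int b) t0 (cf t).
have E : 'D_1 (primitive f) t = f t by rewrite -derive1E; exact: dfE.
exact: DeriveDef df E.
Qed.

(** The value of a primitive is a limit of Riemann sums, hence depends
    measurably on a parameter if the integrand does. *)
Lemma Riemann_sum_cvg f F b : 0 <= b -> continuous f -> evolves 0 b F f -> F 0 = 0 ->
  (fun N : nat => \sum_(k < N.+1) b / N.+1%:R * f (k%:R * (b / N.+1%:R))) @ \oo --> F b.
Proof.
rewrite le_eqVlt => /predU1P[<- _ _ F0|b0 cf ev F0].
  rewrite F0 (_ : (fun _ => _) = fun=> 0); first exact: cvg_cst.
  by apply/funext => N; rewrite big1// => k _; rewrite !mul0r.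
apply/cvgrPdist_le => e e0.
have eb : 0 < e / b by rewrite divr_gt0.
have [r r0 hr] := compact_uniformly_continuous (@segment_compact R 0 b) (continuous_subspaceT cf) eb.
have [N0 _ hN0] : \forall N \near \oo, b / N.+1%:R < r :> R.
  have h : \forall N \near \oo, N.+1%:R^-1 < r / b :> R.
    have := @cvg_harmonic R; move/cvgrPdist_lt/(_ (r / b)); rewrite divr_gt0// => /(_ isT).
    by apply: filterS => N; rewrite sub0r normrN ger0_norm ?invr_ge0.
  by apply: filterS h => N; rewrite ltr_pdivlMr// mulrC.
exists N0 => // N /= NN0; have hN := hN0 N NN0.
set h := b / N.+1%:R in hN *; have h0 : 0 < h by rewrite divr_gt0.
have bE : b = N.+1%:R * h by rewrite /h mulrC divfK.
have step k : (k < N.+1)%N -> `|F (k.+1%:R * h) - F (k%:R * h) - h * f (k%:R * h)| <= h * (e / b).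
  move=> kN; have k0 : 0 <= k%:R * h by rewrite mulr_ge0// ltW.
  have kb : k.+1%:R * h <= b by rewrite bE ler_pM2r// ler_nat.
  have kk : k%:R * h < k.+1%:R * h by rewrite ltr_pM2r// ltr_nat.
  have [c /andP[c1 c2]] := evolves_MVT kk (evolvesW k0 kb ev).
  have -> : k.+1%:R * h - k%:R * h = h by rewrite -natr1; ring.
  move=> ->; rewrite mulrC -mulrBr normrM gtr0_norm// ler_pM2l//; apply/ltW/hr.
  - by rewrite /= in_itv/= (le_trans k0 (ltW c1)) (le_trans (ltW c2) kb).
  - by rewrite /= in_itv/= k0 (le_trans (ltW kk) kb).
  - rewrite -ball_normE/= gtr0_norm ?subr_gt0//.
    apply: lt_trans hN; rewrite ltrBlDr (lt_le_trans c2)//.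
    by rewrite -natr1 mulrDl mul1r addrC.
have -> : F b = \sum_(k < N.+1) (F (k.+1%:R * h) - F (k%:R * h)).
  rewrite -(big_mkord xpredT (fun k => F (k.+1%:R * h) - F (k%:R * h))).
  by rewrite (telescope_sumr (fun k => F (k%:R * h)))// mul0r F0 subr0 -bE.
rewrite -sumrB (le_trans (ler_norm_sum _ _ _))//.
apply: (@le_trans _ _ (\sum_(k < N.+1) h * (e / b))).
  by apply: ler_sum => k _; exact: step.
by rewrite sumr_const card_ord -mulr_natl mulrA -bE mulrC divfK// gt_eqF.
Qed.

Lemma geometric_cvg0 (c : R) : (fun k : nat => c / 2 ^+ k) @ \oo --> (0 : R).
Proof.
rewrite -[X in _ --> X](mulr0 c); apply: cvgM; first exact: cvg_cst.
under eq_fun do rewrite -exprVn.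
by apply: cvg_expr; rewrite ger0_norm; lra.
Qed.

Lemma geometric_cvg (a : nat -> R) (c : R) : (forall k, `|a k.+1 - a k| <= c / 2 ^+ k) ->
  exists2 l : R, a @ \oo --> l & forall k, `|l - a k| <= 2 * c / 2 ^+ k.
Proof.
move=> ha.
have c0 : 0 <= c by have := ha 0%N; rewrite expr0 divr1; apply: le_trans.
have hd k j : `|a (k + j)%N - a k| <= 2 * c / 2 ^+ k - 2 * c / 2 ^+ (k + j).
  elim: j => [|j IH]; first by rewrite addn0 !subrr normr0.
  rewrite addnS -[X in X - _](subrK (a (k + j)%N)) -addrA (le_trans (ler_normD _ _))//.
  have := ha (k + j)%N; rewrite exprS.
  have e0 : 0 < 2 ^+ (k + j) :> R by rewrite exprn_gt0.
  have -> : 2 * c / (2 * 2 ^+ (k + j)) = c / 2 ^+ (k + j) by field; rewrite gt_eqF.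
  have E : 2 * c / 2 ^+ (k + j) = c / 2 ^+ (k + j) + c / 2 ^+ (k + j) by field; rewrite gt_eqF.
  move: IH; rewrite E; set p := c / _; lra.
have hd' k j : `|a (k + j)%N - a k| <= 2 * c / 2 ^+ k.
  rewrite (le_trans (hd k j))// lerBlDr lerDl divr_ge0 ?mulr_ge0// exprn_ge0//.
have lim0 := geometric_cvg0 (2 * c).
have cva : cvg (a @ \oo).
  apply/cauchy_cvgP/cauchy_exP => e e0.
  move/cvgrPdist_lt/(_ e e0) : lim0 => -[N _ hN]; exists (a N); exists N => // k /= Nk.
  rewrite -ball_normE/= distrC -(subnKC Nk) (le_lt_trans (hd' N _))//.
  by have := hN N (leqnn N); rewrite /= sub0r normrN; apply: le_lt_trans; exact: ler_norm.
exists (limn a) => // k.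
have : (fun j => `|a (k + j)%N - a k|) @ \oo --> `|limn a - a k|.
  apply: cvg_norm; apply: cvgB; last exact: cvg_cst.
  by under eq_fun do rewrite addnC; move: cva; rewrite -(cvg_shiftn k).
move=> hl; apply: (cvgr_to_le hl); exact: nearW.
Qed.

End primitives.

Section superposition.
Context {R : realType} {m n : nat}.
Variables (v : 'cV[R]_m) (C : set 'rV[R]_n) (cC : closed C).
Local Notation in_box := (in_box v).

(** Round the inner function down to multiples of 1 / (N + 1): it then takes
    countably many values. *)
Lemma measurable_superposition (f : 'rV[R]_n -> 'cV[R]_m -> R) (w : 'rV[R]_n -> 'cV[R]_m) :
  (forall p, in_box p -> measurable_fun (C : set (lebesgue_type R n)) (f ^~ p)) ->
  (forall e : R, 0 < e -> exists2 r : R, 0 < r & forall x (p q : 'cV[R]_m), C x ->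
     in_box p -> in_box q -> `|p - q| < r -> `|f x p - f x q| < e) ->
  lebesgue_measurable C w -> (forall x, C x -> in_box (w x)) ->
  measurable_fun (C : set (lebesgue_type R n)) (fun x => f x (w x)).
Proof.
move=> mf uf mw wM.
have mC : measurable (C : set (lebesgue_type R n)) by exact: closed_lebesgue_measurable.
pose code (N : nat) x := [seq Num.truncn (w x k 0 * N.+1%:R) | k <- enum 'I_m].
pose rnd (N : nat) x : 'cV[R]_m := \col_k ((Num.truncn (w x k 0 * N.+1%:R))%:R / N.+1%:R).
have rnd_le N x k : C x -> rnd N x k 0 <= w x k 0 < rnd N x k 0 + N.+1%:R^-1.
  move=> Cx; rewrite mxE; have w0 : 0 <= w x k 0 * N.+1%:R.
    by rewrite mulr_ge0//; case/andP: (wM x Cx k).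
  have /andP[h1 h2] := Num.Theory.truncn_itv w0.
  rewrite ler_pdivrMr// h1/= -[X in _ + X]mul1r -mulrDl ltr_pdivlMr//.
  by rewrite natr1.
have rndM N x : C x -> in_box (rnd N x).
  move=> Cx k; have /andP[h1 _] := rnd_le N x k Cx; have /andP[_ h2] := wM x Cx k.
  by rewrite (le_trans h1)// andbT mxE divr_ge0.
apply: (@measurable_fun_cvg _ (lebesgue_type R n) R C (fun N x => f x (rnd N x))); last first.
  move=> x Cx; apply/cvgrPdist_lt => e e0; have [r r0 hr] := uf e e0.
  have := @cvg_harmonic R; move/cvgrPdist_lt/(_ r r0).
  apply: filterS => N; rewrite sub0r normrN ger0_norm ?invr_ge0// => hN.
  apply: hr => //; [exact: wM|exact: rndM|apply/col_norm_lt => // k].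
  have /andP[h1 h2] := rnd_le N x k Cx.
  rewrite [X in `|X|]mxE [X in _ + X]mxE ger0_norm ?subr_ge0//.
  by rewrite ltrBlDl (lt_trans h2)// ltrD2l.
move=> N.
pose E j : set (lebesgue_type R n) := C `&` [set x | pickle (code N x) = j].
have mE j : measurable (E j).
  have [[x0 [Cx0 <-]]|E0] := pselect (E j !=set0); last first.
    by rewrite (_ : E j = set0)//; apply/seteqP; split => // x Ex; apply: E0; exists x.
  pose I k := `[(Num.truncn (w x0 k 0 * N.+1%:R))%:R / N.+1%:R,
     (Num.truncn (w x0 k 0 * N.+1%:R)).+1%:R / N.+1%:R[%classic : set R.
  rewrite (_ : E _ = C `&` \bigcap_(k in [set: 'I_m]) (C `&` (fun x => w x k 0) @^-1` I k)).
    apply: measurableI => //; apply: fin_bigcap_measurable => // k _.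
    by apply: mw => //; exact: measurable_itv.
  have eqI x k : C x -> I k (w x k 0) <->
      Num.truncn (w x k 0 * N.+1%:R) = Num.truncn (w x0 k 0 * N.+1%:R).
    move=> Cx; have w0 : 0 <= w x k 0 * N.+1%:R by rewrite mulr_ge0//; case/andP: (wM x Cx k).
    rewrite /I/= in_itv/= ler_pdivrMr// ltr_pdivlMr// -Num.Theory.truncn_eq//.
    by split=> [/eqP|->].
  apply/seteqP; split=> [x [Cx /= cx]|x [Cx xI]].
    split=> // k _; split=> //; apply/eqI => //.
    have : code N x = code N x0 by apply: (pcan_inj pickleK).
    by move=> /eq_in_map/(_ k (mem_enum _ _)).
  split=> //=; congr pickle; apply/eq_in_map => k _; apply/eqI => //.
  by have [] := xI k Logic.I.
have -> : C = \bigcup_j E j.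
  apply/seteqP; split=> [x Cx|x [j _ []//]].
  by exists (pickle (code N x)).
apply/(measurable_fun_bigcup _ mE) => j.
have [[x0 [Cx0 x0j]]|E0] := pselect (E j !=set0); last first.
  rewrite (_ : E j = set0); first exact: measurable_fun_set0.
  by apply/seteqP; split => // x Ex; apply: E0; exists x.
have mj : measurable_fun (E j) (f ^~ (rnd N x0)).
  by apply: (measurable_funS mC _ (mf _ (rndM N x0 Cx0))) => x [].
apply: (@eq_measurable_fun _ _ (lebesgue_type R n) R (E j) (f ^~ (rnd N x0)) _ _ mj) => x.
rewrite inE => -[Cx xj]; congr f; apply/colP => k; rewrite !mxE.
have : code N x0 = code N x by apply: (pcan_inj pickleK); rewrite x0j xj.
by move=> /eq_in_map/(_ k (mem_enum _ _)) ->.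
Qed.

End superposition.

Lemma max0_dist {R : realType} (p q : R) : `|Num.max 0 p - Num.max 0 q| <= `|p - q|.
Proof.
wlog pq : p q / q <= p.
  move=> W; have [|/ltW] := leP q p; first exact: W.
  by move=> h; have := W q p h; rewrite distrC [X in _ <= X]distrC.
have h1 : Num.max 0 q <= Num.max 0 p.
  by rewrite !maxEle; do ![case: ifPn]; rewrite -?ltNge; lra.
rewrite !ger0_norm ?subr_ge0//.
by rewrite !maxEle; do ![case: ifPn]; rewrite -?ltNge; lra.
Qed.

Lemma min_dist {R : realType} (p q c : R) : `|Num.min p c - Num.min q c| <= `|p - q|.
Proof.
wlog pq : p q / q <= p.
  move=> W; have [|/ltW] := leP q p; first exact: W.
  by move=> h; have := W q p h; rewrite distrC [X in _ <= X]distrC.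
have h1 : Num.min q c <= Num.min p c.
  by rewrite !minEle; do ![case: ifPn]; rewrite -?ltNge; lra.
rewrite !ger0_norm ?subr_ge0//.
by rewrite !minEle; do ![case: ifPn]; rewrite -?ltNge; lra.
Qed.

Section Picard_iteration.
Context {R : realType} {m n : nat}.
Variables (Omega : set 'rV[R]_n) (d : 'rV[R]_m) (K : 'I_m -> R -> 'rV[R]_n -> R).
Variables (g : R -> 'rV[R]_n -> 'cV[R]_m -> 'cV[R]_m) (v : 'cV[R]_m) (T : R).
Hypothesis H : system Omega d K g v T.

Local Notation C := (closure Omega).
Local Notation in_box := (in_box v).
Implicit Types (t s a b r : R) (x y : 'rV[R]_n) (i j k : 'I_m).
Implicit Types (phi psi : 'rV[R]_n -> 'cV[R]_m) (u w : R -> 'rV[R]_n -> 'cV[R]_m).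

Let oO := sys_open H.
Let bO := sys_bounded H.
Let dmax := @dmax R m d.
Let dmax0 : 0 <= dmax := dmax_ge0 H.
Let d_le i : d 0 i <= dmax := d_le_dmax H i.

Definition clamp (p : 'cV[R]_m) : 'cV[R]_m := \col_k Num.max 0 (Num.min (p k 0) (v k 0)).

Lemma clamp_in_box p : in_box (clamp p).
Proof.
move=> k; rewrite mxE le_max lexx/= ge_max ge_min lexx orbT andbT.
exact/ltW/(sys_v H).
Qed.

Lemma clamp_id p : in_box p -> clamp p = p.
Proof.
move=> pM; apply/colP => k; rewrite mxE; have /andP[h1 h2] := pM k.
by rewrite min_l// max_r.
Qed.

Lemma clamp_dist p q k : `|clamp p k 0 - clamp q k 0| <= `|p k 0 - q k 0|.
Proof.
by rewrite !mxE (le_trans (max0_dist _ _))// min_dist.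
Qed.

(** Clamping the state makes the reaction globally Lipschitz. *)
Definition truncated_rate t phi x i :=
  d 0 i * spread Omega (K i t) (fun y => phi y i 0) x - d 0 i * phi x i 0
  + g t x (clamp (phi x)) i 0.

Lemma truncated_Lipschitz : exists2 L : R, 0 < L & forall t phi psi x i (N : R),
  slice_bm Omega phi -> slice_bm Omega psi -> 0 <= N -> C x ->
  (forall y k, C y -> `|phi y k 0 - psi y k 0| <= N) ->
  `|truncated_rate t phi x i - truncated_rate t psi x i| <= L * N.
Proof.
have [B B0 hB] := in_box_norm H; have [L L0 hL] := reaction_Lipschitz H B.
exists (2 * dmax + L) => [|t phi psi x i N bphi bpsi N0 Cx hN].
  by rewrite ltr_wpDl// mulr_ge0.
rewrite /truncated_rate; set S1 := spread _ _ _ _; set S2 := spread _ _ _ _.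
set g1 := g _ _ _ _ _; set g2 := g _ _ _ _ _.
have hS : `|S1 - S2| <= N.
  rewrite /S1 /S2 -(spreadB oO bO x (sys_K H i t) (bphi i) (bpsi i)).
  apply: (spread_bound H i t x (bounded_measurableB (bphi i) (bpsi i))) => // y Oy.
  by apply: hN; exact: subset_closure.
have hg : `|g1 - g2| <= L * N.
  apply: hL => // k; [exact: hB (clamp_in_box _) k|exact: hB (clamp_in_box _) k|].
  by rewrite (le_trans (clamp_dist _ _ _))// hN.
have hp := hN x i Cx; have d0 := sys_d H i.
have -> : d 0 i * S1 - d 0 i * phi x i 0 + g1 - (d 0 i * S2 - d 0 i * psi x i 0 + g2) =
   d 0 i * (S1 - S2) - d 0 i * (phi x i 0 - psi x i 0) + (g1 - g2) by ring.
rewrite (le_trans (ler_normD _ _))// mulrDl lerD//.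
rewrite (le_trans (ler_normB _ _))// mulr_natl mulr2n mulrDl !normrM !(gtr0_norm d0).
by rewrite lerD// ler_pM// ltW.
Qed.

Lemma slice_bm0 : slice_bm Omega (fun=> 0 : 'cV[R]_m).
Proof. by move=> i; under eq_fun do rewrite mxE; exact: bounded_measurable_cst. Qed.

Lemma truncated0 t x i : C x -> truncated_rate t (fun=> 0) x i = 0.
Proof.
move=> Cx; rewrite /truncated_rate clamp_id; last exact: (in_box0 H).
rewrite (sys_g0 H _ Cx) !mxE mulr0 subr0 addr0 /spread.
under eq_Rintegral do rewrite mulr0.
by rewrite /Rintegral integral0 mulr0.
Qed.

Variables (L : R) (L0 : 0 < L).
Hypothesis hL : forall t phi psi x i (N : R),
  slice_bm Omega phi -> slice_bm Omega psi -> 0 <= N -> C x ->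
  (forall y k, C y -> `|phi y k 0 - psi y k 0| <= N) ->
  `|truncated_rate t phi x i - truncated_rate t psi x i| <= L * N.

Variables (phi0 : 'rV[R]_n -> 'cV[R]_m) (B : R) (B0 : 0 < B).
Hypothesis mphi0 : lebesgue_measurable C phi0.
Hypothesis hphi0 : forall x i, C x -> `|phi0 x i 0| <= B / 2.

Let e2 t := expR (2 * L * (t - 0)).

Let e2_gt0 t : 0 < e2 t. Proof. exact: expR_gt0. Qed.

Let e2_ge1 t : 0 <= t -> 1 <= e2 t.
Proof. by move=> t0; rewrite -expR0 ler_expR subr0 mulr_ge0// mulr_ge0// ltW. Qed.

Let e2_mono s t : s <= t -> e2 s <= e2 t.
Proof. by move=> st; rewrite ler_expR !subr0 ler_pM2l// mulr_gt0. Qed.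

(** The curves among which the fixed point is found.  In the norm weighted by
    exp(2 L t) the integral operator halves distances. *)
Record tame u : Prop := Tame {
  tame_m : forall t, 0 <= t -> lebesgue_measurable C (u t) ;
  tame_b : forall t x i, 0 <= t -> C x -> `|u t x i 0| <= B * e2 t ;
  tame_l : forall b s t x i, 0 <= s <= b -> 0 <= t <= b -> C x ->
    `|u s x i 0 - u t x i 0| <= L * (B * e2 b) * `|s - t| }.

Lemma tame_slice_bm u t : tame u -> 0 <= t -> slice_bm Omega (u t).
Proof.
move=> [um ub _] t0 i; split.
  apply: measurable_funS (um t t0 i); last exact: subset_closure.
  by apply: closed_lebesgue_measurable; exact: closed_closure.
by exists (B * e2 t) => y Oy; apply: ub => //; exact: subset_closure.
Qed.

Lemma tame_truncated_bound u t x i : tame u -> 0 <= t -> C x ->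
  `|truncated_rate t (u t) x i| <= L * (B * e2 t).
Proof.
move=> tu t0 Cx; rewrite -[X in `|X|]subr0 -(truncated0 t i Cx).
refine (@hL t (u t) (fun=> 0) x i _ (tame_slice_bm tu t0) slice_bm0 _ Cx _).
  by rewrite mulr_ge0// ltW.
by move=> y k Cy; rewrite [X in _ - X]mxE subr0; exact: (tame_b tu).
Qed.

Lemma tame_truncated_continuous u x i : tame u -> C x ->
  continuous (fun s => truncated_rate (Num.max 0 s) (u (Num.max 0 s)) x i).
Proof.
move=> tu Cx s0.
suff : {within setT, continuous (fun s => truncated_rate (Num.max 0 s) (u (Num.max 0 s)) x i)}.
  by move=> /((continuous_subspace_setT _).2) h; exact: (h s0).
apply/(@within_continuous_ballP R) => {}s0 _ e e0.
pose b := `|s0| + 1.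
pose M := B * e2 b; have M0 : 0 < M by rewrite mulr_gt0.
have e4 : 0 < e / 4 by rewrite divr_gt0.
have [r1 r10 hr1] := influx_modulus H (ltW M0) e4.
have [r2 r20 hr2] := reaction_uniform H e4.
pose Lip := L * M; have Lip0 : 0 < Lip by rewrite mulr_gt0.
have eL : 0 < e / (8 * (dmax + 1) * Lip) by rewrite divr_gt0// !mulr_gt0// ltr_wpDl.
have rL : 0 < r2 / Lip by rewrite divr_gt0.
have [|r r0 hr] := @seq_pos_lower_bound R R [:: 1; r1; r2; e / (8 * (dmax + 1) * Lip); r2 / Lip] id.
  by move=> z; rewrite !inE => /or4P[/eqP->|/eqP->|/eqP->|/orP[/eqP->|/eqP->]].
have rb z : z \in [:: 1; r1; r2; e / (8 * (dmax + 1) * Lip); r2 / Lip] -> r <= z by exact: hr.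
exists r => // s1 _; rewrite -ball_normE/= => s01.
set s := Num.max 0 s0; set s' := Num.max 0 s1.
have ss' : `|s - s'| < r.
  by apply: le_lt_trans s01; exact: max0_dist.
have r1' : r <= 1 by apply: rb; rewrite inE eqxx.
have sb : 0 <= s <= b.
  by rewrite le_max lexx/= ge_max addr_ge0//= (le_trans (ler_norm s0))// lerDl.
have s'b : 0 <= s' <= b.
  rewrite le_max lexx/= ge_max addr_ge0//=.
  have := le_trans (ltW s01) r1'; rewrite distrC => h.
  rewrite -(subrK s0 s1) addrC lerD//; first exact: ler_norm.
  by rewrite (le_trans _ h)// ler_norm.
have /andP[sp _] := sb; have /andP[s'p _] := s'b.
have lip y k : C y -> `|u s y k 0 - u s' y k 0| <= Lip * r.
  by move=> Cy; rewrite (le_trans (tame_l tu k sb s'b Cy))// ler_pM2l// ltW.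
rewrite /truncated_rate; set S1 := spread _ _ _ _; set S2 := spread _ _ _ _.
set g1 := g _ _ _ _ _; set g2 := g _ _ _ _ _.
pose S3 := spread Omega (K i s') (fun y => u s y i 0) x.
have bs := tame_slice_bm tu sp i; have bs' := tame_slice_bm tu s'p i.
have uM y k : C y -> `|u s y k 0| <= M.
  move=> Cy; rewrite (le_trans (tame_b tu k sp Cy))// ler_pM2l//; apply: e2_mono.
  by case/andP: sb.
have h1 : `|d 0 i * S1 - d 0 i * S3| <= e / 4.
  have sr1 : `|s - s'| < r1 by apply: (lt_le_trans ss'); apply: rb; rewrite !inE eqxx orbT.
  apply: hr1 => //; first by rewrite subrr normr0.
  by move=> y Oy; apply: uM; exact: subset_closure.
have small z : 0 <= z -> z <= Lip * r -> d 0 i * z <= e / 8.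
  move=> z0 hz; apply: (@le_trans _ _ ((dmax + 1) * (Lip * (e / (8 * (dmax + 1) * Lip))))).
    apply: ler_pM => //; first exact/ltW/(sys_d H).
      by rewrite (le_trans (d_le i))// lerDl.
    by rewrite (le_trans hz)// ler_pM2l// rb// !inE eqxx !orbT.
  by rewrite le_eqVlt; apply/orP; left; apply/eqP; field; rewrite !gt_eqF// ltr_wpDl.
have h2 : `|d 0 i * (S3 - S2)| <= e / 8.
  rewrite normrM gtr0_norm ?(sys_d H)// small//.
  rewrite /S3 /S2 -(spreadB oO bO x (sys_K H i s') bs bs').
  apply: (spread_bound H i s' x (bounded_measurableB bs bs')) => [y Oy|].
    by apply: lip; exact: subset_closure.
  by rewrite ltW// mulr_gt0.
have h3 : `|d 0 i * (u s x i 0 - u s' x i 0)| <= e / 8.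
  by rewrite normrM gtr0_norm ?(sys_d H)// small// lip.
have h4 : `|g1 - g2| < e / 4.
  apply: hr2 => //; [exact: clamp_in_box|exact: clamp_in_box| | |].
  - by apply: (lt_le_trans ss'); apply: rb; rewrite !inE eqxx !orbT.
  - by rewrite subrr normr0.
  - apply/col_norm_lt => // k; rewrite [X in `|X|]mxE [X in _ + X]mxE.
    rewrite (le_lt_trans (clamp_dist _ _ _))// (le_lt_trans (tame_l tu k sb s'b Cx))//.
    apply: (@lt_le_trans _ _ (Lip * r)); first by rewrite ltr_pM2l.
    rewrite -/M -/Lip mulrC -ler_pdivlMr//; apply: rb; rewrite !inE eqxx !orbT//.
have -> : d 0 i * S1 - d 0 i * u s x i 0 + g1 - (d 0 i * S2 - d 0 i * u s' x i 0 + g2) =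
  (d 0 i * S1 - d 0 i * S3) + d 0 i * (S3 - S2) - d 0 i * (u s x i 0 - u s' x i 0) + (g1 - g2) by ring.
rewrite (le_lt_trans (ler_normD _ _))//.
have -> : e = e / 4 + e / 8 + e / 8 + e / 2 by field.
rewrite ler_ltD//; last by rewrite (lt_le_trans h4)//; lra.
rewrite (le_trans (ler_normB _ _))// lerD//.
by rewrite (le_trans (ler_normD _ _))// lerD.
Qed.

(** The time is cut off at 0 so that the integrand is continuous on the whole
    line. *)
Definition Picard u t x : 'cV[R]_m := \col_i (phi0 x i 0 +
  primitive (fun s => truncated_rate (Num.max 0 s) (u (Num.max 0 s)) x i) t).

Let slope u x i := fun s => truncated_rate (Num.max 0 s) (u (Num.max 0 s)) x i.

Let slopeE u x i s : 0 <= s -> slope u x i s = truncated_rate s (u s) x i.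
Proof. by move=> s0; rewrite /slope max_r. Qed.

Let PicardE u t x i : Picard u t x i 0 = phi0 x i 0 + primitive (slope u x i) t.
Proof. by rewrite mxE. Qed.

Let slope_evolves u b x i : tame u -> 0 <= b -> C x ->
  evolves 0 b (primitive (slope u x i)) (slope u x i).
Proof. by move=> tu b0 Cx; apply: primitive_evolves => //; exact: tame_truncated_continuous. Qed.

Lemma Picard_evolves u b x i : tame u -> 0 <= b -> C x ->
  evolves 0 b (fun t => Picard u t x i 0) (fun t => truncated_rate t (u t) x i).
Proof.
move=> tu b0 Cx.
have := evolvesD (evolves_cst 0 b (phi0 x i 0)) (slope_evolves i tu b0 Cx).
apply: eq_evolves; first by apply/funext => t; rewrite PicardE.
by move=> t /andP[t0 _]; rewrite add0r slopeE// ltW.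
Qed.

Lemma Picard_at0 u x : Picard u 0 x = phi0 x.
Proof. by apply/colP => i; rewrite mxE primitive0 addr0. Qed.

Lemma truncated_measurable u t i : tame u -> 0 <= t ->
  measurable_fun (C : set (lebesgue_type R n)) (fun x => truncated_rate t (u t) x i).
Proof.
move=> tu t0; have mC : measurable (C : set (lebesgue_type R n)).
  by apply: closed_lebesgue_measurable; exact: closed_closure.
have [um ub _] := tu; have bu := tame_slice_bm tu t0 i.
apply: measurable_funD; first apply: measurable_funB.
- apply: within_continuous_measurable => //.
  apply/(@within_continuous_ballP R) => x Cx e e0; have eh : 0 < e / 2 by rewrite divr_gt0.
  have M0 : 0 <= B * e2 t by rewrite mulr_ge0 ?expR_ge0// ltW.
  have [r r0 hr] := influx_modulus H M0 eh; exists r => // y Cy; rewrite -ball_normE/= => xy.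
  apply: (@le_lt_trans _ _ (e / 2)); last by rewrite ltr_pdivrMr// mulr_natr mulr2n ltrDl.
  apply: hr => //; [by rewrite subrr normr0|move=> z Oz].
  by apply: ub => //; exact: subset_closure.
- by apply: measurable_funM; [exact: measurable_cst|exact: um].
apply: (@measurable_superposition R m n v C (@closed_closure _ _) (fun x p => g t x p i 0) (fun x => clamp (u t x))).
- move=> p pM; apply: within_continuous_measurable => //.
  apply/(@within_continuous_ballP R) => x Cx e e0.
  have [r r0 hr] := reaction_uniform H e0; exists r => // y Cy; rewrite -ball_normE/= => xy.
  by apply: hr => //; rewrite subrr normr0.
- move=> e e0; have [r r0 hr] := reaction_uniform H e0; exists r => // x p q Cx pM qM pq.
  by apply: hr => //; rewrite subrr normr0.
- move=> k; under eq_fun do rewrite mxE.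
  apply: measurable_maxr; first exact: measurable_cst.
  by apply: measurable_minr; [exact: um|exact: measurable_cst].
- by move=> x _; exact: clamp_in_box.
Qed.

Let exp_bound b f df (A c : R) : 0 <= b -> evolves 0 b f df ->
  (forall t, 0 < t < b -> `|df t| <= L * (A * e2 t)) -> `|f 0| <= c ->
  `|f b| <= c + A / 2 * (e2 b - 1).
Proof.
move=> b0 ev hdf f0.
pose E t := A / 2 * e2 t.
have evE : evolves 0 b E (fun t => L * (A * e2 t)).
  have := evolvesZ (A / 2) (evolves_expR 0 b (2 * L) 0).
  by apply: eq_evolves => // t _; rewrite /e2; field.
have e20 : e2 0 = 1 by rewrite /e2 subrr mulr0 expR0.
have h1 : E 0 - f 0 <= E b - f b.
  apply: (evolves_incr b0 (evolvesB evE ev)) => t tb.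
  by have := hdf t tb; rewrite ler_norml subr_ge0 => /andP[].
have h2 : E 0 + f 0 <= E b + f b.
  apply: (evolves_incr b0 (evolvesD evE ev)) => t tb.
  by have := hdf t tb; rewrite ler_norml -subr_ge0 opprK addrC => /andP[].
move: h1 h2 f0; rewrite /E e20 !ler_norml => h1 h2 /andP[h3 h4]; apply/andP; split; lra.
Qed.

Lemma Picard_tame u : tame u -> tame (Picard u).
Proof.
move=> tu; split.
- move=> t t0 i; under eq_fun do rewrite PicardE.
  apply: measurable_funD; first exact: mphi0.
  apply: (@measurable_fun_cvg _ (lebesgue_type R n) R C (fun (N : nat) x =>
    \sum_(k < N.+1) t / N.+1%:R * slope u x i (k%:R * (t / N.+1%:R)))) => [N|x Cx].
    apply: measurable_sum => k; apply: measurable_funM; first exact: measurable_cst.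
    have s0 : 0 <= k%:R * (t / N.+1%:R) by rewrite mulr_ge0// divr_ge0.
    under eq_fun do rewrite slopeE//.
    exact: truncated_measurable.
  apply: Riemann_sum_cvg => //; first exact: tame_truncated_continuous.
    exact: slope_evolves.
  exact: primitive0.
- move=> t x i t0 Cx.
  have := exp_bound (A := B) (c := B / 2) t0 (Picard_evolves i tu t0 Cx).
  rewrite Picard_at0 => h; apply: (le_trans (h _ _)).
  + by move=> s /andP[s0 _]; apply: tame_truncated_bound => //; exact: ltW.
  + exact: hphi0.
  + have := e2_ge1 t0; have := B0; nra.
- move=> b s t x i sb tb Cx; have b0 : 0 <= b by case/andP: sb; exact: le_trans.
  apply: (evolves_bounded_slope b0 (Picard_evolves i tu b0 Cx)) => // r /andP[r0 rb].
  rewrite (le_trans (tame_truncated_bound i tu (ltW r0) Cx))//.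
  by rewrite ler_pM2l// ler_pM2l// e2_mono// ltW.
Qed.

(** The weight makes the map a contraction by 1/2 on the whole half-line. *)
Lemma Picard_contraction u w (A : R) : tame u -> tame w -> 0 <= A ->
  (forall t x i, 0 <= t -> C x -> `|u t x i 0 - w t x i 0| <= A * e2 t) ->
  forall t x i, 0 <= t -> C x -> `|Picard u t x i 0 - Picard w t x i 0| <= A / 2 * e2 t.
Proof.
move=> tu tw A0 uw t x i t0 Cx.
have := exp_bound (A := A) (c := 0) t0 (evolvesB (Picard_evolves i tu t0 Cx) (Picard_evolves i tw t0 Cx)).
rewrite !Picard_at0 subrr normr0 lexx add0r => h; apply: (le_trans (h _ isT)).
  move=> s /andP[s0 _]; have s0' := ltW s0.
  refine (@hL s (u s) (w s) x i _ (tame_slice_bm tu s0') (tame_slice_bm tw s0') _ Cx _).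
    by rewrite mulr_ge0// ltW.
  by move=> y k Cy; exact: uw.
by rewrite ler_wpM2l ?divr_ge0// lerBlDr lerDl.
Qed.

Lemma Picard_fixpoint : exists2 u, tame u &
  forall x, C x -> u 0 x = phi0 x /\
    forall b i, 0 <= b -> evolves 0 b (fun t => u t x i 0) (fun t => truncated_rate t (u t) x i).
Proof.
pose U (k : nat) := iter k Picard (fun=> phi0).
have tU (k : nat) : tame (U k).
  elim: k => [|k IH]; last exact: Picard_tame.
  split=> // [t x i t0 Cx|b s t x i _ _ _].
    by rewrite (le_trans (hphi0 i Cx))//; have := e2_ge1 t0; have := B0; nra.
  by rewrite subrr normr0 !mulr_ge0// ltW.
have dU (k : nat) t x i : 0 <= t -> C x -> `|U k.+1 t x i 0 - U k t x i 0| <= 2 * B * e2 t / 2 ^+ k.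
  move=> t0 Cx; rewrite mulrAC.
  elim: k t x i t0 Cx => [|k IH] t x i t0 Cx.
    rewrite expr0 divr1 (le_trans (ler_normB _ _))// mulrDl mul1r mulrDl lerD//; exact: tame_b.
  rewrite exprS (_ : 2 * B / (2 * 2 ^+ k) = 2 * B / 2 ^+ k / 2); last first.
    by field; rewrite gt_eqF// exprn_gt0.
  apply: (Picard_contraction (tU k.+1) (tU k) _ IH) => //.
  by rewrite divr_ge0 ?exprn_ge0// mulr_ge0// ltW.
have ex (p : R * 'rV[R]_n * 'I_m) : exists l : R, 0 <= p.1.1 -> C p.1.2 ->
    (fun k : nat => U k p.1.1 p.1.2 p.2 0) @ \oo --> l /\
    forall k : nat, `|l - U k p.1.1 p.1.2 p.2 0| <= 2 * (2 * B * e2 p.1.1) / 2 ^+ k.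
  have [[t0 Cx]|h] := pselect (0 <= p.1.1 /\ C p.1.2); last by exists 0 => t0 Cx; exfalso; exact: h.
  have [l h1 h2] := geometric_cvg (fun k : nat => dU k p.1.1 p.1.2 p.2 t0 Cx).
  by exists l.
have [l hl] := choice ex.
pose u t x : 'cV[R]_m := \col_i l (t, x, i).
have cvu t x i : 0 <= t -> C x -> (fun k : nat => U k t x i 0) @ \oo --> u t x i 0.
  by move=> t0 Cx; rewrite mxE; exact: (hl (t, x, i) t0 Cx).1.
have du (k : nat) t x i : 0 <= t -> C x -> `|u t x i 0 - U k t x i 0| <= 4 * B / 2 ^+ k * e2 t.
  move=> t0 Cx; rewrite mxE (le_trans ((hl (t, x, i) t0 Cx).2 k))//=.
  by rewrite le_eqVlt; apply/orP; left; apply/eqP; field; rewrite gt_eqF// exprn_gt0.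
have tu : tame u.
  split.
  - move=> t t0 i.
    apply: (@measurable_fun_cvg _ (lebesgue_type R n) R C (fun (k : nat) x => U k t x i 0)) => [k|x Cx].
      exact: (tame_m (tU k)).
    exact: cvu.
  - move=> t x i t0 Cx; have hc : (fun k : nat => `|U k t x i 0|) @ \oo --> `|u t x i 0| by apply: cvg_norm; exact: cvu.
    by apply: (cvgr_to_le hc); apply: nearW => k; exact: (tame_b (tU k)).
  - move=> b s t x i sb tb Cx; have /andP[s0 _] := sb; have /andP[t0 _] := tb.
    have hc : (fun k : nat => `|U k s x i 0 - U k t x i 0|) @ \oo --> `|u s x i 0 - u t x i 0|.
      by apply: cvg_norm; apply: cvgB; exact: cvu.
    by apply: (cvgr_to_le hc); apply: nearW => k; exact: (tame_l (tU k) i sb tb).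
have small (k : nat) : 0 <= 4 * B / 2 ^+ k by rewrite divr_ge0 ?exprn_ge0// mulr_ge0// ltW.
have PuE t x i : 0 <= t -> C x -> Picard u t x i 0 = u t x i 0.
  move=> t0 Cx; apply/eqP; rewrite -subr_eq0 -normr_le0.
  have hz := geometric_cvg0 (4 * B * e2 t).
  apply: (cvgr_to_ge hz); apply: nearW => k.
  rewrite -(subrK (Picard (U k) t x i 0) (Picard u t x i 0)) -addrA (le_trans (ler_normD _ _))//.
  have h1 := Picard_contraction tu (tU k) (small k) (fun t x i h1 h2 => du k t x i h1 h2) i t0 Cx.
  have h2 := du k.+1 t x i t0 Cx; rewrite distrC exprS in h2.
  rewrite (le_trans (lerD h1 h2))// le_eqVlt; apply/orP; left; apply/eqP.
  by field; rewrite gt_eqF// exprn_gt0.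
exists (Picard u); first exact: Picard_tame.
move=> x Cx; split; first exact: Picard_at0.
move=> b i b0; apply: eq_evolves (Picard_evolves i tu b0 Cx) => // t /andP[t0 _].
have t0' := ltW t0; apply/eqP; rewrite -subr_eq0 -normr_le0.
have -> : (0 : R) = L * 0 by rewrite mulr0.
refine (@hL t (u t) (Picard u t) x i 0 (tame_slice_bm tu t0') (tame_slice_bm (Picard_tame tu) t0') (lexx _) Cx _).
by move=> y k Cy; rewrite PuE// subrr normr0.
Qed.

End Picard_iteration.

Section existence.
Context {R : realType} {m n : nat}.
Variables (Omega : set 'rV[R]_n) (d : 'rV[R]_m) (K : 'I_m -> R -> 'rV[R]_n -> R).
Variables (g : R -> 'rV[R]_n -> 'cV[R]_m -> 'cV[R]_m) (v : 'cV[R]_m) (T : R).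
Hypothesis H : system Omega d K g v T.

Local Notation C := (closure Omega).
Local Notation in_box := (in_box v).
Local Notation rhs := (nonlinear_rhs Omega d K g).
Local Notation truncated := (truncated_rate Omega d K g v).
Implicit Types (t s a b r : R) (x y : 'rV[R]_n) (i j k : 'I_m).
Implicit Types (phi psi : 'rV[R]_n -> 'cV[R]_m) (u w : R -> 'rV[R]_n -> 'cV[R]_m).

Let oO := sys_open H.

Lemma order_intervalE (p : 'cV[R]_m) : order_interval v p <-> in_box p.
Proof.
split=> [[h1 h2] k|h]; first by have := h1 k; have := h2 k; rewrite !mxE subr0 subr_ge0 => -> ->.
by split=> k; have /andP[h1 h2] := h k; rewrite !mxE ?subr0 ?subr_ge0.
Qed.

Lemma truncatedE t phi x i : in_box (phi x) -> truncated t phi x i = rhs t phi x i 0.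
Proof. by move=> h; rewrite rhsE /truncated_rate clamp_id. Qed.

Let truncated_ge t phi x i (N : R) : slice_bm Omega phi -> C x -> 0 <= N ->
  (forall y k, C y -> - N <= phi y k 0) -> phi x i 0 < 0 ->
  - (dmax d * N) <= truncated t phi x i.
Proof.
move=> bphi Cx N0 hN neg; have [L L0 hL] := reaction_ordered H.
have hS : - N <= spread Omega (K i t) (fun y => phi y i 0) x.
  have hy y : Omega y -> - N <= phi y i 0 by move=> Oy; apply: hN; exact: subset_closure.
  exact: (spread_ge_cst H x (sys_K H i t) (sys_K1 H i t) (bphi i) N0 hy).
have cl0 : clamp v (phi x) i 0 = 0.
  by rewrite mxE; apply/max_idPl; rewrite ge_min ltW.
have hg : 0 <= g t x (clamp v (phi x)) i 0.
  have := hL t x (clamp v (phi x)) 0 i Cx (clamp_in_box H _) (in_box0 H).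
  rewrite (sys_g0 H _ Cx) cl0 mxE !subr0 mulr0 oppr0; apply => k.
  by rewrite [leLHS]mxE; case/andP: (clamp_in_box H (phi x) k).
have d0 := sys_d H i; have dle := d_le_dmax H i.
have h1 := ler_wpM2l (ltW d0) hS; have h2 := ler_wpM2r N0 dle.
have h3 : 0 <= - (d 0 i * phi x i 0) by rewrite oppr_ge0 mulr_ge0_le0 ?ltW.
rewrite /truncated_rate; lra.
Qed.

Let truncated_le t phi x i (N : R) : slice_bm Omega phi -> C x -> 0 <= N ->
  (forall y k, C y -> - N <= v k 0 - phi y k 0) -> v i 0 < phi x i 0 ->
  truncated t phi x i <= dmax d * N.
Proof.
move=> bphi Cx N0 hN pos; have v0 := sys_v H i.
have hS : - (v i 0 + N) <= - 1 * spread Omega (K i t) (fun y => phi y i 0) x.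
  rewrite -(spreadZ oO (sys_bounded H) _ x (sys_K H i t) (bphi i)).
  have hy y : Omega y -> - (v i 0 + N) <= - 1 * phi y i 0.
    by move=> Oy; have := hN y i (subset_closure Oy); lra.
  have N1 : 0 <= v i 0 + N by rewrite addr_ge0// ltW.
  have hb := bounded_measurableZ (- 1) (bphi i).
  exact: (spread_ge_cst H x (sys_K H i t) (sys_K1 H i t) hb N1 hy).
have clv : clamp v (phi x) i 0 = v i 0.
  by rewrite mxE min_r ?ltW// max_r// ltW.
have hg := sys_gv H t Cx (clamp_in_box H (phi x)) clv.
have d0 := sys_d H i; have dle := d_le_dmax H i.
have hS' : spread Omega (K i t) (fun y => phi y i 0) x - phi x i 0 <= N by lra.
have h1 := ler_wpM2l (ltW d0) hS'; have h2 := ler_wpM2r N0 dle.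
rewrite /truncated_rate; lra.
Qed.

(** The truncated equation has a global solution; it does not leave the box,
    where truncation changes nothing. *)
Lemma existence phi : Xhat_v Omega v phi -> exists u, is_solution Omega d K g phi u /\
  forall t x, 0 <= t -> C x -> in_box (u t x).
Proof.
move=> [[mphi _] bphi].
have phiM x : C x -> in_box (phi x) by move=> /bphi/order_intervalE.
have [B0 B00 hB0] := in_box_norm H; have [L L0 hL] := truncated_Lipschitz H.
have B0' : 0 < 2 * B0 by rewrite mulr_gt0.
have hphi x i : C x -> `|phi x i 0| <= 2 * B0 / 2.
  by move=> Cx; rewrite mulrAC divff ?mul1r ?hB0//; exact: phiM.
have [u tu hu] := Picard_fixpoint H L0 hL B0' mphi hphi.
have ub t x i : 0 <= t -> C x -> `|u t x i 0| <= 2 * B0 * expR (2 * L * (t - 0)).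
  exact: (tame_b tu).
have dm0 := dmax_ge0 H; have dm1 : 0 < dmax d + 1 by rewrite ltr_wpDl.
have ebound b t x i : 0 <= t <= b -> C x -> `|u t x i 0| <= 2 * B0 * expR (2 * L * (b - 0)).
  move=> /andP[t0 tb] Cx; rewrite (le_trans (ub t x i t0 Cx))// ler_pM2l// ler_expR.
  by rewrite !subr0 ler_pM2l// mulr_gt0.
have low t x i : 0 <= t -> C x -> 0 <= u t x i 0.
  move=> t0 Cx; have tt : 0 <= t <= t by rewrite t0 lexx.
  refine (@comparison_principle R ('rV[R]_n * 'I_m)%type [set p | C p.1] 0 t
    (fun s p => u s p.1 p.2 0) (fun s p => truncated s (u s) p.1 p.2)
    (dmax d + 1) (2 * B0 * expR (2 * L * (t - 0))) dm1 _ _ _ _ t (x, i) tt Cx).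
  - by move=> [y j] /= Cy; exact: (hu y Cy).2.
  - by move=> [y j] /= Cy; rewrite (hu y Cy).1; case/andP: (phiM y Cy j).
  - by move=> s [y j] st /= Cy; have := ebound t s y j st Cy; rewrite ler_norml => /andP[].
  - move=> N s [y j] /andP[s0 _] /= Cy N0 hN neg.
    have hN' y' k : C y' -> - N <= u s y' k 0 by move=> Cy'; exact: (hN (y', k) Cy').
    have := truncated_ge s (tame_slice_bm tu (ltW s0)) Cy N0 hN' neg.
    by apply: le_trans; rewrite lerN2 ler_wpM2r// lerDl.
have up t x i : 0 <= t -> C x -> 0 <= v i 0 - u t x i 0.
  move=> t0 Cx; have tt : 0 <= t <= t by rewrite t0 lexx.
  refine (@comparison_principle R ('rV[R]_n * 'I_m)%type [set p | C p.1] 0 t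
    (fun s p => v p.2 0 - u s p.1 p.2 0) (fun s p => 0 - truncated s (u s) p.1 p.2)
    (dmax d + 1) (2 * B0 * expR (2 * L * (t - 0))) dm1 _ _ _ _ t (x, i) tt Cx).
  - by move=> [y j] /= Cy; apply: evolvesB; [exact: evolves_cst|exact: (hu y Cy).2].
  - by move=> [y j] /= Cy; rewrite (hu y Cy).1 subr_ge0; case/andP: (phiM y Cy j).
  - move=> s [y j] st /= Cy; have := ebound t s y j st Cy; rewrite ler_norml => /andP[_ h].
    by have := sys_v H j; lra.
  - move=> N s [y j] /andP[s0 _] /= Cy N0 hN neg.
    have hN' y' k : C y' -> - N <= v k 0 - u s y' k 0 by move=> Cy'; exact: (hN (y', k) Cy').
    have neg' : v j 0 < u s y j 0 by rewrite -subr_lt0.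
    have := truncated_le s (tame_slice_bm tu (ltW s0)) Cy N0 hN' neg'.
    by rewrite sub0r lerN2 => /le_trans; apply; rewrite ler_wpM2r// lerDl.
have ubox t x : 0 <= t -> C x -> in_box (u t x).
  by move=> t0 Cx k; rewrite low//= -subr_ge0 up.
exists u; split => //; split.
- move=> t t0; split; first exact: (tame_m tu).
  apply: (@le_lt_trans _ _ B0%:E); last exact: ltry.
  by apply/supnorm_le => x Cx; apply/col_norm_le; [exact: ltW|exact: hB0 (ubox t x t0 Cx)].
- move=> t t0; apply/(supnorm_cvg0 _ (closure_nonempty H)) => e e0; rewrite near_withinE.
  pose M := L * (2 * B0 * expR (2 * L * (t + 1 - 0))).
  have M0 : 0 < M by rewrite !mulr_gt0// expR_gt0.
  apply/nbhs_ballP; exists (Num.min 1 (e / M)); first by rewrite /= lt_min ltr01 divr_gt0.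
  move=> s; rewrite -ball_normE/= lt_min => /andP[st1 st] s0 x Cx.
  apply/col_norm_le; [exact: ltW|move=> k].
  rewrite mxE [X in _ + X]mxE.
  have sb : 0 <= s <= t + 1 by move: st1; rewrite ltr_norml s0/= => /andP[h1 h2]; lra.
  have tb : 0 <= t <= t + 1 by rewrite t0 lerDl ler01.
  rewrite (le_trans (tame_l tu k sb tb Cx))// -/M distrC mulrC -ler_pdivlMr//.
  exact: ltW.
- move=> t x t0 Cx; apply: is_derive_col => i.
  have t10 : 0 <= t + 1 by rewrite addr_ge0// ltW.
  rewrite -truncatedE; last exact: ubox (ltW t0) Cx.
  by apply: ((hu x Cx).2 (t + 1) i t10).2; rewrite t0 ltrDl ltr01.
- by move=> x Cx; exact: (hu x Cx).1.
Qed.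

Lemma solution_unique phi u w : is_solution Omega d K g phi u -> is_solution Omega d K g phi w ->
  forall t x, 0 <= t -> C x -> u t x = w t x.
Proof.
move=> su sw t x t0 Cx.
have tu := solution_trajectory H t0 su; have tw := solution_trajectory H t0 sw.
have [B1 hB1] := traj_bd tu; have [B2 hB2] := traj_bd tw.
have [L L0 hL] := trajectory_dist H (Num.max B1 B2).
apply/colP => i; apply/eqP; rewrite -subr_eq0 -normr_le0.
have tt : 0 <= t <= t by rewrite t0 lexx.
have := hL 0 t u w 0 (lexx 0) tu tw _ _ t x i tt Cx; rewrite mul0r; apply => //.
- by move=> s y j st Cy; rewrite !le_max hB1// hB2// orbT.
- by move=> y j Cy; rewrite (solution_initial su Cy) (solution_initial sw Cy) subrr normr0.
Qed.

Lemma solution_in_box phi u : Xhat_v Omega v phi -> is_solution Omega d K g phi u ->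
  forall t x, 0 <= t -> C x -> in_box (u t x).
Proof.
move=> /existence[w [sw wM]] su t x t0 Cx; rewrite (solution_unique su sw t0 Cx); exact: wM.
Qed.

End existence.

(** * Positivity spreads over components and over space *)

Section mixing.
Context {R : realType} {m : nat}.
Implicit Types (t s h tau : R) (i j : 'I_m) (z dz : R -> 'I_m -> R).

Lemma decay_factor z dz (C a b : R) i : 0 <= C -> evolves a b (z^~ i) (dz^~ i) ->
  (forall t, a < t < b -> - (C * z t i) <= dz t i) ->
  forall s t, a <= s <= t -> t <= b -> expR (- (C * (t - s))) * z s i <= z t i.
Proof.
move=> C0 ev h s t /andP[ast st] tb.
have := @decay_lower_bound R s t (z^~ i) (dz^~ i) C 0 st C0 (lexx 0) (evolvesW ast tb ev).
rewrite mul0r addr0; apply => r /andP[sr rt]; rewrite addr0 h//.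
by rewrite (le_lt_trans ast sr) (lt_le_trans rt tb).
Qed.

(** A positive component feeds, within a short time, one that is outside of the
    set of the components known to be positive; the set grows at most m times. *)
Lemma mixing (C sg h tau : R) : 0 < C -> 0 < sg -> 0 < h -> 0 < tau ->
  exists2 kap : R, 0 < kap & forall t0 z dz,
  (forall i, evolves t0 (t0 + tau) (z^~ i) (dz^~ i)) ->
  (forall t i, t0 <= t <= t0 + tau -> 0 <= z t i) ->
  (forall t i, t0 < t < t0 + tau -> - (C * z t i) <= dz t i) ->
  (forall t1 (S : {set 'I_m}), t0 <= t1 <= t0 + tau -> S != finset.set0 -> S != finset.setT ->
     exists i j, [/\ i \in S, j \notin S & forall t, t1 < t < t1 + h -> t0 < t < t0 + tau ->
       - (C * z t i) + sg * z t j <= dz t i]) ->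
  forall i j, kap * z t0 i <= z (t0 + tau) j.
Proof.
move=> C0 sg0 h0 tau0.
pose l := Num.min h (tau / m.+1%:R).
have l0 : 0 < l by rewrite lt_min h0 divr_gt0.
have lh : l <= h by rewrite ge_min lexx.
pose E := expR (- (C * l)); have E0 : 0 < E by exact: expR_gt0.
pose q := E * Num.min 1 (sg * E * l).
have q0 : 0 < q by rewrite mulr_gt0// lt_min ltr01 !mulr_gt0.
have qE : q <= E by rewrite ler_piMr ?ge_min ?lexx// ltW.
have qE2 : q <= E * (sg * E * l) by rewrite ler_pM2l// ge_min lexx orbT.
exists (expR (- (C * tau)) * q ^+ m); first by rewrite mulr_gt0 ?expR_gt0 ?exprn_gt0.
move=> t0 z dz ev z0 dec coup i j.
have kl (k : nat) : (k <= m)%N -> k%:R * l <= tau.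
  move=> km; apply: (@le_trans _ _ (m.+1%:R * (tau / m.+1%:R))); last by rewrite mulrC divfK.
  apply: ler_pM; [by []|exact: ltW|by rewrite ler_nat ltnW|].
  by rewrite ge_min lexx orbT.
have dcy := fun k => decay_factor (ltW C0) (ev k) (fun t => dec t k).
have grow (k : nat) : (k <= m)%N ->
    exists2 P : {set 'I_m}, ((k < #|P|)%N || (P == finset.setT)) &
    forall p, p \in P -> q ^+ k * z t0 i <= z (t0 + k%:R * l) p.
  elim: k => [_|k IH km].
    exists [set i]%SET; first by rewrite finset.cards1.
    by move=> k; rewrite inE => /eqP ->; rewrite expr0 mul1r mul0r addr0.
  have [P hP1 hP2] := IH (ltnW km).
  have t1E : t0 + k.+1%:R * l = t0 + k%:R * l + l by rewrite -natr1 mulrDl mul1r addrA.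
  set t1 := t0 + k%:R * l in hP2 t1E *.
  have t01 : t0 <= t1 by rewrite lerDl mulr_ge0// ltW.
  have t1l : t1 + l <= t0 + tau by rewrite -t1E lerD2l kl.
  have lE : t1 + l - t1 = l by rewrite addrC addKr.
  have zi0 : 0 <= z t0 i by apply: z0; rewrite lexx lerDl ltW.
  have keep p : p \in P -> E * (q ^+ k * z t0 i) <= z (t1 + l) p.
    move=> pP; have := dcy p t1 (t1 + l); rewrite lE -/E t01 lerDl (ltW l0) => /(_ isT t1l).
    by apply: le_trans; rewrite ler_pM2l// hP2.
  have c0 : 0 <= q ^+ k * z t0 i by rewrite mulr_ge0// exprn_ge0// ltW.
  rewrite t1E exprS -mulrA.
  have [PT|PnT] := eqVneq P finset.setT.
    exists P; first by rewrite PT eqxx orbT.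
    by move=> p pP; apply: le_trans (keep p pP); rewrite ler_wpM2r.
  have [P0|Pn0] := eqVneq P finset.set0.
    by move: hP1; rewrite (negbTE PnT) P0 finset.cards0 ltn0.
  have [|||a [b [aS bS hab]]] := coup t1 (~: P)%SET.
  - by rewrite t01 (le_trans _ t1l)// lerDl ltW.
  - by rewrite -finset.setCT (inj_eq (@finset.setC_inj _)).
  - by rewrite -finset.setC0 (inj_eq (@finset.setC_inj _)).
  move: aS bS; rewrite !inE negbK => aP bP.
  exists (a |: P)%SET.
    apply/orP; left; rewrite finset.cardsU1 aP add1n ltnS.
    by move: hP1; rewrite (negbTE PnT) orbF.
  move=> p; rewrite !inE => /orP[/eqP ->|pP]; last first.
    by apply: le_trans (keep p pP); rewrite ler_wpM2r.
  have t1t : t1 <= t1 + l by rewrite lerDl ltW.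
  have k0 : 0 <= sg * (E * (q ^+ k * z t0 i)) by rewrite mulr_ge0 ?(ltW sg0)// mulr_ge0 ?(ltW E0).
  have := @decay_lower_bound R t1 (t1 + l) (z^~ a) (dz^~ a) C _ t1t (ltW C0) k0 (evolvesW t01 t1l (ev a)).
  rewrite lE -/E => hh.
  have {hh} : E * (z t1 a + sg * (E * (q ^+ k * z t0 i)) * l) <= z (t1 + l) a.
    apply: hh => t /andP[h1 h2].
    have h3 : t0 < t < t0 + tau by rewrite (le_lt_trans t01 h1) (lt_le_trans h2 t1l).
    have h4 : t1 < t < t1 + h by rewrite h1 (lt_le_trans h2)// lerD2l.
    apply: le_trans (hab t h4 h3); rewrite lerD2l ler_pM2l//.
    have tt : t1 <= t by exact: ltW.
    have := dcy b t1 t; rewrite t01 tt (ltW (andP h3).2) => /(_ isT isT).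
    apply: le_trans; apply: ler_pM => //; first exact: ltW.
      by rewrite ler_expR lerN2 ler_pM2l// lerBlDl ltW.
    exact: hP2.
  apply: le_trans.
  apply: (@le_trans _ _ (E * (sg * E * l) * (q ^+ k * z t0 i))); first by rewrite ler_wpM2r.
  rewrite -mulrA ler_pM2l//.
  have : 0 <= z t1 a by apply: z0; rewrite t01 (le_trans t1t t1l).
  have -> : sg * E * l * (q ^+ k * z t0 i) = sg * (E * (q ^+ k * z t0 i)) * l by ring.
  by move=> za; rewrite lerDr.
have [P hP1 hP2] := grow m (leqnn m).
have jP : j \in P.
  move: hP1; rewrite ltnNge (leq_trans (max_card _)) ?card_ord//= => /eqP ->.
  by rewrite finset.in_setT.
have tm : t0 <= t0 + m%:R * l by rewrite lerDl mulr_ge0// ltW.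
have := dcy j (t0 + m%:R * l) (t0 + tau); rewrite tm lexx lerD2l kl// => /(_ isT isT).
apply: le_trans; rewrite -mulrA; apply: ler_pM => //.
- by rewrite mulr_ge0 ?exprn_ge0 ?(ltW q0)// z0// lexx lerDl ltW.
- rewrite ler_expR lerN2 ler_pM2l// opprD addrA [t0 + tau]addrC addrK gerDl oppr_le0 mulr_ge0// ltW//.
- exact: hP2.
Qed.

End mixing.

Section pairs.
Context {R : realType} {m n : nat}.
Variables (Omega : set 'rV[R]_n) (d : 'rV[R]_m) (K : 'I_m -> R -> 'rV[R]_n -> R).
Variables (g : R -> 'rV[R]_n -> 'cV[R]_m -> 'cV[R]_m) (v : 'cV[R]_m) (T : R).
Hypothesis H : system Omega d K g v T.

Local Notation C := (closure Omega).
Local Notation in_box := (in_box v).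
Implicit Types (t s b r e tau : R) (x : 'rV[R]_n) (i j k : 'I_m).
Implicit Types (y a : R -> 'cV[R]_m) (dy da f : R -> 'I_m -> R).

(** Two curves of states at a fixed point x, of which the upper one has a
    surplus f of growth. *)
Record upper_pair (Lam : R) t0 t1 x y dy a da f : Prop := UpperPair {
  pair_ev_up : forall i, evolves t0 t1 (fun t => y t i 0) (dy^~ i) ;
  pair_ev_low : forall i, evolves t0 t1 (fun t => a t i 0) (da^~ i) ;
  pair_box_up : forall t, t0 <= t <= t1 -> in_box (y t) ;
  pair_box_low : forall t, t0 <= t <= t1 -> in_box (a t) ;
  pair_Lipschitz : forall s t i, t0 <= s <= t1 -> t0 <= t <= t1 ->
    `|a s i 0 - a t i 0| <= Lam * `|s - t| ;
  pair_surplus : forall t i, t0 < t < t1 -> 0 <= f t i ;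
  pair_ineq : forall t i, t0 < t < t1 ->
    - (d 0 i * (y t i 0 - a t i 0)) + (g t x (y t) i 0 - g t x (a t) i 0) + f t i
    <= dy t i - da t i }.

Lemma upper_pairW Lam t0 t1 s0 s1 x y dy a da f : t0 <= s0 -> s1 <= t1 ->
  upper_pair Lam t0 t1 x y dy a da f -> upper_pair Lam s0 s1 x y dy a da f.
Proof.
move=> h0 h1 [ey ea by_ ba la sf ineq].
have sub t : s0 <= t <= s1 -> t0 <= t <= t1.
  by move=> /andP[p q]; rewrite (le_trans h0 p) (le_trans q h1).
have sub' t : s0 < t < s1 -> t0 < t < t1.
  by move=> /andP[p q]; rewrite (le_lt_trans h0 p) (lt_le_trans q h1).
split.
- by move=> i; exact: evolvesW (ey i).
- by move=> i; exact: evolvesW (ea i).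
- by move=> t /sub; exact: by_.
- by move=> t /sub; exact: ba.
- by move=> s t i /sub hs /sub ht; exact: la.
- by move=> t i /sub'; exact: sf.
- by move=> t i /sub'; exact: ineq.
Qed.

Lemma pair_order Lam t0 t1 x y dy a da f : C x -> upper_pair Lam t0 t1 x y dy a da f ->
  (forall i, a t0 i 0 <= y t0 i 0) -> forall t i, t0 <= t <= t1 -> a t i 0 <= y t i 0.
Proof.
move=> Cx pr h0 t i tt.
refine (@box_comparison R m n Omega d K g v T H [set x] t0 t1 (fun t _ => y t) (fun t _ => a t)
  (fun t _ i => dy t i) (fun t _ i => da t i) 0 _ (lexx 0) _ _ _ _ _ t x i tt (erefl x)).
- by move=> z ->.
- by move=> z k _; exact: (pair_ev_up pr).
- by move=> z k _; exact: (pair_ev_low pr).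
- by move=> s z hs _; split; [exact: (pair_box_up pr)|exact: (pair_box_low pr)].
- by move=> z k _; exact: h0.
- move=> N s z k hs -> N0 _; apply: le_trans (pair_ineq pr k hs).
  by rewrite mul0r oppr0 add0r lerDl (pair_surplus pr k hs).
Qed.

Let dmax0 := dmax_ge0 H.

(** The difference of the curves satisfies the hypotheses of the mixing lemma:
    irreducibility at the lower state stays in force while this state moves
    little, that is, for a time which the Lipschitz constant controls. *)
Lemma pair_mixing (Lam tau : R) : 0 < Lam -> 0 < tau -> exists2 kap : R, 0 < kap &
  forall t0 x y dy a da f, C x -> upper_pair Lam t0 (t0 + tau) x y dy a da f ->
  (forall i, a t0 i 0 <= y t0 i 0) ->
  forall i j, kap * (y t0 i 0 - a t0 i 0) <= y (t0 + tau) j 0 - a (t0 + tau) j 0.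
Proof.
move=> Lam0 tau0.
have [L1 [sg [r [L10 sg0 r0 hirr]]]] := reaction_irreducible H.
have [L2 L20 hord] := reaction_ordered H.
pose c := dmax d + L1 + L2.
have c0 : 0 < c by rewrite ltr_wpDl// addr_ge0// ltW.
have h0 : 0 < Num.min r (r / Lam) by rewrite lt_min r0 divr_gt0.
have [kap kap0 hkap] := @mixing R m c sg _ tau c0 sg0 h0 tau0.
exists kap => // t0 x y dy a da f Cx pr ord0 i j.
have ord := pair_order Cx pr ord0.
apply: (hkap t0 (fun t k => y t k 0 - a t k 0) (fun t k => dy t k - da t k)).
- by move=> k; apply: evolvesB; [exact: (pair_ev_up pr)|exact: (pair_ev_low pr)].
- by move=> t k tt; rewrite subr_ge0 ord.
- move=> t k tt; have tt' : t0 <= t <= t0 + tau by case/andP: tt => *; rewrite !ltW.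
  apply: le_trans (pair_ineq pr k tt).
  have h1 := hord t x (y t) (a t) k Cx (pair_box_up pr tt') (pair_box_low pr tt') (fun k => ord t k tt').
  have h2 := pair_surplus pr k tt; have h3 := d_le_dmax H k.
  have z0 : 0 <= y t k 0 - a t k 0 by rewrite subr_ge0 ord.
  have h4 := ler_wpM2r z0 h3; have h5 := mulr_ge0 (ltW L10) z0.
  by rewrite /c !mulrDl; move: h1 h2 h4 h5; clear -dmax0; lra.
- move=> t1 S t1t S0 ST; have [p [q [pS qS hpq]]] := hirr t1 x (a t1) S Cx (pair_box_low pr t1t) S0 ST.
  exists p, q; split => // t /andP[t1t' tr] tt.
  have tt' : t0 <= t <= t0 + tau by case/andP: tt => *; rewrite !ltW.
  have dt : `|t - t1| < r /\ Lam * `|t - t1| < r.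
    rewrite gtr0_norm ?subr_gt0// !ltrBlDl (lt_le_trans tr); last by rewrite lerD2l ge_min lexx.
    split=> //; rewrite mulrC -ltr_pdivlMr// ltrBlDl (lt_le_trans tr)//.
    by rewrite lerD2l ge_min lexx orbT.
  have h1 := hpq t (y t) (a t) dt.1 (pair_box_up pr tt') (pair_box_low pr tt')
    (fun k => le_lt_trans (pair_Lipschitz pr k tt' t1t) dt.2) (fun k => ord t k tt').
  apply: le_trans (pair_ineq pr p tt).
  have h2 := pair_surplus pr p tt; have h3 := d_le_dmax H p.
  have z0 : 0 <= y t p 0 - a t p 0 by rewrite subr_ge0 ord.
  have h4 := ler_wpM2r z0 h3; have h5 := mulr_ge0 (ltW L20) z0.
  by rewrite /c !mulrDl; move: h1 h2 h4 h5; clear -dmax0; lra.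
Qed.

(** A surplus in one component for a short time lifts that component; mixing
    passes this on to all components during the remaining time. *)
Lemma pair_forcing (Lam tau r : R) : 0 < Lam -> 0 < r -> r < tau -> exists2 kap : R, 0 < kap &
  forall t0 x y dy a da f i e, C x -> upper_pair Lam t0 (t0 + tau) x y dy a da f ->
  (forall i, a t0 i 0 <= y t0 i 0) -> 0 <= e ->
  (forall t, t0 < t < t0 + r -> e <= f t i) ->
  forall j, kap * e <= y (t0 + tau) j 0 - a (t0 + tau) j 0.
Proof.
move=> Lam0 r0 rtau; have tau0 : 0 < tau - r by rewrite subr_gt0.
have [kap kap0 hkap] := pair_mixing Lam0 tau0.
have [L2 L20 hord] := reaction_ordered H.
pose c := dmax d + L2; have c0 : 0 < c by rewrite ltr_wpDl.
exists (kap * (expR (- (c * r)) * r)); first by rewrite !mulr_gt0// expR_gt0.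
move=> t0 x y dy a da f i e Cx pr ord0 e0 hf j.
have ord := pair_order Cx pr ord0.
have t0r : t0 <= t0 + r by rewrite lerDl ltW.
have rt : t0 + r <= t0 + tau by rewrite lerD2l ltW.
have E : t0 + tau = t0 + r + (tau - r) by rewrite -addrA [r + _]addrC subrK.
have pr2 : upper_pair Lam (t0 + r) (t0 + r + (tau - r)) x y dy a da f.
  by rewrite -E; exact: upper_pairW pr.
rewrite E; apply: (le_trans _ (hkap (t0 + r) x y dy a da f Cx pr2 _ i j)); last first.
  by move=> k; rewrite ord// t0r rt.
rewrite -!mulrA ler_pM2l//.
have := @decay_lower_bound R t0 (t0 + r) (fun t => y t i 0 - a t i 0) (fun t => dy t i - da t i) c e
  t0r (ltW c0) e0.
rewrite [t0 + r]addrC addrK addrC => hd.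
apply: le_trans (hd _ _).
- rewrite ler_pM2l ?expR_gt0// mulrC lerDr subr_ge0 ord0//.
- by apply: (evolvesW (lexx t0) rt); apply: evolvesB; [exact: (pair_ev_up pr)|exact: (pair_ev_low pr)].
move=> t tr; have tt : t0 < t < t0 + tau by case/andP: tr => p q; rewrite p (lt_le_trans q).
have tt' : t0 <= t <= t0 + tau by case/andP: tt => *; rewrite !ltW.
apply: le_trans (pair_ineq pr i tt).
have h1 := hord t x (y t) (a t) i Cx (pair_box_up pr tt') (pair_box_low pr tt') (fun k => ord t k tt').
have h2 := hf t tr; have h3 := d_le_dmax H i.
have z0 : 0 <= y t i 0 - a t i 0 by rewrite subr_ge0 ord.
have h4 := ler_wpM2r z0 h3; rewrite /c !mulrDl; lra.
Qed.

End pairs.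

Section spatial_Harnack.
Context {R : realType} {m n : nat}.
Variables (Omega : set 'rV[R]_n) (d : 'rV[R]_m) (K : 'I_m -> R -> 'rV[R]_n -> R).
Variables (g : R -> 'rV[R]_n -> 'cV[R]_m -> 'cV[R]_m) (v : 'cV[R]_m) (T : R).
Hypothesis H : system Omega d K g v T.

Local Notation C := (closure Omega).
Implicit Types (t s a b r e tau rho : R) (x y p : 'rV[R]_n) (i j k : 'I_m).
Implicit Types (phi psi : 'rV[R]_n -> R) (z dz : R -> 'rV[R]_n -> R).

Let oO := sys_open H.
Let bO := sys_bounded H.
Let cC : compact C := closure_bounded_compact bO.

(** The space cannot be a null set since the kernels have integral one. *)
Lemma lebesgue_setT_neq0 : lebesgue_outer [set: 'rV[R]_n] != 0%E.
Proof.
apply/eqP => h; have i := Ordinal (sys_m H); have [kc k0] := sys_K H i 0.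
have mk : measurable_fun (setT : set (lebesgue_type R n)) (EFin \o K i 0).
  apply/measurable_EFinP; apply: within_continuous_measurable => //.
  exact: continuous_subspaceT.
have := sys_K1 H i 0.
rewrite (@ge0_negligible_integral _ (lebesgue_type R n) R (lebesgue R n) setT setT) ?setDv ?integral_set0//.
  by move=> /eqP; rewrite eq_sym onee_eq0.
by move=> y _; rewrite lee_fin k0.
Qed.

(** The integral over the domain, as a nonlocal term with constant kernel. *)
Definition amount phi := spread Omega (fun=> 1) phi 0.

Definition mass p rho phi := amount (fun y => phi y * \1_(ball p rho) y).

Let one_kernel : convolution_kernel (fun _ : 'rV[R]_n => 1 : R).
Proof. by split => //; exact: cst_continuous. Qed.

Lemma bounded_measurable_indic (A : set 'rV[R]_n) phi : open A -> bounded_measurable Omega phi ->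
  bounded_measurable Omega (fun y => phi y * \1_A y).
Proof.
move=> oA [mphi [B hB]]; split.
  apply: measurable_funM => //; apply: measurable_indic.
  exact: open_lebesgue_measurable.
exists B => y Oy; rewrite normrM indicE; apply: le_trans (hB y Oy).
by rewrite ler_piMr//; case: (y \in A); rewrite ?normr1 ?normr0.
Qed.

Lemma le_amount phi psi : bounded_measurable Omega phi -> bounded_measurable Omega psi ->
  (forall y, Omega y -> phi y <= psi y) -> amount phi <= amount psi.
Proof. exact: le_spread. Qed.

Lemma amount_ge0 phi : (forall y, Omega y -> 0 <= phi y) -> 0 <= amount phi.
Proof. exact: spread_ge0. Qed.

Lemma mass_ge0 p rho phi : (forall y, Omega y -> 0 <= phi y) -> 0 <= mass p rho phi.
Proof. by move=> h; apply: amount_ge0 => y Oy; rewrite mulr_ge0 ?h// indicE. Qed.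

Let bm_mass p rho phi : bounded_measurable Omega phi ->
  bounded_measurable Omega (fun y => phi y * \1_(ball p rho) y).
Proof. by apply: bounded_measurable_indic; exact: ball_open. Qed.

Lemma le_mass p rho phi psi (c : R) : bounded_measurable Omega phi -> bounded_measurable Omega psi ->
  (forall y, Omega y -> c * phi y <= psi y) -> c * mass p rho phi <= mass p rho psi.
Proof.
move=> bphi bpsi h; have b1 := bm_mass p rho bphi.
rewrite /mass /amount -(spreadZ oO bO c 0 one_kernel b1).
apply: le_amount; [exact: bounded_measurableZ|exact: bm_mass|] => y Oy.
by rewrite mulrA ler_wpM2r ?h// indicE.
Qed.

Lemma mass_le_amount p rho phi : bounded_measurable Omega phi -> (forall y, Omega y -> 0 <= phi y) ->
  mass p rho phi <= amount phi.
Proof.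
move=> bphi phi0; apply: (le_amount (bm_mass p rho bphi) bphi) => y Oy.
by rewrite ler_piMr ?phi0// indicE; case: (y \in _).
Qed.

Lemma mass_ge_cst p rho : C p -> 0 < rho -> exists2 c : R, 0 < c &
  forall phi (N : R), bounded_measurable Omega phi -> 0 <= N -> (forall y, Omega y -> 0 <= phi y) ->
  (forall y, Omega y -> ball p rho y -> N <= phi y) -> c * N <= mass p rho phi.
Proof.
move=> Cp rho0; pose V := ball p rho `&` Omega.
have oV : open V by apply: openI => //; exact: ball_open.
have [q [Oq Bq]] : Omega `&` ball p rho !=set0 by apply: Cp; exact: nbhsx_ballx.
have V0 : (0 < lebesgue R n V)%E.
  by apply: (open_lebesgue_gt0 lebesgue_setT_neq0 oV); exists q.
have Vf : (lebesgue R n V < +oo)%E.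
  apply: le_lt_trans (bounded_lebesgue_lty bO).
  by apply: le_lebesgue_outer => y [].
exists (fine (lebesgue R n V)); first by rewrite fine_gt0// V0.
move=> phi N bphi N0 phi0 hphi.
have <- : mass p rho (fun=> N) = fine (lebesgue R n V) * N.
  rewrite /mass /amount (spreadZ oO bO N 0 one_kernel); last first.
    have := bm_mass p rho (bounded_measurable_cst Omega 1).
    by under [X in bounded_measurable _ X]eq_fun do rewrite mul1r.
  rewrite mulrC; congr (_ * _); rewrite /spread /Rintegral; congr fine.
  under eq_integral do rewrite mul1r.
  rewrite integral_indic//; first exact: open_lebesgue_measurable.
  by apply: open_lebesgue_measurable; exact: ball_open.
apply: le_amount; [exact: bm_mass (bounded_measurable_cst Omega N)|exact: bm_mass|] => y Oy.
rewrite indicE; case: (boolP (y \in _)) => [|_]; last by rewrite !mulr0.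
by rewrite inE => By; rewrite !mulr1; exact: hphi.
Qed.

Lemma amount_le_mass (s : seq 'rV[R]_n) rho phi : bounded_measurable Omega phi ->
  (forall y, Omega y -> 0 <= phi y) ->
  (forall y, Omega y -> exists2 p, p \in s & ball p rho y) ->
  amount phi <= \sum_(p <- s) mass p rho phi.
Proof.
move=> bphi phi0 hs.
pose U (s : seq 'rV[R]_n) := [set y | exists2 p, p \in s & ball p rho y].
have oU (s' : seq 'rV[R]_n) : open (U s').
  rewrite (_ : U s' = \bigcup_(p in [set p | p \in s']) ball p rho); last first.
    by apply/seteqP; split => y [p h1 h2]; exists p.
  by apply: bigcup_open => p _; exact: ball_open.
suff S (s' : seq 'rV[R]_n) : amount (fun y => phi y * \1_(U s') y) <= \sum_(p <- s') mass p rho phi.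
  apply: (le_trans _ (S s)); apply: (le_amount bphi (bounded_measurable_indic (oU s) bphi)).
  by move=> y /hs Uy; rewrite indicE mem_set// mulr1.
elim: s' => [|p s' IH].
  rewrite big_nil /amount (_ : (fun y => phi y * _) = fun=> 0); last first.
    by apply/funext => y; rewrite indicE memNset ?mulr0// => -[].
  by rewrite (spread_cst oO bO)// mul0r.
rewrite big_cons; apply: (le_trans _ (lerD (lexx _) IH)).
have b1 := bm_mass p rho bphi; have b2 := bounded_measurable_indic (oU s') bphi.
rewrite /mass /amount -(spreadD oO bO 0 one_kernel b1 b2).
have b3 := bounded_measurable_indic (oU (p :: s')) bphi.
apply: (le_amount b3 (bounded_measurableD b1 b2)).
move=> y Oy; rewrite -mulrDr ler_wpM2l ?phi0//.
rewrite !indicE; case: (boolP (y \in U (p :: s'))) => [|_]; last by rewrite addr_ge0.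
rewrite inE => -[q]; rewrite inE => /orP[/eqP ->|qs] By.
  by rewrite (mem_set By) lerDl.
have Uy : U s' y by exists q.
by rewrite (mem_set Uy) lerDr.
Qed.

Variables (i : 'I_m) (c k0 r0 : R) (c0 : 0 < c) (k00 : 0 < k0) (r00 : 0 < r0).
Hypothesis hK : forall t x, `|x| < r0 -> k0 <= K i t x.

(** Supersolutions of a linear equation without influx from other components. *)
Record spreading a b z dz : Prop := Spreading {
  spreading_bm : forall t, a <= t <= b -> bounded_measurable Omega (z t) ;
  spreading_ge0 : forall t x, a <= t <= b -> C x -> 0 <= z t x ;
  spreading_ev : forall x, C x -> evolves a b (z^~ x) (dz^~ x) ;
  spreading_ineq : forall t x, a < t < b -> C x ->
    d 0 i * spread Omega (K i t) (z t) x - c * z t x <= dz t x }.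

Lemma spreadingW a b a' b' z dz : a <= a' -> b' <= b -> spreading a b z dz -> spreading a' b' z dz.
Proof.
move=> h0 h1 [bm z0 ev ineq].
have sub t : a' <= t <= b' -> a <= t <= b.
  by move=> /andP[p q]; rewrite (le_trans h0 p) (le_trans q h1).
have sub' t : a' < t < b' -> a < t < b.
  by move=> /andP[p q]; rewrite (le_lt_trans h0 p) (lt_le_trans q h1).
split.
- by move=> t /sub; exact: bm.
- by move=> t x /sub; exact: z0.
- by move=> x Cx; exact: evolvesW (ev x Cx).
- by move=> t x /sub'; exact: ineq.
Qed.

Let z0' a b z dz : spreading a b z dz -> forall t, a <= t <= b -> forall y, Omega y -> 0 <= z t y.
Proof. by move=> sp t tt y Oy; apply: (spreading_ge0 sp) => //; exact: subset_closure. Qed.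

Lemma spreading_decay a b z dz s t x : spreading a b z dz -> C x -> a <= s <= t -> t <= b ->
  expR (- (c * (t - s))) * z s x <= z t x.
Proof.
move=> sp Cx ast tb.
apply: (@decay_factor R 1 (fun t _ => z t x) (fun t _ => dz t x) c a b ord0 (ltW c0) (spreading_ev sp Cx) _ s t ast tb).
move=> r rr; apply: le_trans (spreading_ineq sp rr Cx); rewrite lerBrDr addNr mulr_ge0//.
  exact/ltW/(sys_d H).
apply: spread_ge0; first exact: (sys_K H).
by apply: (z0' sp); case/andP: rr => *; rewrite !ltW.
Qed.

Lemma spread_ge_mass t x p rho phi : C x -> (forall y, ball p rho y -> `|x - y| < r0) ->
  bounded_measurable Omega phi -> (forall y, Omega y -> 0 <= phi y) ->
  k0 * mass p rho phi <= spread Omega (K i t) phi x.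
Proof.
move=> Cx hp bphi phi0.
have b1 := bm_mass p rho bphi.
rewrite /mass /amount -(spreadZ oO bO k0 0 one_kernel b1) /spread.
have [B B0 hB] := K_bounded H; have [_ [M hM]] := bphi.
have Kge0 y : 0 <= K i t (x - y) by exact: (sys_K H i t).2.
apply: (@Rintegral_mono _ _ _ (lebesgue R n) Omega (open_lebesgue_measurable oO) (bounded_lebesgue_lty bO) _ _ (B * M)).
- by move=> y Oy; rewrite mul1r !mulr_ge0 ?phi0// ?indicE// ltW.
- move=> y Oy; rewrite mul1r mulrA [k0 * _]mulrC -mulrA mulrC ler_wpM2r ?phi0// indicE.
  case: (boolP (y \in _)) => [|_]; last by rewrite mulr0.
  by rewrite inE => /hp/(hK t); rewrite mulr1.
- move=> y Oy; apply: ler_pM => //; [exact: phi0|exact: hB|].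
  by rewrite (le_trans (ler_norm _))// hM.
Qed.

(** The kernel is bounded below near 0, so the mass near p acts as a source at
    all points within this distance. *)
Lemma spreading_near (tau : R) : 0 < tau -> exists2 kap : R, 0 < kap & forall a z dz p rho x,
  C x -> (forall y, ball p rho y -> `|x - y| < r0) -> spreading a (a + tau) z dz ->
  kap * mass p rho (z a) <= z (a + tau) x.
Proof.
move=> tau0; pose E := expR (- (c * tau)); have E0 : 0 < E by exact: expR_gt0.
have d0 := sys_d H i.
exists (E * (d 0 i * (k0 * E) * tau)); first by rewrite !mulr_gt0.
move=> a z dz p rho x Cx hp sp.
have aa : a <= a + tau by rewrite lerDl ltW.
have aI : a <= a <= a + tau by rewrite lexx aa.
have m0 : 0 <= mass p rho (z a) by apply: mass_ge0; exact: (z0' sp aI).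
have k0' : 0 <= d 0 i * (k0 * (E * mass p rho (z a))) by rewrite !mulr_ge0// ltW.
have := @decay_lower_bound R a (a + tau) (z^~ x) (dz^~ x) c _ aa (ltW c0) k0' (spreading_ev sp Cx).
rewrite [a + tau]addrC addrK addrC -/E => hd.
apply: le_trans (hd _).
  have -> : E * (d 0 i * (k0 * E) * tau) * mass p rho (z a) =
    E * (d 0 i * (k0 * (E * mass p rho (z a))) * tau) by ring.
  rewrite ler_pM2l//.
  by rewrite lerDr (spreading_ge0 sp aI Cx).
move=> t tt; have tt' : a <= t <= a + tau by case/andP: tt => *; rewrite !ltW.
apply: le_trans (spreading_ineq sp tt Cx); rewrite addrC lerD2r ler_pM2l//.
apply: (@le_trans _ _ (k0 * mass p rho (z t))).
  rewrite ler_pM2l//; apply: le_mass; [exact: (spreading_bm sp aI)|exact: (spreading_bm sp tt')|].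
  move=> y Oy; have Cy := subset_closure Oy.
  have /andP[at1 tb] := tt'.
  have := spreading_decay sp Cy (introT andP (conj (lexx a) at1)) tb.
  apply: le_trans; rewrite ler_wpM2r ?(z0' sp aI)// ler_expR lerN2 ler_pM2l//.
  by rewrite lerBlDl.
by apply: spread_ge_mass => //; [exact: (spreading_bm sp tt')|exact: (z0' sp tt')].
Qed.

Let rho0 := r0 / 4.
Let rho00 : 0 < rho0. Proof. by rewrite divr_gt0. Qed.

(** The mass near p raises the solution near x after an arbitrarily short time. *)
Definition reached p x := exists2 r : R, 0 < r & forall tau : R, 0 < tau ->
  exists2 kap : R, 0 < kap & forall a z dz x', C x' -> `|x - x'| < r -> spreading a (a + tau) z dz ->
  kap * mass p rho0 (z a) <= z (a + tau) x'.

Lemma reached_self p : C p -> reached p p.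
Proof.
move=> Cp; exists rho0 => // tau tau0; have [kap kap0 hk] := spreading_near tau0.
exists kap => // a z dz x' Cx' px' sp; apply: (hk a z dz p rho0 x') => // y; rewrite -ball_normE/= => py.
rewrite -(subrK p x') -addrA (le_lt_trans (ler_normD _ _))// [X in X + _]distrC.
by move: px' py r00; rewrite /rho0; lra.
Qed.

Lemma reached_step p x y : reached p y -> C y -> `|x - y| < rho0 -> reached p x.
Proof.
move=> [r r_gt0 hr] Cy xy.
pose rho := Num.min r rho0; have rho_gt0 : 0 < rho by rewrite lt_min r_gt0 rho00.
exists rho0 => // tau tau0; have tau2 : 0 < tau / 2 by rewrite divr_gt0.
have [k1 k10 hk1] := hr _ tau2; have [k2 k20 hk2] := spreading_near tau2.
have [c1 c10 hc1] := mass_ge_cst Cy rho_gt0.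
exists (k2 * (c1 * k1)); first by rewrite !mulr_gt0.
move=> a z dz x' Cx' xx' sp.
have E : a + tau = a + tau / 2 + tau / 2 by rewrite -addrA -splitr.
have ha : a + tau / 2 <= a + tau by rewrite E lerDl ltW.
have ha' : a <= a + tau / 2 by rewrite lerDl ltW.
have aI : a <= a + tau / 2 <= a + tau by rewrite ha ha'.
have aI0 : a <= a <= a + tau by rewrite lexx (le_trans ha' ha).
have sp1 : spreading a (a + tau / 2) z dz by exact: spreadingW sp.
have sp2 : spreading (a + tau / 2) (a + tau / 2 + tau / 2) z dz by rewrite -E; exact: spreadingW sp.
rewrite E; apply: (le_trans _ (hk2 _ _ _ y rho x' Cx' _ sp2)); last first.
  move=> y'; rewrite -ball_normE/= lt_min => /andP[_ yy'].
  rewrite -(subrK y x') -addrA (le_lt_trans (ler_normD _ _))//.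
  have : `|x' - y| < rho0 + rho0.
    rewrite -(subrK x x') -addrA (le_lt_trans (ler_normD _ _))// ltrD//.
    by rewrite distrC.
  by move: yy' r00; rewrite /rho0; lra.
rewrite -!mulrA ler_pM2l//; apply: hc1.
- exact: (spreading_bm sp aI).
- by rewrite mulr_ge0 ?(ltW k10)// mass_ge0//; exact: (z0' sp aI0).
- exact: (z0' sp aI).
- move=> y' Oy'; rewrite -ball_normE/= lt_min => /andP[yy' _].
  by apply: (hk1 _ _ _ _ _ yy' sp1); exact: subset_closure.
Qed.

(** The points that can be reached from p form a clopen subset of the domain. *)
Lemma reached_all p x : C p -> C x -> reached p x.
Proof.
move=> Cp; have cn : connected C by apply: connected_closure; exact: (sys_connected H).
suff -> : C = C `&` [set x | reached p x] by case.
apply/esym/cn.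
- by exists p; split => //; exact: reached_self.
- exists (\bigcup_(y in C `&` [set x | reached p x]) ball y rho0).
    by apply: bigcup_open => y _; exact: ball_open.
  apply/seteqP; split => [x' [Cx' rx']|x' [Cx' [y [Cy ry] yx']]].
    by split => //; exists x' => //; exact: ballxx.
  split => //; apply: (reached_step ry Cy); rewrite distrC.
  by move: yx'; rewrite -ball_normE.
- exists (closure (C `&` [set x | reached p x])); first exact: closed_closure.
  apply/seteqP; split => [x' [Cx' rx']|x' [Cx' cx']].
    by split => //; apply: subset_closure.
  split => //; have [y [[Cy ry] xy]] := cx' _ (nbhsx_ballx x' _ rho00).
  by apply: (reached_step ry Cy); move: xy; rewrite -ball_normE.
Qed.

(** By compactness finitely many balls carry the whole amount, and each of them
    reaches every point of the domain. *)
Lemma spreading_Harnack (tau : R) : 0 < tau -> exists2 kap : R, 0 < kap & forall a z dz x,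
  C x -> spreading a (a + tau) z dz -> kap * amount (z a) <= z (a + tau) x.
Proof.
move=> tau0.
have [|s sC hs] := @compact_finite_ball_cover R 'rV[R]_n C (fun=> rho0) cC; first by [].
have ex p : exists k : R, 0 < k /\ (p \in s -> forall a z dz x, C x -> spreading a (a + tau) z dz ->
    k * mass p rho0 (z a) <= z (a + tau) x).
  have [ps|_] := boolP (p \in s); last by exists 1.
  have exq q : exists e : R * R, C q -> 0 < e.1 /\ 0 < e.2 /\ forall a z dz x, C x -> `|q - x| < e.1 ->
      spreading a (a + tau) z dz -> e.2 * mass p rho0 (z a) <= z (a + tau) x.
    have [Cq|nCq] := pselect (C q); last by exists (0, 0).
    have [r r_gt0 hr] := reached_all (sC p ps) Cq; have [k k_gt0 hk] := hr _ tau0.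
    by exists (r, k).
  have [e he] := choice exq.
  have [|s2 s2C hs2] := @compact_finite_ball_cover R 'rV[R]_n C (fun q => (e q).1) cC.
    by move=> q /he[].
  have [|k k_gt0 hk] := @seq_pos_lower_bound R _ s2 (fun q => (e q).2).
    by move=> q /s2C/he[_ []].
  exists k; split => // _ a z dz x Cx sp; have [q qs qx] := hs2 x Cx.
  have [_ [_ hq]] := he q (s2C q qs).
  apply: le_trans (hq a z dz x Cx _ sp); last by move: qx; rewrite -ball_normE.
  rewrite ler_wpM2r ?hk//; apply: mass_ge0; apply: (z0' sp).
  by rewrite lexx lerDl ltW.
have [k hk] := choice ex.
have [|k1 k1_gt0 hk1] := @seq_pos_lower_bound R _ s k; first by move=> p _; exact: (hk p).1.
have N0 : 0 < (size s).+1%:R :> R by [].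
exists (k1 / (size s).+1%:R); first by rewrite divr_gt0.
move=> a z dz x Cx sp; have aI : a <= a <= a + tau by rewrite lexx lerDl ltW.
rewrite mulrAC ler_pdivrMr//.
have zp := z0' sp aI; have zx : 0 <= z (a + tau) x.
  by apply: (spreading_ge0 sp) => //; rewrite lexx lerDl ltW.
apply: (@le_trans _ _ (k1 * \sum_(p <- s) mass p rho0 (z a))).
  rewrite ler_pM2l//; apply: amount_le_mass => //; first exact: (spreading_bm sp aI).
  by move=> y Oy; exact: hs (subset_closure Oy).
rewrite mulr_sumr; apply: (@le_trans _ _ (\sum_(p <- s) z (a + tau) x)).
  rewrite big_seq [leRHS]big_seq; apply: ler_sum => p ps.
  apply: le_trans ((hk p).2 ps a z dz x Cx sp); rewrite ler_wpM2r ?hk1//.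
  exact: mass_ge0.
by rewrite big_const_seq count_predT iter_addr_0 -[leLHS]mulr_natr ler_wpM2l// ler_nat ltnW.
Qed.

End spatial_Harnack.

(** * Improvement of the ratio of two orbits *)

Section improvement.
Context {R : realType} {m n : nat}.
Variables (Omega : set 'rV[R]_n) (d : 'rV[R]_m) (K : 'I_m -> R -> 'rV[R]_n -> R).
Variables (g : R -> 'rV[R]_n -> 'cV[R]_m -> 'cV[R]_m) (v : 'cV[R]_m) (T : R).
Hypothesis H : system Omega d K g v T.

Local Notation C := (closure Omega).
Local Notation in_box := (in_box v).
Local Notation rhs := (nonlinear_rhs Omega d K g).
Local Notation trajectory := (trajectory Omega d K g).
Implicit Types (t s r e tau : R) (x : 'rV[R]_n) (i j k : 'I_m).
Implicit Types (u w : R -> 'rV[R]_n -> 'cV[R]_m).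

Let oO := sys_open H.
Let bO := sys_bounded H.
Let cC : compact C := closure_bounded_compact bO.

(** A component raises itself everywhere during the first half of the time, and
    the others at the same place during the second half. *)
Lemma trajectory_positive (tau : R) : 0 < tau -> exists2 kap : R, 0 < kap & forall a u,
  trajectory a (a + tau) u -> (forall t x, a <= t <= a + tau -> C x -> in_box (u t x)) ->
  forall x i j, C x ->
    kap * u a x i 0 <= u (a + tau) x j 0 /\
    kap * amount Omega (fun y => u a y i 0) <= u (a + tau) x j 0.
Proof.
move=> tau0; have tau2 : 0 < tau / 2 by rewrite divr_gt0.
have [k1 k10 hk1] := pair_mixing H ltr01 tau0.
have [k2 k20 hk2] := pair_mixing H ltr01 tau2.
have [c c0 hc] := trajectory_ge_spread H.
have [k0 [r0 [k00 r00 hK]]] := K_lower H.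
have [k4 k40 hk4] : exists2 k : R, 0 < k & forall i a z dz x, C x ->
    spreading Omega d K i c a (a + tau / 2) z dz -> k * amount Omega (z a) <= z (a + tau / 2) x.
  apply: finite_pos_choice => [i r s /andP[_ sr] h a z dz x Cx sp|i].
    apply: le_trans (h a z dz x Cx sp); rewrite ler_wpM2r//; apply: amount_ge0 => y Oy.
    by apply: (spreading_ge0 sp); rewrite ?lexx ?lerDl ?ltW//; exact: subset_closure.
  have [k3 k30 hk3] := spreading_Harnack H c0 k00 r00 (hK i) tau2.
  by exists k3.
have [|kap kap0 hkap] := @seq_pos_lower_bound R R [:: k1; k2 * k4] id.
  by move=> z; rewrite !inE => /orP[/eqP ->|/eqP ->] //; rewrite mulr_gt0.
have h1 : kap <= k1 by apply: hkap; rewrite inE eqxx.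
have h2 : kap <= k2 * k4 by apply: hkap; rewrite !inE eqxx orbT.
exists kap => // a u tu bx x i j Cx.
have pr x' : C x' -> upper_pair d g v 1 a (a + tau) x' (fun t => u t x') (fun t i => rhs t (u t) x' i 0)
    (fun=> 0) (fun _ _ => 0) (fun t i => d 0 i * spread Omega (K i t) (fun y => u t y i 0) x').
  move=> Cx'; split.
  - by move=> k; exact: (traj_ev tu).
  - by move=> k; apply: eq_evolves (evolves_cst _ _ 0) => //; apply/funext => t; rewrite mxE.
  - by move=> t tt; exact: bx.
  - by move=> t _; exact: (in_box0 H).
  - by move=> s t k _ _; rewrite subrr normr0 mul1r.
  - move=> t k tt; rewrite mulr_ge0 ?(ltW (sys_d H k))//.
    apply: spread_ge0; first exact: (sys_K H).
    have tt' : a <= t <= a + tau by case/andP: tt => *; rewrite !ltW.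
    by move=> y Oy; case/andP: (bx t y tt' (subset_closure Oy) k).
  - move=> t k tt; rewrite rhsE (sys_g0 H _ Cx') !mxE !subr0 addrAC [X in X + _]addrC lexx//.
have ge0 t y k : a <= t <= a + tau -> C y -> 0 <= u t y k 0.
  by move=> tt Cy; case/andP: (bx t y tt Cy k).
have aI : a <= a <= a + tau by rewrite lexx lerDl ltW.
have ha : a + tau / 2 <= a + tau by rewrite lerD2l ler_pdivrMr// mulr_natr mulr2n lerDl ltW.
have ha' : a <= a + tau / 2 by rewrite lerDl ltW.
split.
  have := hk1 a x _ _ _ _ _ Cx (pr x Cx) _ i j; rewrite !mxE !subr0 => h.
  apply: (le_trans _ (h _)); last by move=> k; rewrite mxE ge0.
  by rewrite ler_wpM2r// ge0.
have E : a + tau = a + tau / 2 + tau / 2 by rewrite -addrA -splitr.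
have pr2 : upper_pair d g v 1 (a + tau / 2) (a + tau / 2 + tau / 2) x (fun t => u t x) (fun t i => rhs t (u t) x i 0)
    (fun=> 0) (fun _ _ => 0) (fun t i => d 0 i * spread Omega (K i t) (fun y => u t y i 0) x).
  by rewrite -E; exact: upper_pairW (pr x Cx).
have := hk2 (a + tau / 2) x _ _ _ _ _ Cx pr2 _ i j; rewrite -E !mxE !subr0 => h.
apply: (le_trans _ (h _)); last by move=> k; rewrite mxE ge0// ha ha'.
have sp : spreading Omega d K i c a (a + tau / 2) (fun t y => u t y i 0) (fun t y => rhs t (u t) y i 0).
  split.
  - by move=> t /andP[t1 t2]; apply: (traj_bm tu); rewrite t1 (le_trans t2 ha).
  - by move=> t y /andP[t1 t2] Cy; apply: ge0 => //; rewrite t1 (le_trans t2 ha).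
  - by move=> y Cy; apply: evolvesW (traj_ev tu i Cy).
  - by move=> t y /andP[t1 t2] Cy; apply: (hc a (a + tau)) => //; rewrite t1 (lt_le_trans t2 ha).
have t0 : 0 <= amount Omega (fun y => u a y i 0).
  by apply: amount_ge0 => y Oy; apply: ge0 => //; exact: subset_closure.
apply: (@le_trans _ _ (k2 * (k4 * amount Omega (fun y => u a y i 0)))).
  by rewrite mulrA ler_wpM2r.
by rewrite ler_pM2l//; exact: (hk4 i a _ _ x Cx sp).
Qed.

(** An orbit u at a point x' that lies above a multiple al w of an orbit w at a
    nearby point x, al < 1, gains a definite factor if w is bounded away from 0:
    al w is a strict lower solution because of subhomogeneity, with a gap
    proportional to al in at least one component, which is passed on to all of
    them.  The gain tolerates small errors, also proportional to al; they are
    absorbed by comparing with al (w - sigma), where sigma solves a linear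
    equation. *)
Lemma improvement (delta theta tau Lam : R) : 0 < delta -> 0 < theta < 1 -> 0 < tau -> 0 < Lam ->
  exists eta e r : R, [/\ 0 < eta, 0 < e, 0 < r &
  forall t0 x x' u w al, C x -> C x' -> `|x - x'| < r -> 0 < al <= 1 - theta ->
  (forall i, evolves t0 (t0 + tau) (fun t => u t x' i 0) (fun t => rhs t (u t) x' i 0)) ->
  (forall i, evolves t0 (t0 + tau) (fun t => w t x i 0) (fun t => rhs t (w t) x i 0)) ->
  (forall t, t0 <= t <= t0 + tau -> in_box (u t x') /\ in_box (w t x)) ->
  (forall t i, t0 <= t <= t0 + tau -> delta <= w t x i 0) ->
  (forall s t i, t0 <= s <= t0 + tau -> t0 <= t <= t0 + tau -> `|w s x i 0 - w t x i 0| <= Lam * `|s - t|) ->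
  (forall t i, t0 < t < t0 + tau ->
     al * (d 0 i * spread Omega (K i t) (fun y => w t y i 0) x) - al * e <=
     d 0 i * spread Omega (K i t) (fun y => u t y i 0) x') ->
  (forall i, al * w t0 x i 0 <= u t0 x' i 0) ->
  forall i, al * (1 + eta) * w (t0 + tau) x i 0 <= u (t0 + tau) x' i 0].
Proof.
move=> del0 th tau0 Lam0; have /andP[th0 th1] := th.
have [B B0 hB] := in_box_norm H; have [L L0 hL] := reaction_Lipschitz H B.
pose lam := L + 1; have lam0 : 0 < lam by rewrite addr_gt0.
pose Lam2 := Lam + lam * delta.
have Lam20 : 0 < Lam2 by rewrite addr_gt0// mulr_gt0.
have [g0 [r2 [g00 r20 r2tau hgap]]] := gap_persists H del0 th Lam0 tau0.
have [kap kap0 hkap] := pair_forcing H Lam20 r20 r2tau.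
pose G := kap * g0; have G0 : 0 < G by rewrite mulr_gt0.
pose X := expR (lam * tau); have X0 : 0 < X by exact: expR_gt0.
pose e := Num.min delta (G / 2) / (2 * X).
have e0 : 0 < e by rewrite divr_gt0 ?mulr_gt0// lt_min del0 divr_gt0.
have e20 : 0 < 2 * e by rewrite mulr_gt0.
have eX : 2 * e * X = Num.min delta (G / 2) by rewrite /e; field; rewrite gt_eqF.
have eX1 : 2 * e * X <= delta by rewrite eX ge_min lexx.
have eX2 : 2 * e * X <= G / 2 by rewrite eX ge_min lexx orbT.
have [r r_gt0 hr] := reaction_uniform H e0.
exists (G / (2 * B)), e, r; split => //; first by rewrite divr_gt0// mulr_gt0.
move=> t0 x x' u w al Cx Cx' xx' /andP[al0 al1] ey eP bx Pd Plip hb h0 i.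
pose y t := u t x'; pose P t := w t x.
pose dy t k := rhs t (u t) x' k 0; pose dP t k := rhs t (w t) x k 0.
pose bY t k := d 0 k * spread Omega (K k t) (fun z => u t z k 0) x'.
pose bP t k := d 0 k * spread Omega (K k t) (fun z => w t z k 0) x.
have al1' : al <= 1 by rewrite (le_trans al1)// lerBlDr lerDl ltW.
pose sg t := 2 * e * expR (lam * (t - t0)).
have sg_ge t : t0 <= t -> 2 * e <= sg t.
  move=> tt; rewrite /sg -[leLHS]mulr1 (ler_pM2l e20).
  by rewrite (le_trans _ (expR_ge1Dx _))// lerDl mulr_ge0 ?subr_ge0// ltW.
have sg_le t : t <= t0 + tau -> sg t <= 2 * e * X.
  by move=> tt; rewrite /sg (ler_pM2l e20) ler_expR ler_pM2l// lerBlDl.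
have sg0 t : 0 < sg t by rewrite /sg mulr_gt0// expR_gt0.
pose a t : 'cV[R]_m := \col_k (al * P t k 0 - al * sg t).
pose da t k := al * dP t k - al * (lam * sg t).
have esg : evolves t0 (t0 + tau) sg (fun t => lam * sg t).
  have := evolvesZ (2 * e) (evolves_expR t0 (t0 + tau) lam t0).
  by apply: eq_evolves => // t _; rewrite /sg mulrCA.
have ea k : evolves t0 (t0 + tau) (fun t => a t k 0) (da^~ k).
  have := evolvesB (evolvesZ al (eP k)) (evolvesZ al esg).
  by apply: eq_evolves => //; apply/funext => t; rewrite mxE.
have abox t : t0 <= t <= t0 + tau -> in_box (a t).
  move=> tt k; have /andP[t1 t2] := tt; rewrite mxE -mulrBr.
  have h1 := Pd t k tt; have h2 := le_trans (sg_le t t2) eX1.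
  have /andP[h3 h4] := (bx t tt).2 k; have h5 := sg0 t.
  rewrite mulr_ge0 ?(ltW al0)//=; last by rewrite subr_ge0 (le_trans h2).
  apply: (@le_trans _ _ (1 * P t k 0)); last by rewrite mul1r.
  by apply: ler_pM => //; rewrite ?(ltW al0) ?subr_ge0 ?(le_trans h2)// lerBlDr lerDl ltW.
have alip s t k : t0 <= s <= t0 + tau -> t0 <= t <= t0 + tau -> `|a s k 0 - a t k 0| <= Lam2 * `|s - t|.
  move=> ss tt; rewrite !mxE.
  have h1 : `|sg s - sg t| <= lam * delta * `|s - t|.
    have tle : t0 <= t0 + tau by rewrite lerDl ltW.
    apply: (evolves_bounded_slope tle esg) => // q /andP[q1 q2].
    rewrite (gtr0_norm (mulr_gt0 lam0 (sg0 q))) (ler_pM2l lam0) (le_trans _ eX1)// sg_le// ltW//.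
  have h2 := Plip s t k ss tt.
  have -> : al * P s k 0 - al * sg s - (al * P t k 0 - al * sg t) =
    al * (P s k 0 - P t k 0 - (sg s - sg t)) by ring.
  rewrite normrM gtr0_norm// -[leRHS]mul1r; apply: ler_pM => //; first exact: ltW.
  by rewrite (le_trans (ler_normB _ _))// /Lam2 mulrDl lerD.
have pr : upper_pair d g v Lam2 t0 (t0 + tau) x' y dy a da (fun t k => al * gap g theta k t x' (P t)).
  split=> //.
  - by move=> t tt; exact: (bx t tt).1.
  - move=> t k tt; have tt' : t0 <= t <= t0 + tau by case/andP: tt => *; rewrite !ltW.
    by rewrite mulr_ge0 ?(ltW al0)// (gap_ge0 H)//; exact: (bx t tt').2.
  - move=> t k tt; have tt' : t0 <= t <= t0 + tau by case/andP: tt => *; rewrite !ltW.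
    have /andP[t1 t2] := tt'; have PM := (bx t tt').2.
    have al01 : 0 < al <= 1 - theta by rewrite al0.
    have al02 : 0 <= al <= 1 by rewrite (ltW al0).
    have alPM := in_box_scale al02 PM.
    have h1 : bY t k - d 0 k * y t k 0 + g t x' (y t) k 0 <= dy t k by rewrite /dy rhsE.
    have h2 : dP t k <= bP t k - d 0 k * P t k 0 + g t x (P t) k 0 by rewrite /dP rhsE.
    have h3 : al * bP t k - al * e <= bY t k by exact: hb.
    have h4 := gap_le H k t th al01 Cx' PM.
    have h5 : g t x (P t) k 0 <= g t x' (P t) k 0 + e.
      rewrite -lerBlDl (le_trans (ler_norm _))//; apply/ltW; apply: hr => //; by rewrite subrr normr0.
    have h6 : g t x' (al *: P t) k 0 <= g t x' (a t) k 0 + L * (al * sg t).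
      rewrite -lerBlDl (le_trans (ler_norm _))//; apply: hL => // j.
      - exact: hB _ alPM j.
      - exact: hB _ (abox t tt') j.
      - by rewrite !mxE opprB addrCA subrr addr0 (gtr0_norm (mulr_gt0 al0 (sg0 t))) lexx.
    have h7 := ler_wpM2l (ltW al0) h2; have h8 := ler_wpM2l (ltW al0) h5.
    have h9 : al * (2 * e) <= al * sg t by rewrite ler_pM2l// sg_ge.
    have h10 : 0 <= d 0 k * (al * sg t) by exact: (mulr_ge0 (ltW (sys_d H k)) (mulr_ge0 (ltW al0) (ltW (sg0 t)))).
    have aE : a t k 0 = al * P t k 0 - al * sg t by rewrite mxE.
    rewrite aE /da /lam.
    move: h1 h3 h4 h6 h7 h8 h9 h10.
    set g1 := g t x' (y t) k 0; set g2 := g t x' (a t) k 0; set g3 := g t x' (al *: P t) k 0.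
    set g4 := g t x' (P t) k 0; set g5 := g t x (P t) k 0; set ga := gap _ _ _ _ _ _.
    set S := sg t; set p := P t k 0; set q := y t k 0; set D := d 0 k.
    set b1 := bY t k; set b2 := bP t k; set w1 := dy t k; set w2 := dP t k.
    move=> h1 h3 h4 h6 h7 h8 h9 h10.
    have E1 : al * (b2 - D * p + g5) = al * b2 - D * (al * p) + al * g5 by ring.
    have E2 : - (D * (q - (al * p - al * S))) = - (D * q) + D * (al * p) - D * (al * S) by ring.
    have E3 : al * ((L + 1) * S) = L * (al * S) + al * S by ring.
    have E4 : al * (g4 + e) = al * g4 + al * e by ring.
    have E5 : al * (2 * e) = al * e + al * e by ring.
    rewrite E2 E3; rewrite E1 in h7; rewrite E4 in h8; rewrite E5 in h9.
    by move: h1 h3 h4 h6 h7 h8 h9 h10; clear -oO bO cC; lra.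
have tle : t0 <= t0 + tau by rewrite lerDl ltW.
have t0I : t0 <= t0 <= t0 + tau by rewrite lexx tle.
have t1I : t0 <= t0 + tau <= t0 + tau by rewrite lexx tle.
have [k hk] := hgap t0 x' P Cx' (fun t tt => (bx t tt).2) (fun k => Pd t0 k t0I)
  (fun t k tt => Plip t t0 k tt t0I).
have ord0 j : a t0 j 0 <= y t0 j 0.
  by rewrite mxE (le_trans _ (h0 j))// lerBlDr lerDl (mulr_ge0 (ltW al0) (ltW (sg0 t0))).
have e0' : 0 <= al * g0 by exact: (mulr_ge0 (ltW al0) (ltW g00)).
have := hkap t0 x' y dy a da _ k (al * g0) Cx' pr ord0 e0' _ i.
rewrite [a _ _ _]mxE => hfin.
have {hfin} : kap * (al * g0) <= y (t0 + tau) i 0 - (al * P (t0 + tau) i 0 - al * sg (t0 + tau)).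
  by apply: hfin => t tt; rewrite ler_pM2l// hk.
have h1 := le_trans (sg_le _ (lexx _)) eX2.
have /andP[P0 _] := (bx _ t1I).2 i.
have h2 : P (t0 + tau) i 0 <= B by rewrite (le_trans (ler_norm _))// hB//; exact: (bx _ t1I).2.
have h3 : G / (2 * B) * P (t0 + tau) i 0 <= G / 2.
  have -> : G / 2 = G / (2 * B) * B by field; rewrite gt_eqF.
  by rewrite ler_pM2l// divr_gt0// mulr_gt0.
have h4 := ler_wpM2l (ltW al0) h1; have h5 := ler_wpM2l (ltW al0) h3.
have -> : kap * (al * g0) = al * (G / 2) + al * (G / 2) by rewrite /G; field.
rewrite -/(P _) -/(y _).
have -> : al * (1 + G / (2 * B)) * P (t0 + tau) i 0 = al * P (t0 + tau) i 0 + al * (G / (2 * B) * P (t0 + tau) i 0) by ring.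
by move: h4 h5; clear -oO bO cC; lra.
Qed.

End improvement.

(** * Global solutions, time shifts and merging *)

Section evolves_more.
Context {R : realType}.
Implicit Types (a b s t : R) (f df : R -> R).

Lemma evolves_shift a b s f df : evolves a b f df ->
  evolves (a - s) (b - s) (fun t => f (t + s)) (fun t => df (t + s)).
Proof.
move=> [cf ev]; split; last first.
  move=> t /andP[h1 h2]; have ht : a < t + s < b by rewrite -ltrBlDr h1 -ltrBrDr h2.
  have h3 : is_derive t 1 (shift s : R -> R) 1 by exact: is_derive_shift.
  have := @is_derive1_comp R f (shift s) t _ _ (ev _ ht) h3.
  by move=> h; apply: (is_derive_eq h); rewrite mulr1.
have {}cf := (@within_continuous_ballP R R R _ _).1 cf.
apply/(@within_continuous_ballP R) => t tab e e0.
have sh r : `[(a - s)%R, (b - s)%R]%classic r -> `[a, b]%classic (r + s).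
  by rewrite /= !in_itv/= lerBlDr lerBrDr.
have [r r0 hr] := cf _ (sh t tab) e e0; exists r => // y yab ty.
apply: hr; first exact: sh.
by move: ty; rewrite -!ball_normE/= opprD addrACA subrr addr0.
Qed.

Lemma eq_evolves_in a b f g df dg : (forall t, a <= t <= b -> f t = g t) ->
  (forall t, a < t < b -> df t = dg t) -> evolves a b f df -> evolves a b g dg.
Proof.
move=> fg dfg [cf ev]; split.
  have {}cf := (@within_continuous_ballP R R R _ _).1 cf.
  apply/(@within_continuous_ballP R) => t tab e e0.
  have [r r0 hr] := cf t tab e e0; exists r => // y yab ty.
  rewrite -!fg; first exact: hr.
    by move: yab; rewrite /= in_itv.
  by move: tab; rewrite /= in_itv.
move=> t tab; rewrite -dfg//; apply: near_eq_is_derive (ev t tab).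
have tI : t \in `]a, b[ by rewrite in_itv.
apply: filterS (near_in_itvoo tI) => r.
by rewrite in_itv/= => /andP[h1 h2]; rewrite fg// !ltW.
Qed.

End evolves_more.

Section global_solutions.
Context {R : realType} {m n : nat}.
Variables (Omega : set 'rV[R]_n) (d : 'rV[R]_m) (K : 'I_m -> R -> 'rV[R]_n -> R).
Variables (g : R -> 'rV[R]_n -> 'cV[R]_m -> 'cV[R]_m) (v : 'cV[R]_m) (T : R).
Hypothesis H : system Omega d K g v T.

Local Notation C := (closure Omega).
Local Notation in_box := (in_box v).
Local Notation rhs := (nonlinear_rhs Omega d K g).
Local Notation trajectory := (trajectory Omega d K g).
Implicit Types (t s r e tau a b : R) (x y : 'rV[R]_n) (i j : 'I_m).
Implicit Types (u w : R -> 'rV[R]_n -> 'cV[R]_m).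

Let oO := sys_open H.
Let bO := sys_bounded H.

Lemma eq_rhs t (phi psi : 'rV[R]_n -> 'cV[R]_m) x : C x -> (forall y, C y -> phi y = psi y) ->
  rhs t phi x = rhs t psi x.
Proof.
move=> Cx h; apply/colP => i; rewrite !rhsE h//; congr (_ * _ - _ + _).
by apply: eq_Rintegral => y; rewrite inE => Oy; rewrite h//; exact: subset_closure.
Qed.

Lemma rhs_shift (k : int) t (phi : 'rV[R]_n -> 'cV[R]_m) x i : C x ->
  rhs (t + k%:~R * T) phi x i 0 = rhs t phi x i 0.
Proof.
move=> Cx; apply: (@periodic_int R T (fun t => rhs t phi x i 0)) => {}t.
rewrite !rhsE (sys_g H i).2//; congr (_ * _ - _ + _).
by rewrite (_ : K i (t + T) = K i t)//; apply/funext => y; exact: (sys_Kper H).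
Qed.

Lemma eq_trajectory a b u w : (forall t x, a <= t <= b -> C x -> u t x = w t x) ->
  trajectory a b u -> trajectory a b w.
Proof.
move=> uw [ev bm [B bd]]; split.
- move=> x i Cx; apply: eq_evolves_in (ev x i Cx) => t tt; first by rewrite uw.
  by rewrite (eq_rhs _ Cx (fun y Cy => uw t y _ Cy))//; case/andP: tt => *; rewrite !ltW.
- move=> t tt i; have [mu [B' hB']] := bm t tt i; split.
    apply: (@eq_measurable_fun _ _ (lebesgue_type R n) R Omega (fun y => u t y i 0) _ _ mu) => y.
    by rewrite inE => Oy; rewrite uw//; exact: subset_closure.
  by exists B' => y Oy; rewrite -uw ?hB'//; exact: subset_closure.
- by exists B => t x i tt Cx; rewrite -uw// bd.
Qed.

Lemma trajectory_shift (k : int) a b u : trajectory a b u ->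
  trajectory (a - k%:~R * T) (b - k%:~R * T) (fun t => u (t + k%:~R * T)).
Proof.
move=> [ev bm [B bd]]; set s := k%:~R * T.
have sub t : a - s <= t <= b - s -> a <= t + s <= b by rewrite lerBlDr lerBrDr.
split.
- move=> x i Cx; apply: eq_evolves (evolves_shift s (ev x i Cx)) => // t _.
  exact: rhs_shift.
- by move=> t /sub; exact: bm.
- by exists B => t x i /sub; exact: bd.
Qed.

Definition global u := (forall b, 0 <= b -> trajectory 0 b u) /\
  (forall t x, 0 <= t -> C x -> in_box (u t x)).

Lemma globalW u a b : 0 <= a -> a <= b -> global u -> trajectory a b u.
Proof. by move=> a0 ab [tu _]; apply: trajectoryW (tu b _) => //; exact: le_trans ab. Qed.

Lemma solution_global (phi : 'rV[R]_n -> 'cV[R]_m) u : Xhat_v Omega v phi ->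
  is_solution Omega d K g phi u -> global u.
Proof.
move=> hphi su; split=> [b b0|t x t0 Cx]; first exact: (solution_trajectory H b0 su).
exact: (solution_in_box H hphi su).
Qed.

Lemma global_shift (k : nat) u : global u -> global (fun t => u (t + k%:R * T)).
Proof.
move=> gu; have T0 := sys_T H; have kT : 0 <= k%:R * T by rewrite mulr_ge0// ltW.
split=> [b b0|t x t0 Cx]; last by apply: gu.2 => //; rewrite addr_ge0.
have := trajectory_shift (Posz k) (globalW kT (_ : k%:R * T <= b + k%:R * T) gu).
rewrite -!pmulrn addrK subrr; apply.
by rewrite lerDr.
Qed.

Lemma global0 : global (fun _ _ => 0).
Proof.
split=> [b _|t x _ _]; last exact: (in_box0 H).
split.
- move=> x i Cx; apply: eq_evolves (evolves_cst 0 b 0) => [|t _].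
    by apply/funext => t; rewrite mxE.
  rewrite rhsE (sys_g0 H _ Cx) !mxE mulr0 subr0 addr0 /spread.
  by under eq_Rintegral do rewrite mulr0; rewrite /Rintegral integral0 mulr0.
- move=> t _ i; under eq_fun do rewrite mxE; exact: bounded_measurable_cst.
- by exists 0 => t x i _ _; rewrite mxE normr0.
Qed.

Lemma global_scaled_order u w (al s : R) : 0 < al <= 1 -> 0 <= s -> global u -> global w ->
  (forall x i, C x -> al * w s x i 0 <= u s x i 0) ->
  forall t x i, s <= t -> C x -> al * w t x i 0 <= u t x i 0.
Proof.
move=> al01 s0 gu gw h t x i st Cx.
apply: (trajectory_scaled_order H al01 (globalW s0 st gu) (globalW s0 st gw)) => //.
  by move=> r y /andP[sr _] Cy; split; [apply: gu.2|apply: gw.2] => //; exact: le_trans sr.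
by rewrite st lexx.
Qed.

Lemma global_order u w s : 0 <= s -> global u -> global w ->
  (forall x i, C x -> w s x i 0 <= u s x i 0) ->
  forall t x i, s <= t -> C x -> w t x i 0 <= u t x i 0.
Proof.
move=> s0 gu gw h t x i st Cx; rewrite -[leLHS]mul1r.
by apply: (global_scaled_order (s := s)) => //; [rewrite ltr01 lexx|move=> y j Cy; rewrite mul1r h].
Qed.

Lemma global_dist : exists2 L : R, 0 < L & forall u w e s, 0 <= e -> 0 <= s -> global u -> global w ->
  (forall x i, C x -> `|u s x i 0 - w s x i 0| <= e) ->
  forall t x i, s <= t -> C x -> `|u t x i 0 - w t x i 0| <= e * expR (L * (t - s)).
Proof.
have [B B0 hB] := in_box_norm H; have [L L0 hL] := trajectory_dist H B.
exists L => // u w e s e0 s0 gu gw h t x i st Cx.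
apply: (hL s t u w e e0 (globalW s0 st gu) (globalW s0 st gw)) => //.
  by move=> r y j /andP[sr _] Cy; split; apply: hB; [apply: gu.2|apply: gw.2] => //; exact: le_trans sr.
by rewrite st lexx.
Qed.

Lemma global_decay : exists2 c : R, 0 < c & forall u s t x i, global u -> 0 <= s <= t -> C x ->
  expR (- (c * (t - s))) * u s x i 0 <= u t x i 0.
Proof.
have [c c0 hc] := trajectory_ge_spread H; exists c => // u s t x i gu /andP[s0 st] Cx.
have tr := globalW s0 st gu.
have bx r y : s <= r <= t -> C y -> in_box (u r y).
  by move=> /andP[sr _] Cy; apply: gu.2 => //; exact: le_trans sr.
apply: (@decay_factor R 1 (fun t _ => u t x i 0) (fun t _ => rhs t (u t) x i 0) c s t ord0 (ltW c0)
  (traj_ev tr i Cx) _ s t); rewrite ?lexx ?st// => r rr.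
apply: le_trans (hc s t u tr bx r x i rr Cx).
rewrite -[leLHS]add0r lerD2r mulr_ge0 ?(ltW (sys_d H i))//.
apply: spread_ge0; first exact: (sys_K H).
have rr' : s <= r <= t by case/andP: rr => *; rewrite !ltW.
by move=> y Oy; case/andP: (bx r y rr' (subset_closure Oy) i).
Qed.

Lemma global_positive tau : 0 < tau -> exists2 kap : R, 0 < kap & forall u s, 0 <= s -> global u ->
  forall x i j, C x -> kap * u s x i 0 <= u (s + tau) x j 0 /\
    kap * amount Omega (fun y => u s y i 0) <= u (s + tau) x j 0.
Proof.
move=> tau0; have [kap kap0 hk] := trajectory_positive H tau0.
exists kap => // u s s0 gu x i j Cx.
have st : s <= s + tau by rewrite lerDl ltW.
apply: hk (globalW s0 st gu) _ x i j Cx => r y /andP[sr _] Cy.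
by apply: gu.2 => //; exact: le_trans sr.
Qed.

Lemma global_time_Lipschitz : exists2 Lam : R, 0 < Lam & forall u s t x i, global u -> 0 <= s -> 0 <= t -> C x ->
  `|u s x i 0 - u t x i 0| <= Lam * `|s - t|.
Proof.
have [Lam Lam0 hLam] := trajectory_time_Lipschitz H; exists Lam => // u s t x i gu s0 t0 Cx.
have b0 : 0 <= Num.max s t by rewrite le_max s0.
apply: (hLam 0 (Num.max s t) u b0 (globalW (lexx 0) b0 gu)) => //.
- by move=> r y /andP[r0 _] Cy; exact: gu.2.
- by rewrite s0 le_max lexx.
- by rewrite t0 le_max lexx orbT.
Qed.

Lemma exists_large_power (eta c : R) : 0 < eta -> exists N : nat, c <= (1 + eta) ^+ N.
Proof.
move=> eta0.
have pw N : 1 + N%:R * eta <= (1 + eta) ^+ N.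
  elim: N => [|N IH]; first by rewrite expr0 mul0r addr0.
  rewrite exprS -natr1 (le_trans _ (ler_wpM2l _ IH)) ?addr_ge0 ?(ltW eta0)//.
  have := mulr_ge0 (mulr_ge0 (ler0n R N) (ltW eta0)) (ltW eta0); lra.
exists (Num.truncn (c / eta)).+1; apply: le_trans (pw _).
have : c / eta < (Num.truncn (c / eta)).+1%:R by exact: Num.Theory.truncnS_gt.
by rewrite ltr_pdivrMr// => /ltW h; rewrite (le_trans h)// lerDr.
Qed.

(** A ratio that grows by the factor 1 + eta in each step, as long as it is at
    most 1 - theta, exceeds 1 - theta after a number of steps that depends on
    the initial ratio only. *)
Lemma ratio_iteration (al0 eta theta : R) : 0 < al0 -> 0 < eta -> 0 < theta < 1 ->
  exists N : nat, forall Q : nat -> R -> Prop,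
  (forall k al al', 0 < al' <= al -> Q k al -> Q k al') -> Q 0%N al0 ->
  (forall k al, 0 < al <= 1 - theta -> Q k al -> Q k.+1 (al * (1 + eta))) -> Q N (1 - theta).
Proof.
move=> al00 eta0 /andP[th0 th1]; have [N hN] := exists_large_power (al0^-1) eta0.
exists N => Q mono Q0 QS; pose al (k : nat) := Num.min (1 - theta) (al0 * (1 + eta) ^+ k).
have alk (k : nat) : 0 < al k <= 1 - theta.
  by rewrite lt_min subr_gt0 th1 mulr_gt0 ?exprn_gt0 ?addr_gt0//= ge_min lexx.
have step (k : nat) : Q k (al k).
  elim: k => [|k IH].
    by apply: mono Q0; rewrite (andP (alk 0%N)).1 ge_min expr0 mulr1 lexx orbT.
  apply: mono (QS k (al k) (alk k) IH); rewrite (andP (alk k.+1)).1/=.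
  rewrite /al minr_pMl ?addr_ge0 ?(ltW eta0)// le_min !ge_min exprSr mulrA lexx orbT andbT.
  by rewrite ler_peMr ?lerDl ?(ltW eta0)// subr_ge0 ltW.
rewrite (_ : 1 - theta = al N)//; apply/esym/min_idPl.
apply: (@le_trans _ _ 1); first by rewrite lerBlDr lerDl ltW.
by rewrite mulrC -ler_pdivrMr// div1r.
Qed.

(** Two global solutions that stay away from 0 become equal in the long run:
    the ratio improves as long as it is smaller than 1. *)
Lemma merging (delta theta : R) : 0 < delta -> 0 < theta < 1 -> exists2 t1 : R, 0 <= t1 & forall u w,
  global u -> global w ->
  (forall t x i, 0 <= t -> C x -> delta <= u t x i 0) ->
  (forall t x i, 0 <= t -> C x -> delta <= w t x i 0) ->
  forall t x i, t1 <= t -> C x -> (1 - theta) * w t x i 0 <= u t x i 0.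
Proof.
move=> del0 th; have /andP[th0 th1] := th.
have [B B0 hB] := in_box_norm H; have [Lam Lam0 hLam] := global_time_Lipschitz.
have [eta [e [r [eta0 e0 r0 himp]]]] := improvement H del0 th ltr01 Lam0.
pose al0 := delta / B; have al00 : 0 < al0 by rewrite divr_gt0.
have [N hN] := ratio_iteration al00 eta0 th.
exists N%:R => // u w gu gw ud wd.
have al01 : 0 < 1 - theta <= 1 by rewrite subr_gt0 th1 lerBlDr lerDl ltW.
have w0 t x i : 0 <= t -> C x -> 0 <= w t x i 0 by move=> t0 Cx; case/andP: (gw.2 t x t0 Cx i).
suff step : forall x i, C x -> (1 - theta) * w N%:R x i 0 <= u N%:R x i 0.
  by move=> t x i Nt Cx; exact: (global_scaled_order al01 (ler0n R N) gu gw step).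
apply: (hN (fun k al => forall x i, C x -> al * w k%:R x i 0 <= u k%:R x i 0)).
- move=> k al al' /andP[_ le] h x i Cx; apply: le_trans (h x i Cx).
  by rewrite ler_wpM2r ?w0.
- move=> x i Cx; apply: (le_trans _ (ud 0 x i (lexx 0) Cx)).
  rewrite -[leRHS](divfK (lt0r_neq0 B0)) ler_pM2l// (le_trans (ler_norm _))// hB//; exact: gw.2.
move=> k al alI IH x i Cx; have [al0' al1'] := andP alI.
have al1 : 0 < al <= 1 by rewrite al0' (le_trans al1')//; case/andP: al01.
have k0 : 0 <= k%:R :> R by [].
have k1 : k%:R <= k%:R + 1 :> R by rewrite lerDl.
have tu := globalW k0 k1 gu; have tw := globalW k0 k1 gw.
have ge t : k%:R <= t <= k%:R + 1 -> 0 <= t by case/andP => h _; exact: le_trans h.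
have := himp k%:R x x u w al Cx Cx _ alI; rewrite subrr normr0 -natr1 => /(_ r0); apply.
- by move=> j; exact: (traj_ev tu).
- by move=> j; exact: (traj_ev tw).
- by move=> t /ge t0; split; [exact: gu.2|exact: gw.2].
- by move=> t j /ge t0; exact: wd.
- by move=> s t j /ge s0 /ge t0; exact: hLam.
- move=> t j tt; have tt' : k%:R <= t <= k%:R + 1 by case/andP: tt => *; rewrite !ltW.
  have b1 := traj_bm tu tt' j; have b2 := traj_bm tw tt' j.
  apply: (@le_trans _ _ (al * (d 0 j * spread Omega (K j t) (fun y => w t y j 0) x))).
    by rewrite gerBl (mulr_ge0 (ltW al0') (ltW e0)).
  rewrite mulrCA ler_pM2l ?(sys_d H)// -(spreadZ oO bO _ x (sys_K H j t) b2).
  apply: (le_spread oO bO x (sys_K H j t) (bounded_measurableZ al b2) b1) => y Oy.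
  apply: (global_scaled_order al1 k0 gu gw IH); first by case/andP: tt'.
  exact: subset_closure.
- by move=> j; exact: IH.
Qed.

End global_solutions.

(** * The solution that starts from the top of the box *)

Section dichotomy.
Context {R : realType} {m n : nat}.
Variables (Omega : set 'rV[R]_n) (d : 'rV[R]_m) (K : 'I_m -> R -> 'rV[R]_n -> R).
Variables (g : R -> 'rV[R]_n -> 'cV[R]_m -> 'cV[R]_m) (v : 'cV[R]_m) (T : R).
Hypothesis H : system Omega d K g v T.

Local Notation C := (closure Omega).
Local Notation in_box := (in_box v).
Local Notation global := (global Omega d K g v).
Implicit Types (t s r e tau a b : R) (x y : 'rV[R]_n) (i j : 'I_m).
Implicit Types (u w : R -> 'rV[R]_n -> 'cV[R]_m).

Let bO := sys_bounded H.
Let cC : compact C := closure_bounded_compact bO.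
Let T0 : 0 < T := sys_T H.

Lemma Xhat_v_v : Xhat_v Omega v (fun=> v).
Proof.
split; last by move=> x _; apply/order_intervalE; exact: (in_box_v H).
split=> [i|]; first exact: measurable_cst.
by apply: (@le_lt_trans _ _ `|v|%:E); [apply/supnorm_le|rewrite ltry].
Qed.

Variable U : R -> 'rV[R]_n -> 'cV[R]_m.
Hypothesis gU : global U.
Hypothesis U0 : forall x, C x -> U 0 x = v.

Let kT_ge0 (k : nat) : 0 <= k%:R * T. Proof. by rewrite mulr_ge0// ltW. Qed.

Lemma U_periodwise_decreasing (k l : nat) t x i : (k <= l)%N -> 0 <= t -> C x ->
  U (t + l%:R * T) x i 0 <= U (t + k%:R * T) x i 0.
Proof.
move=> kl t0 Cx; rewrite -(subnK kl) natrD mulrDl addrA -[X in X + k%:R * T]addrC.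
have gs := global_shift H (l - k) gU.
have : forall s x i, 0 <= s -> C x -> U (s + (l - k)%:R * T) x i 0 <= U s x i 0.
  move=> s y j s0 Cy; apply: (global_order H (lexx 0) gU gs _ j s0 Cy) => z p Cz.
  rewrite (U0 Cz) add0r; by case/andP: (gU.2 _ z (kT_ge0 (l - k)) Cz p).
move=> h; rewrite addrC addrAC; exact: (h (t + k%:R * T) x i (addr_ge0 t0 (kT_ge0 k)) Cx).
Qed.

Definition persistent := exists2 delta : R, 0 < delta &
  forall t x i, 0 <= t -> C x -> delta <= U t x i 0.

Definition extinct := forall e, 0 < e -> exists2 t1 : R, 0 <= t1 &
  forall t x i, t1 <= t -> C x -> U t x i 0 <= e.

Lemma period_decompose t : 0 <= t -> exists (k : nat) s, [/\ 0 <= s, s < T & t = s + k%:R * T].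
Proof.
move=> t0; pose k := Num.truncn (t / T).
have tT : 0 <= t / T by rewrite divr_ge0// ltW.
have /andP[h1 h2] := Num.Theory.truncn_itv tT.
exists k, (t - k%:R * T); rewrite subr_ge0 -ler_pdivlMr// h1 subrK; split=> //.
by rewrite ltrBlDr -[X in X + _]mul1r -mulrDl -ltr_pdivrMr// addrC natr1.
Qed.

(** A pointwise lower bound at one point propagates to a neighbourhood by
    comparison of the curves at neighbouring points, which have the same start,
    and then to the whole domain. *)
Lemma persistent_of_point x0 i0 e : C x0 -> 0 < e ->
  (forall k : nat, e <= U (k%:R * T) x0 i0 0) -> persistent.
Proof.
move=> Cx0 e0 he.
have [kap kap0 hkap] := global_positive H T0.
have [c c0 hc] := global_decay H.
have [Lam Lam0 hLam] := global_time_Lipschitz H.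
have [B B0 hB] := in_box_norm H.
pose E := expR (- (c * T)); have E0 : 0 < E by exact: expR_gt0.
have all_times (N : R) x : C x -> 0 <= N -> (forall (k : nat) j, N <= U (k%:R * T) x j 0) ->
    forall t j, 0 <= t -> E * N <= U t x j 0.
  move=> Cx N0 hN t j t0; have [k [s [s0 sT tE]]] := period_decompose t0.
  have kt : 0 <= k%:R * T <= t by rewrite kT_ge0 tE lerDr.
  apply: le_trans (hc U _ t x j gU kt Cx); apply: ler_pM; rewrite ?expR_ge0// ?hN//.
  by rewrite ler_expR lerN2 ler_pM2l// tE addrK ltW.
have nat_times (N : R) x : C x -> (forall (k : nat) j, N <= U (k.+1%:R * T) x j 0) ->
    forall (k : nat) j, N <= U (k%:R * T) x j 0.
  move=> Cx hN k j; apply: (le_trans (hN k j)).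
  have := @U_periodwise_decreasing k k.+1 0 x j (leqnSn k) (lexx 0) Cx.
  by rewrite !add0r.
have kS (k : nat) : k.+1%:R * T = k%:R * T + T by rewrite -natr1 mulrDl mul1r.
have h1 : forall (k : nat) j, kap * e <= U (k%:R * T) x0 j 0.
  apply: nat_times => // k j; rewrite kS.
  apply: le_trans (hkap U _ (kT_ge0 k) gU x0 i0 j Cx0).1.
  by rewrite ler_pM2l.
pose delta := E * (kap * e); have del0 : 0 < delta by rewrite !mulr_gt0.
have h2 : forall t j, 0 <= t -> delta <= U t x0 j 0.
  by apply: all_times => //; rewrite mulr_ge0 ?ltW.
have th : 0 < (1 / 2 : R) < 1 by lra.
have [eta [e1 [r1 [eta0 e10 r10 himp]]]] := improvement H del0 th T0 Lam0.
have [r2 r20 hr2] := influx_modulus_ge0 H (ltW B0) (divr_gt0 e10 (ltr0n R 2)).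
pose r := Num.min r1 r2; have r0 : 0 < r by rewrite lt_min r10.
have h3 x : C x -> `|x0 - x| < r -> forall (k : nat) j, (1 / 2) * U (k%:R * T) x0 j 0 <= U (k%:R * T) x j 0.
  move=> Cx; rewrite lt_min => /andP[xr1 xr2]; elim=> [|k IH] j.
    rewrite mul0r !U0// ler_piMl ?(ltW (sys_v H j))//; lra.
  have k0 := kT_ge0 k; have k1 : k%:R * T <= k%:R * T + T by rewrite lerDl ltW.
  have tU := globalW k0 k1 gU.
  have ge t : k%:R * T <= t <= k%:R * T + T -> 0 <= t by case/andP => h _; exact: le_trans h.
  have al12 : 0 < (1 / 2 : R) <= 1 - 1 / 2 by lra.
  have h := himp (k%:R * T) x0 x U U (1 / 2) Cx0 Cx xr1 al12.
  rewrite kS; apply: (@le_trans _ _ (1 / 2 * (1 + eta) * U (k%:R * T + T) x0 j 0)).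
    have /andP[U1 _] := gU.2 _ x0 (addr_ge0 k0 (ltW T0)) Cx0 j.
    by rewrite ler_wpM2r// ler_peMr ?lerDl ?(ltW eta0)//; lra.
  apply: h.
  - by move=> p; exact: (traj_ev tU).
  - by move=> p; exact: (traj_ev tU).
  - by move=> t /ge t0; split; exact: gU.2.
  - by move=> t p /ge t0; exact: h2.
  - by move=> s t p /ge s0 /ge t0; exact: hLam.
  - move=> t p tt; have tt' : k%:R * T <= t <= k%:R * T + T by case/andP: tt => *; rewrite !ltW.
    have Ub y : Omega y -> 0 <= U t y p 0 <= B.
      move=> Oy; have UM := gU.2 t y (ge t tt') (subset_closure Oy); have /andP[-> _] := UM p.
      by rewrite (le_trans (ler_norm _))// hB.
    have S0 : 0 <= d 0 p * spread Omega (K p t) (fun y => U t y p 0) x0.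
      rewrite mulr_ge0 ?(ltW (sys_d H p))//; apply: spread_ge0; first exact: (sys_K H).
      by move=> y /Ub/andP[].
    by have := hr2 p t x0 x _ Cx0 Cx xr2 Ub; move: S0; lra.
  - by move=> p; exact: IH.
have [c1 c10 hc1] := mass_ge_cst H Cx0 r0.
have Uge (k : nat) y j : C y -> 0 <= U (k%:R * T) y j 0.
  by move=> Cy; case/andP: (gU.2 _ y (kT_ge0 k) Cy j).
have bm (k : nat) j : bounded_measurable Omega (fun y => U (k%:R * T) y j 0).
  by apply: (traj_bm (gU.1 (k%:R * T) (kT_ge0 k))); rewrite kT_ge0 lexx.
have h4 (k : nat) j : c1 * (1 / 2 * (kap * e)) <= amount Omega (fun y => U (k%:R * T) y j 0).
  have Ug y : Omega y -> 0 <= U (k%:R * T) y j 0 by move=> Oy; apply: Uge; exact: subset_closure.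
  apply: (@le_trans _ _ (mass Omega x0 r (fun y => U (k%:R * T) y j 0))); last exact: (mass_le_amount H).
  apply: hc1 => //; first by rewrite !mulr_ge0// ltW.
  move=> y Oy; rewrite -ball_normE/= => yr.
  apply: le_trans (h3 y (subset_closure Oy) yr k j).
  by rewrite ler_pM2l ?h1//; lra.
pose N := kap * (c1 * (1 / 2 * (kap * e))).
have N0 : 0 < N by rewrite !mulr_gt0//; lra.
exists (E * N); first by rewrite mulr_gt0.
move=> t x i t0 Cx; apply: all_times => //; first exact: ltW.
apply: nat_times => // k j; rewrite kS.
apply: le_trans (hkap U _ (kT_ge0 k) gU x i0 j Cx).2.
by rewrite ler_pM2l.
Qed.

Lemma U_space_modulus t e : 0 <= t -> 0 < e -> exists2 r : R, 0 < r & forall x x' i, C x -> C x' ->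
  `|x - x'| < r -> `|U t x i 0 - U t x' i 0| <= e.
Proof.
move=> t0 e0; have [L1 L10 hmod] := trajectory_space_modulus H.
have A0 : 0 <= t * expR (L1 * t) by rewrite mulr_ge0// expR_ge0.
have [e' e'0 he'] := small_factor A0 e0.
have [r r0 hr] := hmod _ e'0; exists r => // x x' i Cx Cx' xx'.
have h0 j : `|U 0 x j 0 - U 0 x' j 0| <= 0 by rewrite !U0// subrr normr0.
have bx s y : 0 <= s <= t -> C y -> in_box (U s y) by move=> /andP[s0 _]; exact: gU.2.
have tI : 0 <= t <= t by rewrite t0 lexx.
have := hr 0 t U x x' 0 (gU.1 t t0) bx Cx Cx' xx' (lexx 0) h0 t i tI.
by rewrite add0r subr0 => /le_trans; apply; rewrite -mulrA mulrC.
Qed.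

(** If U does not persist, every component at every point becomes small at some
    multiple of the period and remains so; since U is equicontinuous in space,
    finitely many points settle the matter for all. *)
Lemma dichotomy : persistent \/ extinct.
Proof.
have [[x0 [i0 [e [Cx0 e0 he]]]]|nex] := pselect (exists x0 i0 e, [/\ C x0, 0 < e &
    forall k : nat, e <= U (k%:R * T) x0 i0 0]).
  by left; exact: (persistent_of_point Cx0 e0 he).
right; have [L L0 hL] := global_dist H.
suff key e : 0 < e -> exists k : nat, forall x i, C x -> U (k%:R * T) x i 0 <= e.
  move=> e e0; pose e' := e / expR (L * T).
  have e'0 : 0 < e' by rewrite divr_gt0// expR_gt0.
  have [k hk] := key e' e'0; exists (k%:R * T) => // t x i kt Cx.
  have t0 : 0 <= t - k%:R * T by rewrite subr_ge0.
  have [l [s [s0 sT tE]]] := period_decompose t0.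
  have t1 : 0 <= s + k%:R * T by rewrite addr_ge0.
  have -> : t = s + (k + l)%:R * T by rewrite -(subrK (k%:R * T) t) tE natrD mulrDl addrA addrAC.
  apply: (le_trans (U_periodwise_decreasing i (leq_addr l k) s0 Cx)).
  have ks : k%:R * T <= s + k%:R * T by rewrite lerDr.
  have := hL U (fun _ _ => 0) e' (k%:R * T) (ltW e'0) (kT_ge0 k) gU (global0 H) _ _ x i ks Cx.
  rewrite mxE subr0 addrK => h; apply: (le_trans (ler_norm _)); apply: (le_trans (h _)).
    move=> y j Cy; rewrite mxE subr0 ger0_norm ?hk//.
    by case/andP: (gU.2 _ y (kT_ge0 k) Cy j).
  rewrite -[leRHS](divfK (lt0r_neq0 (expR_gt0 (L * T)))) ler_pM2l// ler_expR ler_pM2l//.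
  exact: ltW.
move=> e0; have e2 : 0 < e / 2 by rewrite divr_gt0.
have exk x : exists k : nat, C x -> forall i, U (k%:R * T) x i 0 <= e / 2.
  have [Cx|nCx] := pselect (C x); last by exists 0%N.
  have exki i : exists k : nat, U (k%:R * T) x i 0 <= e / 2.
    have [//|nk] := pselect (exists k : nat, U (k%:R * T) x i 0 <= e / 2).
    exfalso; apply: nex; exists x, i, (e / 2); split => // k.
    by rewrite leNgt; apply/negP => h; apply: nk; exists k; exact: ltW.
  have [k hk] := choice exki; exists (\max_i k i)%N => _ i.
  have := @U_periodwise_decreasing (k i) (\max_j k j)%N 0 x i (leq_bigmax i) (lexx 0) Cx.
  by rewrite !add0r => /le_trans; apply.
have [k hk] := choice exk.
have exr x : exists r : R, C x -> 0 < r /\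
    forall x' i, C x' -> `|x - x'| < r -> U ((k x)%:R * T) x' i 0 <= e.
  have [r r0 hr] := U_space_modulus (kT_ge0 (k x)) e2; exists r => Cx; split=> // x' i Cx' xx'.
  have := hr x x' i Cx Cx' xx'; have := hk x Cx i; rewrite ler_norml => h3 /andP[h4 _].
  by move: h3 h4; lra.
have [r hr] := choice exr.
have [|s sC hs] := @compact_finite_ball_cover R 'rV[R]_n C r cC; first by move=> x /hr[].
exists (\max_(x <- s) k x)%N => x i Cx; have [x' x's xx'] := hs x Cx.
have kk : (k x' <= \max_(x <- s) k x)%N by exact: leq_bigmax_seq.
have := U_periodwise_decreasing i kk (lexx 0) Cx; rewrite !add0r => /le_trans; apply.
apply: (hr x' (sC x' x's)).2 => //.
by move: xx'; rewrite -ball_normE.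
Qed.

End dichotomy.

(** * The periodic limit *)

Section periodic_limit.
Context {R : realType} {m n : nat}.
Variables (Omega : set 'rV[R]_n) (d : 'rV[R]_m) (K : 'I_m -> R -> 'rV[R]_n -> R).
Variables (g : R -> 'rV[R]_n -> 'cV[R]_m -> 'cV[R]_m) (v : 'cV[R]_m) (T : R).
Hypothesis H : system Omega d K g v T.

Local Notation C := (closure Omega).
Local Notation in_box := (in_box v).
Local Notation trajectory := (trajectory Omega d K g).
Local Notation global := (global Omega d K g v).
Implicit Types (t s r e tau a b : R) (x y : 'rV[R]_n) (i j : 'I_m).
Implicit Types (u w : R -> 'rV[R]_n -> 'cV[R]_m).

Let T0 : 0 < T := sys_T H.
Let kT_ge0 (k : nat) : 0 <= k%:R * T. Proof. by rewrite mulr_ge0// ltW. Qed.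

Lemma global_solution u : global u -> (forall t, 0 <= t -> lebesgue_measurable C (u t)) ->
  is_solution Omega d K g (u 0) u.
Proof.
move=> gu mu; have [B B0 hB] := in_box_norm H; have [Lam Lam0 hLam] := global_time_Lipschitz H.
split=> //.
- move=> t t0; split; first exact: mu.
  apply: (@le_lt_trans _ _ B%:E); last exact: ltry.
  by apply/supnorm_le => x Cx; apply/col_norm_le; [exact: ltW|exact: hB (gu.2 t x t0 Cx)].
- move=> t t0; apply/(supnorm_cvg0 _ (closure_nonempty H)) => e e0; rewrite near_withinE.
  apply/nbhs_ballP; exists (e / Lam); first by rewrite /= divr_gt0.
  move=> s; rewrite -ball_normE/= => st s0 x Cx; apply/col_norm_le; [exact: ltW|move=> k].
  rewrite mxE [X in _ + X]mxE (le_trans (hLam u s t x k gu s0 t0 Cx))//.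
  by rewrite distrC mulrC -ler_pdivlMr// ltW.
- move=> t x t0 Cx; apply: is_derive_col => i.
  have t10 : 0 <= t + 1 by rewrite addr_ge0// ltW.
  by apply: (traj_ev (gu.1 (t + 1) t10) i Cx).2; rewrite t0 ltrDl ltr01.
Qed.

Lemma late (t1 t : R) : exists N : nat, t1 <= t + N%:R * T.
Proof.
exists (Num.truncn ((t1 - t) / T)).+1; rewrite -lerBlDl -ler_pdivrMr//.
exact/ltW/Num.Theory.truncnS_gt.
Qed.

Lemma periodic_nat w : (forall t x, C x -> w (t + T) x = w t x) ->
  forall (k : nat) t x, C x -> w (t + k%:R * T) x = w t x.
Proof.
move=> pw k t x Cx; elim: k => [|k IH]; first by rewrite mul0r addr0.
by rewrite -natr1 mulrDl mul1r addrA pw.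
Qed.

(** Shift the interval into the half-line by a multiple of the period. *)
Lemma periodic_trajectory w a b : (forall t x, C x -> w (t + T) x = w t x) -> global w -> a <= b ->
  trajectory a b w.
Proof.
move=> pw gw ab; have [N hN] := late 0 a.
have := trajectory_shift H (Posz N) (globalW hN (_ : a + N%:R * T <= b + N%:R * T) gw).
rewrite -!pmulrn !addrK lerD2r => /(_ ab).
by apply: eq_trajectory => t x _ Cx; rewrite periodic_nat.
Qed.

Lemma periodic_Lipschitz w : global w -> (forall t x, C x -> w (t + T) x = w t x) ->
  exists2 Lam : R, 0 < Lam & forall s t x i, C x -> `|w s x i 0 - w t x i 0| <= Lam * `|s - t|.
Proof.
move=> gw pw; have [Lam Lam0 hLam] := global_time_Lipschitz H; exists Lam => // s t x i Cx.
have [N1 h1] := late 0 s; have [N2 h2] := late 0 t.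
pose N := maxn N1 N2; have le (N' : nat) r : (N' <= N)%N -> 0 <= r + N'%:R * T -> 0 <= r + N%:R * T.
  by move=> hN h; apply: (le_trans h); rewrite lerD2l ler_wpM2r ?(ltW T0)// ler_nat.
have := hLam w (s + N%:R * T) (t + N%:R * T) x i gw (le N1 s (leq_maxl _ _) h1) (le N2 t (leq_maxr _ _) h2) Cx.
by rewrite !(periodic_nat pw)// opprD addrACA subrr addr0.
Qed.

Variable U : R -> 'rV[R]_n -> 'cV[R]_m.
Hypothesis gU : global U.
Hypothesis U0 : forall x, C x -> U 0 x = v.
Hypothesis mU : forall t, 0 <= t -> lebesgue_measurable C (U t).

Record periodic_limit (delta : R) w : Prop := PeriodicLimit {
  limit_global : global w ;
  limit_periodic : forall t x, C x -> w (t + T) x = w t x ;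
  limit_box : forall t x, C x -> in_box (w t x) ;
  limit_ge : forall t x i, C x -> delta <= w t x i 0 ;
  limit_continuous : forall t x e, C x -> 0 < e -> exists2 r : R, 0 < r &
    forall x' i, C x' -> `|x - x'| < r -> `|w t x i 0 - w t x' i 0| <= e ;
  limit_attracts : forall e, 0 < e -> exists2 t1 : R, 0 <= t1 & forall t x i,
    t1 <= t -> C x -> `|w t x i 0 - U t x i 0| <= e }.

(** U and its shift by a multiple of the period merge, so U(t + k T) is a Cauchy
    sequence.  The solution that starts from the limit follows U(. + k T) on
    bounded times, hence is the limit. *)
Lemma persistent_limit : persistent Omega U -> exists delta w, 0 < delta /\ periodic_limit delta w.
Proof.
move=> [delta del0 hdel]; have [B B0 hB] := in_box_norm H.
have cau e : 0 < e -> exists2 t1 : R, 0 <= t1 & forall (k : nat) t x i, t1 <= t -> C x ->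
    `|U (t + k%:R * T) x i 0 - U t x i 0| <= e.
  move=> e0; pose th := Num.min (1 / 2) (e / B).
  have th01 : 0 < th < 1 by rewrite lt_min divr_gt0//= divr_gt0//= gt_min; apply/orP; left; lra.
  have [th0 th1] := andP th01.
  have [t1 t10 h] := merging H del0 th01; exists t1 => // k t x i tt Cx.
  have gs := global_shift H k gU.
  have t0 : 0 <= t by exact: le_trans tt.
  have hs s y j : 0 <= s -> C y -> delta <= U (s + k%:R * T) y j 0.
    by move=> s0 Cy; apply: hdel => //; rewrite addr_ge0.
  have h1 := h _ _ gU gs hdel hs t x i tt Cx; have h2 := h _ _ gs gU hs hdel t x i tt Cx.
  have bnd s : 0 <= s -> th * U s x i 0 <= e.
    move=> s0; have /andP[p0 _] := gU.2 s x s0 Cx i.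
    apply: (@le_trans _ _ (e / B * B)); last by rewrite divfK// gt_eqF.
    apply: ler_pM => //; [exact: ltW|by rewrite ge_min lexx orbT|].
    by rewrite (le_trans (ler_norm _))// hB//; exact: gU.2.
  have h3 := bnd t t0; have h4 := bnd (t + k%:R * T) (addr_ge0 t0 (kT_ge0 k)).
  move: h1 h2; rewrite /= !mulrBl !mul1r ler_norml => h1 h2.
  by apply/andP; split; move: h1 h2 h3 h4; lra.
pose w t x : 'cV[R]_m := \col_i limn (fun k : nat => U (t + k%:R * T) x i 0).
have cvw t x i : C x -> (fun k : nat => U (t + k%:R * T) x i 0) @ \oo --> w t x i 0.
  move=> Cx; rewrite mxE; apply/cauchy_cvgP/cauchy_exP => e e0.
  have e2 : 0 < e / 2 by rewrite divr_gt0.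
  have [t1 t10 h] := cau _ e2; have [N hN] := late t1 t.
  exists (U (t + N%:R * T) x i 0), N => // k /= Nk; rewrite -ball_normE/= distrC.
  have := h (k - N)%N _ x i hN Cx; rewrite -addrA -mulrDl -natrD subnKC//.
  by move/le_lt_trans; apply; rewrite ltr_pdivrMr// mulr_natr mulr2n ltrDl.
have rate e : 0 < e -> exists2 t1 : R, 0 <= t1 & forall t x i, t1 <= t -> C x ->
    `|w t x i 0 - U t x i 0| <= e.
  move=> e0; have [t1 t10 h] := cau e e0; exists t1 => // t x i tt Cx.
  have hc : (fun k : nat => `|U (t + k%:R * T) x i 0 - U t x i 0|) @ \oo --> `|w t x i 0 - U t x i 0|.
    by apply: cvg_norm; apply: cvgB; [exact: cvw|exact: cvg_cst].
  by apply: (cvgr_to_le hc); apply: nearW => k; exact: h.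
have pw t x : C x -> w (t + T) x = w t x.
  move=> Cx; apply/colP => i; have h1 := cvw (t + T) x i Cx.
  have h2 : (fun k : nat => U (t + T + k%:R * T) x i 0) @ \oo --> w t x i 0.
    have : (fun k : nat => U (t + (k + 1)%N%:R * T) x i 0) @ \oo --> w t x i 0.
      by have := cvw t x i Cx; rewrite -(cvg_shiftn 1).
    by under eq_fun do rewrite natrD mulrDl mul1r [_ + T]addrC addrA.
  exact: (cvg_unique _ h1 h2).
have box0 t x : 0 <= t -> C x -> forall i, delta <= w t x i 0 /\ 0 <= w t x i 0 <= v i 0.
  move=> t0 Cx i; have hc := cvw t x i Cx.
  have bk (k : nat) : delta <= U (t + k%:R * T) x i 0 /\ 0 <= U (t + k%:R * T) x i 0 <= v i 0.
    have h0 : 0 <= t + k%:R * T by rewrite addr_ge0.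
    by split; [exact: hdel|exact: gU.2].
  have h1 : delta <= w t x i 0 by apply: (cvgr_to_ge hc); apply: nearW => k; case: (bk k).
  split=> //; rewrite (le_trans (ltW del0) h1)/=.
  by apply: (cvgr_to_le hc); apply: nearW => k; case: (bk k) => _ /andP[].
have mw : lebesgue_measurable C (w 0).
  move=> i; apply: (@measurable_fun_cvg _ (lebesgue_type R n) R C (fun (k : nat) x => U (0 + k%:R * T) x i 0)).
    by move=> k; apply: mU; rewrite add0r.
  by move=> x Cx; exact: cvw.
have Xw : Xhat_v Omega v (w 0).
  split; last by move=> x Cx; apply/order_intervalE => i; exact: (box0 0 x (lexx 0) Cx i).2.
  split=> //; apply: (@le_lt_trans _ _ B%:E); last exact: ltry.
  by apply/supnorm_le => x Cx; apply/col_norm_le => [|i]; [exact: ltW|apply: hB => j; exact: (box0 0 x (lexx 0) Cx j).2].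
have [w0 [sw0 w0M]] := existence H Xw.
have gw0 := solution_global H Xw sw0.
have [L L0 hL] := global_dist H.
have w0E t x : 0 <= t -> C x -> w0 t x = w t x.
  move=> t0 Cx; apply/colP => i.
  suff h : (fun k : nat => U (t + k%:R * T) x i 0) @ \oo --> w0 t x i 0.
    exact: (cvg_unique _ h (cvw t x i Cx)).
  apply/cvgrPdist_le => e e0; have X0 : 0 < expR (L * t) by exact: expR_gt0.
  have [t1 t10 h] := rate (e / expR (L * t)) (divr_gt0 e0 X0); have [N hN] := late t1 0.
  exists N => // k /= Nk; have gs := global_shift H k gU.
  have := hL w0 _ (e / expR (L * t)) 0 (ltW (divr_gt0 e0 X0)) (lexx 0) gw0 gs _ t x i t0 Cx.
  rewrite subr0 divfK ?gt_eqF//; apply => y j Cy.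
  rewrite (solution_initial sw0 Cy).
  have tk : t1 <= 0 + k%:R * T by rewrite (le_trans hN)// lerD2l ler_wpM2r ?(ltW T0)// ler_nat.
  by have := h _ y j tk Cy; rewrite (periodic_nat pw k 0 Cy).
have boxR t x : C x -> forall i, delta <= w t x i 0 /\ 0 <= w t x i 0 <= v i 0.
  move=> Cx; have [N hN] := late 0 t; rewrite -(periodic_nat pw N t Cx); exact: box0.
have gw : global w.
  split=> [b b0|t x t0 Cx i]; last exact: (boxR t x Cx i).2.
  by apply: eq_trajectory (gw0.1 b b0) => t x /andP[t0 _]; exact: w0E.
exists delta, w; split; first exact: del0.
refine (@PeriodicLimit delta w gw pw _ _ _ rate).
- by move=> t x Cx i; exact: (boxR t x Cx i).2.
- by move=> t x i Cx; exact: (boxR t x Cx i).1.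
- move=> t x e Cx e0; have e3 : 0 < e / 3 by rewrite divr_gt0.
  have [t1 t10 h] := rate _ e3; have [N hN] := late t1 t.
  have [r r0 hr] := U_space_modulus H gU U0 (le_trans t10 hN) e3.
  exists r => // x' i Cx' xx'; rewrite -(periodic_nat pw N t Cx) -(periodic_nat pw N t Cx').
  have h1 := h _ x i hN Cx; have h2 := h _ x' i hN Cx'; have h3 := hr x x' i Cx Cx' xx'.
  move: h1 h2 h3; rewrite !ler_norml => /andP[h1 h1'] /andP[h2 h2'] /andP[h3 h3'].
  by apply/andP; split; lra.
Qed.

End periodic_limit.

(** * The linearization at 0 *)

Section linearization.
Context {R : realType} {m n : nat}.
Variables (Omega : set 'rV[R]_n) (d : 'rV[R]_m) (K : 'I_m -> R -> 'rV[R]_n -> R).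
Variables (g : R -> 'rV[R]_n -> 'cV[R]_m -> 'cV[R]_m) (v : 'cV[R]_m) (T : R).
Hypothesis H : system Omega d K g v T.

Local Notation C := (closure Omega).
Local Notation in_box := (in_box v).
Local Notation rhs := (nonlinear_rhs Omega d K g).
Implicit Types (t s r e a b : R) (x y : 'rV[R]_n) (i j : 'I_m).
Implicit Types (phi psi : 'rV[R]_n -> 'cV[R]_m) (u w : R -> 'rV[R]_n -> 'cV[R]_m).

Let oO := sys_open H.
Let bO := sys_bounded H.
Let cC : compact C := closure_bounded_compact bO.

Definition linear_rate t phi x i := d 0 i * spread Omega (K i t) (fun y => phi y i 0) x
  - d 0 i * phi x i 0 + \sum_j partial g i j t x 0 * phi x j 0.

Lemma linear_rhsE t phi x i : linear_rhs Omega d K g t phi x i 0 = linear_rate t phi x i.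
Proof.
rewrite /linear_rhs mxE [X in _ + X]mxE mxE !mul_diag_mx !mxE; congr (_ + _).
by apply: eq_bigr => j _; rewrite mxE.
Qed.

Lemma linB t phi psi x i : slice_bm Omega phi -> slice_bm Omega psi ->
  linear_rate t (fun y => phi y - psi y) x i = linear_rate t phi x i - linear_rate t psi x i.
Proof.
move=> b1 b2; rewrite /linear_rate.
under [X in spread _ _ X _]eq_fun do rewrite !mxE.
rewrite (spreadB oO bO x (sys_K H i t) (b1 i) (b2 i)) !mxE.
under eq_bigr do rewrite !mxE mulrBr.
rewrite sumrB; ring.
Qed.

Lemma linZ (c : R) t phi x i : slice_bm Omega phi ->
  linear_rate t (fun y => c *: phi y) x i = c * linear_rate t phi x i.
Proof.
move=> b1; rewrite /linear_rate.
under [X in spread _ _ X _]eq_fun do rewrite !mxE.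
rewrite (spreadZ oO bO c x (sys_K H i t) (b1 i)) !mxE.
under eq_bigr do rewrite !mxE mulrCA.
by rewrite -mulr_sumr; ring.
Qed.

Lemma rhs_le_lin t phi x i : C x -> in_box (phi x) -> rhs t phi x i 0 <= linear_rate t phi x i.
Proof. by move=> Cx pM; rewrite rhsE /linear_rate lerD2l (reaction_le_linear H). Qed.

Lemma slice_bmB phi psi : slice_bm Omega phi -> slice_bm Omega psi ->
  slice_bm Omega (fun y => phi y - psi y).
Proof.
by move=> h1 h2 i; under eq_fun do rewrite !mxE; exact: bounded_measurableB.
Qed.

Lemma slice_bmZ (c : R) phi : slice_bm Omega phi -> slice_bm Omega (fun y => c *: phi y).
Proof. by move=> h i; under eq_fun do rewrite !mxE; exact: bounded_measurableZ. Qed.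

(** The linearization at 0 is cooperative, so the comparison principle applies. *)
Lemma linear_ge0 a b (z : R -> 'rV[R]_n -> 'cV[R]_m) (dz : R -> 'rV[R]_n -> 'I_m -> R) (B : R) :
  (forall t, a <= t <= b -> slice_bm Omega (z t)) ->
  (forall t x i, a <= t <= b -> C x -> - B <= z t x i 0) ->
  (forall x i, C x -> evolves a b (fun t => z t x i 0) (fun t => dz t x i)) ->
  (forall t x i, a < t < b -> C x -> linear_rate t (z t) x i <= dz t x i) ->
  (forall x i, C x -> 0 <= z a x i 0) ->
  forall t x i, a <= t <= b -> C x -> 0 <= z t x i 0.
Proof.
move=> bm bd ev ineq z0 t x i tab Cx.
have [L L0 hL] := partial_bounded H 0.
pose M := dmax d + L * m%:R.
have M0 : 0 < M by rewrite ltr_wpDl ?(dmax_ge0 H)// mulr_gt0// ltr0n (sys_m H).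
refine (@comparison_principle R ('rV[R]_n * 'I_m)%type [set p | C p.1] a b
  (fun t p => z t p.1 p.2 0) (fun t p => dz t p.1 p.2) M B M0 _ _ _ _ t (x, i) tab Cx).
- by move=> [y j] /= Cy; exact: ev.
- by move=> [y j] /= Cy; exact: z0.
- by move=> s [y j] sab /= Cy; exact: bd.
move=> N s [y j] sab /= Cy N0 hN neg.
have sab' : a <= s <= b by case/andP: sab => *; rewrite !ltW.
apply: le_trans (ineq s y j sab Cy); rewrite /linear_rate.
have hS : - N <= spread Omega (K j s) (fun y => z s y j 0) y.
  have hy y' : Omega y' -> - N <= z s y' j 0.
    by move=> Oy'; exact: (hN (y', j) (subset_closure Oy')).
  exact: (spread_ge_cst H y (sys_K H j s) (sys_K1 H j s) (bm s sab' j) N0 hy).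
have hsum : - (L * m%:R * N) <= \sum_k partial g j k s y 0 * z s y k 0.
  have -> : - (L * m%:R * N) = \sum_(k < m) - (L * N).
    by rewrite sumr_const card_ord -[RHS]mulr_natr; ring.
  have p0 : in_box 0 by exact: (in_box0 H).
  have z00 q : `|(0 : 'cV[R]_m) q 0| <= 0 by rewrite mxE normr0.
  apply: ler_sum => k _; have hp := hL s y 0 j k Cy z00.
  have [->|kj] := eqVneq k j.
    have : `|partial g j j s y 0 * z s y j 0| <= L * N.
      rewrite normrM; apply: ler_pM; [exact: normr_ge0|exact: normr_ge0|exact: hL|].
      by rewrite ltr0_norm// lerNl; exact: (hN (y, j)).
    by rewrite ler_norml => /andP[].
  have pk0 : 0 <= partial g j k s y 0.
    by apply: (sys_coop H _ Cy p0); rewrite eq_sym.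
  rewrite ger0_norm// in hp.
  have h1 := ler_wpM2l pk0 (hN (y, k) Cy); have h2 := ler_wpM2r N0 hp.
  by apply: le_trans h1; rewrite mulrN lerN2.
have d0 := sys_d H j; have dle := d_le_dmax H j.
have h1 := ler_wpM2l (ltW d0) hS; have h2 := ler_wpM2r N0 dle.
have h3 : 0 <= - (d 0 j * z s y j 0) by rewrite oppr_ge0 mulr_ge0_le0 ?ltW.
by rewrite /M mulrDl; lra.
Qed.

Variable Phi : R -> R -> ('rV[R]_n -> 'cV[R]_m) -> 'rV[R]_n -> 'cV[R]_m.
Hypothesis hPhi : generated_evolution_family Omega d K g Phi.

Lemma Xspace_bounded phi : Xspace Omega phi -> exists B : R, forall x, C x -> `|phi x| <= B.
Proof.
move=> cphi; have /ex_strict_bound_gt0[B _ /= hB] : bounded_set (phi @` C).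
  exact/compact_bounded/continuous_compact.
by exists B => x Cx; apply/ltW/hB; exists x.
Qed.

Lemma Xspace_slice_bm phi : Xspace Omega phi -> slice_bm Omega phi.
Proof.
move=> cphi i; have [B hB] := Xspace_bounded cphi; split.
  apply: within_continuous_measurable; first exact: open_lebesgue_measurable.
  apply/(@within_continuous_ballP R) => x Ox e e0.
  have [r r0 hr] := (within_continuous_ballP C phi).1 cphi x (subset_closure Ox) e e0.
  exists r => // y Oy xy; have := hr y (subset_closure Oy) xy.
  by move=> /(col_norm_lt _ e0)/(_ i); rewrite !mxE.
exists `|B| => y Oy; apply: (col_norm_le _ (normr_ge0 B)).1 i.
by rewrite (le_trans (hB y (subset_closure Oy)))// ler_norm.
Qed.

Lemma Phi_bounded s b phi : s <= b -> Xspace Omega phi ->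
  exists B : R, forall t x, s <= t <= b -> C x -> `|Phi t s phi x| <= B.
Proof.
move=> sb Xphi; apply: uniformly_bounded_of_local => t /andP[st tb].
  exact: Xspace_bounded (evolution_X hPhi st Xphi).
have /(supnorm_cvg0 _ (closure_nonempty H))/(_ 1 ltr01) := evolution_continuous hPhi st Xphi.
rewrite near_withinE => /nbhs_ballP[e /= e0 he]; exists e => // r /andP[sr rb] tr x Cx.
apply: (he (r, s) _ sr x Cx); split=> //=; exact: ballxx.
Qed.

Lemma Phi_evolves s b phi x i : s <= b -> Xspace Omega phi -> C x ->
  evolves s b (fun t => Phi t s phi x i 0) (fun t => linear_rate t (Phi t s phi) x i).
Proof.
move=> sb Xphi Cx; split.
  apply/(@within_continuous_ballP R) => t /=; rewrite in_itv/= => /andP[st tb] e e0.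
  have e2 : 0 < e / 2 by rewrite divr_gt0.
  have /(supnorm_cvg0 _ (closure_nonempty H))/(_ _ e2) := evolution_continuous hPhi st Xphi.
  rewrite near_withinE => /nbhs_ballP[r /= r0 hr]; exists r => // q; rewrite in_itv/= => /andP[sq qb] tq.
  have : `|Phi q s phi x - Phi t s phi x| <= e / 2.
    by apply: (hr (q, s) _ sq x Cx); split => //=; exact: ballxx.
  move/(col_norm_le _ (ltW e2))/(_ i); rewrite !mxE distrC => h; apply: (le_lt_trans h).
  by rewrite ltr_pdivrMr// mulr_natr mulr2n ltrDl.
move=> t /andP[st tb]; have st' := ltW st.
have /(supnorm_cvg0 _ (closure_nonempty H)) hg := evolution_generator hPhi st' Xphi.
suff hc : h^-1 *: (Phi (h *: 1 + t) s phi x i 0 - Phi t s phi x i 0) @[h --> 0^'] --> linear_rate t (Phi t s phi) x i.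
  have hd : derivable (fun t => Phi t s phi x i 0) t 1 by apply/cvg_ex; exists (linear_rate t (Phi t s phi) x i).
  by apply: DeriveDef => //; exact: cvg_lim hc.
apply/cvgrPdist_le => e e0; have := hg e e0.
rewrite !near_withinE => /nbhs_ballP[r /= r0 hr].
apply/nbhs_ballP; exists (Num.min r (t - s)); first by rewrite /= lt_min r0 subr_gt0.
move=> h; rewrite -ball_normE/= sub0r normrN lt_min => /andP[hr' hts] h0.
have sth : s <= t + h.
  by move: hts; rewrite ltr_norml => /andP[h1 _]; move: h1; lra.
have hb : ball (0 : R) r h by rewrite -ball_normE/= sub0r normrN.
have := hr h hb (conj h0 sth) x Cx; move/(col_norm_le _ (ltW e0))/(_ i).
have coordE (c : R) (p q l : 'cV[R]_m) : (c *: (p - q) - l) i 0 = c * (p i 0 - q i 0) - l i 0.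
  by rewrite !mxE.
rewrite coordE linear_rhsE.
by rewrite distrC [h *: 1]mulr1 [h + t]addrC.
Qed.

Lemma Phi_lin s t (c : R) phi x : s <= t -> Xspace Omega phi -> C x ->
  Phi t s (fun y => c *: phi y) x = c *: Phi t s phi x.
Proof.
move=> st Xphi Cx; have X0 : Xspace Omega (fun=> 0 : 'cV[R]_m).
  by apply: continuous_subspaceT; exact: cst_continuous.
have P0 : Phi t s (fun=> 0) x = 0.
  have := evolution_linear hPhi 1 st X0 X0 Cx.
  have -> : (fun _ : 'rV[R]_n => 1 *: (0 : 'cV[R]_m) + 0) = fun=> 0.
    by apply/funext => y; rewrite scaler0 addr0.
  rewrite scale1r.
  by move/eqP; rewrite -subr_eq0 opprD addNKr oppr_eq0 => /eqP.
have := evolution_linear hPhi c st Xphi X0 Cx; rewrite P0 addr0 => <-.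
by congr (Phi t s _ x); apply/funext => y; rewrite addr0.
Qed.

Lemma XspaceZ (c : R) phi : Xspace Omega phi -> Xspace Omega (fun y => c *: phi y).
Proof. by move=> h x; apply: cvgZr; exact: h. Qed.

Lemma Phi_bound s t phi x (N B : R) : s <= t -> Xspace Omega phi -> C x -> 0 < B ->
  (operator_norm Omega (Phi t s) <= N%:E)%E -> (forall y, C y -> `|phi y| <= B) ->
  `|Phi t s phi x| <= N * B.
Proof.
move=> st Xphi Cx B0 hN hB.
have XB := XspaceZ (c := B^-1) Xphi.
have hs : (supnorm C (fun y => B^-1 *: phi y) <= 1%:E)%E.
  apply/supnorm_le => y Cy; rewrite normrZ gtr0_norm ?invr_gt0// mulrC ler_pdivrMr// mul1r.
  exact: hB.
have : (supnorm C (Phi t s (fun y => B^-1 *: phi y)) <= N%:E)%E.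
  by apply: le_trans hN; apply: ereal_sup_ubound; exists (fun y => B^-1 *: phi y).
move/supnorm_le/(_ x Cx); rewrite (Phi_lin _ st Xphi Cx) normrZ gtr0_norm ?invr_gt0// mulrC.
by rewrite ler_pdivrMr.
Qed.

End linearization.

Section growth_bound.
Context {R : realType} {m n : nat}.
Variables (Omega : set 'rV[R]_n) (d : 'rV[R]_m) (K : 'I_m -> R -> 'rV[R]_n -> R).
Variables (g : R -> 'rV[R]_n -> 'cV[R]_m -> 'cV[R]_m) (v : 'cV[R]_m) (T : R).
Hypothesis H : system Omega d K g v T.

Local Notation C := (closure Omega).
Local Notation in_box := (in_box v).
Local Notation rhs := (nonlinear_rhs Omega d K g).
Local Notation global := (global Omega d K g v).
Local Notation lin := (linear_rate Omega d K g).
Implicit Types (t s r e tau a b : R) (x y : 'rV[R]_n) (i j : 'I_m).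
Implicit Types (u w : R -> 'rV[R]_n -> 'cV[R]_m).

Let bO := sys_bounded H.
Let cC : compact C := closure_bounded_compact bO.
Let T0 : 0 < T := sys_T H.

Variable Phi : R -> R -> ('rV[R]_n -> 'cV[R]_m) -> 'rV[R]_n -> 'cV[R]_m.
Hypothesis hPhi : generated_evolution_family Omega d K g Phi.

Let colB (p q : 'cV[R]_m) i : (p - q) i 0 = p i 0 - q i 0.
Proof. by rewrite !mxE. Qed.

Let colZ (c : R) (p : 'cV[R]_m) i : (c *: p) i 0 = c * p i 0.
Proof. by rewrite mxE. Qed.

Lemma growth_bound_lt (c : R) : (growth_bound Omega Phi < c%:E)%E ->
  exists omega M : R, [/\ omega < c, 1 <= M & forall t s, s <= t ->
    (operator_norm Omega (Phi t s) <= (M * expR (omega * (t - s)))%:E)%E].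
Proof.
move/ereal_inf_lt => [_ [omega [M M1 hM] <-]]; rewrite lte_fin => oc.
by exists omega, M.
Qed.

Lemma growth_bound_le (c M : R) : 1 <= M -> (forall t s, s <= t ->
    (operator_norm Omega (Phi t s) <= (M * expR (c * (t - s)))%:E)%E) ->
  (growth_bound Omega Phi <= c%:E)%E.
Proof. by move=> M1 hM; apply: ereal_inf_lbound; exists c => //; exists M. Qed.

Lemma exp_unbounded (e c A : R) : 0 < e -> 0 < c -> exists2 t : R, 0 <= t & A < c * expR (e * t).
Proof.
move=> e0 c0; exists (`|A| / (c * e)); first by rewrite divr_ge0// mulr_ge0// ltW.
apply: (@lt_le_trans _ _ (c * (1 + e * (`|A| / (c * e))))); last first.
  by rewrite ler_pM2l// expR_ge1Dx.
have -> : c * (1 + e * (`|A| / (c * e))) = c + `|A| by field; rewrite !gt_eqF.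
by rewrite (le_lt_trans (ler_norm A))// ltrDr.
Qed.

Lemma exp_decays (e A c : R) : 0 < e -> 0 < c -> exists2 t1 : R, 0 <= t1 & forall t, t1 <= t ->
  A * expR (- e * t) <= c.
Proof.
move=> e0 c0; have [t1 t10 h] := exp_unbounded A e0 c0; exists t1 => // t tt.
rewrite mulNr expRN ler_pdivrMr ?expR_gt0// (le_trans (ltW h))// ler_pM2l// ler_expR ler_pM2l//.
Qed.

Section solution_from_the_top.
Variable U : R -> 'rV[R]_n -> 'cV[R]_m.
Hypothesis gU : global U.
Hypothesis U0 : forall x, C x -> U 0 x = v.

Lemma Xspace_cst (p : 'cV[R]_m) : Xspace Omega (fun=> p).
Proof. by apply: continuous_subspaceT; exact: cst_continuous. Qed.

Lemma lower_bound_of_bounded (f : R -> 'rV[R]_n -> 'cV[R]_m) a b (B : R) :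
  (forall t x, a <= t <= b -> C x -> `|f t x| <= B) ->
  forall t x i, a <= t <= b -> C x -> - `|B| <= f t x i 0 <= `|B|.
Proof.
move=> h t x i tt Cx; rewrite -ler_norml; apply: (col_norm_le _ (normr_ge0 B)).1 i.
by rewrite (le_trans (h t x tt Cx))// ler_norm.
Qed.

(** Subhomogeneity places the reaction below its linearization, and U below the
    linear solution that starts from v. *)
Lemma extinct_of_negative : (growth_bound Omega Phi < 0)%E -> extinct Omega U.
Proof.
move/growth_bound_lt => [omega [M [om0 M1 hM]]].
have [B B0 hB] := in_box_norm H; have Xv := @Xspace_cst v.
have UP t x i : 0 <= t -> C x -> U t x i 0 <= Phi t 0 (fun=> v) x i 0.
  move=> t0 Cx; have [B1 hB1] := Phi_bounded H hPhi t0 Xv; have tU := gU.1 t t0.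
  have tt : 0 <= t <= t by rewrite t0 lexx.
  have sPhi s : 0 <= s <= t -> slice_bm Omega (Phi s 0 (fun=> v)).
    by move=> /andP[s0 _]; apply: (Xspace_slice_bm H); exact: (evolution_X hPhi).
  rewrite -subr_ge0 -colB.
  refine (@linear_ge0 _ _ _ _ _ _ _ _ _ H 0 t (fun t x => Phi t 0 (fun=> v) x - U t x)
    (fun t x i => lin t (Phi t 0 (fun=> v)) x i - rhs t (U t) x i 0) (`|B1| + B) _ _ _ _ _ t x i tt Cx).
  - move=> s st; apply: slice_bmB; first exact: sPhi.
    exact: (traj_bm tU).
  - move=> s y j st Cy; rewrite colB opprD lerD//.
      by case/andP: (lower_bound_of_bounded hB1 j st Cy).
    rewrite lerN2 (le_trans (ler_norm _))//; apply: hB; apply: gU.2 => //.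
    by case/andP: st.
  - move=> y j Cy; have := evolvesB (Phi_evolves H hPhi j t0 Xv Cy) (traj_ev tU j Cy).
    by apply: eq_evolves => //; apply/funext => s; rewrite colB ?colZ.
  - move=> s y j /andP[s0 st] Cy; have ss : 0 <= s <= t by rewrite !ltW.
    rewrite (linB H s y j (sPhi s ss) (traj_bm tU ss)).
    by rewrite lerD2l lerN2 (rhs_le_lin H)//; apply: gU.2 => //; exact: ltW.
  - by move=> y j Cy; rewrite U0// (evolution_id hPhi)// colB subrr.
move=> e e0; have om0n : 0 < - omega by rewrite oppr_gt0.
have [t1 t10 ht1] := exp_decays (M * B) om0n e0; exists t1 => // t x i tt Cx.
have t0 : 0 <= t by exact: le_trans tt.
apply: (le_trans (UP t x i t0 Cx)); apply: (le_trans (ler_norm _)).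
have hv y : C y -> `|v| <= B by move=> _; apply/col_norm_le; [exact: ltW|exact: hB (in_box_v H)].
have := Phi_bound hPhi t0 Xv Cx B0 (hM t 0 t0) hv.
rewrite subr0 => h; have h' : `|Phi t 0 (fun=> v) x| <= e.
  apply: (le_trans h); apply: le_trans (ht1 t tt).
  by rewrite opprK mulrAC.
exact: ((col_norm_le _ (ltW e0)).1 h').
Qed.

End solution_from_the_top.

Section positive_periodic_orbit.
Variables (delta : R) (w : R -> 'rV[R]_n -> 'cV[R]_m).
Hypothesis del0 : 0 < delta.
Hypothesis gw : global w.
Hypothesis pw : forall t x, C x -> w (t + T) x = w t x.
Hypothesis bw : forall t x, C x -> in_box (w t x).
Hypothesis wd : forall t x i, C x -> delta <= w t x i 0.

(** If every component of the reaction is strictly subhomogeneous, exp(e t) w is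
    a lower solution of the linearization. *)
Lemma strict_growth : Xspace Omega (w 0) ->
  (forall t x (p : 'cV[R]_m) (a : R) i, C x -> (forall k, 0 < p k 0 <= v k 0) -> 0 < a < 1 ->
     a * g t x p i 0 < g t x (a *: p) i 0) ->
  (0 < growth_bound Omega Phi)%E.
Proof.
move=> Xw hstrict; have [B B0 hB] := in_box_norm H.
have th : 0 < (1 / 2 : R) < 1 by lra.
pose Q : set 'cV[R]_m := [set p | forall k, delta <= p k 0 <= v k 0].
have cQ : compact Q by exact: (@col_box_compact R m (fun=> delta) (fun k => v k 0)).
have [e1 e10 he1] : exists2 e : R, 0 < e & forall i t x p, C x -> Q p -> e <= gap g (1 / 2) i t x p.
  apply: finite_pos_choice => [i r s /andP[_ sr] h t x p Cx Qp|i].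
    by rewrite (le_trans sr)// h.
  have [|e e0 he] := admissible_pos cC T0 (gap_admissible H (1 / 2) i) cQ; last by exists e.
  move=> t x p Cx Qp; rewrite /gap subr_gt0 ltr_pdivlMr; last by lra.
  rewrite mulrC (_ : 1 - 1 / 2 = 1 / 2 :> R); last by field.
  by apply: hstrict => // k; case/andP: (Qp k) => h ->; rewrite (lt_le_trans del0 h).
pose c := e1 / B; have c0 : 0 < c by rewrite divr_gt0.
have wlin t x i : 0 <= t -> C x -> c * w t x i 0 + rhs t (w t) x i 0 <= lin t (w t) x i.
  move=> t0 Cx; have wM := bw t Cx; have := gap_le_linear H i t th Cx wM.
  have Qw : Q (w t x) by move=> k; rewrite wd//=; case/andP: (wM k).
  have h1 := he1 i t x (w t x) Cx Qw.
  have h3 : c * w t x i 0 <= e1.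
    rewrite -[leRHS](divfK (lt0r_neq0 B0)) ler_pM2l// (le_trans (ler_norm _))// hB//.
  by rewrite rhsE /linear_rate => h4; move: h1 h3 h4; lra.
rewrite ltNge; apply/negP => hgb.
have hgb' : (growth_bound Omega Phi < c%:E)%E by apply: (le_lt_trans hgb); rewrite lte_fin.
have [omega [M [oc M1 hM]]] := growth_bound_lt hgb'.
have [x Cx] := closure_nonempty H; have i := Ordinal (sys_m H).
have hBw y : C y -> `|w 0 y| <= B by move=> Cy; apply/col_norm_le; [exact: ltW|exact: hB (bw 0 Cy)].
have co : 0 < c - omega by rewrite subr_gt0.
have [t t0 ht] := exp_unbounded (M * B) co del0.
have [B1 hB1] := Phi_bounded H hPhi t0 Xw; have tw := gw.1 t t0.
have tt : 0 <= t <= t by rewrite t0 lexx.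
have ew := fun y j Cy => evolvesM (evolves_expR 0 t c 0) (traj_ev tw j Cy : evolves 0 t (fun s => w s y j 0) _).
have := @linear_ge0 _ _ _ _ _ _ _ _ _ H 0 t (fun t x => Phi t 0 (w 0) x - expR (c * (t - 0)) *: w t x)
    (fun t x i => lin t (Phi t 0 (w 0)) x i - (c * expR (c * (t - 0)) * w t x i 0 + expR (c * (t - 0)) * rhs t (w t) x i 0))
    (`|B1| + expR (c * t) * B) _ _ _ _ _ t x i tt Cx.
rewrite colB colZ subr_ge0 => hh.
have {hh} : expR (c * (t - 0)) * w t x i 0 <= Phi t 0 (w 0) x i 0.
  have sPhi s : 0 <= s <= t -> slice_bm Omega (Phi s 0 (w 0)).
    by move=> /andP[s0 _]; apply: (Xspace_slice_bm H); exact: (evolution_X hPhi).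
  apply: hh.
  - move=> s st; apply: slice_bmB; first exact: sPhi.
    by apply: slice_bmZ; exact: (traj_bm tw).
  - move=> s y j st Cy; rewrite colB colZ opprD lerD//.
      by case/andP: (lower_bound_of_bounded hB1 j st Cy).
    rewrite lerN2; have /andP[w0 _] := bw s Cy j.
    apply: ler_pM; [exact: expR_ge0|exact: w0| |].
      by rewrite ler_expR subr0 ler_pM2l//; case/andP: st.
    by rewrite (le_trans (ler_norm _))// hB//; exact: bw.
  - move=> y j Cy; have := evolvesB (Phi_evolves H hPhi j t0 Xw Cy) (ew y j Cy).
    by apply: eq_evolves => //; apply/funext => s; rewrite colB ?colZ.
  - move=> s y j /andP[s0 st] Cy; have ss : 0 <= s <= t by rewrite !ltW.
    have bs := traj_bm tw ss.
    rewrite (linB H s y j (sPhi s ss) (slice_bmZ _ bs)) (linZ H _ s y j bs) lerD2l lerN2.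
    have := wlin s y j (ltW s0) Cy; have X0 : 0 < expR (c * (s - 0)) by exact: expR_gt0.
    by move=> h; rewrite [c * _]mulrC -mulrA -mulrDr ler_pM2l.
  - by move=> y j Cy; rewrite subrr mulr0 expR0 scale1r (evolution_id hPhi)// colB subrr.
apply/negP; rewrite -ltNge; apply: (le_lt_trans (ler_norm _)).
have := Phi_bound hPhi t0 Xw Cx B0 (hM t 0 t0) hBw; rewrite subr0 => h.
have MB0 : 0 <= M * expR (omega * t) * B by rewrite !mulr_ge0 ?expR_ge0 ?(ltW B0)// (le_trans _ M1).
apply: (le_lt_trans ((col_norm_le _ MB0).1 h i)).
apply: (@lt_le_trans _ _ (expR (c * t) * delta)); last by rewrite ler_pM2l ?expR_gt0// wd.
have -> : expR (c * t) = expR ((c - omega) * t) * expR (omega * t) by rewrite -expRD -mulrDl subrK.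
by rewrite mulrAC [ltRHS]mulrAC ltr_pM2r ?expR_gt0// [ltRHS]mulrC.
Qed.

(** A positive entire solution psi of the linearization has a smallest multiple
    c psi above w.  The difference solves the linear equation with the strict
    surplus of subhomogeneity, hence is bounded away from 0, and c was not the
    smallest factor. *)
Lemma no_positive_linear_orbit (psi : R -> 'rV[R]_n -> 'cV[R]_m) (p0 p1 : R) : 0 < p0 ->
  (forall t x i, C x -> p0 <= psi t x i 0 <= p1) ->
  (forall t, slice_bm Omega (psi t)) ->
  (forall a b x i, C x -> evolves a b (fun t => psi t x i 0) (fun t => lin t (psi t) x i)) ->
  False.
Proof.
move=> p00 hpsi bpsi evpsi; have [B B0 hB] := in_box_norm H.
have [x0 Cx0] := closure_nonempty H; have i0 := Ordinal (sys_m H).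
have p10 : 0 < p1 by have /andP[h1 h2] := hpsi 0 x0 i0 Cx0; rewrite (lt_le_trans p00)// (le_trans h1).
have psi0 t x i : C x -> 0 < psi t x i 0 by move=> /hpsi-/(_ t i)/andP[h _]; exact: lt_le_trans h.
pose S : set R := [set c | 0 <= c /\ forall t x i, C x -> w t x i 0 <= c * psi t x i 0].
have S0 : S !=set0.
  exists (B / p0); split=> [|t x i Cx]; first by rewrite divr_ge0// ltW.
  apply: (@le_trans _ _ (B / p0 * p0)).
    by rewrite divfK ?gt_eqF// (le_trans (ler_norm _))// hB//; exact: bw.
  by rewrite ler_pM2l ?divr_gt0//; case/andP: (hpsi t x i Cx).
have lS : has_lbound S by exists 0 => c [].
pose c := inf S.
have cge0 : 0 <= c by apply: lb_le_inf => // c' [].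
have wc t x i : C x -> w t x i 0 <= c * psi t x i 0.
  move=> Cx; apply/ler_addgt0Pr => e e0.
  have ep : 0 < e / psi t x i 0 by rewrite divr_gt0// psi0.
  have [c' [_ hc'] c'c] := inf_adherent ep (conj S0 lS).
  apply: (le_trans (hc' t x i Cx)).
  rewrite -[e](divfK (lt0r_neq0 (psi0 t x i Cx))) -mulrDl.
  by apply: ler_wpM2r; [exact/ltW/psi0|exact: ltW].
have [Lam Lam0 hLam] := periodic_Lipschitz H gw pw.
have th : 0 < (1 / 2 : R) < 1 by lra.
have [g0 [r2 [g00 r20 r2T hgap]]] := gap_persists H del0 th Lam0 T0.
have [kap kap0 hkap] := pair_forcing H ltr01 r20 r2T.
have [|vm vm0 hvm] := @seq_pos_lower_bound R _ (enum 'I_m) (fun i => v i 0).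
  by move=> i _; exact: (sys_v H).
have cp : 0 < c * p1 + 1 by rewrite ltr_wpDl// mulr_ge0// ltW.
pose s := vm / (c * p1 + 1); have s0 : 0 < s by rewrite divr_gt0.
pose z t x : 'cV[R]_m := c *: psi t x - w t x.
have zE t x i : z t x i 0 = c * psi t x i 0 - w t x i 0 by rewrite /z colB colZ.
have z0 t x i : C x -> 0 <= z t x i 0 by move=> Cx; rewrite zE subr_ge0 wc.
have margin t x i : C x -> kap * g0 <= z t x i 0.
  move=> Cx; pose t0 := t - T; have tE : t0 + T = t by rewrite subrK.
  have tT : t0 <= t0 + T by rewrite lerDl ltW.
  have tw := periodic_trajectory H pw gw tT.
  have [k hk] := hgap t0 x (w ^~ x) Cx (fun t _ => bw t Cx) (fun k => wd t0 k Cx)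
    (fun t k _ => hLam t t0 x k Cx).
  have pr : upper_pair d g v 1 t0 (t0 + T) x (fun t => s *: z t x)
      (fun t i => s * (c * lin t (psi t) x i - rhs t (w t) x i 0)) (fun=> 0) (fun _ _ => 0)
      (fun t i => s * gap g (1 / 2) i t x (w t x)).
    have ybox r : in_box (s *: z r x).
      move=> j; rewrite colZ mulr_ge0 ?z0 ?(ltW s0)//=.
      apply: (@le_trans _ _ vm); last by rewrite hvm ?mem_enum.
      rewrite /s mulrAC ler_pdivrMr// ler_pM2l// zE.
      have h1 := ler_wpM2l cge0 (andP (hpsi r x j Cx)).2; have h2 := wd r j Cx.
      by move: h1 h2 del0; lra.
    split=> //.
    - move=> j; have := evolvesZ s (evolvesB (evolvesZ c (evpsi t0 (t0 + T) x j Cx)) (traj_ev tw j Cx)).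
      by apply: eq_evolves => //; apply/funext => r; rewrite colZ zE.
    - by move=> j; apply: eq_evolves (evolves_cst _ _ 0) => //; apply/funext => r; rewrite mxE.
    - by move=> r _; exact: (in_box0 H).
    - by move=> r q j _ _; rewrite subrr normr0 mul1r.
    - by move=> r j _; rewrite (mulr_ge0 (ltW s0))// (gap_ge0 H)//; exact: bw.
    - move=> r j rt; have rt' : t0 <= r <= t0 + T by case/andP: rt => *; rewrite !ltW.
      rewrite (sys_g0 H _ Cx) colZ ![(0 : 'cV[R]_m) j 0]mxE !subr0.
      have bz : slice_bm Omega (z r).
        by apply: slice_bmB; [exact: slice_bmZ|exact: (traj_bm tw)].
      have hlin : lin r (z r) x j = c * lin r (psi r) x j - lin r (w r) x j.
        rewrite /z (linB H r x j (slice_bmZ c (bpsi r)) (traj_bm tw rt')).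
        by rewrite (linZ H c r x j (bpsi r)).
      have hS : 0 <= d 0 j * spread Omega (K j r) (fun y => z r y j 0) x.
        rewrite mulr_ge0 ?(ltW (sys_d H j))//; apply: spread_ge0; first exact: (sys_K H).
        by move=> y Oy; apply: z0; exact: subset_closure.
      have h1 := reaction_le_linear H r j Cx (ybox r).
      have h2 : \sum_k partial g j k r x 0 * (s *: z r x) k 0 = s * \sum_k partial g j k r x 0 * z r x k 0.
        by rewrite mulr_sumr; apply: eq_bigr => q _; rewrite colZ mulrCA.
      have h3 := gap_le_linear H j r th Cx (bw r Cx).
      have h4 : lin r (w r) x j - rhs r (w r) x j 0 =
          \sum_k partial g j k r x 0 * w r x k 0 - g r x (w r x) j 0.
        by rewrite rhsE /linear_rate; ring.
      rewrite h2 in h1; rewrite -h4 in h3.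
      have h5 : c * lin r (psi r) x j - rhs r (w r) x j 0 =
         lin r (z r) x j + (lin r (w r) x j - rhs r (w r) x j 0) by rewrite hlin; ring.
      rewrite h5 (mulrDr s (lin r (z r) x j)); have h6 := ler_wpM2l (ltW s0) h3.
      have h7 : s * (- (d 0 j * z r x j 0) + \sum_k partial g j k r x 0 * z r x k 0) <= s * lin r (z r) x j.
        by rewrite ler_pM2l// /linear_rate lerD2r lerDr.
      apply: lerD => //; apply: le_trans h7.
      by rewrite (mulrDr s (- (d 0 j * z r x j 0))) lerD// mulrN mulrCA.
  have e0 : 0 <= s * g0 by rewrite mulr_ge0 ?(ltW s0)// ltW.
  have ord0 j : (0 : 'cV[R]_m) j 0 <= (s *: z t0 x) j 0.
    by rewrite mxE colZ mulr_ge0 ?z0// ltW.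
  have := hkap t0 x _ _ _ _ _ k (s * g0) Cx pr ord0 e0 _ i.
  rewrite tE colZ [(0 : 'cV[R]_m) i 0]mxE subr0 => hfin.
  suff : kap * (s * g0) <= s * z t x i 0 by rewrite mulrCA ler_pM2l.
  by apply: hfin => r tr; rewrite ler_pM2l// hk.
pose mu := kap * g0; have mu0 : 0 < mu by rewrite mulr_gt0.
have : S (c - mu / p1).
  have key t x i : C x -> w t x i 0 <= (c - mu / p1) * psi t x i 0.
    move=> Cx; have := margin t x i Cx; rewrite zE -/mu mulrBl => h1.
    have : mu / p1 * psi t x i 0 <= mu.
      rewrite -[leRHS](divfK (lt0r_neq0 p10)) ler_pM2l ?divr_gt0//.
      by case/andP: (hpsi t x i Cx).
    by move: h1; lra.
  split=> //; have := key 0 x0 i0 Cx0; have := wd 0 i0 Cx0 => h1 h2.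
  have := lt_le_trans del0 (le_trans h1 h2).
  by rewrite pmulr_lgt0 ?psi0// => /ltW.
move/(inf_lbound lS); rewrite -/c leNgt => /negP; apply.
by rewrite ltrBlDr ltrDl divr_gt0.
Qed.

End positive_periodic_orbit.

End growth_bound.

Section extinction.
Context {R : realType} {m n : nat}.
Variables (Omega : set 'rV[R]_n) (d : 'rV[R]_m) (K : 'I_m -> R -> 'rV[R]_n -> R).
Variables (g : R -> 'rV[R]_n -> 'cV[R]_m -> 'cV[R]_m) (v : 'cV[R]_m) (T : R).
Hypothesis H : system Omega d K g v T.

Local Notation C := (closure Omega).
Local Notation rhs := (nonlinear_rhs Omega d K g).
Local Notation trajectory := (trajectory Omega d K g).
Local Notation global := (global Omega d K g v).
Local Notation lin := (linear_rate Omega d K g).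
Implicit Types (t s r e tau a b : R) (x y : 'rV[R]_n) (i j : 'I_m).
Implicit Types (u w : R -> 'rV[R]_n -> 'cV[R]_m).

Let oO := sys_open H.
Let bO := sys_bounded H.
Let T0 : 0 < T := sys_T H.
Let dmax0 := dmax_ge0 H.

Let one_kernel : convolution_kernel (fun _ : 'rV[R]_n => 1 : R).
Proof. by split => //; exact: cst_continuous. Qed.

Lemma evolves_sum a b (J : Type) (s : seq J) (f df : J -> R -> R) :
  (forall p : J, evolves a b (f p) (df p)) ->
  evolves a b (fun t => \sum_(p <- s) f p t) (fun t => \sum_(p <- s) df p t).
Proof.
move=> h; elim: s => [|p s IH].
  apply: eq_evolves (evolves_cst a b 0) => [|t _]; last by rewrite big_nil.
  by apply/funext => t; rewrite big_nil.
apply: eq_evolves (evolvesD (h p) IH) => [|t _]; last by rewrite big_cons.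
by apply/funext => t; rewrite big_cons.
Qed.

Lemma amount_sum (J : Type) (s : seq J) (f : J -> 'rV[R]_n -> R) :
  (forall p : J, bounded_measurable Omega (f p)) ->
  bounded_measurable Omega (fun y => \sum_(p <- s) f p y) /\
  amount Omega (fun y => \sum_(p <- s) f p y) = \sum_(p <- s) amount Omega (f p).
Proof.
move=> h; elim: s => [|p s [IH1 IH2]].
  rewrite big_nil; under eq_fun do rewrite big_nil.
  split; first exact: bounded_measurable_cst.
  by rewrite /amount (spread_cst oO bO)// mul0r.
rewrite big_cons -IH2; under eq_fun do rewrite big_cons.
split; first exact: bounded_measurableD.
exact: (spreadD oO bO 0 one_kernel (h p) IH1).
Qed.

Lemma spread_le_amount : exists2 B : R, 0 < B & forall i t x (phi : 'rV[R]_n -> R), C x ->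
  bounded_measurable Omega phi -> (forall y, Omega y -> 0 <= phi y) ->
  spread Omega (K i t) phi x <= B * amount Omega phi.
Proof.
have [B B0 hB] := K_bounded H; exists B => // i t x phi Cx bphi phi0.
have [_ [M hM]] := bphi.
rewrite /amount -(spreadZ oO bO B 0 one_kernel bphi) /spread.
have Kge0 y : 0 <= K i t (x - y) by exact: (sys_K H i t).2.
apply: (@Rintegral_mono _ _ _ (lebesgue R n) Omega (open_lebesgue_measurable oO) (bounded_lebesgue_lty bO) _ _ (B * M)).
- by move=> y Oy; rewrite mulr_ge0 ?phi0.
- by move=> y Oy; rewrite mul1r ler_wpM2r ?phi0// hB.
- by move=> y Oy; rewrite mul1r ler_pM2l// (le_trans (ler_norm _))// hM.
Qed.

(** Within one period the sum of the components at x grows at most by a factor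
    of the sum of its initial value at x and of the total amount; by the
    Harnack inequality both are controlled by each component after a period. *)
Lemma components_comparable : exists2 c : R, 0 < c & forall u t x i, global u -> T <= t -> C x ->
  \sum_j u t x j 0 <= c * u t x i 0.
Proof.
have [L L0 hL] := partial_bounded H 0.
have [KB KB0 hKB] := spread_le_amount.
have [kap kap0 hkap] := global_positive H T0.
have [B B0 hB] := in_box_norm H.
pose C1 := m%:R * (m%:R * L); have C10 : 0 <= C1 by rewrite !mulr_ge0// ltW.
pose C2 := m%:R * (dmax d * KB); have C20 : 0 <= C2 by rewrite !mulr_ge0// ltW.
pose q := amount Omega (fun=> 1); have q0 : 0 <= q by apply: amount_ge0 => y _.
pose c := C1 + C2 * (1 + q) + 1.
have c0 : 0 < c by rewrite ltr_wpDl// addr_ge0// mulr_ge0// addr_ge0.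
pose Ex := expR (2 * c * T); have Ex0 : 0 < Ex by exact: expR_gt0.
exists (2 * m%:R * Ex / kap); first by rewrite divr_gt0// !mulr_gt0// ltr0n (sys_m H).
move=> u t' x i gu Tt' Cx; pose t := t' - T.
have t0 : 0 <= t by rewrite subr_ge0.
have tE : t' = t + T by rewrite subrK.
have tt' : t <= t + T by rewrite lerDl ltW.
have tu := globalW t0 tt' gu.
pose S s y := \sum_j u s y j 0.
have upos s y j : t <= s -> C y -> 0 <= u s y j 0.
  by move=> ts Cy; case/andP: (gu.2 s y (le_trans t0 ts) Cy j).
have uS s y j : t <= s -> C y -> u s y j 0 <= S s y.
  move=> ts Cy; rewrite /S (bigD1 j)//= lerDl sumr_ge0// => k _; exact: upos.
have bS s : t <= s <= t + T -> bounded_measurable Omega (S s).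
  by move=> ss; exact: (amount_sum (index_enum 'I_m) (fun j => traj_bm tu ss j)).1.
have S0 s y : t <= s -> C y -> 0 <= S s y by move=> ts Cy; apply: sumr_ge0 => j _; exact: upos.
have ttI : t <= t <= t + T by rewrite lexx.
pose V0 := amount Omega (S t).
have V00 : 0 <= V0 by apply: amount_ge0 => y Oy; apply: S0 => //; exact: subset_closure.
have grow s y : t < s < t + T -> C y -> \sum_j rhs s (u s) y j 0 <= C1 * S s y + C2 * amount Omega (S s).
  move=> /andP[ts st] Cy; have ss : t <= s <= t + T by rewrite !ltW.
  have am0 : 0 <= amount Omega (S s).
    by apply: amount_ge0 => z Oz; apply: S0; [exact: ltW|exact: subset_closure].
  apply: (@le_trans _ _ (\sum_(j < m) (m%:R * L * S s y + dmax d * KB * amount Omega (S s)))); last first.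
    by rewrite sumr_const card_ord -[leLHS]mulr_natl /C1 /C2 mulrDr !mulrA.
  apply: ler_sum => j _; apply: le_trans (rhs_le_lin H s j Cy (gu.2 s y (le_trans t0 (ltW ts)) Cy)) _.
  rewrite /linear_rate addrC lerD//.
    apply: (@le_trans _ _ (\sum_(k < m) L * S s y)); last first.
      by rewrite sumr_const card_ord -[leLHS]mulr_natl mulrA.
    apply: ler_sum => k _; have z00 p : `|(0 : 'cV[R]_m) p 0| <= 0 by rewrite mxE normr0.
    apply: (@le_trans _ _ (L * u s y k 0)).
      rewrite ler_wpM2r ?upos// ?(ltW ts)// (le_trans (ler_norm _))//; exact: hL.
    by rewrite ler_pM2l// uS// ltW.
  have d0 := sys_d H j; have u0 := upos s y j (ltW ts) Cy.
  apply: (@le_trans _ _ (d 0 j * spread Omega (K j s) (fun y => u s y j 0) y)).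
    by rewrite gerBl mulr_ge0// ltW.
  rewrite -mulrA; apply: ler_pM; [exact: ltW| |exact: (d_le_dmax H)|].
    apply: spread_ge0; first exact: (sys_K H).
    by move=> z Oz; apply: upos; [exact: ltW|exact: subset_closure].
  apply: (le_trans (hKB j s y _ Cy (traj_bm tu ss j) _)).
    by move=> z Oz; apply: upos; [exact: ltW|exact: subset_closure].
  rewrite ler_pM2l//; apply: (le_amount H); [exact: (traj_bm tu ss)|exact: bS|].
  by move=> z Oz; apply: uS; [exact: ltW|exact: subset_closure].
pose E1 s := expR (c * (s - t)); pose E2 s := expR (2 * c * (s - t)).
have E10 s : 0 < E1 s by exact: expR_gt0.
have E20 s : 0 < E2 s by exact: expR_gt0.
have E12 s : t <= s -> E1 s <= E2 s.
  move=> ts; rewrite ler_expR -mulrA ler_peMl//; last by lra.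
  by rewrite mulr_ge0 ?subr_ge0// ltW.
pose A s y := S t y * E1 s + V0 * E2 s.
have up : 0 <= A (t + T) x - S (t + T) x.
  pose N0 := m%:R * B.
  have SB s y : t <= s -> C y -> S s y <= N0.
    move=> ts Cy; rewrite /N0 (_ : m%:R * B = \sum_(j < m) B); last first.
      by rewrite sumr_const card_ord mulr_natl.
    by apply: ler_sum => j _; rewrite (le_trans (ler_norm _))// hB//; apply: gu.2 => //; exact: le_trans ts.
  have dm1 : 0 < C1 + C2 * q + 1 by rewrite ltr_wpDl// addr_ge0// mulr_ge0.
  have tTI : t <= t + T <= t + T by rewrite tt' lexx.
  refine (@comparison_principle R 'rV[R]_n C t (t + T) (fun s y => A s y - S s y)
    (fun s y => (S t y * (c * E1 s) + V0 * (2 * c * E2 s)) - \sum_j rhs s (u s) y j 0)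
    (C1 + C2 * q + 1) N0 dm1 _ _ _ _ (t + T) x tTI Cx).
  - move=> y Cy; apply: evolvesB.
      apply: evolvesD; first exact: (evolvesZ (S t y) (evolves_expR t (t + T) c t)).
      exact: (evolvesZ V0 (evolves_expR t (t + T) (2 * c) t)).
    exact: (evolves_sum (index_enum 'I_m) (fun j => traj_ev tu j Cy)).
  - move=> y Cy; rewrite /A /E1 /E2 !subrr !mulr0 expR0 !mulr1 addrC addrA.
    by rewrite addNr add0r.
  - move=> s y /andP[ts _] Cy; have h1 := SB s y ts Cy.
    have h2 : 0 <= A s y by rewrite addr_ge0 ?mulr_ge0 ?S0// ltW.
    by lra.
  - move=> N s y st Cy N00 hN neg; have /andP[ts sT] := st; have ts' := ltW ts.
    have ss : t <= s <= t + T by rewrite ts' ltW.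
    have h1 := grow s y st Cy.
    have h2 : S s y <= A s y + N by have := hN y Cy; lra.
    have h3 : amount Omega (S s) <= V0 * E1 s + (V0 * E2 s + N) * q.
      have bmA : bounded_measurable Omega (fun z => E1 s * S t z) by exact/bounded_measurableZ/bS.
      have -> : V0 * E1 s + (V0 * E2 s + N) * q = amount Omega (fun z => E1 s * S t z + (V0 * E2 s + N)).
        rewrite /amount (spreadD oO bO 0 one_kernel bmA (bounded_measurable_cst Omega _)).
        by rewrite (spreadZ oO bO (E1 s) 0 one_kernel (bS t ttI)) (spread_cst oO bO (V0 * E2 s + N) 0 one_kernel) mulrC.
      apply: (le_amount H); [exact: bS|exact: bounded_measurableD bmA (bounded_measurable_cst Omega _)|].
      move=> z Oz; have := hN z (subset_closure Oz); rewrite /A; lra.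
    have h4 := ler_wpM2l C10 h2; have h5 := ler_wpM2l C20 h3.
    have h6 : 0 <= (C2 * (1 + q) + 1) * (E1 s * S t y).
      apply: mulr_ge0; first by rewrite addr_ge0// mulr_ge0// addr_ge0.
      by apply: mulr_ge0; [exact/ltW/E10|exact: S0].
    have h7 : 0 <= c * (V0 * E2 s) by exact: (mulr_ge0 (ltW c0) (mulr_ge0 V00 (ltW (E20 s)))).
    have h8 : C2 * (V0 * E1 s) <= C2 * (V0 * E2 s) by apply: ler_wpM2l => //; apply: ler_wpM2l => //; exact: E12.
    have h9 : 0 <= V0 * E2 s by rewrite mulr_ge0// ltW.
    move: h1 h4 h5 h6 h7 h8 h9 N00; rewrite /A /c.
    set r1 := \sum_j _; set s1 := S s y; set s2 := S t y; set e1 := E1 s; set e2 := E2 s; set am := amount _ _.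
    move=> h1 h4 h5 h6 h7 h8 h9 N00.
    have F1 : s2 * ((C1 + C2 * (1 + q) + 1) * e1) + V0 * (2 * (C1 + C2 * (1 + q) + 1) * e2)
       = C1 * (s2 * e1 + V0 * e2 + N) + C2 * (V0 * e1 + (V0 * e2 + N) * q) +
         (C2 * (1 + q) + 1) * (e1 * s2) + (C1 + C2 * (1 + q) + 1) * (V0 * e2) + V0 * e2 +
         (C2 * (V0 * e2) - C2 * (V0 * e1)) - (C1 + C2 * q) * N by ring.
    rewrite F1; have F2 : (C1 + C2 * q + 1) * N = (C1 + C2 * q) * N + N by ring.
    by rewrite F2; move: h1 h4 h5 h6 h7 h8 h9 N00; lra.
rewrite subr_ge0 in up; rewrite tE; apply: (le_trans up).
have ExT : E2 (t + T) = Ex by rewrite /E2 addrC addKr.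
apply: (@le_trans _ _ (Ex * (S t x + V0))).
  rewrite /A ExT mulrDr lerD//; last by rewrite mulrC.
  by rewrite mulrC ler_wpM2r ?S0// -ExT E12.
have V0E : V0 = \sum_j amount Omega (fun y => u t y j 0).
  exact: (amount_sum (index_enum 'I_m) (fun j => traj_bm tu ttI j)).2.
have h1 : kap * S t x <= m%:R * u (t + T) x i 0.
  rewrite mulr_sumr (_ : m%:R * _ = \sum_(j < m) u (t + T) x i 0); last first.
    by rewrite sumr_const card_ord mulr_natl.
  by apply: ler_sum => j _; exact: (hkap u t t0 gu x j i Cx).1.
have h2 : kap * V0 <= m%:R * u (t + T) x i 0.
  rewrite V0E mulr_sumr (_ : m%:R * _ = \sum_(j < m) u (t + T) x i 0); last first.
    by rewrite sumr_const card_ord mulr_natl.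
  by apply: ler_sum => j _; exact: (hkap u t t0 gu x j i Cx).2.
have -> : 2 * m%:R * Ex / kap * u (t + T) x i 0 = Ex * ((2 * (m%:R * u (t + T) x i 0)) / kap) by field; rewrite gt_eqF.
by rewrite ler_pM2l// ler_pdivlMr// mulrC mulrDr mulr_natl mulr2n lerD.
Qed.

Variable Phi : R -> R -> ('rV[R]_n -> 'cV[R]_m) -> 'rV[R]_n -> 'cV[R]_m.
Hypothesis hPhi : generated_evolution_family Omega d K g Phi.
Variable U : R -> 'rV[R]_n -> 'cV[R]_m.
Hypothesis gU : global U.
Hypothesis U0 : forall x, C x -> U 0 x = v.

Let colB (p q : 'cV[R]_m) i : (p - q) i 0 = p i 0 - q i 0.
Proof. by rewrite !mxE. Qed.

Let colZ (c : R) (p : 'cV[R]_m) i : (c *: p) i 0 = c * p i 0.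
Proof. by rewrite mxE. Qed.

(** A small solution satisfies the linear equation up to a term eta u, so that
    exp(eta t) u is a supersolution that dominates the evolution family. *)
Lemma growth_bound_of_extinct : extinct Omega U -> (growth_bound Omega Phi <= 0)%E.
Proof.
move=> hext; apply/lee_addgt0Pr => eta eta0; rewrite add0e.
have [Hc Hc0 hHc] := components_comparable.
have [B B0 hB] := in_box_norm H.
have eta1 : 0 < eta / Hc by rewrite divr_gt0.
have [r r0 hr] := reaction_near_zero H eta1.
have r2 : 0 < r / 2 by rewrite divr_gt0.
have [t1 t10 ht1] := hext _ r2.
pose s0 := Num.max t1 T; have s0T : T <= s0 by rewrite le_max lexx orbT.
have s00 : 0 <= s0 by rewrite (le_trans (ltW T0)).
have s0t1 : t1 <= s0 by rewrite le_max lexx.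
have almost t t' x i : s0 <= t' -> C x -> lin t (U t') x i - eta * U t' x i 0 <= rhs t (U t') x i 0.
  move=> st Cx; have t'0 := le_trans s00 st.
  have small k : U t' x k 0 < r.
    by rewrite (le_lt_trans (ht1 t' x k (le_trans s0t1 st) Cx))// ltr_pdivrMr// mulr_natr mulr2n ltrDl.
  have h1 := hr t x (U t' x) i Cx (gU.2 t' x t'0 Cx) small.
  have h2 := hHc U t' x i gU (le_trans s0T st) Cx.
  have h3 : eta / Hc * \sum_j U t' x j 0 <= eta * U t' x i 0.
    by rewrite -mulrA ler_pM2l// ler_pdivrMl.
  by rewrite rhsE /linear_rate; move: h1 h3; lra.
have [c c0 hc] := global_decay H.
have [|vm vm0 hvm] := @seq_pos_lower_bound R _ (enum 'I_m) (fun i => v i 0).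
  by move=> i _; exact: (sys_v H).
pose c1 := expR (- (c * (s0 + T))) * vm; have c10 : 0 < c1 by rewrite mulr_gt0// expR_gt0.
have Uge t x i : s0 <= t <= s0 + T -> C x -> c1 <= U t x i 0.
  move=> /andP[st tT] Cx; have t0 : (0 : R) <= 0 <= t by rewrite lexx (le_trans s00).
  apply: le_trans (hc U 0 t x i gU t0 Cx); rewrite U0//.
  apply: ler_pM; [exact: expR_ge0|exact: ltW| |by rewrite hvm ?mem_enum].
  by rewrite ler_expR lerN2 ler_pM2l// subr0.
have UB t x i : 0 <= t -> C x -> U t x i 0 <= B.
  by move=> t0 Cx; rewrite (le_trans (ler_norm _))// hB//; exact: gU.2.
have dom s t phi x i : s <= t -> Xspace Omega phi -> (forall y, C y -> `|phi y| <= 1) -> C x ->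
    c1 * Phi t s phi x i 0 <= expR (eta * (t - s)) * B.
  move=> st Xphi phi1 Cx.
  have [k /andP[k1 k2]] := period_shift T0 (s - s0).
  set kT := k%:~R * T in k1 k2.
  have hk r' : s <= r' -> s0 <= r' + kT by move: k1; lra.
  have hkT : s0 <= s + kT <= s0 + T by move: k1 k2; lra.
  have tI : s <= t <= t by rewrite st lexx.
  pose W r' x : 'cV[R]_m := expR (eta * (r' - s)) *: U (r' + kT) x.
  have trU : trajectory s t (fun r' => U (r' + kT)).
    have a0 : 0 <= s + kT by rewrite (le_trans s00)//; case/andP: hkT.
    have ab : s + kT <= t + kT by rewrite lerD2r.
    by have := trajectory_shift H k (globalW a0 ab gU); rewrite -/kT !addrK.
  have [B1 hB1] := Phi_bounded H hPhi st Xphi.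
  have ePhi := fun y j Cy => evolvesZ c1 (Phi_evolves H hPhi j st Xphi (Cy : C y)).
  have eW := fun y j Cy => evolvesM (evolves_expR s t eta s) (traj_ev trU j (Cy : C y)).
  have sPhi r' : s <= r' <= t -> slice_bm Omega (Phi r' s phi).
    by move=> /andP[sr _]; apply: (Xspace_slice_bm H); exact: (evolution_X hPhi).
  have -> : expR (eta * (t - s)) * B = expR (eta * (t - s)) * U (t + kT) x i 0 + expR (eta * (t - s)) * (B - U (t + kT) x i 0) by ring.
  rewrite -[leLHS]addr0; apply: lerD; last first.
    by rewrite mulr_ge0 ?expR_ge0// subr_ge0 UB// (le_trans s00)// hk.
  suff : 0 <= (W t x - c1 *: Phi t s phi x) i 0 by rewrite colB !colZ subr_ge0.
  refine (@linear_ge0 _ _ _ _ _ _ _ _ _ H s t (fun r' x => W r' x - c1 *: Phi r' s phi x)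
    (fun r' x i => (eta * expR (eta * (r' - s)) * U (r' + kT) x i 0 + expR (eta * (r' - s)) * rhs r' (U (r' + kT)) x i 0)
       - c1 * lin r' (Phi r' s phi) x i) (c1 * `|B1|) _ _ _ _ _ t x i tI Cx).
  - move=> r' rI; apply: slice_bmB; apply: slice_bmZ; first exact: (traj_bm trU).
    exact: sPhi.
  - move=> r' y j rI Cy; rewrite colB !colZ.
    have /andP[sr' _] := rI; have /andP[U1 _] := gU.2 _ y (le_trans s00 (hk r' sr')) Cy j.
    have h1 : 0 <= expR (eta * (r' - s)) * U (r' + kT) y j 0 by rewrite mulr_ge0// expR_ge0.
    have /andP[_ h2] := lower_bound_of_bounded hB1 j rI Cy.
    by have h3 := ler_wpM2l (ltW c10) h2; move: h1 h3; lra.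
  - move=> y j Cy; apply: eq_evolves (evolvesB (eW y j Cy) (ePhi y j Cy)) => //.
    by apply/funext => r'; rewrite colB !colZ.
  - move=> r' y j /andP[sr' rt] Cy; have rI : s <= r' <= t by rewrite !ltW.
    have bs := traj_bm trU rI.
    rewrite /W (linB H r' y j (slice_bmZ _ bs) (slice_bmZ _ (sPhi r' rI))).
    rewrite (linZ H _ r' y j bs) (linZ H _ r' y j (sPhi r' rI)) lerD2r.
    have := almost r' (r' + kT) y j (hk r' (ltW sr')) Cy; rewrite lerBlDl => h.
    have X0 : 0 < expR (eta * (r' - s)) by exact: expR_gt0.
    apply: (le_trans (ler_wpM2l (ltW X0) h)).
    by rewrite le_eqVlt; apply/orP; left; apply/eqP; ring.
  - move=> y j Cy; rewrite colB !colZ subrr mulr0 expR0 mul1r (evolution_id hPhi)// subr_ge0.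
    apply: le_trans (Uge _ y j hkT Cy); rewrite -[leRHS]mulr1 ler_pM2l//.
    by rewrite (le_trans (ler_norm _))//; exact: ((col_norm_le _ ler01).1 (phi1 y Cy)).
have M1 : 1 <= Num.max 1 (B / c1) by rewrite le_max lexx.
apply: (growth_bound_le M1) => t s st; apply: ge_ereal_sup => _ [phi [Xphi phi1] <-].
apply/supnorm_le => x Cx.
have phi1' : forall y, C y -> `|phi y| <= 1 by apply/supnorm_le.
have Xe : 0 < expR (eta * (t - s)) by exact: expR_gt0.
have b0 : 0 <= Num.max 1 (B / c1) * expR (eta * (t - s)) by rewrite mulr_ge0 ?expR_ge0// (le_trans ler01).
apply/(col_norm_le _ b0) => i.
have h1 := dom s t phi x i st Xphi phi1' Cx.
have h2 : - (c1 * Phi t s phi x i 0) <= expR (eta * (t - s)) * B.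
  have phiN y : C y -> `|-1 *: phi y| <= 1 by move=> Cy; rewrite scaleN1r normrN phi1'.
  have := dom s t (fun y => -1 *: phi y) x i st (XspaceZ Xphi) phiN Cx.
  by rewrite (Phi_lin hPhi _ st Xphi Cx) colZ mulN1r mulrN.
apply: (@le_trans _ _ (B / c1 * expR (eta * (t - s)))); last first.
  by rewrite ler_wpM2r ?expR_ge0// le_max lexx orbT.
have -> : B / c1 * expR (eta * (t - s)) = expR (eta * (t - s)) * B / c1 by ring.
rewrite ler_pdivlMr// -[c1 in _ * c1]gtr0_norm// -normrM mulrC ler_norml.
by rewrite h1 andbT lerNl.
Qed.

End extinction.

(** * Stability and uniqueness *)

Section stability.
Context {R : realType} {m n : nat}.
Variables (Omega : set 'rV[R]_n) (d : 'rV[R]_m) (K : 'I_m -> R -> 'rV[R]_n -> R).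
Variables (g : R -> 'rV[R]_n -> 'cV[R]_m -> 'cV[R]_m) (v : 'cV[R]_m) (T : R).
Hypothesis H : system Omega d K g v T.

Local Notation C := (closure Omega).
Local Notation in_box := (in_box v).
Local Notation global := (global Omega d K g v).
Implicit Types (t s r e tau a b : R) (x y : 'rV[R]_n) (i j : 'I_m).
Implicit Types (u w : R -> 'rV[R]_n -> 'cV[R]_m).

Let oO := sys_open H.
Let bO := sys_bounded H.
Let T0 : 0 < T := sys_T H.

Let colB (p q : 'cV[R]_m) i : (p - q) i 0 = p i 0 - q i 0.
Proof. by rewrite !mxE. Qed.

Variable U : R -> 'rV[R]_n -> 'cV[R]_m.
Hypothesis gU : global U.
Hypothesis U0 : forall x, C x -> U 0 x = v.

Lemma below_top u t x i : global u -> 0 <= t -> C x -> u t x i 0 <= U t x i 0.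
Proof.
move=> gu t0 Cx; apply: (global_order H (lexx 0) gU gu _ i t0 Cx) => y j Cy.
by rewrite U0//; case/andP: (gu.2 0 y (lexx 0) Cy j).
Qed.

(** All solutions stay below U. *)
Lemma zero_stable : extinct Omega U ->
  globally_asymptotically_stable Omega d K g (Xhat_v Omega v) (fun _ _ => 0).
Proof.
move=> hext; have C0 := closure_nonempty H; split.
- apply: (global_solution H (global0 H)) => t _ i.
  by under eq_fun do rewrite mxE; exact: measurable_cst.
- by move=> phi Xphi; have [u [su _]] := existence H Xphi; exists u.
- move=> phi u Xphi su; have gu := solution_global H Xphi su.
  apply/(supnorm_cvg0 _ C0) => e e0; have [t1 t10 h] := hext e e0.
  exists t1; split; first exact: num_real.
  move=> t tt x Cx; apply/(col_norm_le _ (ltW e0)) => i; have t0 := le_trans t10 (ltW tt).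
  rewrite /= subr0 ger0_norm; last by case/andP: (gu.2 t x t0 Cx i).
  exact: (le_trans (below_top i gu t0 Cx) (h t x i (ltW tt) Cx)).
- move=> e e0; have [L L0 hL] := global_dist H.
  have e2 : 0 < e / 2 by rewrite divr_gt0.
  have [t1 t10 h] := hext _ e2; pose X := expR (L * t1); have X0 : 0 < X by exact: expR_gt0.
  exists (e / 2 / X); first by rewrite divr_gt0.
  move=> phi u Xphi su hphi t t0; have gu := solution_global H Xphi su.
  apply: (@le_lt_trans _ _ (e / 2)%:E); last by rewrite lte_fin ltr_pdivrMr// mulr_natr mulr2n ltrDl.
  apply/supnorm_le => x Cx; apply/(col_norm_le _ (ltW e2)) => i; rewrite /= subr0.
  rewrite ger0_norm; last by case/andP: (gu.2 t x t0 Cx i).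
  have [tt|/ltW tt] := leP t1 t; first exact: (le_trans (below_top i gu t0 Cx) (h t x i tt Cx)).
  have eX : 0 <= e / 2 / X by rewrite divr_ge0 ?ltW.
  have := hL u (fun _ _ => 0) (e / 2 / X) 0 eX (lexx 0) gu (global0 H) _ t x i t0 Cx.
  rewrite [X in _ - X]mxE !subr0 => hh; apply: (le_trans (ler_norm _)); apply: (le_trans (hh _)).
    move=> y j Cy; rewrite [X in _ - X]mxE subr0 (solution_initial su Cy).
    have := supnorm_lt hphi Cy; rewrite /= subr0 => /ltW; move/(col_norm_le _ eX); exact.
  rewrite -[leRHS](divfK (lt0r_neq0 X0)) ler_pM2l ?divr_gt0// ler_expR ler_pM2l//.
Qed.

Section attracting_orbit.
Variables (delta : R) (w : R -> 'rV[R]_n -> 'cV[R]_m).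
Hypothesis del0 : 0 < delta.
Hypothesis hw : periodic_limit Omega d K g v T U delta w.

Let gw := limit_global hw.
Let pw := limit_periodic hw.
Let bw := limit_box hw.
Let wd := limit_ge hw.

Lemma limit_measurable t : lebesgue_measurable C (w t).
Proof.
move=> i; apply: within_continuous_measurable.
  by apply: closed_lebesgue_measurable; exact: closed_closure.
apply/(@within_continuous_ballP R) => x Cx e e0; have e2 : 0 < e / 2 by rewrite divr_gt0.
have [r r0 hr] := limit_continuous hw t Cx e2; exists r => // y Cy; rewrite -ball_normE/= => xy.
by rewrite (le_lt_trans (hr y i Cy xy))// ltr_pdivrMr// mulr_natr mulr2n ltrDl.
Qed.

(** A function that vanishes almost everywhere on the open domain does so on
    the closure since the boundary is a null set. *)
Lemma amount_gt0 (phi : 'rV[R]_n -> 'cV[R]_m) : Xhat_v Omega v phi -> ~ Xhat_null Omega phi ->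
  exists i, 0 < amount Omega (fun y => phi y i 0).
Proof.
move=> [Xphi bphi] nnull; have phiM x : C x -> in_box (phi x) by move=> /bphi/order_intervalE.
have [//|nex] := pselect (exists i, 0 < amount Omega (fun y => phi y i 0)).
exfalso; apply: nnull; split => //.
have mO := open_lebesgue_measurable oO.
have bm := Xhat_slice_bm Xphi.
have one_kernel : convolution_kernel (fun _ : 'rV[R]_n => 1 : R).
  by split => //; exact: cst_continuous.
have ae i : ae_eq (lebesgue R n) (Omega : set (lebesgue_type R n)) (fun y => (phi y i 0)%:E) (cst 0%E).
  have phi0 y : Omega y -> 0 <= phi y i 0.
    by move=> Oy; case/andP: (phiM y (subset_closure Oy) i).
  have [mphi [B hB]] := bm i.
  have am0 : amount Omega (fun y => phi y i 0) = 0.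
    apply/eqP; rewrite eq_le amount_ge0// andbT leNgt; apply/negP => h; apply: nex; by exists i.
  apply/(ae_eq_integral_abs (lebesgue R n) mO); first exact/measurable_EFinP.
  have -> : (\int[lebesgue R n]_(y in Omega) `|(phi y i 0)%:E| =
      \int[lebesgue R n]_(y in Omega) (1 * phi y i 0)%:E)%E.
    by apply: eq_integral => y; rewrite inE => Oy; rewrite mul1r abse_EFin ger0_norm ?phi0.
  have fin := integrable_fin_num mO (spread_integrable oO bO 0 one_kernel (bm i)).
  by rewrite -[LHS]fineK//; congr EFin.
have ae1 : {ae lebesgue R n, forall x, forall i, Omega x -> (phi x i 0)%:E = 0%E}.
  by apply: filter_forall => i; exact: ae.
have ae2 : {ae lebesgue R n, forall x, ~ (C `\` Omega) x}.
  exists (C `\` Omega); split.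
  - by apply: measurableD => //; apply: closed_lebesgue_measurable; exact: closed_closure.
  - exact: (sys_boundary H).
  - by move=> x /= /contrapT.
have FF : Filter (almost_everywhere (lebesgue R n)) by exact: ae_filter_ringOfSetsType.
apply: (@filterS2 _ _ FF _ _ _ _ ae1 ae2) => x h1 h2 Cx; have Ox : Omega x.
  by apply: contrapT => nOx; apply: h2.
by apply/colP => i; have := h1 i Ox; rewrite mxE => -[].
Qed.

Let B := projT1 (cid2 (in_box_norm H)).
Let B0 : 0 < B. Proof. by rewrite /B; case: cid2. Qed.
Let hB (p : 'cV[R]_m) : in_box p -> forall k, `|p k 0| <= B.
Proof. by rewrite /B; case: cid2 => /= b _ h; exact: h. Qed.

Let close_of_ratio th (p q : 'cV[R]_m) i : 0 < th < 1 -> in_box p -> in_box q ->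
  (1 - th) * p i 0 <= q i 0 -> (1 - th) * q i 0 <= p i 0 -> `|p i 0 - q i 0| <= th * B.
Proof.
move=> /andP[th0 th1] pM qM h1 h2.
have bnd (s : 'cV[R]_m) : in_box s -> th * s i 0 <= th * B.
  by move=> sM; rewrite ler_pM2l// (le_trans (ler_norm _))// hB.
have h3 := bnd p pM; have h4 := bnd q qM; rewrite ler_norml.
by apply/andP; split; move: h1 h2 h3 h4; rewrite !mulrBl !mul1r; lra.
Qed.

(** Attraction: after one period a solution is above a multiple of v, from then on
    above the same multiple of U; hence it stays away from 0 and merges with w.
    Stability: a small perturbation of w lies between multiples of w with factors
    close to 1, and the equation preserves such bounds. *)
Lemma limit_stable :
  globally_asymptotically_stable Omega d K g (Xhat_v Omega v `\` Xhat_null Omega) w.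
Proof.
have C0 := closure_nonempty H.
have pick e : 0 < e -> exists2 th : R, 0 < th < 1 & th * B <= e.
  move=> e0; exists (Num.min (1 / 2) (e / B)).
    by rewrite lt_min divr_gt0//= divr_gt0//= gt_min; apply/orP; left; lra.
  by rewrite -ler_pdivlMr// ge_min lexx orbT.
split.
- by apply: (global_solution H gw) => t _; exact: limit_measurable.
- by move=> phi [Xphi _]; have [u [su _]] := existence H Xphi; exists u.
- move=> phi u [Xphi nnull] su; have gu := solution_global H Xphi su.
  have [i ami] := amount_gt0 Xphi nnull.
  have am0 : 0 < amount Omega (fun y => u 0 y i 0).
    rewrite (_ : amount _ _ = amount Omega (fun y => phi y i 0))//.
    by apply: eq_Rintegral => y; rewrite inE => Oy; rewrite (solution_initial su (subset_closure Oy)).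
  have [kap kap0 hk] := global_positive H T0.
  pose c := kap * amount Omega (fun y => u 0 y i 0); have c0 : 0 < c by rewrite mulr_gt0.
  have gs := global_shift H 1 gu.
  have uc x j : C x -> c <= u (0 + 1%:R * T) x j 0.
    by move=> Cx; have := (hk u 0 (lexx 0) gu x i j Cx).2; rewrite mul1r.
  pose al := Num.min 1 (c / B).
  have al01 : 0 < al <= 1 by rewrite lt_min ltr01 divr_gt0//= ge_min lexx.
  have [al0 al1] := andP al01.
  have [del del_gt0 hdel] : exists2 del : R, 0 < del & forall t x j, 0 <= t -> C x -> del <= u (t + 1%:R * T) x j 0.
    exists (al * delta); first by rewrite mulr_gt0.
    move=> t x j t0 Cx.
    have hUw : delta <= U t x j 0 by apply: (le_trans (wd t j Cx)); exact: (below_top j gw t0 Cx).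
    apply: (@le_trans _ _ (al * U t x j 0)); first by rewrite ler_pM2l.
    apply: (global_scaled_order H al01 (lexx 0) gs gU _ j t0 Cx) => y k Cy.
    apply: le_trans (uc y k Cy); rewrite U0//.
    apply: (@le_trans _ _ (c / B * B)); last by rewrite divfK// gt_eqF.
    apply: ler_pM; [exact: ltW|exact/ltW/(sys_v H)|by rewrite ge_min lexx orbT|].
    by rewrite (le_trans (ler_norm _))// hB//; exact: (in_box_v H).
  pose del2 := Num.min del delta; have del20 : 0 < del2 by rewrite lt_min del_gt0.
  apply/(supnorm_cvg0 _ C0) => e e0; have [th th01 thB] := pick e e0.
  have [t1 t10 h] := merging H del20 th01.
  exists (t1 + T); split; first exact: num_real.
  move=> t tt x Cx; apply/(col_norm_le _ (ltW e0)) => j; rewrite /= colB.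
  have t1T : t1 <= t - T by rewrite lerBrDr ltW.
  have tT0 : 0 <= t - T by exact: le_trans t1T.
  have hu s y k : 0 <= s -> C y -> del2 <= u (s + 1%:R * T) y k 0.
    by move=> s0 Cy; apply: le_trans (hdel s y k s0 Cy); rewrite ge_min lexx.
  have hw2 s y k : 0 <= s -> C y -> del2 <= w s y k 0.
    by move=> _ Cy; apply: le_trans (wd s k Cy); rewrite ge_min lexx orbT.
  have h1 := h _ _ gs gw hu hw2 (t - T) x j t1T Cx; have h2 := h _ _ gw gs hw2 hu (t - T) x j t1T Cx.
  rewrite /= mul1r subrK in h1 h2.
  have E : w (t - T) x = w t x by rewrite -(pw (t - T) Cx) subrK.
  rewrite E in h1 h2; apply: le_trans thB; apply: close_of_ratio => //.
    by apply: gu.2 => //; rewrite (le_trans tT0)// lerBlDr lerDl ltW.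
  exact: bw.
- move=> e e0; have e2 : 0 < e / 2 by rewrite divr_gt0.
  have [th th01 thB] := pick _ e2; have [th0 th1] := andP th01.
  pose ds := th * (delta / 2); have ds0 : 0 < ds by rewrite mulr_gt0// divr_gt0.
  exists ds => // phi u [Xphi _] su hphi t t0; have gu := solution_global H Xphi su.
  apply: (@le_lt_trans _ _ (e / 2)%:E); last by rewrite lte_fin ltr_pdivrMr// mulr_natr mulr2n ltrDl.
  apply/supnorm_le => x Cx; apply/(col_norm_le _ (ltW e2)) => i; rewrite /= colB.
  have near y j : C y -> - ds <= u 0 y j 0 - w 0 y j 0 <= ds.
    move=> Cy; rewrite (solution_initial su Cy) -ler_norml -colB.
    by have := ltW (supnorm_lt hphi Cy) => /(col_norm_le _ (ltW ds0)); apply.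
  have dsd : ds <= delta / 2 by rewrite ler_piMl ?divr_ge0// ltW.
  have al01 : 0 < 1 - th <= 1 by rewrite subr_gt0 th1 lerBlDr lerDl ltW.
  have h1 : (1 - th) * w t x i 0 <= u t x i 0.
    apply: (global_scaled_order H al01 (lexx 0) gu gw _ i t0 Cx) => y j Cy.
    have /andP[h1 _] := near y j Cy; have h2 := ler_wpM2l (ltW th0) (wd 0 j Cy).
    have h3 : ds <= th * delta by rewrite ler_pM2l// ler_pdivrMr// mulr_natr mulr2n lerDl ltW.
    by rewrite mulrBl mul1r; move: h1 h2 h3; lra.
  have h2 : (1 - th) * u t x i 0 <= w t x i 0.
    apply: (global_scaled_order H al01 (lexx 0) gw gu _ i t0 Cx) => y j Cy.
    have /andP[h1' h1''] := near y j Cy; have h3 := wd 0 j Cy.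
    have h4 : delta / 2 <= u 0 y j 0 by move: h1' h3 dsd; lra.
    have h5 := ler_wpM2l (ltW th0) h4.
    by rewrite mulrBl mul1r; move: h1'' h5; rewrite /ds; lra.
  apply: le_trans thB; apply: close_of_ratio => //; first exact: gu.2.
  exact: bw.
Qed.

End attracting_orbit.
End stability.

Section uniqueness.
Context {R : realType} {m n : nat}.
Variables (Omega : set 'rV[R]_n) (d : 'rV[R]_m) (K : 'I_m -> R -> 'rV[R]_n -> R).
Variables (g : R -> 'rV[R]_n -> 'cV[R]_m -> 'cV[R]_m) (v : 'cV[R]_m) (T : R).
Hypothesis H : system Omega d K g v T.

Local Notation C := (closure Omega).
Local Notation in_box := (in_box v).
Local Notation rhs := (nonlinear_rhs Omega d K g).
Local Notation global := (global Omega d K g v).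
Implicit Types (t s r e tau a b : R) (x y : 'rV[R]_n) (i j : 'I_m).
Implicit Types (u w : R -> 'rV[R]_n -> 'cV[R]_m).

Let oO := sys_open H.
Let bO := sys_bounded H.
Let cC : compact C := closure_bounded_compact bO.
Let T0 : 0 < T := sys_T H.
Let dmax0 := dmax_ge0 H.

Variable U : R -> 'rV[R]_n -> 'cV[R]_m.
Hypothesis gU : global U.
Hypothesis U0 : forall x, C x -> U 0 x = v.
Variables (delta : R) (w : R -> 'rV[R]_n -> 'cV[R]_m).
Hypothesis del0 : 0 < delta.
Hypothesis hw : periodic_limit Omega d K g v T U delta w.

(** The time slices of q may fail to be measurable, so their integrals are only
    compared by monotonicity. *)
Variable q : R -> 'rV[R]_n -> 'cV[R]_m.
Hypothesis bq : forall t x, C x -> in_box (q t x).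
Hypothesis q0 : forall t x i, C x -> 0 < q t x i 0.
Hypothesis dq : forall t x, C x -> is_derive t 1 (fun s : R => q s x) (rhs t (q t) x).
Hypothesis pq : forall t x, C x -> q (t + T) x = q t x.

Let eq_ a b x i : C x -> evolves a b (fun t => q t x i 0) (fun t => rhs t (q t) x i 0).
Proof. by move=> Cx; apply: evolves_everywhere => t; apply: is_derive_coord; exact: dq. Qed.

Let q_ge0 t i y : Omega y -> 0 <= q t y i 0.
Proof. by move=> Oy; exact/ltW/q0/subset_closure. Qed.

Let B := projT1 (cid2 (in_box_norm H)).
Let B0 : 0 < B. Proof. by rewrite /B; case: cid2. Qed.
Let hB (p : 'cV[R]_m) : in_box p -> forall k, `|p k 0| <= B.
Proof. by rewrite /B; case: cid2 => /= b _ h; exact: h. Qed.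

Let q_le t i y : C y -> q t y i 0 <= B.
Proof. by move=> Cy; rewrite (le_trans (ler_norm _))// hB//; exact: bq. Qed.

Let spread_q_ge0 t i x : 0 <= spread Omega (K i t) (fun y => q t y i 0) x.
Proof. by apply: spread_ge0; [exact: (sys_K H)|exact: q_ge0]. Qed.

Let spread_q_le t i x : spread Omega (K i t) (fun y => q t y i 0) x <= B.
Proof.
apply: (@le_trans _ _ (spread Omega (K i t) (fun=> B) x)).
  apply: (le_spread_nonmeasurable oO bO x (B := B) (sys_K H i t)) => // y Oy.
  by rewrite q_ge0//= q_le//; exact: subset_closure.
rewrite (spread_cst oO bO B x (sys_K H i t)) ler_piMr ?(ltW B0)//.
exact: (spread1_le1 oO x (sys_K H i t) (sys_K1 H i t)).
Qed.

Let q_Lipschitz : exists2 Lam : R, 0 < Lam & forall s t x i, C x ->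
  `|q s x i 0 - q t x i 0| <= Lam * `|s - t|.
Proof.
have [L L0 hL] := reaction_Lipschitz H B.
exists (dmax d * B + dmax d * B + L * B) => [|s t x i Cx].
  by rewrite ltr_wpDl ?mulr_gt0// addr_ge0// mulr_ge0// ltW.
have ab : Num.min s t <= Num.max s t by rewrite ge_min le_max lexx.
apply: (evolves_bounded_slope ab (eq_ _ _ i Cx)) => [r _||]; last 2 first.
- by rewrite ge_min lexx le_max lexx.
- by rewrite ge_min lexx le_max lexx !orbT.
rewrite rhsE (le_trans (ler_normD _ _))// lerD//.
  rewrite (le_trans (ler_normB _ _))// !normrM !(gtr0_norm (sys_d H i)).
  have d0 := ltW (sys_d H i); have dle := d_le_dmax H i.
  by rewrite lerD//; apply: ler_pM => //; [rewrite ger0_norm|apply: hB; exact: bq].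
have := hL r x (q r x) 0 i B Cx (hB (bq r Cx)).
rewrite (sys_g0 H _ Cx) mxE subr0; apply => k; first by rewrite mxE normr0 ltW.
by rewrite mxE subr0; apply: hB; exact: bq.
Qed.

Let pqn (k : nat) t x : C x -> q (t + k%:R * T) x = q t x.
Proof. by move=> Cx; exact: (periodic_nat pq). Qed.

Let pwn (k : nat) t x : C x -> w (t + k%:R * T) x = w t x.
Proof. by move=> Cx; exact: (periodic_nat (limit_periodic hw)). Qed.

(** The components decay at most exponentially, and by periodicity only a time
    of length T matters. *)
Let q_low x : C x -> exists2 e : R, 0 < e & forall t i, e <= q t x i 0.
Proof.
move=> Cx; have [L L0 hL] := reaction_ordered H.
pose c := dmax d + L; have c0 : 0 < c by rewrite ltr_wpDl.
have [|e e0 he] := @seq_pos_lower_bound R _ (enum 'I_m) (fun i => q 0 x i 0).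
  by move=> i _; exact: q0.
exists (expR (- (c * T)) * e) => [|t i]; first by rewrite mulr_gt0// expR_gt0.
have [N hN] := late H 0 t; have [k [s [s0 sT tE]]] := period_decompose H hN.
have -> : q t x = q s x by rewrite -(pqn N t Cx) tE pqn.
have dec r : - (c * q r x i 0) <= rhs r (q r) x i 0.
  have u0 k' : (0 : 'cV[R]_m) k' 0 <= q r x k' 0 by rewrite mxE; case/andP: (bq r Cx k').
  have := hL r x (q r x) 0 i Cx (bq r Cx) (in_box0 H) u0.
  rewrite (sys_g0 H _ Cx) mxE !subr0 rhsE => h.
  have h1 := mulr_ge0 (ltW (sys_d H i)) (spread_q_ge0 r i x).
  have h2 := ler_wpM2r (ltW (q0 r i Cx)) (d_le_dmax H i).
  by rewrite /c mulrDl; move: h h1 h2; lra.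
have ss : (0 : R) <= 0 <= s by rewrite lexx.
have := @decay_factor R 1 (fun t _ => q t x i 0) (fun t _ => rhs t (q t) x i 0) c 0 s ord0 (ltW c0)
  (eq_ 0 s i Cx) (fun r _ => dec r) 0 s ss (lexx s).
apply: le_trans; apply: ler_pM; [exact: expR_ge0|exact: ltW| |by rewrite he ?mem_enum].
by rewrite ler_expR lerN2 ler_pM2l// subr0 ltW.
Qed.

(** Orbits at neighbouring points are comparable, because the nonlocal term
    depends continuously on the point and the ratio of the orbits improves from
    period to period while the orbits repeat. *)
Let q_near x : C x -> exists2 e : R * R, 0 < e.1 /\ 0 < e.2 & forall t x' i, C x' -> `|x - x'| < e.1 ->
  e.2 <= q t x' i 0.
Proof.
move=> Cx; have [dx dx0 hdx] := q_low Cx; have [Lam Lam0 hLam] := q_Lipschitz.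
have th : 0 < (1 / 2 : R) < 1 by lra.
have [eta [e1 [r1 [eta0 e10 r10 himp]]]] := improvement H dx0 th T0 Lam0.
have [r2 r20 hr2] := influx_modulus_ge0 H (ltW B0) e10.
exists (Num.min r1 r2, 1 / 2 * dx) => [|t x' i Cx' /=].
  by split; rewrite /= ?lt_min ?r10// mulr_gt0//; lra.
rewrite lt_min => /andP[xr1 xr2].
have [|c c0 hc] := @seq_pos_lower_bound R _ (enum 'I_m) (fun i => q t x' i 0).
  by move=> j _; exact: q0.
pose al0 := c / B; have al00 : 0 < al0 by rewrite divr_gt0.
have [N hN] := ratio_iteration al00 eta0 th.
suff step : forall j, (1 - 1 / 2) * q t x j 0 <= q t x' j 0.
  by apply: le_trans (step i); have := hdx t i; lra.
apply: (hN (fun _ al => forall j, al * q t x j 0 <= q t x' j 0)).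
- move=> k al al' /andP[_ le] h j; apply: le_trans (h j).
  by rewrite ler_wpM2r ?(ltW (q0 _ _ Cx)).
- move=> j; apply: (@le_trans _ _ (al0 * B)); last by rewrite divfK ?gt_eqF// hc ?mem_enum.
  by rewrite ler_pM2l// q_le.
move=> k al alI IH j; have := himp t x x' q q al Cx Cx' xr1 alI; rewrite !pq// => h; apply: h => //.
- by move=> p; exact: eq_.
- by move=> p; exact: eq_.
- by move=> s _; split; exact: bq.
- by move=> s r p _ _; exact: hLam.
- move=> s p _; have /andP[a0 a1] := alI.
  have hy y : Omega y -> 0 <= q s y p 0 <= B.
    by move=> Oy; rewrite q_ge0//= q_le//; exact: subset_closure.
  have h1 := ler_wpM2l (ltW a0) (hr2 p s x x' _ Cx Cx' xr2 hy).
  have S0 : 0 <= d 0 p * spread Omega (K p s) (fun y => q s y p 0) x'.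
    by rewrite mulr_ge0 ?(ltW (sys_d H p)).
  have h2 : al * (d 0 p * spread Omega (K p s) (fun y => q s y p 0) x') <=
      d 0 p * spread Omega (K p s) (fun y => q s y p 0) x' by rewrite ler_piMl//; lra.
  by move: h1 h2; rewrite mulrDr; lra.
Qed.

Let q_bounded_below : exists2 e : R, 0 < e & forall t x i, C x -> e <= q t x i 0.
Proof.
have ex x : exists e : R * R, C x -> 0 < e.1 /\ 0 < e.2 /\ forall t x' i, C x' -> `|x - x'| < e.1 ->
    e.2 <= q t x' i 0.
  have [Cx|nCx] := pselect (C x); last by exists (0, 0).
  by have [e [e1 e2] he] := q_near Cx; exists e.
have [e he] := choice ex.
have [|s sC hs] := @compact_finite_ball_cover R 'rV[R]_n C (fun x => (e x).1) cC; first by move=> x /he[].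
have [|e0 e00 he0] := @seq_pos_lower_bound R _ s (fun x => (e x).2); first by move=> x /sC/he[_ []].
exists e0 => // t x i Cx; have [x' x's xx'] := hs x Cx.
have [_ [_ h]] := he x' (sC x' x's); apply: (le_trans (he0 x' x's)); apply: h => //.
by move: xx'; rewrite -ball_normE.
Qed.

Let q_le_U t x i : 0 <= t -> C x -> q t x i 0 <= U t x i 0.
Proof.
move=> t0 Cx; have tU := gU.1 t t0; have tt : 0 <= t <= t by rewrite t0 lexx.
apply: (@box_comparison R m n Omega d K g v T H C 0 t U q (fun t x i => rhs t (U t) x i 0)
  (fun t x i => rhs t (q t) x i 0) (dmax d)) => //.
- by move=> y j Cy; exact: (traj_ev tU).
- by move=> y j Cy; exact: eq_.
- by move=> s y /andP[s0 _] Cy; split; [exact: gU.2|exact: bq].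
- by move=> y j Cy; rewrite U0//; case/andP: (bq 0 Cy j).
move=> N s y j /andP[s0 st] Cy N0 hN; have ss : 0 <= s <= t by rewrite !ltW.
rewrite !rhsE; have bmU := traj_bm tU ss j; have kk := sys_K H j s.
have hS : spread Omega (K j s) (fun y => q s y j 0) y <= spread Omega (K j s) (fun y => U s y j 0) y + N.
  apply: (@le_trans _ _ (spread Omega (K j s) (fun y => U s y j 0 + N) y)).
    apply: (le_spread_nonmeasurable oO bO y (B := B + N) kk) => z Oz; have Cz := subset_closure Oz.
      by rewrite q_ge0//=; have := hN z j Cz; lra.
    by rewrite lerD2r (le_trans (ler_norm _))// hB//; apply: gU.2 => //; exact: ltW.
  rewrite (spreadD oO bO y kk bmU (bounded_measurable_cst Omega N)) lerD2l.
  rewrite (spread_cst oO bO N y kk) ler_piMr//.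
  exact: (spread1_le1 oO y kk (sys_K1 H j s)).
have d0 := sys_d H j; have dle := d_le_dmax H j.
have h1 := ler_wpM2l (ltW d0) hS; have h2 := ler_wpM2r N0 dle.
move: h1 h2; set S1 := spread _ _ _ _; set S2 := spread _ _ _ _; set g1 := g _ _ _ _ _; set g2 := g _ _ _ _ _.
by rewrite mulrDr; lra.
Qed.

(** A periodic solution in the box stays below U, which approaches w. *)
Lemma positive_orbit_le t x i : C x -> q t x i 0 <= w t x i 0.
Proof.
move=> Cx; apply/ler_addgt0Pr => e e0; have [t1 t10 h] := limit_attracts hw e0.
have [N hN] := late H t1 t; have := h _ x i hN Cx; rewrite (pwn N t Cx) ler_norml => /andP[h1 _].
have := q_le_U i (le_trans t10 hN) Cx; rewrite (pqn N t Cx).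
by move: h1; lra.
Qed.

(** A lower bound on the ratio of q and w holds at all times at once by
    periodicity; it improves until it exceeds every number below 1. *)
Lemma positive_orbit_ge t x i : C x -> w t x i 0 <= q t x i 0.
Proof.
move=> Cx; have [e e0 he] := q_bounded_below; have bw := limit_box hw.
have w0 s y j : C y -> 0 <= w s y j 0 by move=> Cy; case/andP: (bw s y Cy j).
have w_le s y j : C y -> w s y j 0 <= B by move=> Cy; rewrite (le_trans (ler_norm _))// hB//; exact: bw.
have [Lam Lam0 hLam] := q_Lipschitz.
have wLip : exists2 Lam : R, 0 < Lam & forall s t x i, C x -> `|w s x i 0 - w t x i 0| <= Lam * `|s - t|.
  exact: (periodic_Lipschitz H (limit_global hw) (limit_periodic hw)).
have {Lam Lam0 hLam} [Lam Lam0 hLam] := wLip.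
suff main th : 0 < th < 1 -> (1 - th) * w t x i 0 <= q t x i 0.
  apply/ler_addgt0Pr => e' e'0; pose th := Num.min (1 / 2) (e' / B).
  have th01 : 0 < th < 1.
    by rewrite lt_min divr_gt0//= divr_gt0//= gt_min; apply/orP; left; lra.
  have h1 : th * w t x i 0 <= e'.
    rewrite -[leRHS](divfK (lt0r_neq0 B0)); apply: ler_pM; rewrite ?w0 ?w_le//.
      by case/andP: th01 => /ltW.
    by rewrite ge_min lexx orbT.
  by have := main th th01; rewrite mulrBl mul1r; move: h1; lra.
move=> th01; have /andP[th0 th1] := th01.
have [eta [e1 [r1 [eta0 e10 r10 himp]]]] := improvement H del0 th01 T0 Lam0.
pose al0 := e / B; have al00 : 0 < al0 by rewrite divr_gt0.
have [N hN] := ratio_iteration al00 eta0 th01.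
suff step : forall s y j, C y -> (1 - th) * w s y j 0 <= q s y j 0 by exact: step.
apply: (hN (fun _ al => forall s y j, C y -> al * w s y j 0 <= q s y j 0)).
- move=> k al al' /andP[_ le] h s y j Cy; apply: le_trans (h s y j Cy).
  by rewrite ler_wpM2r ?w0.
- move=> s y j Cy; apply: (@le_trans _ _ (al0 * B)); last by rewrite divfK ?gt_eqF// he.
  by rewrite ler_pM2l// w_le.
move=> k al alI IH s y j Cy; have /andP[a0 a1] := alI.
pose t0 := s - T; have tT : t0 <= t0 + T by rewrite lerDl ltW.
rewrite (_ : s = t0 + T); last by rewrite subrK.
have tw := periodic_trajectory H (limit_periodic hw) (limit_global hw) tT.
have := himp t0 y y q w al Cy Cy _ alI; rewrite subrr normr0 => /(_ r10); apply.
- by move=> p; exact: eq_.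
- by move=> p; exact: (traj_ev tw).
- by move=> r _; split; [exact: bq|exact: bw].
- by move=> r p _; exact: (limit_ge hw).
- by move=> r r' p _ _; exact: hLam.
- move=> r p rt; have rt' : t0 <= r <= t0 + T by case/andP: rt => *; rewrite !ltW.
  have b2 := traj_bm tw rt' p.
  apply: (@le_trans _ _ (al * (d 0 p * spread Omega (K p r) (fun z => w r z p 0) y))).
    by rewrite gerBl mulr_ge0// ltW.
  rewrite mulrCA ler_pM2l ?(sys_d H)// -(spreadZ oO bO _ y (sys_K H p r) b2).
  apply: (le_spread_nonmeasurable oO bO y (B := B) (sys_K H p r)) => z Oz; have Cz := subset_closure Oz.
    by rewrite IH// mulr_ge0 ?w0// ltW.
  exact: q_le.
- by move=> p; exact: IH.
Qed.

End uniqueness.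

(** * The theorem *)

Lemma nneg_cone_interiorP {R : realType} {m : nat} (p : 'cV[R]_m) :
  nneg_cone° p <-> forall i, 0 < p i 0.
Proof.
split=> [/nbhs_ballP[r /= r0 hr] i|p0].
  have r2 : 0 < r / 2 by rewrite divr_gt0.
  have : nneg_cone (p - const_mx (r / 2)).
    apply: hr; rewrite -ball_normE/= opprB addrCA subrr addr0.
    apply/(col_norm_lt _ r0) => j; rewrite mxE gtr0_norm//.
    by rewrite ltr_pdivrMr// mulr_natr mulr2n ltrDl.
  by move=> /(_ i); rewrite !mxE subr_ge0; exact: lt_le_trans.
have [|e e0 he] := @seq_pos_lower_bound R _ (enum 'I_m) (fun i => p i 0); first by move=> i _.
apply/nbhs_ballP; exists e => // q; rewrite -ball_normE/= => /(col_norm_lt _ e0) h i.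
have := h i; have := he i (mem_enum _ _); rewrite !mxE ltr_norml => h1 /andP[h2 h3].
by move: h1 h3; lra.
Qed.

Section hypotheses.
Context {R : realType} {m n : nat}.
Variables (Omega : set 'rV[R]_n) (d : 'rV[R]_m) (K : 'I_m -> R -> 'rV[R]_n -> R).
Variables (g : R -> 'rV[R]_n -> 'cV[R]_m -> 'cV[R]_m) (v : 'cV[R]_m) (T : R).
Local Notation C := (closure Omega).

Lemma C001_admissible : C001 Omega g ->
  (forall t x u, C x -> g (t + T) x u = g t x u) ->
  (forall i, admissible C T (fun t x u => g t x u i 0)) /\
  (forall i j, admissible C T (partial g i j)).
Proof.
move=> [cG _ cD] pg.
have coord (F : R * 'rV[R]_n * 'cV[R]_m -> 'cV[R]_m) i : {within [set p | C p.1.2], continuous F} ->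
    {within [set p | C p.1.2], continuous (fun p => F p i 0)}.
  move=> cF; apply/(@within_continuous_ballP R) => p Ap e e0.
  have [r r0 hr] := (@within_continuous_ballP R _ _ _ _).1 cF p Ap e e0.
  exists r => // q Aq pq; have := hr q Aq pq.
  by move=> /(col_norm_lt _ e0)/(_ i); rewrite !mxE.
split=> [i|i j]; split=> [|t x u Cx].
- exact: coord cG.
- by rewrite pg.
- exact: coord (cD j).
- by rewrite /partial (_ : g (t + T) x = g t x)//; apply/funext => p; exact: pg.
Qed.

(** Periodicity turns statements for t >= 0 into statements for all t. *)
Lemma future_reaction : 0 < T -> (forall t x u, C x -> g (t + T) x u = g t x u) ->
  forall t x, C x -> exists2 t' : R, 0 <= t' & g t' x = g t x.
Proof.
move=> T0 gper t x Cx; pose N := (Num.truncn (- t / T)).+1; exists (t + N%:R * T).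
  by rewrite -lerBlDl sub0r -ler_pdivrMr//; exact/ltW/Num.Theory.truncnS_gt.
elim: N => [|k IH]; first by rewrite mul0r addr0.
by rewrite -IH -natr1 mulrDl mul1r addrA; apply/funext => p; exact: gper.
Qed.

Lemma system_intro : (0 < m)%N -> domain Omega -> bounded_set Omega -> smooth_boundary Omega ->
  (forall i, 0 < d 0 i) -> nneg_cone° v -> 0 < T ->
  (forall i t x, 0 <= K i t x) -> (forall i, continuous (fun p : R * 'rV[R]_n => K i p.1 p.2)) ->
  (forall i t, 0 < K i t 0) -> (forall i t, (\int[lebesgue R n]_x (K i t x)%:E = 1)%E) ->
  C001 Omega g ->
  (forall t x u, 0 <= t -> C x -> order_interval v u ->
     cooperative (jacobian_mx (g t x) u) /\ irreducible_mx (jacobian_mx (g t x) u)) ->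
  (forall t x, 0 <= t -> C x -> g t x 0 = 0) ->
  (forall t x u i, 0 <= t -> C x -> order_interval v u -> u i 0 = v i 0 -> g t x u i 0 <= 0) ->
  (forall t x u (alpha : R), 0 <= t -> C x -> order_interval v u -> nneg_cone° u -> 0 < alpha < 1 ->
     vlt (alpha *: g t x u) (g t x (alpha *: u))) ->
  (forall i t x, K i (t + T) x = K i t x) ->
  (forall t x u, C x -> g (t + T) x u = g t x u) ->
  system Omega d K g v T.
Proof.
move=> m0 [ne0 oO cO] bO sO d0 vi T0 K0 Kc Kp K1 gC gJ g0 gv gs Kper gper.
have [ag ap] := C001_admissible gC gper.
have future t x := future_reaction T0 gper t (x := x).
have box (u : 'cV[R]_m) : (forall k, 0 <= u k 0 <= v k 0) -> order_interval v u.
  by move=> h; split=> k; have /andP[h1 h2] := h k; rewrite !mxE ?subr0 ?subr_ge0.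
have jac t x u i j : jacobian_mx (g t x) u i j = partial g i j t x u by rewrite mxE.
split=> //.
- exact: smooth_boundary_null.
- exact/nneg_cone_interiorP.
- move=> i t; split=> // y.
  apply: (@continuous_comp _ _ _ (fun y => (t, y)) (fun p : R * 'rV[R]_n => K i p.1 p.2)); last exact: Kc.
  move=> A /= /nbhs_ballP[e /= e0 he]; apply/nbhs_ballP; exists e => // z yz.
  by apply: he; split => //=; exact: ballxx.
- by move=> t x u j Cx; case: gC => _ + _; apply.
- move=> t x u i j Cx uM ij; have [t' t'0 E] := future t x Cx.
  by have [h _] := gJ t' x u t'0 Cx (box u uM); have := h i j ij; rewrite jac /partial E.
- move=> t x u S Cx uM S0 ST; have [t' t'0 E] := future t x Cx.
  have [_ h] := gJ t' x u t'0 Cx (box u uM); have [i [j [iS jS]]] := h S S0 ST.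
  by rewrite jac /partial E => hij; exists i, j.
- by move=> t x Cx; have [t' t'0 <-] := future t x Cx; exact: g0.
- by move=> t x u i Cx uM; have [t' t'0 <-] := future t x Cx; apply: gv => //; exact: box.
- move=> t x u a Cx uM a01; have [t' t'0 <-] := future t x Cx.
  have uM' k : 0 <= u k 0 <= v k 0 by have /andP[h1 ->] := uM k; rewrite ltW.
  have ui : nneg_cone° u by apply/nneg_cone_interiorP => k; case/andP: (uM k).
  have [h1 h2] := gs t' x u a t'0 Cx (box u uM') ui a01.
  have h3 i : a * g t' x u i 0 <= g t' x (a *: u) i 0 by have := h1 i; rewrite !mxE subr_ge0.
  split=> //; apply: contrapT => nex; apply: h2; apply/colP => i; rewrite mxE.
  apply/eqP; rewrite eq_le h3 leNgt; apply/negP => h; apply: nex; by exists i.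
Qed.

End hypotheses.

Section periodic_functions.
Context {R : realType} {m n : nat}.
Variables (Omega : set 'rV[R]_n) (T : R).
Hypothesis T0 : 0 < T.
Hypothesis cC : compact (closure Omega).
Local Notation C := (closure Omega).
Implicit Types (u w : R -> 'rV[R]_n -> 'cV[R]_m).

Lemma CT_bounded u : CT Omega T u -> exists2 B : R, 0 < B & forall t x, C x -> `|u t x| <= B.
Proof.
move=> [cu pu].
have cK : compact (`[0, T]%classic `*` C) by apply: compact_setX => //; exact: segment_compact.
have cu' : {within `[0, T]%classic `*` C, continuous (on_cylinder u)}.
  by apply: continuous_subspaceW cu => p [].
have /compact_bounded/ex_strict_bound_gt0[B B0 /= hB] := continuous_compact cu' cK.
exists B => // t x Cx; have [k /andP[k0 kT]] := period_shift T0 t.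
have <- : u (t + k%:~R * T) x = u t x.
  apply/colP => i.
  by apply: (@periodic_int R T (fun t => u t x i 0)) => s; rewrite pu.
apply/ltW/hB; exists (t + k%:~R * T, x) => //.
by split => //=; rewrite in_itv/= k0 ltW.
Qed.

Lemma CT_slice u t : CT Omega T u -> Xspace Omega (u t).
Proof.
move=> [cu _]; apply/(@within_continuous_ballP R) => x Cx e e0.
have [r r0 hr] := (@within_continuous_ballP R _ _ _ _).1 cu (t, x) (conj I Cx) e e0.
by exists r => // y Cy xy; apply: (hr (t, y)); split => //=; exact: ballxx.
Qed.

Lemma CT_shift_down u (e : R) : CT Omega T u -> CT Omega T (fun t x => u t x - const_mx e).
Proof.
move=> [cu pu]; split; last by move=> t x Cx; rewrite pu.
apply/(@within_continuous_ballP R) => p Ap r r0.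
have [r' r'0 hr'] := (@within_continuous_ballP R _ _ _ _).1 cu p Ap r r0.
exists r' => // q Aq pq; have := hr' q Aq pq.
by rewrite /on_cylinder opprB addrA subrK.
Qed.

Lemma CT_nneg_int_ge u : CT_nneg_int Omega T u ->
  exists2 e : R, 0 < e & forall t x i, C x -> e <= u t x i 0.
Proof.
move=> [Cu [e e0 he]]; have e2 : 0 < e / 2 by rewrite divr_gt0.
exists (e / 2) => // t x i Cx.
have [_ h] : CT_nneg Omega T (fun t x => u t x - const_mx (e / 2)).
  apply: he; first exact: CT_shift_down.
  apply: (@le_lt_trans _ _ (e / 2)%:E); last by rewrite lte_fin ltr_pdivrMr// mulr_natr mulr2n ltrDl.
  apply/supnorm_le => -[s y] _; apply/(col_norm_le _ (ltW e2)) => j.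
  by rewrite /on_cylinder/= !mxE addrAC subrr add0r normrN gtr0_norm.
by have := h t x Cx i; rewrite !mxE subr_ge0.
Qed.

Lemma CT_nneg_int_intro u (e : R) : 0 < e -> CT Omega T u ->
  (forall t x i, C x -> e <= u t x i 0) -> CT_nneg_int Omega T u.
Proof.
move=> e0 Cu ue; split=> //; exists e => // w Cw hw; split=> // t x Cx i.
have := supnorm_lt hw (_ : cylinder Omega (t, x)) => /(_ (conj I Cx)).
move=> /(col_norm_lt _ e0)/(_ i); rewrite /on_cylinder/= !mxE ltr_norml => /andP[h1 h2].
by have := ue t x i Cx; move: h1; lra.
Qed.

Lemma CT_Xtilde u : CT Omega T u -> Xtilde Omega T u.
Proof.
move=> Cu; have [B B0 hB] := CT_bounded Cu; have [cu pu] := Cu; split; [|apply: (@le_lt_trans _ _ B%:E); last exact: ltry|exact: pu]; last first.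
  by apply/supnorm_le => -[t x] [_ Cx]; exact: hB.
have split_ball (z z' : 'rV[R]_(1 + n)) (r : R) : ball z r z' ->
    ball (lsubmx z 0 0 : R, rsubmx z) r (lsubmx z' 0 0 : R, rsubmx z').
  move=> zz'; have h : `|z - z'| < r by move: zz'; rewrite -ball_normE.
  have r0 : 0 < r by exact: le_lt_trans (normr_ge0 _) h.
  have {}h := (mx_norm_lt _ r0).1 h.
  split; rewrite /= -ball_normE/=.
    by have := h (lshift n 0); rewrite !mxE.
  by apply/(mx_norm_lt _ r0) => i; have := h (rshift 1 i); rewrite !mxE.
move=> i; apply: within_continuous_measurable.
  apply: closed_lebesgue_measurable.
  have -> : [set z : 'rV[R]_(1 + n) | C (rsubmx z)] = rsubmx @^-1` C by [].
  apply: ((continuous_closedP _).1 _ _ (@closed_closure _ _)) => z A /= /nbhs_ballP[e /= e0 he].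
  apply/nbhs_ballP; exists e => // z' zz'; apply: he.
  by have [] := split_ball z z' e zz'.
apply/(@within_continuous_ballP R) => z Cz e e0.
have [r r0 hr] := (@within_continuous_ballP R _ _ _ _).1 cu (lsubmx z 0 0, rsubmx z) (conj I Cz) e e0.
exists r => // z' Cz' zz'; have := hr (lsubmx z' 0 0, rsubmx z') (conj I Cz') (split_ball z z' r zz').
by move=> /(col_norm_lt _ e0)/(_ i); rewrite /on_cylinder/= !mxE.
Qed.

End periodic_functions.

Section conclusions.
Context {R : realType} {m n : nat}.
Variables (Omega : set 'rV[R]_n) (d : 'rV[R]_m) (K : 'I_m -> R -> 'rV[R]_n -> R).
Variables (g : R -> 'rV[R]_n -> 'cV[R]_m -> 'cV[R]_m) (v : 'cV[R]_m) (T : R).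
Hypothesis H : system Omega d K g v T.
Local Notation C := (closure Omega).

Let T0 : 0 < T := sys_T H.
Let cC : compact C := closure_bounded_compact (sys_bounded H).

Section attracting_orbit.
Variables (U : R -> 'rV[R]_n -> 'cV[R]_m) (delta : R) (w : R -> 'rV[R]_n -> 'cV[R]_m).
Hypothesis del0 : 0 < delta.
Hypothesis hw : periodic_limit Omega d K g v T U delta w.

Lemma limit_CT : CT Omega T w.
Proof.
split; last by move=> t x Cx; exact: (limit_periodic hw).
have [Lam Lam0 hLam] := periodic_Lipschitz H (limit_global hw) (limit_periodic hw).
apply/(@within_continuous_ballP R) => -[t x] [_ /= Cx] e e0.
have e4 : 0 < e / 4 by rewrite divr_gt0.
have [r r0 hr] := limit_continuous hw t Cx e4.
exists (Num.min r (e / 4 / Lam)); first by rewrite lt_min r0 divr_gt0.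
move=> [t' x'] [_ /= Cx'] [/= tt xx]; apply/(col_norm_lt _ e0) => i; rewrite /on_cylinder/= !mxE.
have h1 : `|w t x i 0 - w t x' i 0| <= e / 4.
  apply: hr => //; move: xx; rewrite -ball_normE/= => /lt_le_trans; apply.
  by rewrite ge_min lexx.
have h2 : `|w t x' i 0 - w t' x' i 0| <= e / 4.
  rewrite (le_trans (hLam t t' x' i Cx'))// mulrC -ler_pdivlMr//; apply/ltW.
  by move: tt; rewrite -ball_normE/= => /lt_le_trans; apply; rewrite ge_min lexx orbT.
move: h1 h2; rewrite !ler_norml ltr_norml => /andP[h1 h1'] /andP[h2 h2'].
by apply/andP; split; lra.
Qed.

Lemma limit_solution : positive_periodic_solution Omega d K g v T w.
Proof.
split.
- split; first exact: (CT_Xtilde T0 cC limit_CT).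
  by move=> t x Cx; apply/order_intervalE; exact: (limit_box hw).
- by move=> t x i Cx; apply: (lt_le_trans del0); exact: (limit_ge hw).
- move=> t x Cx; apply: is_derive_col => i.
  have ab : t - 1 <= t + 1 by lra.
  have := (traj_ev (periodic_trajectory H (limit_periodic hw) (limit_global hw) ab) i Cx).2 t.
  by apply; apply/andP; split; lra.
Qed.

Lemma limit_unique q : (forall x, C x -> U 0 x = v) -> global Omega d K g v U ->
  positive_periodic_solution Omega d K g v T q -> forall t x, C x -> q t x = w t x.
Proof.
move=> U0 gU [[[_ _ pq] bq] q0 dq] t x Cx; apply/colP => i; apply/eqP; rewrite eq_le.
have bq' s y : C y -> in_box v (q s y) by move=> Cy; apply/order_intervalE; exact: bq.
rewrite (positive_orbit_le H gU U0 hw bq' q0 dq pq)//=.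
exact: (positive_orbit_ge H del0 hw bq' q0 dq pq).
Qed.

End attracting_orbit.

Variable Phi : R -> R -> ('rV[R]_n -> 'cV[R]_m) -> 'rV[R]_n -> 'cV[R]_m.
Hypothesis hPhi : generated_evolution_family Omega d K g Phi.

(** A principal eigenfunction for the eigenvalue 0 is a positive periodic
    solution of the linearization. *)
Lemma no_orbit_at_principal_eigenvalue (delta : R) w U : 0 < delta ->
  periodic_limit Omega d K g v T U delta w -> growth_bound Omega Phi = 0%E ->
  ~ is_principal_eigenvalue_growth_bound Omega d K g T Phi.
Proof.
move=> del0 hw gb0 [lambda]; rewrite gb0 => -[<-] [psi [[Cpsi dpsi cdpsi] ipsi Lpsi]].
have [p0 p00 hp0] := CT_nneg_int_ge ipsi; have [B B0 hB] := CT_bounded T0 cC Cpsi.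
have bpsi t : slice_bm Omega (psi t) by apply: (Xspace_slice_bm H); exact: CT_slice Cpsi.
apply: (@no_positive_linear_orbit _ _ _ _ _ _ _ _ _ H delta w del0 (limit_global hw)
  (limit_periodic hw) (limit_box hw) (limit_ge hw) psi p0 B p00) => //.
  move=> t x i Cx; rewrite hp0//= (le_trans (ler_norm _))//.
  exact: ((col_norm_le _ (ltW B0)).1 (hB t x Cx)).
move=> a b x i Cx; apply: evolves_everywhere => t; rewrite -(linear_rhsE).
apply: (is_derive_coord (f := fun t => psi t x)); apply: DeriveDef; first exact: dpsi.
have := Lpsi t x Cx; rewrite scale0r /LT derive1E => /eqP.
by rewrite addrC subr_eq0 => /eqP ->.
Qed.

End conclusions.

Theorem theorem3p10 (R : realType) (m n : nat) (m1 : (1 <= m)%N) (n1 : (1 <= n)%N)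
  (Omega : set 'rV[R]_n) (d : 'rV[R]_m) (K : 'I_m -> R -> 'rV[R]_n -> R)
  (g : R -> 'rV[R]_n -> 'cV[R]_m -> 'cV[R]_m) (v : 'cV[R]_m) (T : R)
  (Phi : R -> R -> ('rV[R]_n -> 'cV[R]_m) -> 'rV[R]_n -> 'cV[R]_m)
  (Omega_domain : domain Omega)
  (Omega_bounded : bounded_set Omega)
  (Omega_simply_connected : simply_connected Omega)
  (Omega_smooth : smooth_boundary Omega)
  (d_pos : forall i, 0 < d 0 i)
  (v_int : nneg_cone° v)
  (T_pos : 0 < T)
  (* (a) *)
  (K_ge0 : forall i t x, 0 <= K i t x)
  (K_continuous : forall i, continuous (fun p : R * 'rV[R]_n => K i p.1 p.2))
  (K_pos : forall i t, 0 < K i t 0)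
  (K_int : forall i t, (\int[lebesgue R n]_x (K i t x)%:E = 1)%E)
  (* (b) *)
  (g_C001 : C001 Omega g)
  (g_jacobian : forall t x u, 0 <= t -> closure Omega x -> order_interval v u ->
     cooperative (jacobian_mx (g t x) u) /\ irreducible_mx (jacobian_mx (g t x) u))
  (g_0 : forall t x, 0 <= t -> closure Omega x -> g t x 0 = 0)
  (g_v : forall t x u i, 0 <= t -> closure Omega x -> order_interval v u ->
     u i 0 = v i 0 -> g t x u i 0 <= 0)
  (* (c) *)
  (g_subhomogeneous : forall t x u (alpha : R), 0 <= t -> closure Omega x ->
     order_interval v u -> nneg_cone° u -> 0 < alpha < 1 ->
     vlt (alpha *: g t x u) (g t x (alpha *: u)))
  (* (d) *)
  (K_periodic : forall i t x, K i (t + T) x = K i t x)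
  (g_periodic : forall t x u, closure Omega x -> g (t + T) x u = g t x u)
  (Phi_generated : generated_evolution_family Omega d K g Phi) :
  [/\ (growth_bound Omega Phi < 0)%E ->
        globally_asymptotically_stable Omega d K g (Xhat_v Omega v)
          (fun _ _ => 0),
      growth_bound Omega Phi = 0%E ->
        (forall t x u (alpha : R), 0 <= t -> closure Omega x ->
           order_interval v u -> nneg_cone° u -> 0 < alpha < 1 ->
           vll (alpha *: g t x u) (g t x (alpha *: u))) \/
        is_principal_eigenvalue_growth_bound Omega d K g T Phi ->
        globally_asymptotically_stable Omega d K g (Xhat_v Omega v)
          (fun _ _ => 0) &
      (0 < growth_bound Omega Phi)%E ->
        exists w, [/\ positive_periodic_solution Omega d K g v T w,
          (forall w', positive_periodic_solution Omega d K g v T w' ->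
             forall t x, closure Omega x -> w' t x = w t x),
          CT_nneg_int Omega T w &
          globally_asymptotically_stable Omega d K g
            (Xhat_v Omega v `\` Xhat_null Omega) w]].
Proof.
have H : system Omega d K g v T by exact: system_intro.
have [U [sU _]] := existence H (Xhat_v_v H).
have gU := solution_global H (Xhat_v_v H) sU.
have U0 := solution_initial sU.
have mU t : 0 <= t -> lebesgue_measurable (closure Omega) (U t).
  by move=> t0; exact: (solution_Xhat sU t0).1.
have limit := persistent_limit H gU U0 mU.
split=> [neg|zero side|pos].
- exact: (zero_stable H gU U0 (extinct_of_negative H Phi_generated gU U0 neg)).
- have [pers|ext] := dichotomy H gU U0; last exact: (zero_stable H gU U0 ext).
  have [delta [w [del0 hw]]] := limit pers; exfalso.
  case: side => [strict|]; last exact: (no_orbit_at_principal_eigenvalue H del0 hw zero).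
  suff : (0 < growth_bound Omega Phi)%E by rewrite zero ltxx.
  apply: (strict_growth H Phi_generated del0 (limit_global hw) (limit_box hw) (limit_ge hw)).
    by apply: CT_slice; exact: limit_CT hw.
  move=> t x p a i Cx hp a01.
  have [s s0 E] := future_reaction (sys_T H) g_periodic t Cx.
  have pM : order_interval v p.
    by apply/order_intervalE => k; have /andP[h1 ->] := hp k; rewrite ltW.
  have pI : nneg_cone° p by apply/nneg_cone_interiorP => k; case/andP: (hp k).
  have := strict s x p a s0 Cx pM pI a01; rewrite E.
  by move=> /nneg_cone_interiorP/(_ i); rewrite !mxE subr_gt0.
- have [pers|ext] := dichotomy H gU U0; last first.
    by have := growth_bound_of_extinct H Phi_generated gU U0 ext; rewrite leNgt pos.
  have [delta [w [del0 hw]]] := limit pers; exists w; split.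
  + exact: (limit_solution H del0 hw).
  + by move=> w' hw' t x; exact: (limit_unique H del0 hw U0 gU hw').
  + apply: (CT_nneg_int_intro del0); first exact: (limit_CT H hw).
    by move=> t x i; exact: (limit_ge hw).
  + exact: (limit_stable H gU U0 del0 hw).
Qed.
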